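(* Let $0<s<n/2$ and write $s=m+\gamma$ with $m\in\{0,1,2,\dots\}$ and $\gamma\in[0,1)$. Let $f:\mathbb{R}^n\times[0,+\infty)\to[0,+\infty)$ be continuous and let $v\in\mathcal L_s$ be a nonnegative strong solution of $(-\Delta)^sv=f(x,v)$ in $\mathbb{R}^n$. Assume that $f(\cdot,v(\cdot))\in L^p(\mathbb{R}^n)$ for some $1<p<\frac n{2s}$, and that either (a) $f(x,t)$ is nondecreasing in $t>0$ for each $x$ and $\inf_{x\in\mathbb{R}^n}f(x,t)>0$ for every $t>0$, or (b) $\lim_{|x|\to\infty}v(x)=0$. Then $v$ is a nonnegative solution of $$v(x)=c_{n,s}\int_{\mathbb{R}^n}\frac{f(y,v(y))}{|x-y|^{n-2s}}\,dy,\qquad x\in\mathbb{R}^n,$$ where $c_{n,s}=\frac{\Gamma(\frac n2-s)}{\pi^{n/2}2^{2s}\Gamma(s)}$.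
   Context: $(-\Delta)^\gamma$ ($0<\gamma<1$) is the fractional Laplacian with Fourier symbol $|\xi|^{2\gamma}$, which for sufficiently regular functions is given pointwise (up to a positive normalizing constant) by $\mathrm{P.V.}\int_{\mathbb{R}^n}\frac{v(x)-v(y)}{|x-y|^{n+2\gamma}}dy$; $(-\Delta)^0$ is the identity. $\mathcal L_s=\{v:\mathbb{R}^n\to\mathbb{R}:\int_{\mathbb{R}^n}\frac{|v(x)|}{1+|x|^{n+2\gamma}}dx<\infty\}$. A function $v\in\mathcal L_s$ is a strong solution of $(-\Delta)^sv=F$ if $v\in C^{2m+\lfloor2\gamma\rfloor,\,2\gamma-\lfloor2\gamma\rfloor+\varepsilon}_{loc}(\mathbb{R}^n)$ for some $\varepsilon>0$ and $(-\Delta)^sv=(-\Delta)^m(-\Delta)^\gamma v$ is pointwise well defined, continuous on $\mathbb{R}^n$, and equals $F$. *)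

(* Defs.v *)
From HB Require Import structures.
From mathcomp Require Import all_boot all_order all_algebra.
From mathcomp Require Import all_classical all_reals all_analysis.
Set Implicit Arguments. Unset Strict Implicit. Unset Printing Implicit Defensive.
Import Order.TTheory GRing.Theory Num.Theory.
Import numFieldNormedType.Exports.
Local Open Scope classical_set_scope.
Local Open Scope ring_scope.

Section Defs.
Variable R : realType.

Definition eucl n (x : 'rV[R]_n) : R := Num.sqrt (\sum_(i < n) (x ord0 i) ^+ 2).

Definition evec n (i : 'I_n) : 'rV[R]_n := \row_(j < n) (i == j)%:R.

(* ---------- Lebesgue integral over R^n (iterated, Tonelli) ---------- *)

Definition cons_fun n (x : R) (g : 'I_n -> R) : 'I_n.+1 -> R :=
  fun i => if unlift ord0 i is Some j then g j else x.

Fixpoint iint (n : nat) : (('I_n -> R) -> \bar R) -> \bar R :=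
  match n return (('I_n -> R) -> \bar R) -> \bar R with
  | 0 => fun F => F (fun _ => 0)
  | n'.+1 => fun F =>
      (\int[@lebesgue_measure R]_x iint (fun g => F (cons_fun x g)))%E
  end.

Definition Rn_int_ge0 n (F : 'rV[R]_n -> \bar R) : \bar R :=
  iint (fun g => F (\row_(i < n) g i)).

Definition Rn_integrable n (F : 'rV[R]_n -> R) : Prop :=
  (Rn_int_ge0 (fun x => (`|F x|)%:E) < +oo)%E.

Definition Rn_int n (F : 'rV[R]_n -> R) : R :=
  fine (Rn_int_ge0 (fun x => (Num.max (F x) 0)%:E))
  - fine (Rn_int_ge0 (fun x => (Num.max (- F x) 0)%:E)).

Definition Lp n (p : R) (F : 'rV[R]_n -> R) : Prop :=
  (Rn_int_ge0 (fun x => (`|F x| `^ p)%:E) < +oo)%E.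

Definition Gamma (x : R) : R :=
  fine (\int[@lebesgue_measure R]_(t in [set t : R | (0 < t)%R]) ((t `^ (x - 1)) * expR (- t))%R%:E)%E.

(* normalizing constant of (-Delta)^g, 0 < g < 1, so that its symbol is |xi|^(2g) *)
Definition C_frac n (g : R) : R :=
  2 `^ (2 * g) * g * Gamma (n%:R / 2 + g) / (pi `^ (n%:R / 2) * Gamma (1 - g)).

Definition c_ns n (s : R) : R :=
  Gamma (n%:R / 2 - s) / (pi `^ (n%:R / 2) * 2 `^ (2 * s) * Gamma s).

Definition Ls n (g : R) (v : 'rV[R]_n -> R) : Prop :=
  Rn_integrable (fun x => v x / (1 + eucl x `^ (n%:R + 2 * g))).

Definition frac_trunc n (g : R) (v : 'rV[R]_n -> R) (x : 'rV[R]_n) (e : R) : R :=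
  Rn_int (fun y => if e < eucl (x - y)
                   then (v x - v y) / eucl (x - y) `^ (n%:R + 2 * g) else 0).

Definition fraclap_defined n (g : R) (v : 'rV[R]_n -> R) (x : 'rV[R]_n) : Prop :=
  g = 0 \/
  ((forall e, 0 < e -> Rn_integrable (fun y => if e < eucl (x - y)
       then (v x - v y) / eucl (x - y) `^ (n%:R + 2 * g) else 0))
   /\ cvg (frac_trunc g v x @ 0^'+)).

Definition fraclap n (g : R) (v : 'rV[R]_n -> R) (x : 'rV[R]_n) : R :=
  if g == 0 then v x else C_frac n g * lim (frac_trunc g v x @ 0^'+).

Fixpoint pderiv n (l : seq 'I_n) (f : 'rV[R]_n -> R) : 'rV[R]_n -> R :=
  match l with
  | [::] => f
  | i :: l' => fun x => 'D_(evec i) (pderiv l' f) x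
  end.

Definition Ck n (k : nat) (f : 'rV[R]_n -> R) : Prop :=
  forall l : seq 'I_n, (size l <= k)%N ->
    continuous (pderiv l f) /\
    ((size l < k)%N -> forall (i : 'I_n) x, derivable (pderiv l f) x (evec i)).

Definition holder_loc n (a : R) (h : 'rV[R]_n -> R) : Prop :=
  forall r : R, 0 < r -> exists C : R, forall x y : 'rV[R]_n,
    eucl x <= r -> eucl y <= r -> `|h x - h y| <= C * eucl (x - y) `^ a.

Definition Cka_loc n (k : nat) (a : R) (f : 'rV[R]_n -> R) : Prop :=
  Ck k f /\ forall l : seq 'I_n, size l = k -> holder_loc a (pderiv l f).

Definition lap n (h : 'rV[R]_n -> R) (x : 'rV[R]_n) : R :=
  \sum_(i < n) 'D_(evec i) (fun y => 'D_(evec i) h y) x.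

Fixpoint neglap_iter n (j : nat) (h : 'rV[R]_n -> R) : 'rV[R]_n -> R :=
  match j with
  | 0 => h
  | j'.+1 => fun x => - lap (neglap_iter j' h) x
  end.

Definition neglap_defined n (j : nat) (h : 'rV[R]_n -> R) : Prop :=
  forall j', (j' < j)%N -> forall (i : 'I_n) (x : 'rV[R]_n),
    derivable (neglap_iter j' h) x (evec i) /\
    derivable (fun y => 'D_(evec i) (neglap_iter j' h) y) x (evec i).

(* v is a strong solution of (-Delta)^s v = F, with s = m + g, 0 <= g < 1 *)
Definition strong_solution n (m : nat) (g : R) (v F : 'rV[R]_n -> R) : Prop :=
  Ls g v /\
  (exists eps : R, 0 < eps /\
     Cka_loc (2 * m + Num.truncn (2 * g)%R)%N
             (2 * g - (Num.truncn (2 * g))%:R + eps) v) /\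
  (forall x, fraclap_defined g v x) /\
  neglap_defined m (fraclap g v) /\
  continuous (neglap_iter m (fraclap g v)) /\
  (forall x, neglap_iter m (fraclap g v) x = F x).

End Defs.

(* Main.v *)
Require Import Defs.
From HB Require Import structures.
From mathcomp Require Import all_boot all_order all_algebra.
From mathcomp Require Import all_classical all_reals all_analysis.
From mathcomp Require Import measurable_realfun zify ring lra.
Set Implicit Arguments. Unset Strict Implicit. Unset Printing Implicit Defensive.
Import Order.TTheory GRing.Theory Num.Theory.
Import numFieldNormedType.Exports.
Local Open Scope classical_set_scope.
Local Open Scope ring_scope.

(* Let F(x) = f(x, v(x)) and let h_t be the heat kernel. Put psi^j_t = (-d/dt)^j h_t = (-Laplacian)^j h_t,
   U_j(t) = int psi^j_t(y) v(x+y) dy and W(t) = int h_t(y) F(x+y) dy. Moving the operator onto h_t gives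
     W(t) = g / Gamma(1-g) int_0^oo (U_m(t) - U_m(t+r)) r^(-1-g) dr      (W = U_m if g = 0).
   This is legitimate although v is only in L_s: the Gaussian is a superposition over the radius r of the
   compactly supported bumps (r - |y|^2)_+^k, on which the equation is tested by summation by parts for
   difference quotients, and everything is dominated by the weight (1+|y|^2)^(-n/2-g).
   Now U_j' = -U_(j+1), U_j(t) = O(t^(g-j)) and, since F is in L^p, W(t) = O(t^(-n/2p)) with n/2p > s.
   Inverting the Marchaud-type formula and integrating, U_0(t) = C(x) + I^s W(t), where I^s is the
   right-sided Riemann-Liouville integral. By a Harnack inequality for h_t the constants C(x) are
   comparable to each other, and v >= C; a nonzero constant contradicts (b), and under (a) it bounds F
   from below, which contradicts the decay of W. Hence U_0 = I^s W, and t -> 0 gives the formula because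
   int_0^oo h_r(y) r^(s-1) dr is a multiple of |y|^(2s-n). *)

(** * Lebesgue measure on row vectors *)

(** Fourier analysis is out of reach: [v] may grow as far as [Ls] permits, and the fractional
    Laplacian of a bump decays in general only like |y|^(-n-2g), exactly that weight. Each test is
    therefore estimated in this weight, at a cost polynomial in the radius, so that an exponential
    superposition over radii converges. Bumps are chosen because the Laplacian of (r - |y|^2)_+^k is
    a combination of bumps with coefficients in r. Difference quotients stand in for derivatives
    because the iterated Laplacian of (-Delta)^g v is only known to exist pointwise; uniform bounds
    on iterated quotients give the domination. The integrability of F against the heat kernel is
    read off from the tested equation, by positivity. The semigroup law of the heat kernel turns the
    singular integral in space into an integral in time. There U_0 need not decay, so the calculus
    runs on increments U(t) - U(t+h), and a constant survives. Polar coordinates are avoided: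
    integrals of powers of |z| come from Gaussians by subordination. *)

Section RowMeasurable.
Context {R : realType}.

Definition coords n (i : 'I_n) (x : 'rV[R]_n) : R := x ord0 i.

Lemma rv_sigma0 n : g_sigma_preimage (@coords n) set0.
Proof. exact: sigma_algebra0. Qed.

Lemma rv_sigmaC n A : g_sigma_preimage (@coords n) A ->
  g_sigma_preimage (@coords n) (~` A).
Proof. exact: sigma_algebraC. Qed.

Lemma rv_sigma_bigcup n (F : (set 'rV[R]_n)^nat) :
  (forall i, g_sigma_preimage (@coords n) (F i)) ->
  g_sigma_preimage (@coords n) (\bigcup_i (F i)).
Proof. exact: sigma_algebra_bigcup. Qed.

HB.instance Definition _ n := @isMeasurable.Build default_measure_display
  'rV[R]_n (g_sigma_preimage (@coords n)) (@rv_sigma0 n) (@rv_sigmaC n)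
  (@rv_sigma_bigcup n).

Lemma measurable_rvP d (T : measurableType d) n (f : T -> 'rV[R]_n) :
  measurable_fun [set: T] f <->
  forall i, measurable_fun [set: T] (fun x => f x ord0 i).
Proof.
apply: (@iff_trans _ (g_sigma_preimage
    (fun i => @coords n i \o f) `<=` measurable)).
  rewrite g_sigma_preimage_comp; split=> [mf A [/= C preC <-]|prefS].
    exact: mf.
  by move=> _ A mA; apply: prefS; exists A.
split=> [tnthfS i|mf].
- move=> _ A mA.
  apply: tnthfS; apply: sub_sigma_algebra.
  case: n i => [[] []//|n i] in f *.
  rewrite -bigcup_mkord_ord.
  exists i; first exact: ltn_ord.
  by exists A => //; rewrite inord_val.
- apply: smallest_sub; first exact: sigma_algebra_measurable.
  case: n => [|n] in f mf *; first by rewrite big_ord0.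
  rewrite -bigcup_mkord_ord; apply: bigcup_sub => i Ii.
  by move=> A [B mB <-]; exact: mf.
Qed.

Lemma measurable_coord n (i : 'I_n) :
  measurable_fun [set: 'rV[R]_n] (fun x => x ord0 i).
Proof. by have /measurable_rvP := @measurable_id _ 'rV[R]_n setT; exact. Qed.

(** [D] is arbitrary: ['rV[int]_n] is countable, so the preimage is a countable union of finite
    intersections of coordinate fibres. Any function of a rounded point is measurable for this
    reason. *)
Lemma measurable_rv_countable n (D : set 'rV[int]_n) (h : 'rV[R]_n -> 'rV[int]_n) :
  (forall i (z : int), measurable [set x | h x ord0 i = z]) ->
  measurable (h @^-1` D).
Proof.
move=> mh.
have -> : h @^-1` D = \bigcup_(z in [set: 'rV[int]_n])
    (if z \in D then \bigcap_(i in [set: 'I_n]) [set x | h x ord0 i = z ord0 i]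
     else set0).
  apply/seteqP; split=> [x Dx|x [z _]] /=.
    by exists (h x) => //; rewrite mem_set.
  case: ifPn => // /set_mem Dz hz.
  suff -> : h x = z by [].
  by apply/rowP => i; exact: hz.
apply: countable_bigcupT_measurable; first exact: countableP.
move=> z; case: ifPn => // _.
apply: fin_bigcap_measurable => [|i _]; first exact: finite_finset.
exact: mh.
Qed.

Lemma rv_norm_le n (x : 'rV[R]_n) (e : R) : 0 <= e ->
  (forall i, `|x ord0 i| <= e) -> `|x| <= e.
Proof.
move=> e0 xe; rewrite /Num.norm/= mx_normrE.
by apply/bigmax_leP; split => // -[i j] _ /=; rewrite (ord1 i).
Qed.

(* A continuous function is the pointwise limit of its compositions with rounding to a mesh, which take countably many values on boxes. *)
Lemma continuous_measurable_rv n (f : 'rV[R]_n -> R) :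
  continuous f -> measurable_fun [set: 'rV[R]_n] f.
Proof.
move=> cf.
pose fl k (x : 'rV[R]_n) : 'rV[int]_n := \row_i Num.floor (x ord0 i * k.+1%:R).
pose un k (z : 'rV[int]_n) : 'rV[R]_n := \row_i ((z ord0 i)%:~R / k.+1%:R).
apply: (@measurable_fun_cvg _ _ _ _ (fun k x => f (un k (fl k x)))) => [k|x _].
  move=> _ A mA; rewrite setTI.
  rewrite (_ : _ @^-1` A = fl k @^-1` [set z | A (f (un k z))])//.
  apply: measurable_rv_countable => i z.
  have -> : [set x : 'rV[R]_n | fl k x ord0 i = z] =
      (fun x : 'rV[R]_n => x ord0 i * k.+1%:R) @^-1` `[z%:~R, (z + 1)%:~R[%classic.
    apply/seteqP; split => x /=; rewrite mxE in_itv/=.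
      by move=> /eqP; rewrite floor_eq.
    by rewrite -floor_eq => /eqP.
  rewrite -[X in measurable X]setTI.
  suff : measurable_fun setT (fun x : 'rV[R]_n => x ord0 i * k.+1%:R).
    by apply => //; exact: measurable_itv.
  by apply: measurable_funM => //; exact: measurable_coord.
apply: (@cvg_comp _ _ _ (fun k => un k (fl k x)) f _ (nbhs x)); last exact: cf.
apply/cvgrPdist_le => /= e e0.
near=> k.
apply: rv_norm_le => [|i]; first exact: ltW.
rewrite !mxE.
have k0 : 0 < k.+1%:R :> R by rewrite ltr0n.
have /andP[f1 f2] := floor_itv (x ord0 i * k.+1%:R).
have ke : k.+1%:R^-1 <= e by apply: ltW; near: k; exact: (near_infty_natSinv_lt (PosNum e0)).

rewrite (_ : _ - _ = (x ord0 i * k.+1%:R - (Num.floor (x ord0 i * k.+1%:R))%:~R) / k.+1%:R);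
  last by rewrite mulrBl mulfK// gt_eqF.
rewrite ger0_norm; last by rewrite divr_ge0 ?subr_ge0// ltW.
apply: le_trans ke; rewrite ler_piMl// ?invr_ge0 ?ltW//.
by rewrite ltrBlDl (lt_le_trans f2)// intrD addrC.
Unshelve. all: end_near. Qed.

End RowMeasurable.

(** * Product Lebesgue measure and its invariances *)

Section RnMeasure.
Context {R : realType}.
Notation leb := (@lebesgue_measure R).

Definition cons_rv n (xy : measurableTypeR R * 'rV[R]_n) : 'rV[R]_n.+1 :=
  \row_i cons_fun xy.1 (fun j => xy.2 ord0 j) i.

Lemma cons_rv0 n (xy : measurableTypeR R * 'rV[R]_n) : cons_rv xy ord0 ord0 = xy.1.
Proof. by rewrite mxE /cons_fun unlift_none. Qed.

Lemma cons_rvS n (xy : measurableTypeR R * 'rV[R]_n) i :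
  cons_rv xy ord0 (lift ord0 i) = xy.2 ord0 i.
Proof. by rewrite mxE /cons_fun liftK. Qed.

Lemma measurable_cons_rv n : measurable_fun setT (@cons_rv n).
Proof.
apply/measurable_rvP => i; case: (unliftP ord0 i) => [j ->|->].
  under eq_fun do rewrite cons_rvS.
  exact: (measurableT_comp (measurable_coord j) measurable_snd).
by under eq_fun do rewrite cons_rv0; exact: measurable_fst.
Qed.

Definition uncons_rv n (z : 'rV[R]_n.+1) : measurableTypeR R * 'rV[R]_n :=
  (z ord0 ord0, \row_j z ord0 (lift ord0 j)).

Lemma cons_rvK n : cancel (@cons_rv n) (@uncons_rv n).
Proof.
by move=> [x y]; rewrite /uncons_rv cons_rv0; congr pair; apply/rowP => j; rewrite mxE cons_rvS.
Qed.

Lemma uncons_rvK n : cancel (@uncons_rv n) (@cons_rv n).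
Proof.
move=> z; apply/rowP => i; case: (unliftP ord0 i) => [j ->|->].
  by rewrite cons_rvS mxE.
by rewrite cons_rv0.
Qed.

Lemma measurable_uncons_rv n : measurable_fun setT (@uncons_rv n).
Proof.
apply: measurable_fun_pair; first exact: measurable_coord.
by apply/measurable_rvP => i; under eq_fun do rewrite mxE; exact: measurable_coord.
Qed.

Section step.
Context (n : nat) (m : {sigma_finite_measure set 'rV[R]_n -> \bar R}).

Definition cons_measure : set 'rV[R]_n.+1 -> \bar R :=
  pushforward (leb \x m)%E (@cons_rv n).

HB.instance Definition _ := Measure.copy cons_measure
  (measure_function_pushforward__canonical__measure_function_Measure
     (leb \x m)%E (@measurable_cons_rv n)).

Lemma cons_measure_sigma_finite : sigma_finite setT cons_measure.
Proof.
have /sigma_finiteP[A [UA ndA mA]] := sigma_finiteT leb.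
have /sigma_finiteP[B [UB ndB mB]] := sigma_finiteT m.
have preE i : @cons_rv n @^-1` ((@uncons_rv n) @^-1` (A i `*` B i)) = A i `*` B i.
  rewrite -comp_preimage (_ : _ \o _ = id) ?preimage_id//.
  by apply/funext => z /=; exact: cons_rvK.
exists (fun i => (@uncons_rv n) @^-1` (A i `*` B i)).
  apply/esym/seteqP; split => // z _.
  have [i _ Ai] : (\bigcup_i A i) (uncons_rv z).1 by rewrite -UA.
  have [j _ Bj] : (\bigcup_i B i) (uncons_rv z).2 by rewrite -UB.
  exists (maxn i j) => //; split.
    by move: Ai; apply/subsetPset/ndA/leq_maxl.
  by move: Bj; apply/subsetPset/ndB/leq_maxr.
move=> i; split.
  rewrite -[X in measurable X]setTI; apply: measurable_uncons_rv => //.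
  by apply: measurableX; [exact: (mA i).1|exact: (mB i).1].
rewrite /cons_measure /pushforward preE product_measure1E; [|exact: (mA i).1|exact: (mB i).1].
by rewrite lte_mul_pinfty ?(mB i).2// ge0_fin_numE ?(mA i).2.
Qed.

HB.instance Definition _ := @Measure_isSigmaFinite.Build _ _ _
  cons_measure cons_measure_sigma_finite.

Lemma integral_cons_measure (F : 'rV[R]_n.+1 -> \bar R) :
  measurable_fun setT F -> (forall x, (0 <= F x)%E) ->
  (\int[cons_measure]_z F z = \int[leb]_x \int[m]_y F (cons_rv (x, y)))%E.
Proof.
move=> mF F0.
rewrite [LHS](_ : _ = \int[(leb \x m)%E]_(x in setT) (F \o @cons_rv n) x)%E; last first.
  have := @ge0_integral_pushforward _ _ _ _ _ _ (@measurable_cons_rv n) (leb \x m)%E setT F measurableT mF (fun y _ => F0 y).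
  by rewrite preimage_setT.
rewrite fubini_tonelli1//=.
by apply: measurableT_comp => //; exact: measurable_cons_rv.
Qed.

End step.

(* Lebesgue measure, on the sigma-algebra generated by the coordinates. *)
Fixpoint rnm n : {sigma_finite_measure set 'rV[R]_n -> \bar R} :=
  match n with
  | 0 => \d_(0 : 'rV[R]_0)
  | k.+1 => cons_measure (rnm k)
  end.

Lemma integral_rnmS n (F : 'rV[R]_n.+1 -> \bar R) :
  measurable_fun setT F -> (forall x, (0 <= F x)%E) ->
  (\int[rnm n.+1]_z F z = \int[leb]_x \int[rnm n]_y F (cons_rv (x, y)))%E.
Proof. exact: integral_cons_measure. Qed.

Lemma integral_rnm0 (F : 'rV[R]_0 -> \bar R) :
  (\int[rnm 0]_z F z = F 0%R)%E.
Proof.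
rewrite (eq_integral (cst (F 0%R))); last first.
  by move=> z _; rewrite /cst; congr F; apply/rowP => -[].
have := @integral_dirac _ _ (0 : 'rV[R]_0) R setT measurableT _ (measurable_cst (F 0%R)).
by rewrite diracT mul1e.
Qed.

(** [iint] and [rnm] peel off coordinates in the same order, so each induction step is one use of
    Tonelli's theorem. This is the passage from the iterated integrals of the statement to measure
    theory. *)
Lemma Rn_int_ge0E n (F : 'rV[R]_n -> \bar R) :
  measurable_fun setT F -> (forall x, (0 <= F x)%E) ->
  Rn_int_ge0 F = (\int[rnm n]_x F x)%E.
Proof.
elim: n F => [|n IH] F mF F0.
  by rewrite integral_rnm0 /Rn_int_ge0/=; congr F; apply/rowP => -[].
rewrite integral_rnmS// /Rn_int_ge0/=; apply: eq_integral => x _.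
rewrite -IH//.
  by rewrite /Rn_int_ge0; congr iint; apply/funext => h; congr F; apply/rowP => i; rewrite !mxE;
     congr (cons_fun _ _ _); apply/funext => j; rewrite mxE.
apply: (measurableT_comp mF).
apply: (measurableT_comp (@measurable_cons_rv n)).
exact: measurable_fun_pair.
Qed.

(** The image of Lebesgue measure under the translation agrees with it on half-open intervals, hence
    everywhere. Scaling is treated in the same way below, with the factor absorbed into the
    measure. *)
Lemma ge0_integral_leb_shift (a : R) (F : R -> \bar R) :
  measurable_fun setT F -> (forall x, (0 <= F x)%E) ->
  (\int[leb]_x F (x + a)%R = \int[leb]_x F x)%E.
Proof.
move=> mF F0.
have mph : measurable_fun setT (fun x : measurableTypeR R => (x + a)%R : measurableTypeR R).
  exact: measurable_funD.
transitivity (\int[pushforward leb (fun x : measurableTypeR R => (x + a)%R : measurableTypeR R)]_x F x)%E.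
  by rewrite (ge0_integral_pushforward mph)//.
apply: eq_measure_integral => A mA _.
apply/esym; pose nu := measure_function_pushforward__canonical__measure_function_Measure
     (leb : {measure set _ -> \bar R}) mph.
apply: (@lebesgue_measure_unique _ nu) => // _ [[b c]] _ <-.
rewrite /nu/= /pushforward.
have -> : (fun x : R => x + a) @^-1` `]b, c]%classic = `](b - a), (c - a)]%classic.
  by apply/seteqP; split => x /=; rewrite !in_itv/= ltrBlDr lerBrDr.
rewrite !lebesgue_measure_itv/= !lte_fin ltrD2r; case: ifPn => // _.
by rewrite -!EFinD; congr EFin; ring.
Qed.

Lemma ge0_integral_leb_opp (F : R -> \bar R) :
  measurable_fun setT F -> (forall x, (0 <= F x)%E) ->
  (\int[leb]_x F (- x)%R = \int[leb]_x F x)%E.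
Proof.
move=> mF F0.
have mph : measurable_fun setT (fun x : measurableTypeR R => (- x)%R : measurableTypeR R).
  exact: measurable_funN.
transitivity (\int[pushforward leb (fun x : measurableTypeR R => (- x)%R : measurableTypeR R)]_x F x)%E.
  by rewrite (ge0_integral_pushforward mph)//.
apply: eq_measure_integral => A mA _; exact: lebesgue_measureN.
Qed.

Lemma ge0_integral_leb_scale (c : R) (F : R -> \bar R) : 0 < c ->
  measurable_fun setT F -> (forall x, (0 <= F x)%E) ->
  (\int[leb]_x F (c * x)%R = c^-1%:E * \int[leb]_x F x)%E.
Proof.
move=> c0 mF F0.
have mph : measurable_fun setT (fun x : measurableTypeR R => (c * x)%R : measurableTypeR R).
  exact: measurable_funM.
have ci0 : 0 <= c^-1 by rewrite invr_ge0 ltW.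
transitivity (\int[pushforward leb (fun x : measurableTypeR R => (c * x)%R : measurableTypeR R)]_x F x)%E.
  by rewrite (ge0_integral_pushforward mph)//.
have <- := ge0_integral_mscale leb measurableT (NngNum ci0) mF (fun x _ => F0 x).
apply: eq_measure_integral => A mA _.
rewrite /mscale/=.
pose nu0 := measure_function_pushforward__canonical__measure_function_Measure
     (leb : {measure set _ -> \bar R}) mph.
have c0' : 0 <= c by exact: ltW.
rewrite /mscale/=; suff -> : leb A = (c%:E * nu0 A)%E.
  by rewrite muleA -EFinM mulVf ?mul1e// gt_eqF.
  apply: (@lebesgue_measure_unique _ (mscale (NngNum c0') nu0)) => // _ [[b d]] _ <-.
  change (leb `]b, d]%classic = c%:E * leb ((fun x : measurableTypeR R => (c * x)%R : measurableTypeR R) @^-1` `]b, d]%classic))%E.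
  have -> : (fun x : measurableTypeR R => (c * x)%R : measurableTypeR R) @^-1` `]b, d]%classic = `](b / c), (d / c)]%classic.
    by apply/seteqP; split => x /=; rewrite !in_itv/= ltr_pdivrMr// ler_pdivlMr// !(mulrC x).
  rewrite !lebesgue_measure_itv; move: (mule0 c%:E); rewrite /= !lte_fin ltr_pM2r ?invr_gt0// => c0E; case: ifPn => // _.
  rewrite -!EFinD -EFinM; congr EFin; field; exact: lt0r_neq0.
Qed.

Lemma measurable_cons_rvr n (x : R) :
  measurable_fun setT (fun y : 'rV[R]_n => cons_rv (x, y)).
Proof.
apply: (measurableT_comp (@measurable_cons_rv n)).
exact: measurable_fun_pair.
Qed.

Lemma measurable_cons_int n (F : 'rV[R]_n.+1 -> \bar R) :
  measurable_fun setT F -> (forall x, (0 <= F x)%E) ->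
  measurable_fun (setT : set (measurableTypeR R)) (fun x => \int[rnm n]_y F (cons_rv (x, y)))%E.
Proof.
move=> mF F0.
have mFc : measurable_fun setT (fun z : measurableTypeR R * 'rV[R]_n => F (cons_rv z)).
  exact: (measurableT_comp mF (@measurable_cons_rv n)).
exact: (measurable_fun_fubini_tonelli_F _ mFc (fun z => F0 (cons_rv z))).
Qed.

Lemma measurable_rv_add n (a : 'rV[R]_n) :
  measurable_fun setT (fun x : 'rV[R]_n => x + a).
Proof.
apply/measurable_rvP => i; under eq_fun do rewrite mxE.
apply: measurable_funD => //; exact: measurable_coord.
Qed.

Lemma measurable_rv_opp n : measurable_fun setT (fun x : 'rV[R]_n => - x).
Proof.
apply/measurable_rvP => i; under eq_fun do rewrite mxE.
apply: measurable_funN; exact: measurable_coord.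
Qed.

Lemma ge0_integral_rnm_shift n (a : 'rV[R]_n) (F : 'rV[R]_n -> \bar R) :
  measurable_fun setT F -> (forall x, (0 <= F x)%E) ->
  (\int[rnm n]_x F (x + a)%R = \int[rnm n]_x F x)%E.
Proof.
elim: n a F => [|n IH] a F mF F0.
  by rewrite !integral_rnm0; congr F; apply/rowP => -[].
rewrite (integral_rnmS (measurableT_comp mF (@measurable_rv_add _ a)) (fun x => F0 _)) (integral_rnmS mF F0).
pose a' := (uncons_rv a).2.
have E (x : R) y : cons_rv (x, y) + a = cons_rv (x + a ord0 ord0, y + a') :> 'rV[R]_n.+1.
  apply/rowP => i; case: (unliftP ord0 i) => [j ->|->]; rewrite mxE.
    by rewrite !cons_rvS/= !mxE.
  by rewrite !cons_rv0.
transitivity (\int[leb]_x \int[rnm n]_y F (cons_rv ((x + a ord0 ord0)%R, y)))%E.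
  apply: eq_integral => x _.
  under eq_integral do rewrite /= E.
  rewrite (IH a' (fun y => F (cons_rv (x + a ord0 ord0, y))))//.
  exact: (measurableT_comp mF (@measurable_cons_rvr n _)).
rewrite (ge0_integral_leb_shift (a ord0 ord0) (F := fun x => \int[rnm n]_y F (cons_rv (x, y))))%E//.
  exact: measurable_cons_int.
by move=> x; apply: integral_ge0.
Qed.

Lemma ge0_integral_rnm_opp n (F : 'rV[R]_n -> \bar R) :
  measurable_fun setT F -> (forall x, (0 <= F x)%E) ->
  (\int[rnm n]_x F (- x)%R = \int[rnm n]_x F x)%E.
Proof.
elim: n F => [|n IH] F mF F0.
  by rewrite !integral_rnm0; congr F; apply/rowP => -[].
rewrite (integral_rnmS (measurableT_comp mF (@measurable_rv_opp _)) (fun x => F0 _)) (integral_rnmS mF F0).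
have E (x : R) y : - cons_rv (x, y) = cons_rv (- x, - y) :> 'rV[R]_n.+1.
  apply/rowP => i; case: (unliftP ord0 i) => [j ->|->]; rewrite mxE.
    by rewrite !cons_rvS/= !mxE.
  by rewrite !cons_rv0.
transitivity (\int[leb]_x \int[rnm n]_y F (cons_rv ((- x)%R, y)))%E.
  apply: eq_integral => x _.
  under eq_integral do rewrite /= E.
  rewrite (IH (fun y => F (cons_rv (- x, y))))//.
  exact: (measurableT_comp mF (@measurable_cons_rvr n _)).
rewrite (ge0_integral_leb_opp (F := fun x => \int[rnm n]_y F (cons_rv (x, y))))%E//.
  exact: measurable_cons_int.
by move=> x; apply: integral_ge0.
Qed.

(** Meant for Gaussians: the mass and the convolution law of [heat] reduce to one variable. *)
Lemma integral_rnm_prod n (h : 'I_n -> R -> R) (c : 'I_n -> R) :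
  (forall i, measurable_fun setT (h i)) -> (forall i t, 0 <= h i t) ->
  (forall i, (\int[leb]_t (h i t)%:E = (c i)%:E)%E) ->
  (\int[rnm n]_x (\prod_i h i (x ord0 i))%:E = (\prod_i c i)%:E)%E.
Proof.
elim: n h c => [|n IH] h c mh h0 hc.
  by rewrite integral_rnm0 !big_ord0.
rewrite integral_rnmS//; last 2 first.
- apply/measurable_EFinP; apply: measurable_prod => i _.
  exact: (measurableT_comp (mh i) (measurable_coord i)).
- by move=> x; rewrite lee_fin; apply: prodr_ge0.
have mP : measurable_fun setT (fun y : 'rV[R]_n => (\prod_(i < n) h (lift ord0 i) (y ord0 i))%:E).
  apply/measurable_EFinP; apply: measurable_prod => i _.
  exact: (measurableT_comp (mh _) (measurable_coord i)).
have P0 (y : 'rV[R]_n) : (0 <= (\prod_(i < n) h (lift ord0 i) (y ord0 i))%:E)%E.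
  by rewrite lee_fin; apply: prodr_ge0.
transitivity (\int[leb]_x ((\prod_(i < n) c (lift ord0 i))%:E * (h ord0 x)%:E))%E.
  apply: eq_integral => x _.
  rewrite -(IH (fun i => h (lift ord0 i)) (fun i => c (lift ord0 i)))// muleC.
  rewrite -ge0_integralZl//; last by rewrite lee_fin.
  apply: eq_integral => y _; rewrite big_ord_recl cons_rv0 EFinM.
  by congr ((_)%:E * (_)%:E)%E; apply: eq_bigr => i _; rewrite cons_rvS.
rewrite ge0_integralZl//; last 3 first.
- by apply/measurable_EFinP; exact: mh.
- by move=> x _; rewrite lee_fin.
- by rewrite lee_fin; apply: prodr_ge0 => i _; rewrite -lee_fin -hc; apply: integral_ge0 => t _; rewrite lee_fin.
by rewrite hc -EFinM big_ord_recl mulrC.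
Qed.

Lemma measurable_rv_set1 n (a : 'rV[R]_n) : measurable [set a].
Proof.
have -> : [set a] = \bigcap_(i in [set: 'I_n]) ((fun x : 'rV[R]_n => x ord0 i) @^-1` [set a ord0 i]).
  apply/seteqP; split=> [x -> //|x xa]; apply/rowP => i; exact: xa.
apply: fin_bigcap_measurable => [|i _]; first exact: finite_finset.
by rewrite -[X in measurable X]setTI; apply: measurable_coord.
Qed.

(** Serves to discard the origin, where the Riesz kernel takes a default value. *)
Lemma rnm_set1 n (a : 'rV[R]_n) : (0 < n)%N -> rnm n [set a] = 0%E.
Proof.
case: n a => // n a _.
rewrite /= /cons_measure /pushforward.
have -> : @cons_rv n @^-1` [set a] = [set (uncons_rv a).1] `*` [set (uncons_rv a).2].
  apply/seteqP; split=> [[x y] /= <-|[x y] /= [-> ->]].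
    by split; [rewrite cons_rv0|apply/rowP => j; rewrite mxE cons_rvS].
  exact: uncons_rvK.
rewrite product_measure1E//; last exact: measurable_rv_set1.
have h := lebesgue_measure_set1 (uncons_rv a).1.
by rewrite [X in (X * _)%E]h mul0e.
Qed.

End RnMeasure.

Arguments rnm : simpl never.
#[global] Opaque rnm.

(** * One-dimensional integrals *)

Section Tonelli.
Context d1 d2 (T1 : measurableType d1) (T2 : measurableType d2) (R : realType).
Variables (m1 : {sigma_finite_measure set T1 -> \bar R}).
Variables (m2 : {sigma_finite_measure set T2 -> \bar R}).

Lemma tonelli_in (D1 : set T1) (D2 : set T2) (f : T1 * T2 -> \bar R) :
  measurable D1 -> measurable D2 -> measurable_fun setT f ->
  (forall z, (0 <= f z)%E) ->
  (\int[m1]_(x in D1) \int[m2]_(y in D2) f (x, y) =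
   \int[m2]_(y in D2) \int[m1]_(x in D1) f (x, y))%E.
Proof.
move=> mD1 mD2 mf f0.
pose h := f \_ (D1 `*` D2).
have mh : measurable_fun setT h.
  apply/(measurable_restrictT f); first exact: measurableX.
  exact: measurable_funS mf.
have h0 z : (0 <= h z)%E by rewrite /h patchE; case: ifPn.
transitivity (\int[m1]_x \int[m2]_y h (x, y))%E.
  rewrite integral_mkcond; apply: eq_integral => x _; rewrite patchE.
  case: ifPn => [/set_mem Dx|/negP nDx]; last first.
    rewrite integral0_eq// => y _; rewrite /h patchE; case: ifPn => // /set_mem [Dx _].
    by exfalso; apply: nDx; rewrite inE.
  rewrite integral_mkcond; apply: eq_integral => y _; rewrite /h !patchE.
  congr (if _ then _ else _).
  by apply/idP/idP => [/set_mem Dy|/set_mem[_ Dy]]; rewrite inE.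
rewrite (fubini_tonelli h mh h0); apply/esym.
rewrite integral_mkcond; apply: eq_integral => y _; rewrite patchE.
case: ifPn => [/set_mem Dy|/negP nDy]; last first.
  rewrite integral0_eq// => x _; rewrite /h patchE; case: ifPn => // /set_mem [_ Dy].
  by exfalso; apply: nDy; rewrite inE.
rewrite integral_mkcond; apply: eq_integral => x _; rewrite /h !patchE.
congr (if _ then _ else _).
by apply/idP/idP => [/set_mem Dx|/set_mem[Dx _]]; rewrite inE.
Qed.

End Tonelli.

Section OneDim.
Context {R : realType}.
Notation leb := (@lebesgue_measure R).
Implicit Types a b c t x : R.

Lemma integral_itv_if (i : interval R) (f : R -> \bar R) :
  (\int[leb]_(x in [set` i]) f x = \int[leb]_x (if x \in i then f x else 0))%E.
Proof.
rewrite integral_mkcond; apply: eq_integral => x _; rewrite patchE.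
by congr (if _ then _ else _); apply/idP/idP; rewrite inE.
Qed.

Lemma powRDp x a b : 0 < x -> x `^ (a + b) = x `^ a * x `^ b.
Proof. by move=> x0; rewrite powRD// (gt_eqF x0) implybT. Qed.

Lemma powRVp x a : 0 < x -> x^-1 `^ a = x `^ (- a).
Proof. by move=> x0; rewrite -powR_inv1 ?ltW// -powRrM mulN1r. Qed.

(** Round the exponent up to an integer k+1; for x >= 1 a single term x^(k+1)/(k+1)! of the
    exponential series already dominates. *)
Lemma powR_le_exp (a : R) : 0 <= a ->
  exists2 C, 0 < C & forall x, 0 <= x -> x `^ a <= C * expR x.
Proof.
move=> a0; pose k := (Num.truncn `|a|).+1.
exists (k.+1`!%:R + 1) => [|x x0].
  by rewrite addr_gt0// ltr0n fact_gt0.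
have ak : a <= k.+1%:R.
  apply: (le_trans (ler_norm _)); apply: ltW; apply: lt_trans (truncnS_gt _) _.
  by rewrite ltr_nat.
have [x1|x1] := leP x 1.
  have : x `^ a <= 1.
    by apply: (@le_trans _ _ (1 `^ a)); [rewrite ge0_ler_powR// ?nnegrE|rewrite powR1].
  move=> h; apply: (le_trans h).
  have e1 : 1 <= expR x by apply: le_trans (expR_ge1Dx x); rewrite lerDl.
  apply: (le_trans e1); rewrite ler_peMl ?expR_ge0//.
  by rewrite lerDr ler0n.
have h1 : x `^ a <= x ^+ k.+1.
  by rewrite -powR_mulrn// ler_powR// ltW.
have := expR_ge1Dxn k x0.
have f0 : 0 < k.+1`!%:R :> R by rewrite ltr0n fact_gt0.
move=> h2.
apply: (le_trans h1).
have h3 : x ^+ k.+1 / k.+1`!%:R <= expR x by apply: le_trans h2; rewrite lerDr.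
move: h3; rewrite ler_pdivrMr// mulrC => h3; apply: (le_trans h3).
by rewrite ler_wpM2r ?expR_ge0// lerDl.
Qed.

Lemma powR_le_exp_scale (a e : R) : 0 <= a -> 0 < e ->
  exists2 C, 0 < C & forall x, 0 <= x -> x `^ a <= C * expR (e * x).
Proof.
move=> a0 e0; have [C C0 h] := powR_le_exp a0.
exists (C * e `^ (- a)) => [|x x0]; first by rewrite mulr_gt0// powR_gt0.
have ex0 : 0 <= e * x by rewrite mulr_ge0// ltW.
have := h _ ex0; rewrite powRM ?(ltW e0)// => h'.
rewrite mulrAC -mulrC powRN -ler_pdivrMl ?invrK ?invr_gt0 ?powR_gt0//.
Qed.

Lemma cvg_powRN (al : R) : 0 < al -> x `^ (- al) @[x --> +oo] --> (0 : R).
Proof.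
move=> al0; apply/cvgrPdist_le => e e0; near=> x.
have x0 : 0 < x by near: x; exact: nbhs_pinfty_gt.
rewrite sub0r normrN ger0_norm ?powR_ge0//.
have -> : e = (e `^ (- al^-1) `^ al)^-1.
  by rewrite -powRN -powRrM mulrNN mulVf ?gt_eqF// powRr1// ltW.
have hx : e `^ (- al^-1) <= x by near: x; apply: nbhs_pinfty_ge; rewrite num_real.
rewrite powRN lef_pV2 ?posrE ?powR_gt0//.
by rewrite ge0_ler_powR ?nnegrE ?powR_ge0// ltW.
Unshelve. all: end_near. Qed.

Lemma is_derive_powR_scaled (al x : R) : al != 0 -> 0 < x ->
  is_derive x 1 (fun t => t `^ al / al) (x `^ (al - 1)).
Proof.
move=> al0 x0.
have -> : (fun t : R => t `^ al / al) = al^-1 \*: (fun t : R => t `^ al).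
  by apply/funext => t; rewrite /= mulrC.
have h := is_derive1_powR al x0.
have h2 := is_deriveZ (f := fun t : R => t `^ al) al^-1 h.
by apply: (is_derive_eq h2); rewrite /GRing.scale/= mulrA mulVf// mul1r.
Qed.

Lemma is_derive_cont (F : R -> R) (x d : R) : is_derive x 1 F d -> {for x, continuous F}.
Proof. by move=> h; apply: differentiable_continuous; apply/derivable1_diffP; case: h. Qed.

Lemma integral_pow_tail (al a : R) : 0 < al -> 0 < a ->
  (\int[leb]_(x in `]a, +oo[) (x `^ (- al - 1))%:E = (a `^ (- al) / al)%:E)%E.
Proof.
move=> al0 a0.
have mp : measurable_fun `]a, +oo[ (fun x : R => (x `^ (- al - 1))%:E).
  by apply/measurable_EFinP; apply: measurable_funTS; exact: measurable_powR.
rewrite integral_itv_obnd_cbnd//.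
have dF x : 0 < x -> is_derive x 1 (fun t : R => t `^ (- al) / (- al)) (x `^ (- al - 1)).
  by move=> x0; apply: is_derive_powR_scaled => //; rewrite oppr_eq0 gt_eqF.
rewrite (@ge0_continuous_FTC2y _ _ (fun t => t `^ (- al) / (- al)) _ 0).
- by rewrite sub0e -EFinN; congr EFin; rewrite invrN mulrN opprK.
- by move=> x _; exact: powR_ge0.
- apply: derivable_within_continuous => x; rewrite in_itv/= andbT => ax.
  by apply: derivable_powR; rewrite in_itv/= andbT (lt_le_trans a0).
- rewrite -[X in _ --> X](mul0r (- al)^-1); apply: cvgMl; exact: cvg_powRN.
- by move=> x ax; case: (dF x (lt_trans a0 ax)).
- by apply: cvg_at_right_filter; exact: is_derive_cont (dF _ a0).
- move=> x; rewrite in_itv/= andbT => ax; rewrite derive1E.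
  by case: (dF x (lt_trans a0 ax)).
Qed.

Lemma integral_exp_tail (a : R) :
  (\int[leb]_(x in `]a, +oo[) (expR (- x))%:E = (expR (- a))%:E)%E.
Proof.
have mp : measurable_fun `]a, +oo[ (fun x : R => (expR (- x))%:E).
  apply/measurable_EFinP; apply: measurable_funTS; apply: measurableT_comp => //.
rewrite integral_itv_obnd_cbnd//.
have dF x : is_derive x 1 (fun t : R => - expR (- t)) (expR (- x)).
  by apply: is_derive_eq; rewrite /GRing.scale/= mulrN1 opprK.
rewrite (@ge0_continuous_FTC2y _ _ (fun t => - expR (- t)) _ 0).
- by rewrite sub0e -EFinN opprK.
- by move=> x _; exact: expR_ge0.
- apply: continuous_subspaceT => x.
  by apply: continuous_comp; [exact: opp_continuous|exact: continuous_expR].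
- by rewrite -[X in _ --> X]oppr0; apply: cvgN; exact: cvgr_expR.
- by move=> x ax; case: (dF x).
- by apply: cvg_at_right_filter; exact: is_derive_cont (dF _).
- by move=> x _; rewrite derive1E; case: (dF x).
Qed.

(** For [al < 1] the integrand is unbounded at 0, so the fundamental theorem is applied on
    [a/(k+2), a] and the lower end is sent to 0 by monotone convergence. The shift by 2 keeps these
    intervals nondegenerate. *)
Lemma integral_pow_head (al a : R) : 0 < al -> 0 < a ->
  (\int[leb]_(x in `]0%R, a]) (x `^ (al - 1))%:E = (a `^ al / al)%:E)%E.
Proof.
move=> al0 a0.
pose F k : set R := `[a * (k.+2%:R)^-1, a]%classic.
have mp D : measurable_fun D (fun x : R => (x `^ (al - 1))%:E).
  by apply/measurable_EFinP; apply: measurable_funTS; exact: measurable_powR.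
have UF : `]0%R, a]%classic = \bigcup_k F k.
  apply/seteqP; split => x /=; rewrite /F; last first.
    move=> [k _] /=; rewrite !in_itv/= => /andP[h ->]; rewrite andbT.
    by apply: lt_le_trans h; rewrite mulr_gt0// invr_gt0 ltr0n.
  rewrite in_itv/= => /andP[x0 xa].
  have xa0 : 0 < x / a by rewrite divr_gt0.
  have [k _ hk] := near_infty_natSinv_lt (PosNum xa0).
  exists k => //=; rewrite in_itv/= xa andbT.
  rewrite mulrC -ler_pdivlMr//; apply: ltW; apply: le_lt_trans (hk k (leqnn k)) => /=.
  by rewrite lef_pV2 ?posrE ?ltr0n// ler_nat.
have ndF : nondecreasing_seq F.
  move=> i j ij; apply/subsetPset => x; rewrite /F /= !in_itv/= => /andP[h ->]; rewrite andbT.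
  by apply: le_trans h; rewrite ler_pM2l// lef_pV2 ?posrE ?ltr0n// ler_nat.
have mF k : measurable (F k) by exact: measurable_itv.
have := ge0_nondecreasing_set_cvg_integral (mu := leb) ndF mF (fun i => mp (F i))
  (fun i x _ => powR_ge0 x (al - 1)).
rewrite -UF => /cvg_unique; apply => //.
have -> : (fun i => \int[leb]_(x in F i) (x `^ (al - 1))%:E)%E =
    (fun i => (a `^ al / al - (a / i.+2%:R) `^ al / al)%:E).
  apply/funext => i.
  have ai0 : 0 < a / i.+2%:R by rewrite divr_gt0// ltr0n.
  have aia : a / i.+2%:R < a by rewrite ltr_pdivrMr ?ltr0n// ltr_pMr// ltr1n.
  have dF x : 0 < x -> is_derive x 1 (fun t : R => t `^ al / al) (x `^ (al - 1)).
    by move=> x0; apply: is_derive_powR_scaled => //; rewrite gt_eqF.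
  rewrite (@continuous_FTC2 _ _ (fun t => t `^ al / al))//.
  - apply: derivable_within_continuous => x; rewrite in_itv/= => /andP[ax _].
    by apply: derivable_powR; rewrite in_itv/= andbT (lt_le_trans ai0).
  - split.
    + by move=> x; rewrite in_itv/= => /andP[ax _]; case: (dF x (lt_trans ai0 ax)).
    + by apply: cvg_at_right_filter; exact: is_derive_cont (dF _ ai0).
    + by apply: cvg_at_left_filter; exact: is_derive_cont (dF _ a0).
  - move=> x; rewrite in_itv/= => /andP[ax _]; rewrite derive1E.
    by case: (dF x (lt_trans ai0 ax)).
apply: cvg_EFin; first by near=> k.
rewrite -[X in _ --> X]subr0.
apply: cvgB; first exact: cvg_cst.
rewrite -[X in _ --> X](mul0r al^-1); apply: cvgMl.
have -> : (fun k : nat => (a / k.+2%:R) `^ al) = (fun k : nat => (k.+2%:R / a) `^ (- al)).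
  by apply/funext => k; rewrite -powRVp ?divr_gt0 ?ltr0n// invf_div.
apply: (@cvg_comp _ _ _ (fun k : nat => k.+2%:R / a) (fun t => t `^ (- al)) _ (+oo)); last exact: cvg_powRN.
apply/cvgryPge => A; near=> k.
rewrite ler_pdivlMr//.
have h : A * a <= k%:R by near: k; exact: nbhs_infty_ger.
by apply: (le_trans h); rewrite ler_nat; exact: leq_trans (leqnSn _) (leqnSn _).
Unshelve. all: end_near. Qed.

Notation D0 := (`]0%R, +oo[%classic : set R).

Lemma Gamma_D0 (x : R) : Gamma x =
  fine (\int[leb]_(t in D0) (t `^ (x - 1) * expR (- t))%:E)%E.
Proof.
rewrite /Gamma; congr fine; congr integral.
by apply/seteqP; split => t /=; rewrite in_itv/= andbT.
Qed.

Lemma D0_split : D0 = `]0%R, 1] `|` `]1, +oo[.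
Proof.
apply/seteqP; split => t /=; rewrite !in_itv/= !andbT.
  by move=> ->; case: (leP t 1) => _; [left|right].
by move=> [/andP[]//|]; exact: lt_trans.
Qed.

Lemma measurable_gamma_fun (b : R) : measurable_fun setT (fun t : R => (t `^ b * expR (- t))%:E).
Proof.
apply/measurable_EFinP; apply: measurable_funM; first exact: measurable_powR.
by apply: measurableT_comp => //; exact: measurable_expR.
Qed.

Lemma integral_D0_lty (f : R -> \bar R) (al be C : R) : 0 < al -> 0 < be -> 0 <= C ->
  measurable_fun setT f ->
  (forall t, (0 <= f t)%E) ->
  (forall t, 0 < t -> t <= 1 -> (f t <= (C * t `^ (al - 1))%:E)%E) ->
  (forall t, 1 < t -> (f t <= (C * t `^ (- be - 1))%:E)%E) ->
  (\int[leb]_(t in D0) f t < +oo)%E.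
Proof.
move=> al0 be0 C0 mf f0 h1 h2.
have mpow (D : set R) b : measurable_fun D (fun t : R => (C * t `^ b)%:E).
  apply/measurable_EFinP; apply: measurable_funM => //; apply: measurable_funTS; exact: measurable_powR.
have mp (D : set R) b : measurable_fun D (fun t : R => (t `^ b)%:E).
  apply/measurable_EFinP; apply: measurable_funTS; exact: measurable_powR.
have mfD D : measurable_fun D f by exact: measurable_funTS.
rewrite D0_split ge0_integral_setU//; last 2 first.
  exact: mfD.
  rewrite /disj_set; apply/eqP/seteqP; split=> // t [] /=; rewrite !in_itv/= andbT => /andP[_ t1].
  by rewrite ltNge t1.
apply: lte_add_pinfty.
  apply: (@le_lt_trans _ _ (\int[leb]_(t in `]0%R, 1%R]) (C * t `^ (al - 1))%:E)%E).
    apply: ge0_le_integral => //.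
    + exact: mfD.
    + exact: mpow.
    + by move=> t; rewrite /= in_itv/= => /andP[]; exact: h1.
  under eq_integral do rewrite EFinM.
  rewrite ge0_integralZl//; [|exact: mp|by move=> t _; rewrite lee_fin powR_ge0].
  by rewrite integral_pow_head// -EFinM ltry.
apply: (@le_lt_trans _ _ (\int[leb]_(t in `]1%R, +oo[) (C * t `^ (- be - 1))%:E)%E).
  apply: ge0_le_integral => //.
  + exact: mfD.
  + exact: mpow.
  + by move=> t; rewrite /= in_itv/= andbT; exact: h2.
under eq_integral do rewrite EFinM.
rewrite ge0_integralZl//; [|exact: mp|by move=> t _; rewrite lee_fin powR_ge0].
by rewrite integral_pow_tail// -EFinM ltry.
Qed.

Lemma gamma_lty (a : R) : 0 < a ->
  (\int[leb]_(t in D0) (t `^ (a - 1) * expR (- t))%:E < +oo)%E.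
Proof.
move=> a0.
have [C C0 hC] := powR_le_exp (ltW (addr_gt0 a0 ltr01)).
apply: (@integral_D0_lty _ a 1 (C + 1)) => //.
- by rewrite addr_ge0// ltW.
- exact: measurable_gamma_fun.
- by move=> t; rewrite lee_fin mulr_ge0 ?powR_ge0 ?expR_ge0.
- move=> t t0 t1; rewrite lee_fin mulrC ler_wpM2r ?powR_ge0//.
  apply: (@le_trans _ _ 1); last by rewrite lerDr ltW.
  by rewrite expR_le1 oppr_le0 ltW.
- move=> t t1; have t0 : 0 < t by apply: lt_trans t1.
  have -> : a - 1 = (a + 1) + (- 1 - 1) by ring.
  rewrite lee_fin powRDp// mulrAC ler_wpM2r ?powR_ge0//.
  rewrite expRN ler_pdivrMr ?expR_gt0//; apply: (le_trans (hC _ (ltW t0))).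
  by rewrite ler_wpM2r ?expR_ge0// lerDl.
Qed.

Lemma GammaE (a : R) : 0 < a ->
  (\int[leb]_(t in D0) (t `^ (a - 1) * expR (- t))%:E = (Gamma a)%:E)%E.
Proof.
move=> a0; rewrite Gamma_D0 fineK// ge0_fin_numE; first exact: gamma_lty.
by apply: integral_ge0 => t _; rewrite lee_fin mulr_ge0 ?powR_ge0 ?expR_ge0.
Qed.

Lemma Gamma_gt0 (a : R) : 0 < a -> 0 < Gamma a.
Proof.
move=> a0; rewrite -lte_fin -GammaE//.
have mp (D : set R) b : measurable_fun D (fun t : R => (t `^ b)%:E).
  apply/measurable_EFinP; apply: measurable_funTS; exact: measurable_powR.
have e1 : (0 < \int[leb]_(t in `]0%R, 1%R]) ((expR (- 1)%R)%:E * (t `^ (a - 1))%:E))%E.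
  rewrite ge0_integralZl//; [|exact: mp|by move=> t _; rewrite lee_fin powR_ge0].
  by rewrite integral_pow_head// -EFinM lte_fin mulr_gt0 ?expR_gt0 ?divr_gt0 ?powR_gt0.
apply: (lt_le_trans e1).
apply: (@le_trans _ _ (\int[leb]_(t in `]0%R, 1%R]) (t `^ (a - 1) * expR (- t))%:E)%E).
  apply: ge0_le_integral => //.
  - by move=> t _; rewrite -EFinM lee_fin mulr_ge0 ?powR_ge0 ?expR_ge0.
  - apply: (emeasurable_funM (f := fun=> (expR (-1))%:E)); last exact: mp.
    exact: (@measurable_cst _ _ _ _ _ (expR (-1))%:E).
  - by apply: measurable_funTS; exact: measurable_gamma_fun.
  - move=> t; rewrite /= in_itv/= => /andP[t0 t1]; rewrite -EFinM lee_fin mulrC.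
    by rewrite ler_wpM2l ?powR_ge0// ler_expR lerN2.
apply: ge0_subset_integral => //.
- by apply: measurable_funTS; exact: measurable_gamma_fun.
- by move=> t _; rewrite lee_fin mulr_ge0 ?powR_ge0 ?expR_ge0.
- by move=> t /=; rewrite !in_itv/= andbT => /andP[].
Qed.

Lemma measurable_indic_lt (f g : R * R -> R) : measurable_fun setT f -> measurable_fun setT g ->
  measurable_fun setT (fun z => ((f z < g z)%R : bool)%:R : R).
Proof.
move=> mf mg.
have -> : (fun z => ((f z < g z)%R : bool)%:R : R) = (fun z => if (f z < g z)%R then 1 else 0).
  by apply/funext => z; case: (f z < g z).
apply: measurable_fun_ifT => //.
exact: measurable_fun_ltr.
Qed.

(* Layer cake: [x^a] is the integral of [a u^(a-1)] over [0 < u <= x]. *)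
Lemma GammaS (a : R) : 0 < a -> Gamma (a + 1) = a * Gamma a.
Proof.
move=> a0; have a10 : 0 < a + 1 by rewrite addr_gt0.
apply: EFin_inj; rewrite -GammaE// addrK EFinM -GammaE//.
pose F (z : R * R) : \bar R :=
  ((z.2 < z.1)%R%:R * ((a * z.2 `^ (a - 1)) * expR (- z.1)))%:E.
have mF : measurable_fun setT F.
  apply/measurable_EFinP; apply: measurable_funM; first exact: measurable_indic_lt.
  apply: measurable_funM.
    by apply: measurable_funM => //; exact: (measurableT_comp (measurable_powR _)).
  by apply: (measurableT_comp (@measurable_expR R)); exact: measurable_funN.
have F0 z : (0 <= F z)%E.
  by rewrite lee_fin !mulr_ge0 ?expR_ge0 ?powR_ge0 ?ler0n// ltW.
have mD0 : measurable (D0 : set (measurableTypeR R)) by exact: measurable_itv.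
have mpow (D : set R) b : measurable_fun D (fun t : R => (t `^ b)%:E).
  apply/measurable_EFinP; apply: measurable_funTS; exact: measurable_powR.
have mexp (D : set R) : measurable_fun D (fun t : R => (expR (- t))%:E).
  by apply/measurable_EFinP; apply: measurable_funTS; apply: (measurableT_comp (@measurable_expR R)).
transitivity (\int[leb]_(x in D0) \int[leb]_(y in D0) F (x, y))%E.
  apply: eq_integral => x; rewrite inE/= in_itv/= andbT => x0.
  transitivity (\int[leb]_(y in `]0%R, x]) ((a * expR (- x))%:E * (y `^ (a - 1))%:E))%E.
    rewrite ge0_integralZl//; [|exact: mpow|by move=> t _; rewrite lee_fin powR_ge0
      |by rewrite lee_fin mulr_ge0 ?expR_ge0 ?ltW].
    rewrite integral_pow_head// -EFinM; congr EFin.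
    by field; rewrite gt_eqF.
  rewrite -integral_itv_bndo_bndc; last first.
    apply: (emeasurable_funM (f := fun=> (a * expR (- x))%:E)); last exact: mpow.
    exact: (@measurable_cst _ _ _ _ _ (a * expR (- x))%:E).
  rewrite [LHS]integral_itv_if [RHS]integral_itv_if; apply: eq_integral => y _.
  rewrite /F !in_itv/= andbT.
  case: (ltP 0 y) => y0 //=; case: (ltP y x) => yx; rewrite ?mul0r//.
  by rewrite mul1r -EFinM; congr EFin; ring.
rewrite (@tonelli_in _ _ _ _ R leb leb D0 D0 F mD0 mD0 mF F0).
transitivity (\int[leb]_(y in D0) (a%:E * (y `^ (a - 1) * expR (- y))%:E))%E; last first.
  rewrite ge0_integralZl//.
  - by apply: measurable_funTS; exact: measurable_gamma_fun.
  - by move=> t _; rewrite lee_fin mulr_ge0 ?powR_ge0 ?expR_ge0.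
  - by rewrite lee_fin ltW.
apply: eq_integral => y; rewrite inE/= in_itv/= andbT => y0.
transitivity (\int[leb]_(x in `]y, +oo[) ((a * y `^ (a - 1))%:E * (expR (- x))%:E))%E.
  rewrite [LHS]integral_itv_if [RHS]integral_itv_if; apply: eq_integral => x _.
  rewrite /F !in_itv/= !andbT.
  case: (ltP y x) => yx; rewrite ?mul0r ?if_same// (lt_trans y0 yx).
  by rewrite mul1r -EFinM.
rewrite ge0_integralZl//; [by rewrite integral_exp_tail -!EFinM mulrA|exact: mexp|].
by rewrite lee_fin mulr_ge0 ?powR_ge0 ?ltW.
Qed.

(* The substitution [t = c / r] is avoided by writing [expR (- (c / t))] as an exponential tail. *)
Lemma integral_inverse_gamma (al c : R) : 0 < al -> 0 < c ->
  (\int[leb]_(t in D0) (t `^ (- al - 1) * expR (- (c / t)))%:E =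
   (c `^ (- al) * Gamma al)%:E)%E.
Proof.
move=> al0 c0.
pose F (z : R * R) : \bar R :=
  ((c * z.1 `^ (-1) < z.2)%R%:R * (z.1 `^ (- al - 1) * expR (- z.2)))%:E.
have mF : measurable_fun setT F.
  apply/measurable_EFinP; apply: measurable_funM.
    apply: measurable_indic_lt => //; apply: measurable_funM => //.
    exact: (measurableT_comp (measurable_powR _)).
  apply: measurable_funM; first exact: (measurableT_comp (measurable_powR _)).
  by apply: (measurableT_comp (@measurable_expR R)); exact: measurable_funN.
have F0 z : (0 <= F z)%E by rewrite lee_fin !mulr_ge0 ?expR_ge0 ?powR_ge0 ?ler0n.
have mD0 : measurable (D0 : set (measurableTypeR R)) by exact: measurable_itv.
have mpow (D : set R) b : measurable_fun D (fun t : R => (t `^ b)%:E).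
  apply/measurable_EFinP; apply: measurable_funTS; exact: measurable_powR.
have mexp (D : set R) : measurable_fun D (fun t : R => (expR (- t))%:E).
  by apply/measurable_EFinP; apply: measurable_funTS; apply: (measurableT_comp (@measurable_expR R)).
have al10 : 0 < al + 1 by rewrite addr_gt0.
transitivity (\int[leb]_(x in D0) \int[leb]_(y in D0) F (x, y))%E.
  apply: eq_integral => x; rewrite inE/= in_itv/= andbT => x0.
  have cx0 : 0 < c / x by rewrite divr_gt0.
  transitivity (\int[leb]_(y in `](c / x)%R, +oo[) ((x `^ (- al - 1))%:E * (expR (- y))%:E))%E.
    rewrite ge0_integralZl//; [by rewrite integral_exp_tail|exact: mexp|by rewrite lee_fin powR_ge0].
  rewrite [LHS]integral_itv_if [RHS]integral_itv_if; apply: eq_integral => y _.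
  rewrite /F !in_itv/= !andbT powR_inv1 ?(ltW x0)//.
  case: (ltP (c / x) y) => yx; rewrite ?mul0r ?if_same// (lt_trans cx0 yx).
  by rewrite mul1r -EFinM.
rewrite (@tonelli_in _ _ _ _ R leb leb D0 D0 F mD0 mD0 mF F0).
transitivity (\int[leb]_(y in D0) ((c `^ (- al) / al)%:E * (y `^ (al + 1 - 1) * expR (- y))%:E))%E; last first.
  rewrite ge0_integralZl//; last 3 first.
  - by apply: measurable_funTS; exact: measurable_gamma_fun.
  - by move=> t _; rewrite lee_fin mulr_ge0 ?powR_ge0 ?expR_ge0.
  - by rewrite lee_fin divr_ge0 ?powR_ge0 ?ltW.
  rewrite (GammaE al10) (GammaS al0) -EFinM; congr EFin.
  by rewrite mulrA divfK ?gt_eqF.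
apply: eq_integral => y; rewrite inE/= in_itv/= andbT => y0.
have cy0 : 0 < c / y by rewrite divr_gt0.
transitivity (\int[leb]_(x in `](c / y)%R, +oo[) ((expR (- y))%:E * (x `^ (- al - 1))%:E))%E.
  rewrite [LHS]integral_itv_if [RHS]integral_itv_if; apply: eq_integral => x _.
  rewrite /F !in_itv/= !andbT.
  case: (ltP 0 x) => x0; last first.
    by case: ltP => // h; move: (lt_le_trans (lt_trans cy0 h) x0); rewrite ltxx.
  rewrite powR_inv1 ?(ltW x0)// ltr_pdivrMr// ltr_pdivrMr// (mulrC y x).
  by case: ifPn => _; rewrite ?mul0r// mul1r -EFinM mulrC.
rewrite ge0_integralZl//; [|exact: mpow|by move=> t _; rewrite lee_fin powR_ge0].
rewrite integral_pow_tail// -!EFinM; congr EFin.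
rewrite powRM ?invr_ge0 ?(ltW c0) ?(ltW y0)// powRVp// opprK addrK.
by field; rewrite gt_eqF.
Qed.

Lemma lebZl (k : R) (f : R -> \bar R) : 0 <= k -> measurable_fun setT f ->
  (forall x, (0 <= f x)%E) -> (\int[leb]_x (k%:E * f x) = k%:E * \int[leb]_x f x)%E.
Proof.
move=> k0 mf f0; rewrite ge0_integralZl; first by [].
- exact: measurableT.
- exact: mf.
- by move=> x _; exact: f0.
- by rewrite lee_fin.
Qed.

End OneDim.

Section IntZl.
Context d (T : measurableType d) (R : realType) (mu : {measure set T -> \bar R}).

Lemma intZl (k : R) (f : T -> \bar R) : 0 <= k -> measurable_fun setT f ->
  (forall x, (0 <= f x)%E) -> (\int[mu]_x (k%:E * f x) = k%:E * \int[mu]_x f x)%E.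
Proof.
move=> k0 mf f0; rewrite ge0_integralZl; first by [].
- exact: measurableT.
- exact: mf.
- by move=> x _; exact: f0.
- by rewrite lee_fin.
Qed.

End IntZl.

(** * Riemann-Liouville integrals and their semigroup law *)

Section FracInt.
Context {R : realType}.
Notation leb := (@lebesgue_measure R).
Notation D0 := (`]0%R, +oo[%classic : set R).
Implicit Types a b c t x : R.

(* [hpow a / Gamma a] is the kernel of the right-sided Riemann-Liouville integral of order [a]. *)
Definition hpow a r : R := locked ((0 < r)%R%:R * r `^ (a - 1)).

Lemma hpow_ge0 a r : 0 <= hpow a r.
Proof. by rewrite /hpow -lock mulr_ge0 ?powR_ge0 ?ler0n. Qed.

Lemma hpow_gt0 a r : 0 < r -> hpow a r = r `^ (a - 1).
Proof. by move=> r0; rewrite /hpow -lock r0 mul1r. Qed.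

Lemma hpow_le0 a r : r <= 0 -> hpow a r = 0.
Proof. by move=> r0; rewrite /hpow -lock ltNge r0 mul0r. Qed.

Lemma measurable_hpow a : measurable_fun setT (hpow a).
Proof.
have -> : hpow a = (fun r => (0 < r)%R%:R * r `^ (a - 1)) by apply/funext => r; rewrite /hpow -lock.
apply: measurable_funM; last exact: measurable_powR.
have -> : (fun r : R => (0 < r)%R%:R : R) = (fun r => if 0 < r then 1 else 0).
  by apply/funext => r; case: (0 < r).
by apply: measurable_fun_ifT => //; exact: measurable_fun_ltr.
Qed.

Lemma integral_hpow a (f : R -> \bar R) : (\int[leb]_r ((hpow a r)%:E * f r) =
  \int[leb]_(r in D0) ((r `^ (a - 1))%:E * f r))%E.
Proof.
rewrite [RHS]integral_itv_if; apply: eq_integral => r _.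
rewrite in_itv/= andbT; case: (ltP 0 r) => r0; first by rewrite hpow_gt0.
by rewrite hpow_le0// mul0e.
Qed.

Definition fracint a (W : R -> \bar R) t : \bar R :=
  (\int[leb]_r ((hpow a r / Gamma a)%:E * W (t + r)%R))%E.

Lemma hpowG_ge0 a r : 0 < a -> 0 <= hpow a r / Gamma a.
Proof. by move=> a0; rewrite divr_ge0 ?hpow_ge0 ?ltW ?Gamma_gt0. Qed.

(** The Beta function, whose value is never computed: it enters only through a constant that
    [fracint_add] determines indirectly. *)
Definition betae a b : \bar R := (\int[leb]_x (hpow a x * hpow b (1 - x))%:E)%E.

Lemma beta_scale a b (q : R) : 0 < q ->
  (\int[leb]_x (hpow a x * hpow b (q - x))%:E = (q `^ (a + b - 1))%:E * betae a b)%E.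
Proof.
move=> q0.
have mh : measurable_fun setT (fun x : R => (hpow a x * hpow b (q - x))%:E).
  apply/measurable_EFinP; apply: measurable_funM; first exact: measurable_hpow.
  apply: (measurableT_comp (measurable_hpow b)); exact: measurable_funB.
have mh1 : measurable_fun setT (fun x : R => (hpow a x * hpow b (1 - x))%:E).
  apply/measurable_EFinP; apply: measurable_funM; first exact: measurable_hpow.
  apply: (measurableT_comp (measurable_hpow b)); exact: measurable_funB.
have h0 x : (0 <= (hpow a x * hpow b (q - x))%:E)%E by rewrite lee_fin mulr_ge0 ?hpow_ge0.
have := ge0_integral_leb_scale q0 mh h0.
have -> : (fun x : R => (hpow a (q * x) * hpow b (q - q * x))%:E) =
    (fun x : R => ((q `^ (a + b - 1 - 1))%:E * (hpow a x * hpow b (1 - x))%:E)%E).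
  apply/funext => x; rewrite -EFinM; congr EFin.
  have -> : q - q * x = q * (1 - x) by ring.
  rewrite /hpow -!lock !pmulr_rgt0//.
  case: (ltP 0 x) => x0; last by rewrite !mul0r mulr0.
  case: (ltP 0 (1 - x)) => x1; last by rewrite !mul0r !mulr0.
  rewrite !powRM ?(ltW q0) ?(ltW x0) ?(ltW x1)//.
  have -> : a + b - 1 - 1 = (a - 1) + (b - 1) by ring.
  rewrite (powRDp (a - 1) (b - 1) q0) /= !mul1r; ring.
have h1 x : (0 <= (hpow a x * hpow b (1 - x))%:E)%E by rewrite lee_fin mulr_ge0 ?hpow_ge0.
rewrite (lebZl (powR_ge0 _ _) mh1 h1).
rewrite -/(betae a b) => h.
have -> : (\int[leb]_x (hpow a x * hpow b (q - x))%:E =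
   q%:E * (q^-1%:E * \int[leb]_x (hpow a x * hpow b (q - x))%:E))%E.
  by rewrite muleA -EFinM divff ?mul1e// gt_eqF.
rewrite -h muleA -EFinM; congr (_%:E * _)%E.
have -> : a + b - 1 = 1 + (a + b - 1 - 1) by ring.
rewrite (powRDp 1 _ q0) powRr1 ?(ltW q0)//.
by have -> : 1 + (a + b - 1 - 1) - 1 = a + b - 1 - 1 by ring.
Qed.

Lemma beta_fiber a b q : (\int[leb]_x (hpow a x * hpow b (q - x))%:E =
  (hpow (a + b) q)%:E * betae a b)%E.
Proof.
have [q0|q0] := ltP 0 q; first by rewrite beta_scale// hpow_gt0.
rewrite [in RHS]hpow_le0// mul0e integral0_eq// => x _; congr EFin.
have [x0|x0] := leP x 0; first by rewrite hpow_le0// mul0r.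
by rewrite [hpow b _]hpow_le0 ?mulr0// subr_le0 ltW// (le_lt_trans q0).
Qed.

(** In the absolute variable q the inner kernel becomes [hpow b (q - x)]; after Tonelli the fibre
    over q is a Beta integral, homogeneous in q. *)
Lemma fracint_comp a b (W : R -> \bar R) t : 0 < a -> 0 < b ->
  measurable_fun setT W -> (forall t, (0 <= W t)%E) ->
  fracint a (fracint b W) t =
  (((Gamma a)^-1 * (Gamma b)^-1)%:E * betae a b * \int[leb]_q ((hpow (a + b) q)%:E * W (t + q)%R))%E.
Proof.
move=> a0 b0 mW W0.
have Ga := Gamma_gt0 a0; have Gb := Gamma_gt0 b0.
pose F (z : R * R) : \bar R := ((hpow a z.1 * hpow b (z.2 - z.1) * ((Gamma a)^-1 * (Gamma b)^-1))%:E * W (t + z.2)%R)%E.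
have mWt s : measurable_fun setT (fun r : R => W (s + r)).
  by apply: (measurableT_comp mW (f := W)); exact: measurable_funD.
have mab : measurable_fun setT (fun z : R * R => hpow a z.1 * hpow b (z.2 - z.1)).
  apply: measurable_funM; first exact: (measurableT_comp (measurable_hpow a)).
  apply: (measurableT_comp (measurable_hpow b)); exact: measurable_funB.
have mF : measurable_fun setT F.
  apply: emeasurable_funM.
    by apply/measurable_EFinP; apply: measurable_funM.
  apply: (measurableT_comp mW (f := W)); exact: measurable_funD.
have c0 : 0 <= (Gamma a)^-1 * (Gamma b)^-1 by rewrite mulr_ge0// invr_ge0 ltW.
have F0 z : (0 <= F z)%E.
  by apply: mule_ge0 => //; rewrite lee_fin; apply: mulr_ge0 => //; apply: mulr_ge0; exact: hpow_ge0.
transitivity (\int[leb]_x \int[leb]_y F (x, y))%E.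
  apply: eq_integral => x _.
  pose G (r : R) := ((hpow b r / Gamma b)%:E * W (t + x + r)%R)%E.
  have mG : measurable_fun setT G.
    apply: emeasurable_funM; last exact: mWt.
    by apply/measurable_EFinP; apply: measurable_funM => //; exact: measurable_hpow.
  have G0 r : (0 <= G r)%E by rewrite mule_ge0// lee_fin hpowG_ge0.
  rewrite /fracint -/(G _) -(ge0_integral_leb_shift (- x) mG G0).
  rewrite -ge0_integralZl; [|exact: measurableT|..]; last 3 first.
  - apply: (measurableT_comp mG (f := G)); exact: measurable_funD.
  - by move=> y _; exact: G0.
  - by rewrite lee_fin hpowG_ge0.
  apply: eq_integral => y _; rewrite /G /F/= muleA -EFinM.
  have -> : t + x + (y - x) = t + y by ring.
  by congr (_%:E * _)%E; ring.
rewrite (@fubini_tonelli _ _ _ _ R leb leb F mF F0).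
transitivity (\int[leb]_y ((((Gamma a)^-1 * (Gamma b)^-1)%:E * betae a b) * ((hpow (a + b) y)%:E * W (t + y)%R)))%E.
  apply: eq_integral => y _.
  have hh : (\int[leb]_x F (x, y) = \int[leb]_x ((((Gamma a)^-1 * (Gamma b)^-1)%:E * W (t + y)%R) * (hpow a x * hpow b (y - x))%:E))%E.
    apply: eq_integral => x _; rewrite /F/= EFinM (muleC (hpow a x * hpow b (y - x))%:E).
    by rewrite -!muleA; congr (_ * _)%E; rewrite muleC.
  rewrite hh ge0_integralZl//; last 3 first.
  - apply/measurable_EFinP; apply: measurable_funM; first exact: measurable_hpow.
    apply: (measurableT_comp (measurable_hpow b)); exact: measurable_funB.
  - by move=> x _; rewrite lee_fin mulr_ge0 ?hpow_ge0.
  - by rewrite mule_ge0.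
  by rewrite beta_fiber -!muleA; congr (_ * _)%E; rewrite muleC -muleA muleCA.
rewrite ge0_integralZl//.
- apply: emeasurable_funM; last exact: mWt.
  by apply/measurable_EFinP; exact: measurable_hpow.
- by move=> y _; rewrite mule_ge0// lee_fin hpow_ge0.
- rewrite mule_ge0 ?lee_fin//; apply: integral_ge0 => x _.
  by rewrite lee_fin mulr_ge0 ?hpow_ge0.
Qed.

Lemma fracint_exp a t : 0 < a -> fracint a (fun t => (expR (- t))%:E) t = (expR (- t))%:E.
Proof.
move=> a0; have Ga := Gamma_gt0 a0.
transitivity (\int[leb]_r ((hpow a r)%:E * ((expR (- t) / Gamma a)%:E * (expR (- r))%:E)))%E.
  apply: eq_integral => r _; rewrite -!EFinM; congr EFin.
  by rewrite opprD expRD; ring.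
rewrite integral_hpow.
transitivity (\int[leb]_(r in D0) ((expR (- t) / Gamma a)%:E * (r `^ (a - 1) * expR (- r))%:E))%E.
  by apply: eq_integral => r _; rewrite -!EFinM; congr EFin; ring.
rewrite ge0_integralZl//; last 3 first.
- by apply: measurable_funTS; exact: measurable_gamma_fun.
- by move=> r _; rewrite lee_fin mulr_ge0 ?powR_ge0 ?expR_ge0.
- by rewrite lee_fin divr_ge0 ?expR_ge0 ?ltW.
by rewrite (GammaE a0) -EFinM divfK ?gt_eqF.
Qed.

Lemma fracint_add a b (W : R -> \bar R) t : 0 < a -> 0 < b ->
  measurable_fun setT W -> (forall t, (0 <= W t)%E) ->
  fracint a (fracint b W) t = fracint (a + b) W t.
Proof.
move=> a0 b0 mW W0; have ab0 : 0 < a + b by rewrite addr_gt0.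
have Ga := Gamma_gt0 a0; have Gb := Gamma_gt0 b0; have Gab := Gamma_gt0 ab0.
rewrite (fracint_comp _ a0 b0 mW W0).
set K := (_%:E * betae a b)%E.
have splitG (V : R -> \bar R) s : measurable_fun setT V -> (forall t, (0 <= V t)%E) ->
  (\int[leb]_q ((hpow (a + b) q)%:E * V (s + q)%R) = (Gamma (a + b))%:E * fracint (a + b) V s)%E.
  move=> mV V0; rewrite /fracint -ge0_integralZl; [|exact: measurableT|..].
  - apply: eq_integral => q _; rewrite muleA -EFinM; congr (_%:E * _)%E.
    by rewrite mulrC divfK ?gt_eqF.
  - apply: emeasurable_funM.
      by apply/measurable_EFinP; apply: measurable_funM => //; exact: measurable_hpow.
    by apply: (measurableT_comp mV (f := V)); exact: measurable_funD.
  - by move=> q _; rewrite mule_ge0// lee_fin hpowG_ge0.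
  - by rewrite lee_fin ltW.
have mE : measurable_fun setT (fun t : R => (expR (- t))%:E).
  apply/measurable_EFinP; apply: (measurableT_comp (@measurable_expR R)); exact: measurable_funN.
have E0 (r : R) : (0 <= (expR (- r))%:E)%E by rewrite lee_fin expR_ge0.
have KG : (K * (Gamma (a + b))%:E = 1)%E.
  have := fracint_comp 0 a0 b0 mE E0.
  rewrite -/K (splitG _ _ mE E0) (fracint_exp _ ab0).
  have -> : fracint b (fun t => (expR (- t))%:E) = (fun t => (expR (- t))%:E).
    by apply/funext => r; exact: fracint_exp.
  by rewrite (fracint_exp _ a0) oppr0 expR0 mule1 => <-.
by rewrite (splitG _ _ mW W0) muleA KG mul1e.
Qed.

End FracInt.

(** * The heat kernel and the fractional kernel *)

Section Heat.
Context {R : realType}.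
Notation leb := (@lebesgue_measure R).
Notation D0 := (`]0%R, +oo[%classic : set R).

Definition sq n (x : 'rV[R]_n) : R := \sum_(i < n) (x ord0 i) ^+ 2.

Lemma sq_ge0 n (x : 'rV[R]_n) : 0 <= sq x.
Proof. by apply: sumr_ge0 => i _; exact: sqr_ge0. Qed.

Lemma measurable_sq n : measurable_fun setT (@sq n).
Proof.
apply: (@measurable_sum _ _ _ _ _ _ (fun (i : 'I_n) (x : 'rV[R]_n) => (x ord0 i) ^+ 2)) => i.
by apply: measurable_funX; exact: measurable_coord.
Qed.

Lemma sqN n (x : 'rV[R]_n) : sq (- x) = sq x.
Proof. by apply: eq_bigr => i _; rewrite mxE sqrrN. Qed.

Lemma sqD_le n (x y : 'rV[R]_n) : sq (x + y) <= 2 * sq x + 2 * sq y.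
Proof.
rewrite /sq !mulr_sumr -big_split/=; apply: ler_sum => i _; rewrite mxE.
have := sqr_ge0 (x ord0 i - y ord0 i); nra.
Qed.

Lemma sq0_eq0 n (x : 'rV[R]_n) : (sq x == 0) = (x == 0).
Proof.
apply/idP/idP => [|/eqP ->]; last by apply/eqP/big1 => i _; rewrite mxE expr0n.
rewrite psumr_eq0; last by move=> i _; exact: sqr_ge0.
move=> /allP h; apply/eqP/rowP => i; rewrite mxE.
have := h i (mem_index_enum _); rewrite sqrf_eq0 => /eqP //.
Qed.

Lemma sq_gt0 n (x : 'rV[R]_n) : x != 0 -> 0 < sq x.
Proof. by move=> x0; rewrite lt_neqAle sq_ge0 eq_sym sq0_eq0 x0. Qed.

Lemma eucl_powR n (x : 'rV[R]_n) b : eucl x `^ b = sq x `^ (b / 2).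
Proof. by rewrite /eucl -/(sq x) -powR12_sqrt ?sq_ge0// -powRrM mulrC. Qed.

Lemma sqrt_pow (n : nat) (c : R) : 0 <= c -> Num.sqrt c ^+ n = c `^ (n%:R / 2).
Proof.
move=> c0; rewrite -powR_mulrn ?sqrtr_ge0// -powR12_sqrt// -powRrM.
by rewrite mulrC.
Qed.

Definition heat n t (x : 'rV[R]_n) : R :=
  locked (Num.sqrt (4 * pi * t) ^- n * expR (- (sq x / (4 * t)))).

Lemma fourpi_gt0 (t : R) : 0 < t -> 0 < 4 * pi * t.
Proof. by move=> t0; rewrite !mulr_gt0// pi_gt0. Qed.

Lemma sqrt_fourpi_gt0 (t : R) : 0 < t -> 0 < Num.sqrt (4 * pi * t).
Proof. by move=> t0; rewrite sqrtr_gt0 fourpi_gt0. Qed.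

Lemma heat_ge0 n t (x : 'rV[R]_n) : 0 <= heat t x.
Proof. by rewrite /heat -lock mulr_ge0 ?expR_ge0// invr_ge0 exprn_ge0// sqrtr_ge0. Qed.

Lemma heatN n t (x : 'rV[R]_n) : heat t (- x) = heat t x.
Proof. by rewrite /heat sqN. Qed.

Lemma measurable_heat n t : measurable_fun setT (@heat n t).
Proof.
have -> : @heat n t = (fun x => Num.sqrt (4 * pi * t) ^- n * expR (- (sq x / (4 * t)))).
  by apply/funext => x; rewrite /heat -lock.
apply: measurable_funM => //; apply: (measurableT_comp (@measurable_expR R)).
by apply: measurable_funN; apply: measurable_funM => //; exact: measurable_sq.
Qed.

Definition heat1 t y : R := (Num.sqrt (4 * pi * t))^-1 * expR (- (y ^+ 2 / (4 * t))).

Lemma heat1_ge0 t y : 0 <= heat1 t y.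
Proof. by rewrite mulr_ge0 ?expR_ge0// invr_ge0 sqrtr_ge0. Qed.

Lemma measurable_heat1 t : measurable_fun setT (heat1 t).
Proof.
apply: measurable_funM => //; apply: (measurableT_comp (@measurable_expR R)).
by apply: measurable_funN; apply: measurable_funM => //; exact: measurable_funX.
Qed.

Lemma heat_prod n t (x : 'rV[R]_n) : heat t x = \prod_i heat1 t (x ord0 i).
Proof.
rewrite /heat -lock /heat1 big_split/= prodr_const card_ord exprVn; congr (_ * _).
by rewrite -expR_sum sumrN mulr_suml.
Qed.

Lemma heat1_int t : 0 < t -> (\int[leb]_y (heat1 t y)%:E = 1)%E.
Proof.
move=> t0; have t40 : 0 < 4 * t by rewrite mulr_gt0.
have s0 : 0 < Num.sqrt (4 * t) by rewrite sqrtr_gt0.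
have mg : measurable_fun setT (fun x : R => (gauss_fun x)%:E).
  by apply/measurable_EFinP; exact: measurable_gauss_fun.
have g0 (x : R) : (0 <= (gauss_fun x)%:E)%E by rewrite lee_fin gauss_fun_ge0.
have si0 : 0 < (Num.sqrt (4 * t))^-1 by rewrite invr_gt0.
have := ge0_integral_leb_scale si0 mg g0.
rewrite integralT_gauss invrK => h.
have s4 : 0 <= (Num.sqrt (4 * pi * t))^-1 by rewrite invr_ge0 sqrtr_ge0.
have mgs : measurable_fun setT (fun x : R => (gauss_fun ((Num.sqrt (4 * t))^-1 * x))%:E).
  by apply: (measurableT_comp mg); exact: measurable_funM.
have gs0 (x : R) : (0 <= (gauss_fun ((Num.sqrt (4 * t))^-1 * x))%:E)%E by rewrite lee_fin gauss_fun_ge0.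
transitivity (\int[leb]_y (((Num.sqrt (4 * pi * t))^-1)%:E * (gauss_fun ((Num.sqrt (4 * t))^-1 * y))%:E))%E.
  apply: eq_integral => y _; rewrite -EFinM /heat1 /gauss_fun; congr (_ * expR (- _))%:E.
  by rewrite exprMn exprVn sqr_sqrtr ?(ltW t40)// mulrC.
rewrite (lebZl s4 mgs gs0) h -!EFinM -sqrtrM ?(ltW t40)//.
have -> : 4 * t * pi = 4 * pi * t by ring.
by rewrite mulVf// gt_eqF// sqrt_fourpi_gt0.
Qed.

Lemma heat1_conv (t u y : R) : 0 < t -> 0 < u ->
  (\int[leb]_z (heat1 u (y - z) * heat1 t z)%:E = (heat1 (t + u) y)%:E)%E.
Proof.
move=> t0 u0; have tu0 : 0 < t + u by rewrite addr_gt0.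
(* Completing the square in z: the product of the two Gaussians is [heat1 (t + u) y] times a
   Gaussian of time [w] centred at y t/(t+u). *)
pose w := t * u / (t + u); have w0 : 0 < w by rewrite divr_gt0 ?mulr_gt0.
have m1 : measurable_fun setT (fun z => (heat1 w z)%:E).
  by apply/measurable_EFinP; exact: measurable_heat1.
have h0 z : (0 <= (heat1 w z)%:E)%E by rewrite lee_fin heat1_ge0.
have m2 : measurable_fun setT (fun z : R => (heat1 w (z + - (y * t / (t + u))))%:E).
  by apply: (measurableT_comp m1); exact: measurable_funD.
transitivity (\int[leb]_z ((heat1 (t + u) y)%:E * (heat1 w (z + - (y * t / (t + u))))%:E))%E.
  apply: eq_integral => z _; rewrite -EFinM; congr EFin.
  rewrite /heat1 mulrACA [RHS]mulrACA -!expRD -!invfM -!sqrtrM ?ltW ?fourpi_gt0//.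
  congr (_ * expR _); last first.
    rewrite /w; field; rewrite ?gt_eqF//.
  congr (_^-1); congr Num.sqrt; rewrite /w; field; rewrite ?gt_eqF//.
rewrite (lebZl (heat1_ge0 _ _) m2 (fun z => h0 _)).
by rewrite (ge0_integral_leb_shift (- (y * t / (t + u))) m1 h0) heat1_int// mule1.
Qed.

Lemma heat_int n t : 0 < t -> (\int[rnm n]_x (heat t x)%:E = 1)%E.
Proof.
move=> t0; under eq_integral do rewrite heat_prod.
rewrite (integral_rnm_prod (h := fun _ => heat1 t) (c := fun=> 1)).
- by rewrite big1.
- by move=> _; exact: measurable_heat1.
- by move=> _; exact: heat1_ge0.
- by move=> _; exact: heat1_int.
Qed.

Lemma heat_conv n t u (y : 'rV[R]_n) : 0 < t -> 0 < u ->
  (\int[rnm n]_z (heat u (y - z) * heat t z)%:E = (heat (t + u) y)%:E)%E.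
Proof.
move=> t0 u0.
transitivity (\int[rnm n]_z (\prod_i (heat1 u (y ord0 i - z ord0 i) * heat1 t (z ord0 i)))%:E)%E.
  apply: eq_integral => z _; rewrite !heat_prod -big_split/=; congr EFin.
  by apply: eq_bigr => i _; rewrite !mxE.
rewrite (integral_rnm_prod (h := fun i z => heat1 u (y ord0 i - z) * heat1 t z)
  (c := fun i => heat1 (t + u) (y ord0 i))).
- by rewrite heat_prod.
- move=> i; apply: measurable_funM; last exact: measurable_heat1.
  by apply: (measurableT_comp (measurable_heat1 u)); exact: measurable_funB.
- by move=> i z; rewrite mulr_ge0 ?heat1_ge0.
- by move=> i; exact: heat1_conv.
Qed.

Lemma heat_powR n t (x : 'rV[R]_n) : 0 < t ->
  heat t x = (4 * pi * t) `^ (- (n%:R / 2)) * expR (- (sq x / (4 * t))).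
Proof. by move=> t0; rewrite /heat -lock sqrt_pow ?powRN// ltW// fourpi_gt0. Qed.

(** The exponential factor only grows with time, so the comparison costs just the ratio of the
    prefactors. It provides majorants that are uniform near a given time. *)
Lemma heat_scale_le n (t u : R) (x : 'rV[R]_n) : 0 < t -> t <= u ->
  heat t x <= (u / t) `^ (n%:R / 2) * heat u x.
Proof.
move=> t0 tu; have u0 := lt_le_trans t0 tu.
set a := n%:R / 2; rewrite !heat_powR// -/a.
have -> : (u / t) `^ a = u `^ a * t `^ (- a).
  by rewrite powRM ?invr_ge0 ?(ltW t0) ?(ltW u0)// powRVp.
have pM (r : R) : 0 < r -> (4 * pi * r) `^ (- a) = (4 * pi) `^ (- a) * r `^ (- a).
  by move=> r0; rewrite powRM ?(ltW r0) ?mulr_ge0 ?pi_ge0.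
rewrite !pM//; set c := (4 * pi) `^ (- a).
have h : u `^ a * u `^ (- a) = 1 by rewrite -powRDp// subrr powRr0.
have -> : u `^ a * t `^ (- a) * (c * u `^ (- a) * expR (- (sq x / (4 * u)))) =
   u `^ a * u `^ (- a) * (c * t `^ (- a) * expR (- (sq x / (4 * u)))) by ring.
rewrite h mul1r.
apply: ler_wpM2l; first by rewrite !mulr_ge0 ?powR_ge0.
rewrite ler_expR lerN2; apply: ler_wpM2l; first exact: sq_ge0.
by rewrite lef_pV2 ?posrE ?mulr_gt0// ler_pM2l.
Qed.

(** Passing from t to 2t halves the Gaussian exponent; the freed factor e^(-|x|^2/8t) absorbs any
    power of |x|^2/t. Hence the 8. *)
Lemma heat_moment_le n (a : R) : 0 <= a -> exists2 C : R, 0 < C &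
  forall (t : R) (x : 'rV[R]_n), 0 < t -> (sq x / t) `^ a * heat t x <= C * heat (2 * t) x.
Proof.
move=> a0; have e8 : 0 < (8^-1 : R) by rewrite invr_gt0.
have [C C0 hC] := powR_le_exp_scale a0 e8.
exists (C * 2 `^ (n%:R / 2)) => [|t x t0]; first by rewrite mulr_gt0// powR_gt0.
have u0 : 0 <= sq x / t by rewrite divr_ge0 ?sq_ge0// ltW.
have t20 : 0 < 2 * t by rewrite mulr_gt0.
rewrite !heat_powR//.
have -> : 4 * pi * (2 * t) = 2 * (4 * pi * t) by ring.
rewrite [(2 * _) `^ _]powRM ?(ltW (fourpi_gt0 t0))//.
set P := (4 * pi * t) `^ _.
have h2 : 2 `^ (n%:R / 2) * 2 `^ (- (n%:R / 2)) = 1 :> R by rewrite -powRDp// subrr powRr0.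
have -> : C * 2 `^ (n%:R / 2) * (2 `^ (- (n%:R / 2)) * P * expR (- (sq x / (4 * (2 * t))))) =
  C * P * expR (- (sq x / (4 * (2 * t)))) *  (2 `^ (n%:R / 2) * 2 `^ (- (n%:R / 2))) by ring.
rewrite h2 mulr1 mulrCA (mulrC C) -(mulrA P); apply: ler_wpM2l; first exact: powR_ge0.
apply: (@le_trans _ _ (C * expR (8^-1 * (sq x / t)) * expR (- (sq x / (4 * t))))).
  by rewrite ler_wpM2r ?expR_ge0// hC.
rewrite -mulrA -expRD ler_wpM2l ?(ltW C0)// ler_expR le_eqVlt; apply/orP; left.
by apply/eqP; field; rewrite gt_eqF.
Qed.

(** One formula serves both kernels: [si = g] gives the singular kernel of the fractional Laplacian,
    and [si = - s] the Riesz kernel. *)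
Lemma integral_heat_power n (si : R) (z : 'rV[R]_n) : 0 < n%:R / 2 + si -> z != 0 ->
  (\int[leb]_(t in D0) (t `^ (- si - 1) * heat t z)%:E =
   (4 `^ si * pi `^ (- (n%:R / 2)) * Gamma (n%:R / 2 + si) * eucl z `^ (- (n%:R + 2 * si)))%:E)%E.
Proof.
move=> al0 z0; have q0 := sq_gt0 z0; set al := n%:R / 2 + si in al0 *.
have c0 : 0 < sq z / 4 by rewrite divr_gt0.
have pi0 : 0 <= pi :> R by exact: pi_ge0.
transitivity (\int[leb]_(t in D0) (((4 * pi) `^ (- (n%:R / 2)))%:E * (t `^ (- al - 1) * expR (- (sq z / 4 / t)))%:E))%E.
  apply: eq_integral => t; rewrite inE/= in_itv/= andbT => t0.
  rewrite -EFinM heat_powR// powRM ?(ltW t0) ?mulr_ge0//; congr EFin.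
  have -> : - al - 1 = - (n%:R / 2) + (- si - 1) by rewrite /al; ring.
  rewrite (powRDp (- (n%:R / 2)) (- si - 1) t0).
  have -> : sq z / (4 * t) = sq z / 4 / t by field; rewrite gt_eqF.
  ring.
rewrite ge0_integralZl; [|exact: measurable_itv|..].
- rewrite (integral_inverse_gamma al0 c0) -EFinM; congr EFin.
  have -> : (sq z / 4) `^ (- al) = sq z `^ (- al) * 4 `^ al.
    by rewrite powRM ?(ltW q0)// powRVp// opprK.
  have -> : (4 * pi) `^ (- (n%:R / 2)) = 4 `^ (- (n%:R / 2)) * pi `^ (- (n%:R / 2)) :> R by rewrite powRM.
  rewrite eucl_powR.
  have -> : - (n%:R + 2 * si) / 2 = - al by rewrite /al; field.
  have -> : al = n%:R / 2 + si by [].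
  rewrite (powRDp (n%:R / 2) si)//.
  have h4 : 4 `^ (- (n%:R / 2)) * 4 `^ (n%:R / 2) = 1 :> R by rewrite -powRDp// addNr powRr0.
  set A := 4 `^ (- (n%:R / 2)) in h4 *; set B := 4 `^ (n%:R / 2) in h4 *.
  transitivity ((A * B) * (4 `^ si * pi `^ (- (n%:R / 2)) * Gamma (n%:R / 2 + si) * sq z `^ (- (n%:R / 2 + si)))); first by ring.
  by rewrite h4 mul1r.
- apply/measurable_EFinP.
  have mD : measurable (D0 : set R) by exact: measurable_itv.
  have oD : open (D0 : set R) by exact: interval_open.
  apply: (open_continuous_measurable_fun oD) => t; rewrite inE/= in_itv/= andbT => t0.
  apply: cvgM.
    exact: (is_derive_cont (is_derive1_powR (- al - 1) t0)).
  apply: (@cvg_comp _ _ _ (fun t : R => - (sq z / 4 / t)) expR _ (nbhs (- (sq z / 4 / t)))); last exact: continuous_expR.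
  by apply: cvgN; apply: cvgM; [exact: cvg_cst|apply: cvgV; [rewrite gt_eqF|exact: cvg_id]].
- by move=> t _; rewrite lee_fin mulr_ge0 ?powR_ge0 ?expR_ge0.
- by rewrite lee_fin powR_ge0.
Qed.

End Heat.

#[global] Arguments intZl {d T R mu k f}.

(** * The weight of [Ls] and the singular kernel *)

Section Weights.
Context {R : realType}.
Notation leb := (@lebesgue_measure R).
Notation D0 := (`]0%R, +oo[%classic : set R).

(* [om (n/2 + g)] is comparable to the weight in [Ls g]. *)
Definition om n (a : R) (y : 'rV[R]_n) : R := (1 + sq y) `^ (- a).

Lemma sq1_gt0 n (y : 'rV[R]_n) : 0 < 1 + sq y.
Proof. by rewrite ltr_pwDl// sq_ge0. Qed.

Lemma om_ge0 n a (y : 'rV[R]_n) : 0 <= om a y.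
Proof. exact: powR_ge0. Qed.

Lemma measurable_om n a : measurable_fun setT (@om n a).
Proof.
apply: (measurableT_comp (measurable_powR (- a))).
by apply: measurable_funD => //; exact: measurable_sq.
Qed.

(** Peetre's inequality: translating the weight costs a power of 1 + |shift|^2. *)
Lemma peetre n (y z : 'rV[R]_n) : 1 + sq y <= 2 * (1 + sq z) * (1 + sq (y + z)).
Proof.
have -> : sq y = sq ((y + z) + (- z)) by rewrite addrK.
have := sqD_le (y + z) (- z); rewrite sqN.
have := sq_ge0 z; have := sq_ge0 (y + z); nra.
Qed.

Lemma powRN_le (a x y : R) : 0 <= a -> 0 < x -> x <= y -> y `^ (- a) <= x `^ (- a).
Proof.
move=> a0 x0 xy; have y0 := lt_le_trans x0 xy.
rewrite !powRN lef_pV2 ?posrE ?powR_gt0//.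
by apply: ge0_ler_powR => //; rewrite nnegrE; exact: ltW.
Qed.

Lemma om_peetre n (a : R) (y z : 'rV[R]_n) : 0 <= a ->
  om a z <= 2 `^ a * (1 + sq (y + z)) `^ a * om a y.
Proof.
move=> a0; have p := peetre y z.
have z0 := sq1_gt0 z; have yz0 := sq1_gt0 (y + z).
have -> : 2 `^ a * (1 + sq (y + z)) `^ a * om a y =
  ((1 + sq y) / (2 * (1 + sq (y + z)))) `^ (- a).
  rewrite powRM ?invr_ge0 ?mulr_ge0 ?(ltW yz0) ?(ltW (sq1_gt0 y))//.
  by rewrite powRVp ?mulr_gt0// opprK powRM ?(ltW yz0)// mulrC.
apply: powRN_le => //; first by rewrite divr_gt0 ?mulr_gt0 ?sq1_gt0.
by rewrite ler_pdivrMr ?mulr_gt0//; apply: (le_trans p); rewrite mulrCA mulrA.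
Qed.

Lemma om_shift n (a : R) (y z : 'rV[R]_n) : 0 <= a ->
  om a (y + z) <= 2 `^ a * (1 + sq z) `^ a * om a y.
Proof.
move=> a0; have := om_peetre y (- (y + z)) a0.
by rewrite opprD addrA subrr add0r sqN /om -opprD sqN.
Qed.

(* Junk value [0] at [z = 0]. *)
Definition kern n (g : R) (z : 'rV[R]_n) : R := eucl z `^ (- (n%:R + 2 * g)).

Lemma kern_ge0 n g (z : 'rV[R]_n) : 0 <= kern g z.
Proof. exact: powR_ge0. Qed.

Lemma kernN n g (z : 'rV[R]_n) : kern g (- z) = kern g z.
Proof. by rewrite /kern !eucl_powR sqN. Qed.

Lemma kernE n g (z : 'rV[R]_n) : kern g z = sq z `^ (- (n%:R / 2 + g)).
Proof. by rewrite /kern eucl_powR; congr (_ `^ _); field. Qed.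

Lemma measurable_kern n g : measurable_fun setT (@kern n g).
Proof.
have -> : @kern n g = fun z => sq z `^ (- (n%:R / 2 + g)) by apply/funext => z; exact: kernE.
by apply: (measurableT_comp (measurable_powR _)); exact: measurable_sq.
Qed.

Lemma C_frac_gt0 n (g : R) : 0 < g -> g < 1 -> 0 < C_frac n g.
Proof.
move=> g0 g1; have a0 : 0 < n%:R / 2 + g by rewrite ltr_wpDl// divr_ge0.
rewrite /C_frac divr_gt0 ?mulr_gt0 ?powR_gt0 ?Gamma_gt0 ?subr_gt0 ?pi_gt0//.
Qed.

(** Here the normalization of [C_frac] is used. The factor g/Gamma(1-g) is that of lambda^g =
    g/Gamma(1-g) int_0^oo (1 - e^(-t lambda)) t^(-1-g) dt, so that the heat semigroup will later
    turn the singular integral into a Marchaud derivative in time. *)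
Lemma kern_heat n (g : R) (z : 'rV[R]_n) : 0 < g -> g < 1 -> z != 0 ->
  ((C_frac n g * kern g z)%:E =
   (g / Gamma (1 - g))%:E * \int[leb]_(t in D0) (t `^ (- g - 1) * heat t z)%:E)%E.
Proof.
move=> g0 g1 z0; have a0 : 0 < n%:R / 2 + g by rewrite ltr_wpDl// divr_ge0.
rewrite (integral_heat_power a0 z0) -EFinM; congr EFin.
rewrite /C_frac -/(kern g z).
have -> : 2 `^ (2 * g) = 4 `^ g :> R.
  rewrite powRrM; congr (_ `^ g).
  by rewrite -[2 `^ 2]/(2 `^ (2%:R)) powR_mulrn// expr2 -natrM.
rewrite powRN invfM; ring.
Qed.

Lemma heat_power_measurable n (b : R) :
  measurable_fun setT (fun z : R * 'rV[R]_n => hpow b z.1 * heat z.1 z.2).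
Proof.
have -> : (fun z : R * 'rV[R]_n => hpow b z.1 * heat z.1 z.2) =
  (fun z => hpow b z.1 * ((4 * pi * z.1) `^ (- (n%:R / 2)) * expR (- (sq z.2 * (4 * z.1) `^ (-1))))).
  apply/funext => z; have [z0|z0] := ltP 0 z.1; last by rewrite hpow_le0// !mul0r.
  by rewrite heat_powR// powR_inv1// mulr_ge0// ltW.
have m1 : measurable_fun setT (fun z : R * 'rV[R]_n => z.1) by exact: measurable_fst.
have m2 : measurable_fun setT (fun z : R * 'rV[R]_n => sq z.2).
  by apply: (measurableT_comp (@measurable_sq R n)); exact: measurable_snd.
apply: measurable_funM; first exact: (measurableT_comp (measurable_hpow b)).
apply: measurable_funM.
  by apply: (measurableT_comp (measurable_powR _)); exact: measurable_funM.
apply: (measurableT_comp (@measurable_expR R)); apply: measurable_funN.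
apply: measurable_funM => //.
by apply: (measurableT_comp (measurable_powR _)); exact: measurable_funM.
Qed.

(* Subordination and Tonelli; the two sides could differ only through the point [z = 0]. *)
Lemma integral_kern_le n (g : R) (w : 'rV[R]_n -> R) : 0 < g -> g < 1 ->
  measurable_fun setT w -> (forall z, 0 <= w z) ->
  (\int[rnm n]_z ((C_frac n g * kern g z * w z)%:E) <=
  (g / Gamma (1 - g))%:E *
    \int[leb]_t ((hpow (- g) t)%:E * \int[rnm n]_z (heat t z * w z)%:E))%E.
Proof.
move=> g0 g1 mw w0.
have G0 : 0 < g / Gamma (1 - g) by rewrite divr_gt0// Gamma_gt0// subr_gt0.
have Cf := C_frac_gt0 n g0 g1.
have mwz : measurable_fun setT (fun z : 'rV[R]_n * R => w z.1).
  by apply: (measurableT_comp mw); exact: measurable_fst.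
pose F (z : 'rV[R]_n * R) : \bar R := (hpow (- g) z.2 * heat z.2 z.1 * w z.1)%:E.
have msw : measurable_fun setT (fun z : 'rV[R]_n * R => hpow (- g) z.2 * heat z.2 z.1).
  apply: (measurableT_comp (@heat_power_measurable n (- g)) (g := fun z : 'rV[R]_n * R => (z.2, z.1))).
  by apply: measurable_fun_pair; [exact: measurable_snd|exact: measurable_fst].
have mF : measurable_fun setT F by apply/measurable_EFinP; exact: measurable_funM.
have F0 z : (0 <= F z)%E.
  by rewrite lee_fin; apply: mulr_ge0 => //; apply: mulr_ge0; [exact: hpow_ge0|exact: heat_ge0].
have mh t : measurable_fun setT (fun z : 'rV[R]_n => (heat t z * w z)%:E).
  by apply/measurable_EFinP; apply: measurable_funM => //; exact: measurable_heat.
have h0 t (z : 'rV[R]_n) : (0 <= (heat t z * w z)%:E)%E by rewrite lee_fin mulr_ge0 ?heat_ge0.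
have E : (\int[rnm n]_z \int[leb]_t F (z, t) =
   \int[leb]_t ((hpow (- g) t)%:E * \int[rnm n]_z (heat t z * w z)%:E))%E.
  rewrite (@fubini_tonelli _ _ _ _ R (rnm n) leb F mF F0).
  apply: eq_integral => t _; rewrite -(intZl (hpow_ge0 _ _) (mh t) (h0 t)).
  by apply: eq_integral => z _; rewrite /F/= -EFinM; congr EFin; rewrite mulrA.
have mG : measurable_fun setT (fun z => \int[leb]_t F (z, t))%E.
  exact: (@measurable_fun_fubini_tonelli_F _ _ _ _ R leb F mF F0).
have GG0 z : (0 <= \int[leb]_t F (z, t))%E by apply: integral_ge0.
rewrite -E -(intZl (ltW G0) mG GG0).
apply: ge0_le_integral.
- exact: measurableT.
- move=> z _; rewrite lee_fin; apply: mulr_ge0 => //; apply: mulr_ge0; [exact: ltW|exact: kern_ge0].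
- apply/measurable_EFinP; apply: measurable_funM => //; apply: measurable_funM => //.
  exact: measurable_kern.
- by apply: (emeasurable_funM (f := fun=> (g / Gamma (1 - g))%:E)).
- move=> z _; have [->|z0] := eqVneq z 0.
    rewrite kernE /sq big1; last by move=> i _; rewrite mxE expr0n.
    rewrite powR0; last by rewrite oppr_eq0 gt_eqF// ltr_wpDl// divr_ge0.
    by rewrite mulr0 mul0r mule_ge0// lee_fin ltW.
  rewrite EFinM (kern_heat g0 g1 z0) -muleA; apply: lee_wpmul2l; first by rewrite lee_fin ltW.
  have mt : measurable_fun setT (fun t => (hpow (- g) t * heat t z)%:E).
    apply/measurable_EFinP.
    apply: (measurableT_comp (@heat_power_measurable n (- g)) (g := fun t : R => (t, z))).
    exact: measurable_fun_pair.
  have mt0 t : (0 <= (hpow (- g) t * heat t z)%:E)%E by rewrite lee_fin mulr_ge0 ?hpow_ge0 ?heat_ge0.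
  have -> : (\int[leb]_(t in D0) (t `^ (- g - 1) * heat t z)%:E = \int[leb]_t (hpow (- g) t * heat t z)%:E)%E.
    under [RHS]eq_integral do rewrite EFinM.
    by rewrite integral_hpow; apply: eq_integral => t _; rewrite EFinM.
  rewrite muleC -(lebZl (w0 z) mt mt0).
  rewrite le_eqVlt; apply/orP; left; apply/eqP; apply: eq_integral => t _; rewrite /F -EFinM; congr EFin; exact: mulrC.
Qed.

Definition trunc_sq n (z : 'rV[R]_n) : R := Num.min 1 (sq z).

Lemma trunc_sq_ge0 n (z : 'rV[R]_n) : 0 <= trunc_sq z.
Proof. by rewrite le_min ler01 sq_ge0. Qed.

Lemma measurable_trunc_sq n : measurable_fun setT (@trunc_sq n).
Proof. by apply: measurable_minr => //; exact: measurable_sq. Qed.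

(** Instead of polar coordinates, the kernel is written as a superposition of Gaussians; it then
    suffices to integrate t^(-g-1) against the Gaussian mean of min(1, |z|^2). *)
Lemma integral_trunc_kern n (g : R) : 0 < g -> g < 1 ->
  (\int[rnm n]_z ((trunc_sq z * kern g z)%:E) < +oo)%E.
Proof.
move=> g0 g1; have Cf := C_frac_gt0 n g0 g1.
have G0 : 0 < g / Gamma (1 - g) by rewrite divr_gt0// Gamma_gt0// subr_gt0.
have := @integral_kern_le n g (@trunc_sq n) g0 g1 (@measurable_trunc_sq n) (@trunc_sq_ge0 n).
have mk : measurable_fun setT (fun z : 'rV[R]_n => (trunc_sq z * kern g z)%:E).
  apply/measurable_EFinP; apply: measurable_funM; [exact: measurable_trunc_sq|exact: measurable_kern].
have k0 (z : 'rV[R]_n) : (0 <= (trunc_sq z * kern g z)%:E)%E by rewrite lee_fin mulr_ge0 ?trunc_sq_ge0 ?kern_ge0.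
have -> : (\int[rnm n]_z ((C_frac n g * kern g z * trunc_sq z)%:E) =
   (C_frac n g)%:E * \int[rnm n]_z ((trunc_sq z * kern g z)%:E))%E.
  rewrite -(intZl (ltW Cf) mk k0); apply: eq_integral => z _.
  by rewrite -EFinM -mulrA (mulrC (kern g z)).
set I := (\int[rnm n]_z _)%E; set J := (\int[leb]_t _)%E => IJ.
suff Jy : (J < +oo)%E.
  have : ((C_frac n g)%:E * I < +oo)%E.
    apply: (le_lt_trans IJ); apply: lte_mul_pinfty => //; rewrite ?lee_fin ?ltW//.
  case: I {IJ} => [r _||]; rewrite ?ltry ?ltNyr//.
  by rewrite mulry gtr0_sg// mul1e.
have [C C0 hC] := @heat_moment_le R n 1 ler01.
(* The mass of the Gaussian gives the bound 1, its second moment the bound C t. *)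
have tsh t : 0 < t -> (\int[rnm n]_z (heat t z * trunc_sq z)%:E <= (Num.min 1 (C * t))%:E)%E.
  move=> t0; have t20 : 0 < 2 * t by rewrite mulr_gt0.
  have mm : measurable_fun setT (fun z : 'rV[R]_n => (heat t z * trunc_sq z)%:E).
    by apply/measurable_EFinP; apply: measurable_funM; [exact: measurable_heat|exact: measurable_trunc_sq].
  have mh u : measurable_fun setT (fun z : 'rV[R]_n => (heat u z)%:E).
    by apply/measurable_EFinP; exact: measurable_heat.
  have hh0 u (z : 'rV[R]_n) : (0 <= (heat u z)%:E)%E by rewrite lee_fin heat_ge0.
  have h1 : (\int[rnm n]_z (heat t z * trunc_sq z)%:E <= 1%:E)%E.
    rewrite -(heat_int n t0); apply: ge0_le_integral => //.
    - by move=> z _; rewrite lee_fin mulr_ge0 ?heat_ge0 ?trunc_sq_ge0.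
    - by move=> z _; rewrite lee_fin ler_piMr ?heat_ge0// ge_min lexx.
  have h2 : (\int[rnm n]_z (heat t z * trunc_sq z)%:E <= (C * t)%:E)%E.
    have Ct0 : 0 <= C * t by rewrite mulr_ge0 ?ltW.
    have -> : ((C * t)%:E = \int[rnm n]_z ((C * t)%:E * (heat (2 * t) z)%:E))%E.
      by rewrite (intZl Ct0 (mh _) (hh0 _)) (heat_int n t20) mule1.
    apply: ge0_le_integral => //.
    - by move=> z _; rewrite lee_fin mulr_ge0 ?heat_ge0 ?trunc_sq_ge0.
    - by apply: (emeasurable_funM (f := fun=> (C * t)%:E)) => //.
    - move=> z _; rewrite -EFinM lee_fin.
      have := hC t z t0; rewrite powRr1 ?divr_ge0 ?sq_ge0 ?(ltW t0)// => h.
      apply: (@le_trans _ _ (heat t z * sq z)).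
        by rewrite ler_wpM2l ?heat_ge0// ge_min lexx orbT.
      have -> : heat t z * sq z = t * (sq z / t * heat t z) by field; rewrite gt_eqF.
      have -> : C * t * heat (2 * t) z = t * (C * heat (2 * t) z) by ring.
      by rewrite ler_wpM2l// ltW.
  by rewrite EFin_min le_min h1 h2.
have mtr : measurable_fun setT (fun z : R * 'rV[R]_n => trunc_sq z.2).
  by apply: (measurableT_comp (@measurable_trunc_sq n)); exact: measurable_snd.
have mJ : measurable_fun setT (fun t => \int[rnm n]_z (hpow (- g) t * heat t z * trunc_sq z)%:E)%E.
  have mFF : measurable_fun setT (fun z : R * 'rV[R]_n => (hpow (- g) z.1 * heat z.1 z.2 * trunc_sq z.2)%:E).
    by apply/measurable_EFinP; apply: measurable_funM => //; exact: heat_power_measurable.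
  apply: (@measurable_fun_fubini_tonelli_F _ _ _ _ R (rnm n) _ mFF) => z.
  by rewrite lee_fin !mulr_ge0 ?hpow_ge0 ?heat_ge0 ?trunc_sq_ge0.
have mh t : measurable_fun setT (fun z : 'rV[R]_n => (heat t z * trunc_sq z)%:E).
  by apply/measurable_EFinP; apply: measurable_funM; [exact: measurable_heat|exact: measurable_trunc_sq].
have h0 t (z : 'rV[R]_n) : (0 <= (heat t z * trunc_sq z)%:E)%E.
  by rewrite lee_fin mulr_ge0 ?heat_ge0 ?trunc_sq_ge0.
have -> : J = (\int[leb]_(t in D0) \int[rnm n]_z (hpow (- g) t * heat t z * trunc_sq z)%:E)%E.
  rewrite [RHS]integral_itv_if /J; apply: eq_integral => t _; rewrite in_itv/= andbT.
  case: (ltP 0 t) => t0; last by rewrite hpow_le0// mul0e.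
  rewrite -(intZl (hpow_ge0 _ _) (mh t) (h0 t)); apply: eq_integral => z _.
  by rewrite -EFinM mulrA.
have Et t : 0 < t -> (\int[rnm n]_z (hpow (- g) t * heat t z * trunc_sq z)%:E =
    (t `^ (- g - 1))%:E * \int[rnm n]_z (heat t z * trunc_sq z)%:E)%E.
  move=> t0; rewrite -(intZl (powR_ge0 _ _) (mh t) (h0 t)); apply: eq_integral => z _.
  by rewrite hpow_gt0// -EFinM mulrA.
(* t^(-g-1) min(1, C t) is integrable at 0 because g < 1, and at infinity because g > 0. *)
apply: (@integral_D0_lty _ _ (1 - g) g (C + 1)) => //.
- by rewrite subr_gt0.
- by rewrite addr_ge0 ?ltW.
- by move=> t; apply: integral_ge0 => z _; rewrite lee_fin !mulr_ge0 ?hpow_ge0 ?heat_ge0 ?trunc_sq_ge0.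
- move=> t t0 t1; rewrite Et//.
  apply: (@le_trans _ _ ((t `^ (- g - 1))%:E * (C * t)%:E)%E).
    apply: lee_wpmul2l; first by rewrite lee_fin powR_ge0.
    by apply: (le_trans (tsh t t0)); rewrite lee_fin ge_min lexx orbT.
  rewrite -EFinM lee_fin.
  have -> : t `^ (- g - 1) * (C * t) = C * t `^ (1 - g - 1).
    have -> : 1 - g - 1 = (- g - 1) + 1 by ring.
    by rewrite (powRDp (- g - 1) 1 t0) powRr1 ?ltW//; ring.
  by rewrite ler_wpM2r ?powR_ge0// lerDl.
- move=> t t1; have t0 : 0 < t by apply: lt_trans t1.
  rewrite Et//.
  apply: (@le_trans _ _ ((t `^ (- g - 1))%:E * 1%:E)%E).
    apply: lee_wpmul2l; first by rewrite lee_fin powR_ge0.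
    by apply: (le_trans (tsh t t0)); rewrite lee_fin ge_min lexx.
  by rewrite -EFinM lee_fin mulr1 ler_peMl ?powR_ge0// lerDr ltW.
Qed.

Lemma om_le_eucl n (g : R) (y : 'rV[R]_n) : 0 <= g -> 0 < n%:R / 2 + g ->
  om (n%:R / 2 + g) y <= 2 / (1 + eucl y `^ (n%:R + 2 * g)).
Proof.
move=> g0 a0; set a := n%:R / 2 + g.
have -> : eucl y `^ (n%:R + 2 * g) = sq y `^ a.
  by rewrite eucl_powR; congr (_ `^ _); rewrite /a; field.
have p0 : 0 < 1 + sq y `^ a by rewrite ltr_pwDl// powR_ge0.
rewrite ler_pdivlMr// /om powRN -ler_pdivlMl ?invr_gt0 ?powR_gt0 ?sq1_gt0// invrK.
have h1 : 1 <= (1 + sq y) `^ a.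
  rewrite -[leLHS](powRr0 (1 + sq y)); apply: ler_powR; last exact: ltW.
  by rewrite lerDl sq_ge0.
have h2 : sq y `^ a <= (1 + sq y) `^ a.
  by apply: ge0_ler_powR; rewrite ?nnegrE ?sq_ge0 ?addr_ge0 ?sq_ge0 ?(ltW a0)// lerDr.
by rewrite mulrC mulr_natl mulr2n lerD.
Qed.

(** The weight is recentred at [x]: translate the integral, then compare the two centres by
    [om_shift]. *)
Lemma Ls_om n (g : R) (v : 'rV[R]_n -> R) (x : 'rV[R]_n) : 0 <= g -> 0 < n%:R / 2 + g ->
  measurable_fun setT v -> (forall y, 0 <= v y) -> Ls g v ->
  (\int[rnm n]_y (v (x + y) * om (n%:R / 2 + g) y)%:E < +oo)%E.
Proof.
move=> g0 a0 mv v0; rewrite /Ls /Rn_integrable; set a := n%:R / 2 + g.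
have me : measurable_fun setT (fun y : 'rV[R]_n => (1 + eucl y `^ (n%:R + 2 * g)) `^ (-1)).
  apply: (measurableT_comp (measurable_powR (-1))); apply: measurable_funD => //.
  under eq_fun do rewrite eucl_powR.
  by apply: (measurableT_comp (measurable_powR _)); exact: measurable_sq.
have E : (fun y => `|v y / (1 + eucl y `^ (n%:R + 2 * g))|%:E) =
    (fun y => (v y * (1 + eucl y `^ (n%:R + 2 * g)) `^ (-1))%:E).
  apply/funext => y; rewrite powR_inv1; last by rewrite addr_ge0// powR_ge0.
  by rewrite ger0_norm// divr_ge0// addr_ge0// powR_ge0.
rewrite E Rn_int_ge0E; last 2 first.
- by apply/measurable_EFinP; exact: measurable_funM.
- by move=> y; rewrite lee_fin mulr_ge0 ?powR_ge0.
set I := (\int[rnm n]_y _)%E => Iy.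
pose F y : \bar R := (v y * om a (y - x))%:E.
have mF : measurable_fun setT F.
  apply/measurable_EFinP; apply: measurable_funM => //.
  apply: (measurableT_comp (@measurable_om n a)); exact: measurable_rv_add.
have F0 y : (0 <= F y)%E by rewrite lee_fin mulr_ge0 ?om_ge0.
have -> : (\int[rnm n]_y (v (x + y) * om a y)%:E = \int[rnm n]_y F y)%E.
  rewrite -(ge0_integral_rnm_shift x mF F0); apply: eq_integral => y _.
  by rewrite /F addrK addrC.
pose K := 2 `^ a * (1 + sq (- x)) `^ a * 2.
have K0 : 0 <= K by rewrite !mulr_ge0 ?powR_ge0.
have mG : measurable_fun setT (fun y => (v y * (1 + eucl y `^ (n%:R + 2 * g)) `^ (-1))%:E).
  by apply/measurable_EFinP; exact: measurable_funM.
have G0 y : (0 <= (v y * (1 + eucl y `^ (n%:R + 2 * g)) `^ (-1))%:E)%E.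
  by rewrite lee_fin mulr_ge0 ?powR_ge0.
apply: (@le_lt_trans _ _ (\int[rnm n]_y (K%:E * (v y * (1 + eucl y `^ (n%:R + 2 * g)) `^ (-1))%:E))%E); last first.
  by rewrite (intZl K0 mG G0) lte_mul_pinfty// lee_fin.
apply: ge0_le_integral => //.
- apply: (emeasurable_funM (f := fun=> K%:E)) => //.
move=> y _; rewrite -EFinM lee_fin mulrCA; apply: ler_wpM2l => //.
apply: (le_trans (om_shift _ _ (ltW a0))); rewrite /K -(mulrA _ 2); apply: ler_wpM2l.
  by rewrite mulr_ge0 ?powR_ge0.
apply: (le_trans (om_le_eucl _ g0 a0)); by rewrite powR_inv1// addr_ge0// powR_ge0.
Qed.

End Weights.

(** * Real-valued integrals *)

Section RealIntegral.
Context {R : realType} {d : measure_display} {T : measurableType d}.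
Variable mu : {measure set T -> \bar R}.
Implicit Types f g h : T -> R.

Definition L1 f : Prop := mu.-integrable setT (fun x => (f x)%:E).
(* Junk value [0] when the integral is infinite. *)
Definition RI f : R := fine (\int[mu]_x (f x)%:E)%E.

Lemma L1_measurable f : L1 f -> measurable_fun setT f.
Proof. by move=> /integrableP[/measurable_EFinP]. Qed.

Lemma L1_lty f : L1 f -> (\int[mu]_x `|f x|%:E < +oo)%E.
Proof. by move=> /integrableP[]. Qed.

Lemma lty_L1 f : measurable_fun setT f -> (\int[mu]_x `|f x|%:E < +oo)%E -> L1 f.
Proof. by move=> mf h; apply/integrableP; split; [exact/measurable_EFinP|]. Qed.

Lemma ge0_L1 f : measurable_fun setT f -> (forall x, 0 <= f x) ->
  (\int[mu]_x (f x)%:E < +oo)%E -> L1 f.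
Proof.
move=> mf f0 h; apply: lty_L1 => //.
by under eq_integral do rewrite ger0_norm//.
Qed.

Lemma L1_le f g : measurable_fun setT f -> (forall x, `|f x| <= g x) -> L1 g -> L1 f.
Proof.
move=> mf fg ig; apply: (le_integrable _ _ _ ig) => //; first exact/measurable_EFinP.
by move=> x _; rewrite lee_fin; apply: (le_trans (fg x)); exact: ler_norm.
Qed.

Lemma RI_EFin f : L1 f -> (RI f)%:E = (\int[mu]_x (f x)%:E)%E.
Proof. by move=> lf; rewrite fineK//; exact: integrable_fin_num. Qed.

Lemma eq_RI f g : f =1 g -> RI f = RI g.
Proof. by move=> fg; congr fine; apply: eq_integral => x _; rewrite fg. Qed.

Lemma eq_L1 f g : f =1 g -> L1 f -> L1 g.
Proof. by move=> /funext ->. Qed.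

Lemma L1_0 : L1 (fun=> 0).
Proof. exact: integrable0. Qed.

Lemma RI_0 : RI (fun=> 0) = 0.
Proof. by rewrite /RI integral0. Qed.

Lemma L1D f g : L1 f -> L1 g -> L1 (fun x => f x + g x).
Proof. by move=> lf lg; have := integrableD measurableT lf lg. Qed.

Lemma RID f g : L1 f -> L1 g -> RI (fun x => f x + g x) = RI f + RI g.
Proof.
move=> lf lg; apply: EFin_inj; rewrite EFinD !RI_EFin//; last exact: L1D.
by under eq_integral do rewrite EFinD; exact: integralD.
Qed.

Lemma L1Z c f : L1 f -> L1 (fun x => c * f x).
Proof. by move=> lf; have := integrableZl measurableT c lf. Qed.

Lemma RIZ c f : L1 f -> RI (fun x => c * f x) = c * RI f.
Proof.
move=> lf; apply: EFin_inj; rewrite EFinM !RI_EFin//; last exact: L1Z.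
by under eq_integral do rewrite EFinM; exact: integralZl.
Qed.

Lemma L1N f : L1 f -> L1 (fun x => - f x).
Proof. by move=> lf; apply: (eq_L1 _ (L1Z (-1) lf)) => x; rewrite mulN1r. Qed.

Lemma RIN f : L1 f -> RI (fun x => - f x) = - RI f.
Proof. by move=> lf; rewrite -mulN1r -(RIZ _ lf); apply: eq_RI => x; rewrite mulN1r. Qed.

Lemma L1B f g : L1 f -> L1 g -> L1 (fun x => f x - g x).
Proof. by move=> lf lg; apply: L1D => //; exact: L1N. Qed.

Lemma RIB f g : L1 f -> L1 g -> RI (fun x => f x - g x) = RI f - RI g.
Proof. by move=> lf lg; rewrite RID ?RIN//; exact: L1N. Qed.

Lemma L1_sum (I : Type) (r : seq I) (F : I -> T -> R) :
  (forall i, L1 (F i)) -> L1 (fun x => \sum_(i <- r) F i x).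
Proof.
move=> lF; elim: r => [|i r IH].
  by apply: (eq_L1 _ L1_0) => x; rewrite big_nil.
by apply: (eq_L1 _ (L1D (lF i) IH)) => x; rewrite big_cons.
Qed.

Lemma RI_sum (I : Type) (r : seq I) (F : I -> T -> R) :
  (forall i, L1 (F i)) -> RI (fun x => \sum_(i <- r) F i x) = \sum_(i <- r) RI (F i).
Proof.
move=> lF; elim: r => [|i r IH].
  by rewrite big_nil -[RHS]RI_0; apply: eq_RI => x; rewrite big_nil.
rewrite big_cons -IH -RID//; last exact: L1_sum.
by apply: eq_RI => x; rewrite big_cons.
Qed.

Lemma L1_norm f : L1 f -> L1 (fun x => `|f x|).
Proof. exact: integrable_norm. Qed.

Lemma le_RI f g : L1 f -> L1 g -> (forall x, f x <= g x) -> RI f <= RI g.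
Proof.
move=> lf lg fg; rewrite -lee_fin !RI_EFin//; apply: le_integral => //.
by move=> x _; rewrite lee_fin.
Qed.

Lemma RI_ge0 f : (forall x, 0 <= f x) -> 0 <= RI f.
Proof. by move=> f0; apply: fine_ge0; apply: integral_ge0 => x _; rewrite lee_fin. Qed.

Lemma norm_RI_le f g : measurable_fun setT f -> (forall x, `|f x| <= g x) -> L1 g ->
  `|RI f| <= RI g.
Proof.
move=> mf fg lg; have lf := L1_le mf fg lg.
rewrite ler_norml; apply/andP; split.
  rewrite -RIN//; apply: le_RI => //; first exact: L1N.
  by move=> x; rewrite lerNl; apply: le_trans (fg x); rewrite -normrN; exact: ler_norm.
by apply: le_RI => // x; apply: le_trans (fg x); exact: ler_norm.
Qed.

Lemma RI_cvg (f_ : nat -> T -> R) f g :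
  (forall k, measurable_fun setT (f_ k)) -> (forall x, f_ ^~ x @ \oo --> f x) ->
  (forall k x, `|f_ k x| <= g x) -> L1 g -> L1 f /\ (fun k => RI (f_ k)) @ \oo --> RI f.
Proof.
move=> mf_ cf fg lg.
have mf : measurable_fun setT f.
  by apply: (@measurable_fun_cvg _ _ _ _ f_) => // x _; exact: cf.
have lf : L1 f.
  apply: (L1_le mf _ lg) => x.
  apply: (@limr_le_norm_of _ _ _ _ _) || idtac.
  have h : `|f_ k x| @[k --> \oo] --> `|f x| by apply: cvg_norm; exact: cf.
  rewrite -(cvg_lim _ h)//; apply: limr_le; first by apply/cvg_ex; exists `|f x|.
  by apply: nearW => k; exact: fg.
split=> //; rewrite /RI; apply: fine_cvg; rewrite -(RI_EFin lf) RI_EFin//.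
apply: (@dominated_cvg _ _ _ mu setT measurableT (fun k x => (f_ k x)%:E) (fun x => (f x)%:E)
  (fun x => (g x)%:E)) => //.
- by move=> k; apply/measurable_EFinP.
- by move=> x _; apply: cvg_EFin; [exact: nearW|exact: cf].
- by move=> k x _; rewrite lee_fin.
Qed.

End RealIntegral.
Arguments RI : simpl never.

(** * Fubini for real-valued integrals *)

Section RealFubini.
Context {R : realType} {d1 d2 : measure_display}.
Context {T1 : measurableType d1} {T2 : measurableType d2}.
Variable m1 : {sigma_finite_measure set T1 -> \bar R}.
Variable m2 : {sigma_finite_measure set T2 -> \bar R}.
Variable F : T1 -> T2 -> R.
Hypothesis mF : measurable_fun setT (fun z : T1 * T2 => F z.1 z.2).

Let mFE : measurable_fun setT (fun z : T1 * T2 => (F z.1 z.2)%:E).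
Proof. exact/measurable_EFinP. Qed.

Let mFx x : measurable_fun setT (F x).
Proof. exact: (measurableT_comp mF (g := fun y => (x, y)) (measurable_pair1 x)). Qed.

Let mint : measurable_fun setT (fun x => \int[m2]_y (F x y)%:E)%E.
Proof.
have -> : (fun x => \int[m2]_y (F x y)%:E)%E =
    (fun x => \int[m2]_y (fun z : T1 * T2 => (F z.1 z.2)%:E)^\+ (x, y) -
              \int[m2]_y (fun z : T1 * T2 => (F z.1 z.2)%:E)^\- (x, y))%E.
  apply/funext => x; rewrite [LHS]integralE.
  by congr (_ - _)%E; apply: eq_integral => y _; rewrite ?funeposE ?funenegE.
apply: emeasurable_funB.
  by apply: (measurable_fun_fubini_tonelli_F (m2 := m2)) => //; exact: measurable_funepos.
by apply: (measurable_fun_fubini_tonelli_F (m2 := m2)) => //; exact: measurable_funeneg.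
Qed.

Lemma measurable_RI : measurable_fun setT (fun x => RI m2 (F x)).
Proof. exact: (measurableT_comp (@fine_measurable R setT measurableT) mint). Qed.

Lemma norm_RI_le_int (f : T2 -> R) : measurable_fun setT f ->
  (`|RI m2 f|%:E <= \int[m2]_y `|f y|%:E)%E.
Proof.
move=> mf; have [h|h] := ltP (\int[m2]_y `|f y|%:E)%E +oo%E; last exact: le_trans (leey _) h.
have lf := lty_L1 mf h.
by rewrite -(RI_EFin (L1_norm lf)) lee_fin; apply: norm_RI_le => //; exact: L1_norm.
Qed.

Hypothesis ioo : (\int[m1]_x \int[m2]_y `|F x y|%:E < +oo)%E.

Lemma L1_RI : L1 m1 (fun x => RI m2 (F x)).
Proof.
apply: lty_L1; first exact: measurable_RI.
apply: le_lt_trans ioo; apply: ge0_le_integral => //.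
- by apply/measurable_EFinP; apply: measurableT_comp => //; exact: measurable_RI.
- apply: (@measurable_fun_fubini_tonelli_F _ _ _ _ R m2 (fun z => `|F z.1 z.2|%:E)) => //.
  by apply/measurable_EFinP; exact: measurableT_comp.
- by move=> x _; exact: norm_RI_le_int.
Qed.

Let iF : (m1 \x m2)%E.-integrable setT (fun z => (F z.1 z.2)%:E).
Proof. exact: ((@integrable12ltyP _ _ _ _ R m1 m2 (fun z => (F z.1 z.2)%:E) mFE).2 ioo). Qed.

(** [RI] takes the default value 0 where the inner integral is not finite. Those points form a null
    set by Fubini, so the outer integral does not see them. *)
Lemma integral_RI : (\int[m1]_x (RI m2 (F x))%:E = \int[m1]_x \int[m2]_y (F x y)%:E)%E.
Proof.
apply: (@ae_eq_integral _ _ _ m1 setT _ _ measurableT _ mint); first by apply/measurable_EFinP; exact: measurable_RI.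
have := ae_integrable1 iF; apply: filterS => x h _.
by rewrite /RI fineK//; exact: integrable_fin_num.
Qed.

Lemma fubini_swap_lty : (\int[m2]_y \int[m1]_x `|F x y|%:E < +oo)%E.
Proof.
rewrite -(@fubini_tonelli _ _ _ _ R m1 m2 (fun z => `|F z.1 z.2|%:E))//.
by apply/measurable_EFinP; exact: measurableT_comp.
Qed.

End RealFubini.

Lemma RI_fubini (R : realType) (d1 d2 : measure_display) (T1 : measurableType d1)
  (T2 : measurableType d2) (m1 : {sigma_finite_measure set T1 -> \bar R})
  (m2 : {sigma_finite_measure set T2 -> \bar R}) (F : T1 -> T2 -> R) :
  measurable_fun setT (fun z : T1 * T2 => F z.1 z.2) ->
  (\int[m1]_x \int[m2]_y `|F x y|%:E < +oo)%E ->
  RI m1 (fun x => RI m2 (F x)) = RI m2 (fun y => RI m1 (F ^~ y)).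
Proof.
move=> mF ioo; have mFE : measurable_fun setT (fun z : T1 * T2 => (F z.1 z.2)%:E).
  exact/measurable_EFinP.
have mF' : measurable_fun setT (fun z : T2 * T1 => F z.2 z.1).
  by apply: (measurableT_comp mF (g := fun z : T2 * T1 => (z.2, z.1))); exact: measurable_fun_pair.
rewrite /RI (integral_RI mF ioo) (@integral_RI _ _ _ _ _ m2 m1 (fun y x => F x y) mF' (fubini_swap_lty mF ioo)).
rewrite (@Fubini _ _ _ _ R m1 m2 (fun z => (F z.1 z.2)%:E))//.
exact: ((@integrable12ltyP _ _ _ _ R m1 m2 (fun z => (F z.1 z.2)%:E) mFE).2 ioo).
Qed.

Section RealShift.
Context {R : realType}.
Variable n : nat.
Implicit Types f : 'rV[R]_n -> R.

Let maxD0 (f : 'rV[R]_n -> R) : measurable_fun setT f ->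
  measurable_fun setT (fun x => (Num.max (f x) 0)%:E) /\ forall x, (0 <= (Num.max (f x) 0)%:E :> \bar R)%E.
Proof.
move=> mf; split; first by apply/measurable_EFinP; apply: measurable_maxr.
by move=> x; rewrite lee_fin le_max lexx orbT.
Qed.

Lemma L1_shift f a : L1 (rnm n) f -> L1 (rnm n) (fun x => f (x + a)).
Proof.
move=> lf; have mf := L1_measurable lf; apply: lty_L1.
  exact: (measurableT_comp mf (@measurable_rv_add _ _ a)).
have -> : (\int[rnm n]_x `|f (x + a)|%:E = \int[rnm n]_x `|f x|%:E)%E.
  apply: (@ge0_integral_rnm_shift _ _ a (fun x => `|f x|%:E)) => //.
  by apply/measurable_EFinP; exact: measurableT_comp.
exact: L1_lty.
Qed.

Lemma L1_opp f : L1 (rnm n) f -> L1 (rnm n) (fun x => f (- x)).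
Proof.
move=> lf; have mf := L1_measurable lf; apply: lty_L1.
  exact: (measurableT_comp mf (@measurable_rv_opp _ _)).
have -> : (\int[rnm n]_x `|f (- x)|%:E = \int[rnm n]_x `|f x|%:E)%E.
  apply: (@ge0_integral_rnm_opp _ _ (fun x => `|f x|%:E)) => //.
  by apply/measurable_EFinP; exact: measurableT_comp.
exact: L1_lty.
Qed.

(** The right-hand side is the shape of [Rn_int] in the statement. *)
Lemma RI_maxE f : L1 (rnm n) f -> RI (rnm n) f =
  fine (\int[rnm n]_y (Num.max (f y) 0)%:E)%E - fine (\int[rnm n]_y (Num.max (- f y) 0)%:E)%E.
Proof.
move=> lf; have lm g : L1 (rnm n) g -> L1 (rnm n) (fun y => Num.max (g y) 0).
  move=> lg; apply: (L1_le _ _ (L1_norm lg)).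
    by apply: measurable_maxr => //; exact: L1_measurable lg.
  by move=> y; rewrite ger0_norm ?le_max ?lexx ?orbT// ge_max ler_norm normr_ge0.
rewrite -![fine _]/(RI (rnm n) _) -RIB; first 1 last.
- exact: lm.
- by apply: lm; exact: L1N.
apply: eq_RI => y; case: (leP (f y) 0) => h.
  by rewrite max_l ?oppr_ge0// opprK add0r.
by rewrite max_r ?oppr_le0 ?(ltW h)// subr0.
Qed.

Lemma RI_shift f a : L1 (rnm n) f -> RI (rnm n) (fun x => f (x + a)) = RI (rnm n) f.
Proof.
move=> lf; have mf := L1_measurable lf.
have [m1 p1] := maxD0 mf; have [m2 p2] := maxD0 (measurable_funN mf).
rewrite (RI_maxE (L1_shift a lf)) (RI_maxE lf).
by rewrite -(ge0_integral_rnm_shift a m1 p1) -(ge0_integral_rnm_shift a m2 p2).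
Qed.

Lemma RI_opp f : L1 (rnm n) f -> RI (rnm n) (fun x => f (- x)) = RI (rnm n) f.
Proof.
move=> lf; have mf := L1_measurable lf.
have [m1 p1] := maxD0 mf; have [m2 p2] := maxD0 (measurable_funN mf).
rewrite (RI_maxE (L1_opp lf)) (RI_maxE lf).
by rewrite -(ge0_integral_rnm_opp m1 p1) -(ge0_integral_rnm_opp m2 p2).
Qed.

End RealShift.

(** * Second differences and bump test functions *)

Section SecondDifferences.
Context {R : realType}.

Lemma is_derive_comp (f g : R -> R) (x a b c : R) :
  is_derive (g x) 1 f a -> is_derive x 1 g b -> c = a * b -> is_derive x 1 (fun y => f (g y)) c.
Proof. by move=> df dg ->; exact: is_derive1_comp. Qed.

Lemma is_derive_pow (k : nat) (x : R) : is_derive x 1 (fun y : R => y ^+ k) (k%:R * x ^+ k.-1).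
Proof.
have := @is_deriveX R R id k x 1 1 (is_derive_id _ _).
by rewrite /GRing.scale/= mulr1 exprfctE.
Qed.

Lemma is_derive_mul (f g : R -> R) (x a b c : R) :
  is_derive x 1 f a -> is_derive x 1 g b -> c = a * g x + f x * b ->
  is_derive x 1 (fun y => f y * g y) c.
Proof.
move=> df dg ->; apply: (is_derive_eq (is_deriveM df dg)).
by rewrite /GRing.scale/= addrC mulrC.
Qed.

Lemma is_derive_scale (f : R -> R) (x a b k : R) : is_derive x 1 f a -> b = k * a ->
  is_derive x 1 (fun y => k * f y) b.
Proof.
by move=> df ->; apply: (is_derive_mul (is_derive_cst k x 1) df); rewrite mul0r add0r.
Qed.

Lemma is_derive_affine (a b x : R) : is_derive x 1 (fun y => a + b * y) b.
Proof.
have := @is_deriveD R R R (cst a) (fun y => b * y) x 1 0 b (is_derive_cst _ _ _).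
by rewrite add0r; apply; apply: (is_derive_scale (is_derive_id x 1)); rewrite mulr1.
Qed.

Lemma is_derive_opp (x : R) : is_derive x 1 (fun y : R => - y) (-1).
Proof.
have -> : (fun y : R => - y) = (fun y => 0 + -1 * y) by apply/funext => y; rewrite mulN1r add0r.
exact: is_derive_affine.
Qed.

Lemma is_derive_addl (a x : R) : is_derive x 1 (fun y : R => a + y) 1.
Proof.
have -> : (fun y : R => a + y) = (fun y => a + 1 * y) by apply/funext => y; rewrite mul1r.
exact: is_derive_affine.
Qed.

(** Meant for [pp 2], whose derivative at the kink is out of reach of the product rules. *)
Lemma derive_quadratic (f : R -> R) (x a C : R) :
  (forall h, `|f (x + h) - f x - a * h| <= C * h ^+ 2) -> is_derive x 1 f a.
Proof.
move=> H; have C0 : 0 <= C by move: (H 1); rewrite expr1n !mulr1; apply: le_trans; exact: normr_ge0.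
have cv : h^-1 *: ((f \o shift x) (h *: 1) - f x) @[h --> 0^'] --> a.
  apply/cvgrPdist_le => e e0; near=> h.
  have h0 : h != 0 by near: h; exact: nbhs_dnbhs_neq.
  rewrite /= /GRing.scale/= mulr1 distrC.
  have -> : h^-1 * (f (h + x) - f x) - a = h^-1 * (f (x + h) - f x - a * h).
    by rewrite [in LHS](addrC h); field.
  rewrite normrM normfV.
  apply: (@le_trans _ _ (C * `|h|)).
    rewrite mulrC ler_pdivrMr ?normr_gt0// -mulrA.
    by apply: (le_trans (H h)); rewrite -normrM -expr2 ger0_norm ?sqr_ge0.
  apply: (@le_trans _ _ ((C + 1) * `|h|)); first by rewrite ler_wpM2r// lerDl.
  rewrite mulrC -ler_pdivlMr ?ltr_pwDr//.
  near: h; apply: dnbhs0_le; by rewrite divr_gt0// ltr_pwDr.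
by split; [apply/cvg_ex; exists a|exact: cvg_lim cv].
Unshelve. all: by end_near. Qed.

Lemma mvt0 (f f' : R -> R) (h : R) : 0 < h ->
  (forall s : R, is_derive s 1 f (f' s)) -> exists2 c, 0 < c < h & f h - f 0 = f' c * h.
Proof.
move=> h0 df; have [|c] := @MVT _ f f' 0 h h0 (fun s _ => df s).
  apply: continuous_subspaceT => s; apply: differentiable_continuous.
  by apply/derivable1_diffP; have [] := df s.
by rewrite in_itv/= subr0 => hc E; exists c.
Qed.

Lemma second_diff_eq (f f1 : R -> R) (h : R) : 0 < h ->
  (forall s : R, is_derive s 1 f (f1 s)) ->
  exists2 c, 0 < c < h & f h + f (- h) - 2 * f 0 = (f1 c - f1 (- c)) * h.
Proof.
move=> h0 df.
have dE (s : R) : is_derive s 1 (fun s => f s + f (- s)) (f1 s - f1 (- s)).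
  have d1 : is_derive s 1 (fun s => f (- s)) (- f1 (- s)).
    by apply: (@is_derive_comp f -%R s _ _ _ (df _) (is_derive_opp s)); rewrite mulrN1.
  exact: is_deriveD.
have [c hc E] := mvt0 h0 dE; exists c => //.
by rewrite -E oppr0; ring.
Qed.

Lemma second_diff_le (f f1 f2 : R -> R) (h M : R) : 0 < h ->
  (forall s : R, is_derive s 1 f (f1 s)) -> (forall s : R, is_derive s 1 f1 (f2 s)) ->
  (forall s, `|s| <= h -> `|f2 s| <= M) ->
  `|2 * f 0 - f h - f (- h)| <= 2 * M * h ^+ 2.
Proof.
move=> h0 df df1 fM; have [c /andP[c0 ch] E] := second_diff_eq h0 df.
have d1 (s : R) : is_derive s 1 (fun s => f1 (- c + s)) (f2 (- c + s)).
  apply: (is_derive_comp (df1 _) (b := 1)); last by rewrite mulr1.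
  exact: is_derive_addl.
have [e /andP[e0 ec] Ee] := mvt0 (mulr_gt0 (ltr0n _ 2) c0) d1.
have {}Ee : f1 c - f1 (- c) = f2 (- c + e) * (2 * c).
  by rewrite -Ee addr0; congr (f1 _ - _); ring.
have -> : 2 * f 0 - f h - f (- h) = - (f2 (- c + e) * (2 * c) * h) by rewrite -Ee -E; ring.
rewrite normrN !normrM.
have M2 : `|f2 (- c + e)| <= M by apply: fM; rewrite ler_norml; lra.
have M0 : 0 <= M by apply: le_trans M2.
rewrite (ger0_norm (ltW h0)) (ger0_norm (ltW c0)) (ger0_norm (ler0n _ 2)).
have -> : 2 * M * h ^+ 2 = M * (2 * h) * h by ring.
by apply: ler_wpM2r; [exact: ltW|apply: ler_pM => //; rewrite ?mulr_ge0 ?(ltW c0)//; lra].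
Qed.

(** [f1] is differentiable at 0 only, which is all that [neglap_defined] yields along a line.
    Subtracting the quadratic model reduces the claim to f1 c - f1 0 - a c = o(c), after one mean
    value theorem. *)
Lemma second_diff_cvg (f f1 : R -> R) (a : R) (u : nat -> R) :
  (forall s : R, is_derive s 1 f (f1 s)) -> is_derive (0 : R) 1 f1 a ->
  (forall k, 0 < u k) -> u @ \oo --> (0 : R) ->
  (fun k => (2 * f 0 - f (u k) - f (- u k)) / u k ^+ 2) @ \oo --> - a.
Proof.
move=> df df1 u0 cu.
pose g s := f s - a / 2 * s ^+ 2; pose g1 s := f1 s - a * s.
have dg (s : R) : is_derive s 1 g (g1 s).
  have e : is_derive s 1 (fun s => f s - a / 2 * s ^+ 2) (f1 s - a / 2 * (2 * s ^+ 1 * 1)).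
    apply: is_deriveB; apply: (is_derive_scale (is_derive_pow 2 s)).
    by rewrite mulr1.
  by apply: (is_derive_eq e); rewrite /g1 expr1; field.
apply/cvgrPdist_le => e e0.
have cl : h^-1 *: ((f1 \o shift 0) (h *: 1) - f1 0) @[h --> 0^'] --> a.
  by have [h1 <-] := df1; exact: h1.
have e2 : 0 < e / 2 by rewrite divr_gt0.
have /cvgrPdist_le/(_ _ e2)/nbhs_ballP[d d0 Hd] := cl.
have H (h : R) : `|h| < d -> `|f1 h - f1 0 - a * h| <= e / 2 * `|h|.
  move=> hd; have [->|h0] := eqVneq h 0; first by rewrite subrr mulr0 subr0 normr0 mulr0.
  have := Hd h; rewrite /ball/= sub0r normrN => /(_ hd h0).
  rewrite /GRing.scale/= mulr1 addr0 => Hh.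
  rewrite -ler_pdivrMr ?normr_gt0// -normfV -normrM.
  have -> : (f1 h - f1 0 - a * h) / h = h^-1 * (f1 h - f1 0) - a by field.
  by rewrite distrC.
have : \forall k \near \oo, u k < d.
  by move/cvgr_lt : cu; apply.
apply: filterS => k ukd; have uk := u0 k.
have [c /andP[c0 cu'] E] := second_diff_eq uk dg.
have -> : - a - (2 * f 0 - f (u k) - f (- u k)) / u k ^+ 2 =
    (g (u k) + g (- u k) - 2 * g 0) / u k ^+ 2.
  by rewrite /g expr0n /=; field; rewrite gt_eqF.
rewrite E normrM normfV (ger0_norm (sqr_ge0 _)) ler_pdivrMr ?exprn_gt0// normrM (ger0_norm (ltW uk)).
rewrite expr2 mulrA; apply: ler_wpM2r; first exact: ltW.
have cd : c < d by exact: lt_trans ukd.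
have -> : g1 c - g1 (- c) = (f1 c - f1 0 - a * c) - (f1 (- c) - f1 0 - a * (- c)).
  by rewrite /g1; ring.
apply: (le_trans (ler_normB _ _)).
have h1 := H c; have h2 := H (- c).
rewrite normrN (ger0_norm (ltW c0)) in h1 h2.
apply: (le_trans (lerD (h1 cd) (h2 cd))).
by rewrite -mulrDl -splitr ler_wpM2l// ltW.
Qed.

Lemma cvg_sumR (I : Type) (r : seq I) (u : I -> nat -> R) (l : I -> R) :
  (forall i, u i @ \oo --> l i) ->
  (fun j => \sum_(i <- r) u i j) @ \oo --> \sum_(i <- r) l i.
Proof.
move=> H; elim: r => [|i r IH].
  by rewrite big_nil; under eq_fun do rewrite big_nil; exact: cvg_cst.
by rewrite big_cons; under eq_fun do rewrite big_cons; exact: cvgD.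
Qed.

(** The truncated power x_+^k. For [k = 0] it is constantly 1, so it vanishes on negative numbers
    only for positive powers. *)
Definition pp (k : nat) (x : R) : R := Num.max x 0 ^+ k.

Lemma pp_ge0 k x : 0 <= pp k x.
Proof. by rewrite exprn_ge0// le_max lexx orbT. Qed.

Lemma pp_pos k x : 0 <= x -> pp k x = x ^+ k.
Proof. by move=> x0; rewrite /pp max_l. Qed.

Lemma pp_neg k x : x <= 0 -> pp k.+1 x = 0.
Proof. by move=> x0; rewrite /pp max_r// expr0n. Qed.

(** [pp 1] has a kink, so the start is [pp 2]; higher powers are x^k x_+^2. *)
Lemma is_derive_pp (k : nat) (x : R) : is_derive x 1 (pp k.+2) (k.+2%:R * pp k.+1 x).
Proof.
have d2 : is_derive x 1 (pp 2) (2 * pp 1 x).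
  apply: (@derive_quadratic _ _ _ 1) => h; rewrite mul1r /pp expr1 !expr2.
  rewrite ler_norml.
  by case: (leP x 0); case: (leP (x + h) 0) => a b; nra.
have dk : is_derive x 1 (fun x => x ^+ k * pp 2 x)
    (k%:R * x ^+ k.-1 * pp 2 x + x ^+ k * (2 * pp 1 x)).
  exact: (is_derive_mul (is_derive_pow k x) d2).
have -> : pp k.+2 = fun x => x ^+ k * pp 2 x.
  apply/funext => y; have [y0|y0] := leP y 0; first by rewrite !pp_neg// mulr0.
  by rewrite !pp_pos ?(ltW y0)// -exprD addn2.
apply: (is_derive_eq dk).
have [y0|y0] := leP x 0; first by rewrite !pp_neg// !mulr0 addr0.
rewrite !pp_pos ?(ltW y0)// expr1.
case: k {dk} => [|k] /=; first by rewrite !mul0r add0r expr0 mul1r.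
by rewrite !exprS -[k.+3]addn2 natrD; ring.
Qed.

End SecondDifferences.

(** * The bumps and their Laplacians *)

Section Bumps.
Context {R : realType}.
Variable n : nat.
Implicit Types y z : 'rV[R]_n.

Definition ip y z : R := \sum_(i < n) y ord0 i * z ord0 i.

Lemma sq_line y z (s : R) : sq (y + s *: z) = sq y + 2 * s * ip y z + s ^+ 2 * sq z.
Proof.
rewrite /sq /ip !mulr_sumr -!big_split/=; apply: eq_bigr => i _.
by rewrite !mxE; ring.
Qed.

Lemma ip_line y z (s : R) : ip (y + s *: z) z = ip y z + s * sq z.
Proof.
rewrite /sq /ip mulr_sumr -big_split/=; apply: eq_bigr => i _.
by rewrite !mxE; ring.
Qed.

Lemma ip_sq_le y z : ip y z ^+ 2 <= sq y * sq z.
Proof.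
have H (s : R) : 0 <= sq y + 2 * s * ip y z + s ^+ 2 * sq z by rewrite -sq_line sq_ge0.
have := sq_ge0 y; have := sq_ge0 z.
have [z0|z0] := eqVneq (sq z) 0 => zz yy.
  move: z0 => /eqP; rewrite sq0_eq0 => /eqP ->.
  by rewrite /ip big1 ?expr0n/= ?mulr_ge0 ?sq_ge0// => i _; rewrite mxE mulr0.
have zp : 0 < sq z by rewrite lt_neqAle eq_sym z0.
have := H (- ip y z / sq z).
have -> : sq y + 2 * (- ip y z / sq z) * ip y z + (- ip y z / sq z) ^+ 2 * sq z =
  (sq y * sq z - ip y z ^+ 2) / sq z by field.
by rewrite pmulr_lge0 ?invr_gt0// subr_ge0.
Qed.

Definition bmp (k : nat) (r : R) y : R := pp k (r - sq y).

Lemma bump_ge0 k r y : 0 <= bmp k r y.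
Proof. exact: pp_ge0. Qed.

Lemma bump_out k r y : r <= sq y -> bmp k.+1 r y = 0.
Proof. by move=> h; rewrite /bmp pp_neg// subr_le0. Qed.

Lemma bump_le k r y : 0 <= r -> bmp k r y <= r ^+ k.
Proof.
move=> r0; rewrite /bmp /pp lerXn2r ?nnegrE ?le_max ?lexx ?orbT//.
by rewrite ge_max r0 andbT gerBl sq_ge0.
Qed.

Lemma bumpN k r y : bmp k r (- y) = bmp k r y.
Proof. by rewrite /bmp sqN. Qed.

Lemma measurable_pp k : measurable_fun setT (@pp R k).
Proof. by apply: measurable_funX; apply: measurable_maxr. Qed.

Lemma measurable_bump2 k : measurable_fun setT (fun z : R * 'rV[R]_n => bmp k z.1 z.2).
Proof.
apply: (measurableT_comp (measurable_pp k)); apply: measurable_funB; first exact: measurable_fst.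
by apply: (measurableT_comp (@measurable_sq R n)); exact: measurable_snd.
Qed.

Lemma measurable_bump k r : measurable_fun setT (bmp k r).
Proof.
apply: (measurableT_comp (measurable_pp k)); apply: measurable_funB => //.
exact: measurable_sq.
Qed.

(** First derivative of the bump in the direction [z], for k >= 2; [bmp2] is the second one, for k
    >= 3. *)
Definition bmp1 (k : nat) (r : R) y z : R := - (2 * k%:R) * (pp k.-1 (r - sq y) * ip y z).

Definition bmp2 (k : nat) (r : R) y z : R :=
  4 * (k%:R * k.-1%:R) * (pp k.-2 (r - sq y) * ip y z ^+ 2)
  - 2 * k%:R * (pp k.-1 (r - sq y) * sq z).

Lemma is_derive_sq_line r y z (s : R) :
  is_derive s 1 (fun s => r - sq (y + s *: z)) (- 2 * ip (y + s *: z) z).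
Proof.
have -> : (fun s => r - sq (y + s *: z)) =
    (fun s => (r - sq y + (- 2 * ip y z) * s) + (- sq z) * s ^+ 2).
  by apply/funext => t; rewrite sq_line; ring.
have d1 := is_derive_affine (r - sq y) (- 2 * ip y z) s.
have d2 := @is_derive_scale R _ s _ (- sq z * (2 * s)) (- sq z) (is_derive_pow 2 s) erefl.
by apply: (is_derive_eq (is_deriveD d1 d2)); rewrite ip_line; ring.
Qed.

Lemma is_derive_bump k r y z (s : R) :
  is_derive s 1 (fun s => bmp k.+2 r (y + s *: z)) (bmp1 k.+2 r (y + s *: z) z).
Proof.
apply: (@is_derive_comp R _ (fun s => r - sq (y + s *: z)) s _ _ _
  (is_derive_pp k _) (is_derive_sq_line r y z s)).
by rewrite /bmp1/=; ring.
Qed.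

Lemma is_derive_bump1 k r y z (s : R) :
  is_derive s 1 (fun s => bmp1 k.+3 r (y + s *: z) z) (bmp2 k.+3 r (y + s *: z) z).
Proof.
have d1 : is_derive s 1 (fun s => pp k.+2 (r - sq (y + s *: z)))
    (k.+2%:R * pp k.+1 (r - sq (y + s *: z)) * (- 2 * ip (y + s *: z) z)).
  exact: (@is_derive_comp R _ (fun s => r - sq (y + s *: z)) s _ _ _
    (is_derive_pp k _) (is_derive_sq_line r y z s)).
have d2 : is_derive s 1 (fun s => ip (y + s *: z) z) (sq z).
  have -> : (fun s => ip (y + s *: z) z) = (fun s => ip y z + sq z * s).
    by apply/funext => t; rewrite ip_line mulrC.
  exact: is_derive_affine.
apply: (is_derive_scale (is_derive_mul d1 d2 erefl)).
by rewrite /bmp2/=; ring.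
Qed.

Lemma bump2_le k r y z : 0 <= r ->
  `|bmp2 k.+3 r y z| <= 4 * k.+3%:R ^+ 2 * r ^+ k.+2 * sq z.
Proof.
move=> r0; have z0 := sq_ge0 z; rewrite /bmp2 /=.
have k3 : 0 <= k.+3%:R :> R by [].
have rh : 0 <= 4 * k.+3%:R ^+ 2 * r ^+ k.+2 * sq z.
  by rewrite mulr_ge0// mulr_ge0 ?exprn_ge0// mulr_ge0// exprn_ge0.
have [h|h] := leP r (sq y).
  by rewrite !pp_neg ?subr_le0// !(mul0r, mulr0) subr0 normr0.
have h0 : 0 <= r - sq y by rewrite subr_ge0 ltW.
rewrite !pp_pos//.
have p1 : (r - sq y) ^+ k.+1 <= r ^+ k.+1 by rewrite lerXn2r ?nnegrE// gerBl sq_ge0.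
have p2 : (r - sq y) ^+ k.+2 <= r ^+ k.+2 by rewrite lerXn2r ?nnegrE// gerBl sq_ge0.
have q1 : 0 <= (r - sq y) ^+ k.+1 by rewrite exprn_ge0.
have q2 : 0 <= (r - sq y) ^+ k.+2 by rewrite exprn_ge0.
have i1 : ip y z ^+ 2 <= r * sq z.
  by apply: (le_trans (ip_sq_le y z)); rewrite ler_wpM2r// ltW.
have A : (r - sq y) ^+ k.+1 * ip y z ^+ 2 <= r ^+ k.+2 * sq z.
  by rewrite [r ^+ k.+2]exprSr -mulrA ler_pM ?sqr_ge0.
have B : (r - sq y) ^+ k.+2 * sq z <= r ^+ k.+2 * sq z by rewrite ler_wpM2r.
have A0 : 0 <= (r - sq y) ^+ k.+1 * ip y z ^+ 2 by rewrite mulr_ge0 ?sqr_ge0.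
have B0 : 0 <= (r - sq y) ^+ k.+2 * sq z by rewrite mulr_ge0.
move: A B A0 B0; move: (_ * ip y z ^+ 2) ((r - sq y) ^+ k.+2 * sq z) => a b A B A0 B0.
have -> : 4 * k.+3%:R ^+ 2 * r ^+ k.+2 * sq z = 4 * k.+3%:R ^+ 2 * (r ^+ k.+2 * sq z) by ring.
have E : k.+3%:R = k.+2%:R + 1 :> R by rewrite -natr1.
have k2 : 0 <= k.+2%:R :> R by [].
rewrite E; move: (k.+2%:R : R) k2 => x x0; move: (r ^+ k.+2 * sq z) A B => c A B.
rewrite ler_norml; apply/andP; split; nra.
Qed.

(** The sign is that of minus the Laplacian, and also that of the symmetrized numerator of the
    singular integral, so one object serves both operators. *)
Definition d2 (u : 'rV[R]_n -> R) z y : R := 2 * u y - u (y + z) - u (y - z).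

Lemma d2_bump_le k r y z : 0 <= r ->
  `|d2 (bmp k.+3 r) z y| <= 8 * k.+3%:R ^+ 2 * r ^+ k.+2 * sq z.
Proof.
move=> r0.
have := @second_diff_le R (fun s => bmp k.+3 r (y + s *: z)) _ _ 1
  (4 * k.+3%:R ^+ 2 * r ^+ k.+2 * sq z) ltr01
  (is_derive_bump k.+1 r y z) (is_derive_bump1 k r y z).
move=> /(_ (fun s _ => bump2_le k _ z r0)).
rewrite scale0r addr0 scale1r scaleN1r expr1n mulr1.
have -> : 8 * k.+3%:R ^+ 2 * r ^+ k.+2 * sq z = 2 * (4 * k.+3%:R ^+ 2 * r ^+ k.+2 * sq z) by ring.
exact.
Qed.

Lemma sq_evec (i : 'I_n) : sq (evec R i) = 1.
Proof.
rewrite /sq (bigD1 i)//= mxE eqxx expr1n big1 ?addr0// => j ji.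
by rewrite mxE eq_sym (negbTE ji) expr0n.
Qed.

Lemma ip_evec y i : ip y (evec R i) = y ord0 i.
Proof.
rewrite /ip (bigD1 i)//= mxE eqxx mulr1 big1 ?addr0// => j ji.
by rewrite mxE eq_sym (negbTE ji) mulr0.
Qed.

Lemma sqZ (c : R) z : sq (c *: z) = c ^+ 2 * sq z.
Proof. by rewrite /sq mulr_sumr; apply: eq_bigr => i _; rewrite mxE exprMn. Qed.

Definition dlap (h : R) (u : 'rV[R]_n -> R) y : R :=
  \sum_(i < n) d2 u (h *: evec R i) y / h ^+ 2.

(** The Laplacian produces |y|^2 (r - |y|^2)_+^(k-2); writing |y|^2 = r - (r - |y|^2) brings it back
    to bumps, with a factor r. This closure is the reason for the choice of family. *)
Lemma dlap_bump_cvg k r y (u : nat -> R) : (forall j, 0 < u j) -> u @ \oo --> (0 : R) ->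
  (fun j => dlap (u j) (bmp k.+3 r) y) @ \oo -->
  (2 * n%:R * k.+3%:R + 4 * k.+3%:R * k.+2%:R) * bmp k.+2 r y
  - 4 * k.+3%:R * k.+2%:R * (r * bmp k.+1 r y).
Proof.
move=> u0 cu; rewrite /dlap.
have E : (2 * n%:R * k.+3%:R + 4 * k.+3%:R * k.+2%:R) * bmp k.+2 r y
  - 4 * k.+3%:R * k.+2%:R * (r * bmp k.+1 r y) = \sum_(i < n) - bmp2 k.+3 r y (evec R i).
  rewrite /bmp2 /=.
  under eq_bigr do rewrite sq_evec ip_evec mulr1.
  rewrite sumrN big_split/= -2!mulr_sumr -/(sq y) sumr_const card_ord.
  have P : r * bmp k.+1 r y = bmp k.+2 r y + sq y * bmp k.+1 r y.
    rewrite /bmp; have [h|h] := leP r (sq y).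
      by rewrite !pp_neg ?subr_le0// !mulr0 addr0.
    by rewrite !pp_pos ?subr_ge0 ?(ltW h)// [_ ^+ k.+2]exprS; ring.
  rewrite P /bmp -mulr_natl; ring.
rewrite E; apply: cvg_sumR => i.
have := @second_diff_cvg R (fun s => bmp k.+3 r (y + s *: evec R i)) _ _ u
  (is_derive_bump k.+1 r y (evec R i)) (is_derive_bump1 k r y (evec R i) 0) u0 cu.
rewrite scale0r addr0; apply: cvg_trans; apply: near_eq_cvg; apply: nearW => j /=.
by rewrite /d2 scaleNr.
Qed.

End Bumps.
Arguments d2 {R n} u z y.
Arguments dlap {R n} h u y.

(** * Summation by parts against bumps *)

Section TestFunctions.
Context {R : realType}.
Variable n : nat.
Implicit Types (x y z : 'rV[R]_n) (l : seq (R * nat * nat)).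

(* A list of triples [(c, i, k)] encodes the test function [sum c r^i (r - |y|^2)_+^k], with the radius
   [r] as a parameter; [bneglap] acts on the list as minus the Laplacian in [y]. *)
Definition bterm (t : R * nat * nat) (r : R) y : R := t.1.1 * r ^+ t.1.2 * bmp t.2 r y.

Definition btest l (r : R) y : R := \sum_(t <- l) bterm t r y.

Definition bneglap1 (t : R * nat * nat) : seq (R * nat * nat) :=
  [:: (t.1.1 * (2 * n%:R * t.2%:R + 4 * t.2%:R * t.2.-1%:R), t.1.2, t.2.-1);
      (- (t.1.1 * (4 * t.2%:R * t.2.-1%:R)), t.1.2.+1, t.2.-2)].

Definition bneglap l := flatten [seq bneglap1 t | t <- l].

(** A smoothness budget, of which each [bneglap] spends two. Powers of at least 1 make the test
    function vanish outside the ball; powers of at least 3 bound its second differences by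
    [sq z]. *)
Definition bdeg (k : nat) l := all (fun t => (k <= t.2)%N) l.

Lemma bdegW (j k : nat) l : (j <= k)%N -> bdeg k l -> bdeg j l.
Proof. by move=> jk; apply: sub_all => t; exact: leq_trans. Qed.

Lemma bdeg_neglap k l : bdeg k.+2 l -> bdeg k (bneglap l).
Proof.
elim: l => //= t l IH /andP[h /IH]; rewrite /bneglap/= => ->.
by move: h; case: (t.2) => [|[|j]] //=; rewrite !ltnS => h; rewrite h leqW.
Qed.

Lemma bdeg_iter j k l : bdeg (j.*2 + k) l -> bdeg k (iter j bneglap l).
Proof.
elim: j k => // j IH k; rewrite doubleS => dl; rewrite iterS; apply: bdeg_neglap.
by apply: IH; rewrite !addnS -!addSn.
Qed.

Lemma btest_cons t l r y : btest (t :: l) r y = bterm t r y + btest l r y.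
Proof. by rewrite /btest big_cons. Qed.

Lemma btest_nil r y : btest [::] r y = 0.
Proof. by rewrite /btest big_nil. Qed.

Lemma btest_out l r y : bdeg 1 l -> r <= sq y -> btest l r y = 0.
Proof.
move=> dl ry; rewrite /btest big_seq big1// => t tl.
have := allP dl t tl; rewrite /bterm; case: (t.2) => // k _.
by rewrite bump_out// mulr0.
Qed.

Lemma measurable_btest2 l : measurable_fun setT (fun z : R * 'rV[R]_n => btest l z.1 z.2).
Proof.
rewrite /btest; apply: measurable_sum => t.
apply: measurable_funM; last exact: measurable_bump2.
by apply: measurable_funM => //; apply: measurable_funX; exact: measurable_fst.
Qed.

Lemma measurable_btest l r : measurable_fun setT (btest l r : 'rV[R]_n -> R).
Proof.
rewrite /btest; apply: measurable_sum => t.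
by apply: measurable_funM => //; exact: measurable_bump.
Qed.

Lemma expr_le_1D (r : R) (i q : nat) : 0 <= r -> (i <= q)%N -> r ^+ i <= (1 + r) ^+ q.
Proof.
move=> r0 iq; apply: (@le_trans _ _ ((1 + r) ^+ i)).
  by rewrite lerXn2r ?nnegrE ?addr_ge0// lerDr.
by rewrite ler_weXn2l// lerDl.
Qed.

(** Polynomial growth in the radius is what the weight e^(-br) of the later superposition tolerates;
    the same form of bound recurs for all test functions. *)
Lemma btest_le l : exists C : R, exists q : nat, 0 <= C /\
  forall r y, 0 <= r -> `|btest l r y| <= C * (1 + r) ^+ q.
Proof.
elim: l => [|t l [C [q [C0 IH]]]].
  exists 0, 0%N; split=> // r y r0; by rewrite btest_nil normr0 mul0r.
exists (`|t.1.1| + C), (maxn (t.1.2 + t.2) q); split; first by rewrite addr_ge0.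
move=> r y r0; rewrite btest_cons mulrDl; apply: (le_trans (ler_normD _ _)); apply: lerD.
  rewrite /bterm -mulrA normrM; apply: ler_wpM2l => //.
  rewrite (ger0_norm (mulr_ge0 (exprn_ge0 _ r0) (bump_ge0 _ _ _))).
  apply: (@le_trans _ _ (r ^+ t.1.2 * r ^+ t.2)); first by rewrite ler_wpM2l ?exprn_ge0 ?bump_le.
  by rewrite -exprD expr_le_1D// leq_maxl.
apply: (le_trans (IH r y r0)); apply: ler_wpM2l => //.
by rewrite ler_weXn2l ?leq_maxr// lerDl.
Qed.

Lemma d2_btest_cons t l r z y :
  d2 (btest (t :: l) r) z y = t.1.1 * r ^+ t.1.2 * d2 (bmp t.2 r) z y + d2 (btest l r) z y.
Proof. by rewrite /d2 !btest_cons /bterm; ring. Qed.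

Lemma d2_btest_le l : bdeg 3 l -> exists C : R, exists q : nat, 0 <= C /\
  forall r z y, 0 <= r -> `|d2 (btest l r) z y| <= C * (1 + r) ^+ q * sq z.
Proof.
elim: l => [_|t l IH /= /andP[kt /IH[C [q [C0 {}IH]]]]].
  exists 0, 0%N; split=> // r z y r0; by rewrite /d2 !btest_nil mulr0 !subr0 normr0 !mul0r.
move: kt IH; case: t => [[c i] [|[|[|k]]]] //= _ IH.
pose A := 8 * k.+3%:R ^+ 2 : R; have A0 : 0 <= A by rewrite mulr_ge0// exprn_ge0.
exists (`|c| * A + C), (maxn (i + k.+2) q); split; first by rewrite addr_ge0// mulr_ge0.
move=> r z y r0; rewrite d2_btest_cons /= !mulrDl; apply: (le_trans (ler_normD _ _)); apply: lerD.
  rewrite -mulrA normrM -!(mulrA `|c|); apply: ler_wpM2l => //.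
  rewrite normrM ger0_norm ?exprn_ge0//.
  apply: (@le_trans _ _ (r ^+ i * (A * r ^+ k.+2 * sq z))).
    by rewrite ler_wpM2l ?exprn_ge0// d2_bump_le.
  have -> : r ^+ i * (A * r ^+ k.+2 * sq z) = A * (r ^+ (i + k.+2)) * sq z by rewrite exprD; ring.
  apply: ler_wpM2r; first exact: sq_ge0.
  by apply: ler_wpM2l => //; rewrite expr_le_1D// leq_maxl.
apply: (le_trans (IH r z y r0)); apply: ler_wpM2r; first exact: sq_ge0.
by apply: ler_wpM2l => //; rewrite ler_weXn2l ?leq_maxr// lerDl.
Qed.

Lemma dlap_btest_le l r : bdeg 3 l -> 0 <= r -> exists2 C : R, 0 <= C &
  forall h y, 0 < h -> `|dlap h (btest l r) y| <= C.
Proof.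
move=> /d2_btest_le[C [q [C0 H]]] r0; have K0 : 0 <= C * (1 + r) ^+ q.
  by rewrite mulr_ge0 ?exprn_ge0 ?addr_ge0.
exists (n%:R * (C * (1 + r) ^+ q)); first by rewrite mulr_ge0.
move=> h y h0; apply: (le_trans (ler_norm_sum _ _ _)).
have -> : n%:R * (C * (1 + r) ^+ q) = \sum_(i < n) C * (1 + r) ^+ q.
  by rewrite sumr_const card_ord mulr_natl.
apply: ler_sum => i _; rewrite normrM normfV (ger0_norm (sqr_ge0 _)) ler_pdivrMr ?exprn_gt0//.
by apply: (le_trans (H _ _ _ r0)); rewrite sqZ sq_evec mulr1.
Qed.

Lemma dlap_btest_cvg l r y (u : nat -> R) : bdeg 3 l ->
  (forall j, 0 < u j) -> u @ \oo --> (0 : R) ->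
  (fun j => dlap (u j) (btest l r) y) @ \oo --> btest (bneglap l) r y.
Proof.
move=> + u0 cu; elim: l => [_|t l IH /= /andP[kt /IH {}IH]].
  rewrite /bneglap /=.
  have -> : (fun j => dlap (u j) (btest [::] r) y) = fun=> 0.
    apply/funext => j; rewrite /dlap big1// => i _.
    by rewrite /d2 !btest_nil mulr0 !subr0 mul0r.
  by rewrite btest_nil; exact: cvg_cst.
have -> : (fun j => dlap (u j) (btest (t :: l) r) y) =
    (fun j => t.1.1 * r ^+ t.1.2 * dlap (u j) (bmp t.2 r) y + dlap (u j) (btest l r) y).
  apply/funext => j; rewrite /dlap mulr_sumr -big_split/=; apply: eq_bigr => i _.
  by rewrite d2_btest_cons; ring.
move: kt; case: t => [[c i] [|[|[|k]]]] //= _.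
have := cvgD (cvgM (cvg_cst (c * r ^+ i)) (@dlap_bump_cvg _ _ k r y u u0 cu)) IH.
rewrite /bneglap/= !btest_cons /bterm/= addrA.
have -> : c * r ^+ i * ((2 * n%:R * k.+3%:R + 4 * k.+3%:R * k.+2%:R) * bmp k.+2 r y -
     4 * k.+3%:R * k.+2%:R * (r * bmp k.+1 r y)) =
  c * (2 * n%:R * k.+3%:R + 4 * k.+3%:R * k.+2%:R) * r ^+ i * bmp k.+2 r y +
  - (c * (4 * k.+3%:R * k.+2%:R)) * r ^+ i.+1 * bmp k.+1 r y by rewrite exprS; ring.
exact.
Qed.

(** A multiple of the Gaussian centred at [x] dominates, being bounded below on the ball; no volume
    of balls is computed. *)
Lemma L1_compact (f : 'rV[R]_n -> R) (M r : R) x : measurable_fun setT f ->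
  (forall y, `|f y| <= M) -> (forall y, r < sq (y - x) -> f y = 0) -> L1 (rnm n) f.
Proof.
move=> mf fM f0; have lh : L1 (rnm n) (heat 1 : 'rV[R]_n -> R).
  apply: ge0_L1; [exact: measurable_heat|exact: heat_ge0|].
  by rewrite heat_int// ltry.
pose c := (Num.sqrt (4 * pi * 1) ^+ n)^-1 * expR (- (r / (4 * 1))) : R.
have c0 : 0 < c by rewrite mulr_gt0 ?invr_gt0 ?exprn_gt0 ?sqrt_fourpi_gt0 ?expR_gt0.
have M0 : 0 <= M by apply: le_trans (fM 0).
apply: (L1_le mf _ (L1Z (M / c) (L1_shift (- x) lh))) => y.
have [h|h] := ltP r (sq (y - x)).
  by rewrite f0// normr0 mulr_ge0 ?heat_ge0 ?divr_ge0// ltW.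
apply: (le_trans (fM y)); rewrite mulrAC ler_pdivlMr//; apply: ler_wpM2l => //.
rewrite /heat -lock /c ler_wpM2l ?invr_ge0 ?exprn_ge0 ?sqrtr_ge0//.
by rewrite ler_expR lerN2 ler_wpM2r.
Qed.

Definition locally_bounded (w : 'rV[R]_n -> R) := forall r : R, exists M : R,
  forall y, sq y <= r -> `|w y| <= M.

Lemma L1_loc (w f : 'rV[R]_n -> R) (M r : R) x : measurable_fun setT w -> locally_bounded w ->
  measurable_fun setT f -> (forall y, `|f y| <= M) -> (forall y, r < sq (y - x) -> f y = 0) ->
  L1 (rnm n) (fun y => w y * f y).
Proof.
move=> mw bw mf fM f0.
have [N wN] := bw (2 * `|r| + 2 * sq x).
have M0 : 0 <= M by apply: le_trans (fM 0).
apply: (@L1_compact _ (`|N| * M) r x); first exact: measurable_funM.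
  move=> y; rewrite normrM; have [h|h] := ltP r (sq (y - x)).
    by rewrite f0// normr0 mulr0 mulr_ge0.
  apply: ler_pM => //; apply: (le_trans (wN y _)); last exact: ler_norm.
  have -> : y = (y - x) + x by rewrite subrK.
  apply: (le_trans (sqD_le _ _)); rewrite lerD2r ler_wpM2l//.
  by apply: (le_trans h); exact: ler_norm.
by move=> y /f0 ->; rewrite mulr0.
Qed.

Lemma measurable_shift_rv (w : 'rV[R]_n -> R) a : measurable_fun setT w ->
  measurable_fun setT (fun y => w (y + a)).
Proof. by move=> mw; exact: (measurableT_comp mw (@measurable_rv_add _ _ a)). Qed.

Lemma measurable_d2 (w : 'rV[R]_n -> R) z : measurable_fun setT w -> measurable_fun setT (d2 w z).
Proof.
move=> mw; apply: measurable_funB; last exact: measurable_shift_rv.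
by apply: measurable_funB; [exact: measurable_funM|exact: measurable_shift_rv].
Qed.

Lemma measurable_dlap (w : 'rV[R]_n -> R) h : measurable_fun setT w -> measurable_fun setT (dlap h w).
Proof. by move=> mw; apply: measurable_sum => i; apply: measurable_funM => //; exact: measurable_d2. Qed.

Lemma locally_bounded_shift (w : 'rV[R]_n -> R) a : locally_bounded w ->
  locally_bounded (fun y => w (y + a)).
Proof.
move=> bw r; have [M wM] := bw (2 * r + 2 * sq a); exists M => y yr; apply: wM.
by apply: (le_trans (sqD_le _ _)); rewrite lerD2r ler_wpM2l.
Qed.

(** Translation invariance alone makes the second difference symmetric; no differentiability of [w]
    enters. The compact support of [f] makes each of the three terms integrable separately. *)
Lemma RI_d2_swap (w f : 'rV[R]_n -> R) (M r : R) x z : measurable_fun setT w -> locally_bounded w ->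
  measurable_fun setT f -> (forall y, `|f y| <= M) -> (forall y, r < sq (y - x) -> f y = 0) ->
  RI (rnm n) (fun y => d2 w z y * f y) = RI (rnm n) (fun y => w y * d2 f z y).
Proof.
move=> mw bw mf fM f0.
have l0 := L1_loc mw bw mf fM f0.
have lp a : L1 (rnm n) (fun y => w (y + a) * f y).
  exact: (L1_loc (measurable_shift_rv a mw) (locally_bounded_shift a bw) mf fM f0).
have lm a : L1 (rnm n) (fun y => w y * f (y - a)).
  by apply: (eq_L1 _ (L1_shift (- a) (lp a))) => y /=; rewrite subrK.
have sh a : RI (rnm n) (fun y => w (y + a) * f y) = RI (rnm n) (fun y => w y * f (y - a)).
  by rewrite -(RI_shift (- a) (lp a)); apply: eq_RI => y; rewrite subrK.
transitivity (2 * RI (rnm n) (fun y => w y * f y) - RI (rnm n) (fun y => w (y + z) * f y)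
   - RI (rnm n) (fun y => w (y - z) * f y)).
  have l2 := L1Z 2 l0.
  rewrite -(RIZ _ l0) -(RIB l2 (lp z)) -(RIB (L1B l2 (lp z)) (lp (- z))).
  by apply: eq_RI => y; rewrite /d2; ring.
rewrite !sh opprK.
have l2 := L1Z 2 l0; have lz := lm (- z); rewrite opprK in lz.
rewrite -(RIZ _ l0) -(RIB l2 (lm z)) -(RIB (L1B l2 (lm z)) lz).
by apply: eq_RI => y; rewrite /d2; ring.
Qed.

Lemma RI_dlap_swap (w f : 'rV[R]_n -> R) (M r h : R) x : measurable_fun setT w -> locally_bounded w ->
  measurable_fun setT f -> (forall y, `|f y| <= M) -> (forall y, r < sq (y - x) -> f y = 0) ->
  RI (rnm n) (fun y => dlap h w y * f y) = RI (rnm n) (fun y => w y * dlap h f y).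
Proof.
move=> mw bw mf fM f0.
have M0 : 0 <= M by apply: le_trans (fM 0).
have lw a : L1 (rnm n) (fun y => d2 w a y * f y).
  apply: (L1_loc (measurable_d2 a mw) _ mf fM f0) => s.
  have [N0 B0] := bw s; have [N1 B1] := locally_bounded_shift a bw s.
  have [N2 B2] := locally_bounded_shift (- a) bw s.
  exists (2 * N0 + N1 + N2) => y ys; rewrite /d2.
  apply: (le_trans (ler_normB _ _)); apply: lerD; last exact: B2.
  apply: (le_trans (ler_normB _ _)); apply: lerD; last exact: B1.
  by rewrite normrM ger0_norm// ler_wpM2l// B0.
have lf a : L1 (rnm n) (fun y => w y * d2 f a y).
  apply: (@L1_loc _ _ (4 * M) (2 * `|r| + 2 * sq a) x) => //; first exact: measurable_d2.
    move=> y; rewrite /d2; have -> : 4 * M = 2 * M + M + M by ring.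
    apply: (le_trans (ler_normB _ _)); apply: lerD; last exact: fM.
    apply: (le_trans (ler_normB _ _)); apply: lerD; last exact: fM.
    by rewrite normrM ger0_norm// ler_wpM2l.
  have H b y : sq b = sq a -> 2 * `|r| + 2 * sq a < sq (y - x) -> f (y + b) = 0.
    move=> ba h'; apply: f0; rewrite addrAC.
    have e : sq (y - x) <= 2 * sq (y - x + b) + 2 * sq b.
      by have := sqD_le (y - x + b) (- b); rewrite addrK sqN.
    by have := ler_norm r; rewrite ba in e; lra.
  move=> y h'; rewrite /d2 (H a)// (H (- a)) ?sqN// f0; first by rewrite mulr0 !subr0.
  by have := ler_norm r; have := sq_ge0 a; have := normr_ge0 r; lra.
rewrite /dlap.
have -> : (fun y => (\sum_(i < n) d2 w (h *: evec R i) y / h ^+ 2) * f y) =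
   (fun y => \sum_(i < n) (h ^+ 2)^-1 * (d2 w (h *: evec R i) y * f y)).
  by apply/funext => y; rewrite mulr_suml; apply: eq_bigr => i _; ring.
have -> : (fun y => w y * (\sum_(i < n) d2 f (h *: evec R i) y / h ^+ 2)) =
   (fun y => \sum_(i < n) (h ^+ 2)^-1 * (w y * d2 f (h *: evec R i) y)).
  by apply/funext => y; rewrite mulr_sumr; apply: eq_bigr => i _; ring.
rewrite !RI_sum; [|by move=> i; exact: L1Z|by move=> i; exact: L1Z].
by apply: eq_bigr => i _; rewrite !RIZ// (RI_d2_swap _ mw bw mf fM f0).
Qed.

Lemma line_derive (u : 'rV[R]_n -> R) y e (s : R) : derivable u (y + s *: e) e ->
  is_derive s 1 (fun s => u (y + s *: e)) ('D_e u (y + s *: e)).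
Proof.
have E (h : R) : h *: (1 : R) = h by rewrite /GRing.scale/= mulr1.
have H : (fun h : R => h^-1 *: (((fun s => u (y + s *: e)) \o shift s) (h *: 1) - u (y + s *: e))) =
  (fun h : R => h^-1 *: ((u \o shift (y + s *: e)) (h *: e) - u (y + s *: e))).
  apply/funext => h; rewrite /= E; congr (_ *: (u _ - _)).
  by rewrite scalerDl addrCA.
by move=> d; split; rewrite /derivable /derive/= H.
Qed.

Lemma neglap_iterSr (m : nat) (u : 'rV[R]_n -> R) :
  neglap_iter m.+1 u = neglap_iter m (neglap_iter 1 u).
Proof.
elim: m => [//|m IH]; apply/funext => x.
change (- lap (neglap_iter m.+1 u) x = - lap (neglap_iter m (neglap_iter 1 u)) x).
by rewrite IH.
Qed.

Lemma dlap_cvg_neglap (w : 'rV[R]_n -> R) (u : nat -> R) y : neglap_defined 1 w ->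
  (forall j, 0 < u j) -> u @ \oo --> (0 : R) ->
  (fun j => dlap (u j) w y) @ \oo --> neglap_iter 1 w y.
Proof.
move=> dw u0 cu; rewrite /= /lap -sumrN; apply: cvg_sumR => i.
have d1 (s : R) : is_derive s 1 (fun s => w (y + s *: evec R i)) ('D_(evec R i) w (y + s *: evec R i)).
  by apply: line_derive; have [] := dw 0 isT i (y + s *: evec R i).
have d2' : is_derive (0 : R) 1 (fun s => 'D_(evec R i) w (y + s *: evec R i))
    ('D_(evec R i) ('D_(evec R i) w) y).
  have := @line_derive ('D_(evec R i) w) y (evec R i) 0; rewrite scale0r addr0; apply.
  by have [] := dw 0 isT i y.
have := second_diff_cvg d1 d2' u0 cu.
rewrite scale0r addr0; apply: cvg_trans; apply: near_eq_cvg; apply: nearW => j /=.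
by rewrite /d2 scaleNr.
Qed.

(** Bounds on nested difference quotients, uniform in the steps. They replace local bounds on the
    derivatives, and are inherited by the limit when one quotient is turned into a Laplacian. *)
Definition dlap_bounded (m : nat) (w : 'rV[R]_n -> R) := forall r : R, exists M : R,
  forall hs, (size hs <= m)%N -> all (fun h => 0 < h <= 1) hs ->
  forall y, sq y <= r -> `|foldr dlap w hs y| <= M.

Lemma harmonic_cvg0 : (fun j : nat => j.+1%:R^-1 : R) @ \oo --> (0 : R).
Proof. exact: cvg_harmonic. Qed.

Lemma foldr_dlap_cvg (w : 'rV[R]_n -> R) (wk : nat -> 'rV[R]_n -> R) hs y :
  (forall y, (wk ^~ y) @ \oo --> w y) ->
  (fun k => foldr dlap (wk k) hs y) @ \oo --> foldr dlap w hs y.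
Proof.
move=> H; elim: hs y => [|h hs IH] y //=.
apply: cvg_sumR => i; apply: cvgM; last exact: cvg_cst.
by apply: cvgB; [apply: cvgB; [apply: cvgM; [exact: cvg_cst|]|]|].
Qed.

Lemma foldr_dlap_rcons (w : 'rV[R]_n -> R) hs h :
  foldr dlap w (rcons hs h) = foldr dlap (dlap h w) hs.
Proof. by rewrite -cats1 foldr_cat. Qed.

Lemma cvg_norm_le (u : nat -> R) (a M : R) : u @ \oo --> a -> (forall k, `|u k| <= M) -> `|a| <= M.
Proof.
move=> cu uM; have h : `|u k| @[k --> \oo] --> `|a| by exact: cvg_norm.
rewrite -(cvg_lim _ h)//; apply: limr_le; first by apply/cvg_ex; exists `|a|.
by apply: nearW => k; exact: uM.
Qed.

(** Minus the Laplacian of [w] is the pointwise limit of quotients with step 1/(k+1). Inserted as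
    the innermost step, they are covered by the bound on m+1 quotients, which survives in the
    limit. *)
Lemma dlap_bounded_neglap m (w : 'rV[R]_n -> R) : neglap_defined 1 w ->
  dlap_bounded m.+1 w -> dlap_bounded m (neglap_iter 1 w).
Proof.
move=> dw bw r; have [M wM] := bw r; exists M => hs shs ahs y yr.
have u0 (j : nat) : 0 < (j.+1%:R^-1 : R) by rewrite invr_gt0.
have cv z : (fun k : nat => dlap (k.+1%:R^-1) w z) @ \oo --> neglap_iter 1 w z.
  by apply: dlap_cvg_neglap; [exact: dw|exact: u0|exact: harmonic_cvg0].
apply: (cvg_norm_le (@foldr_dlap_cvg _ (fun k : nat => dlap (k.+1%:R^-1) w) hs y cv)) => k.
rewrite -foldr_dlap_rcons; apply: wM => //; first by rewrite size_rcons.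
by rewrite all_rcons ahs andbT u0 /= invf_le1// ler1n.
Qed.

Lemma dlap_bounded_loc m (w : 'rV[R]_n -> R) : dlap_bounded m w -> locally_bounded w.
Proof. by move=> bw r; have [M wM] := bw r; exists M; apply: (wM [::]). Qed.

Lemma neglap_definedS m (w : 'rV[R]_n -> R) : neglap_defined m.+1 w ->
  neglap_defined 1 w /\ neglap_defined m (neglap_iter 1 w).
Proof.
by move=> dw; split=> j jm; [apply: dw; rewrite (leq_trans jm)|rewrite -neglap_iterSr; exact: dw].
Qed.

Lemma measurable_neglap (w : 'rV[R]_n -> R) : neglap_defined 1 w -> measurable_fun setT w ->
  measurable_fun setT (neglap_iter 1 w).
Proof.
move=> dw mw; have u0 (j : nat) : 0 < (j.+1%:R^-1 : R) by rewrite invr_gt0.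
apply: (@measurable_fun_cvg _ _ _ _ (fun k y => dlap (k.+1%:R^-1) w y)) => [k|y _].
  exact: measurable_dlap.
by apply: dlap_cvg_neglap; [exact: dw|exact: u0|exact: harmonic_cvg0].
Qed.

(* Summation by parts for difference quotients, followed by dominated convergence. *)
Lemma neglap_parts1 (w : 'rV[R]_n -> R) l (r : R) x : measurable_fun setT w ->
  neglap_defined 1 w -> dlap_bounded 1 w -> bdeg 3 l -> 0 <= r ->
  RI (rnm n) (fun y => neglap_iter 1 w y * btest l r (y - x)) =
  RI (rnm n) (fun y => w y * btest (bneglap l) r (y - x)).
Proof.
move=> mw dw bw dl r0.
pose u (j : nat) : R := j.+1%:R^-1.
have u0 j : 0 < u j by rewrite invr_gt0.
have cu : u @ \oo --> (0 : R) by exact: harmonic_cvg0.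
pose f y := btest l r (y - x).
have mf : measurable_fun setT f by apply: (measurable_shift_rv (- x)); exact: measurable_btest.
have [C [q [C0 HC]]] := btest_le l.
pose M := C * (1 + r) ^+ q.
have fM y : `|f y| <= M by exact: HC.
have f0 y : r < sq (y - x) -> f y = 0.
  by move=> h; apply: btest_out; [exact: bdegW dl|exact: ltW].
have lbw := dlap_bounded_loc bw.
have M0 : 0 <= M by apply: le_trans (fM 0).
have [B wB] := bw (2 * r + 2 * sq x).
have c1 : (fun k => RI (rnm n) (fun y => dlap (u k) w y * f y)) @ \oo -->
    RI (rnm n) (fun y => neglap_iter 1 w y * f y).
  have lg : L1 (rnm n) (fun y => `|B| * `|f y|).
    apply: (@L1_compact _ (`|B| * M) r x).
    - by apply: measurable_funM => //; exact: measurableT_comp.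
    - by move=> y; rewrite normrM !normr_id ler_wpM2l.
    - by move=> y /f0 ->; rewrite normr0 mulr0.
  have [] // := @RI_cvg R _ _ (rnm n) (fun k y => dlap (u k) w y * f y)
     (fun y => neglap_iter 1 w y * f y) _ _ _ _ lg.
  - by move=> k; apply: measurable_funM => //; exact: measurable_dlap.
  - by move=> y; apply: cvgM; [exact: dlap_cvg_neglap|exact: cvg_cst].
  - move=> k y; rewrite normrM; have [h|h] := ltP r (sq (y - x)).
      by rewrite f0// normr0 !mulr0.
    apply: ler_wpM2r => //; apply: le_trans (ler_norm B).
    apply: (wB [:: u k]) => //=; first by rewrite u0 andbT /= invf_le1// ler1n.
    have -> : y = (y - x) + x by rewrite subrK.
    by apply: (le_trans (sqD_le _ _)); rewrite lerD2r ler_wpM2l.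
have [K K0 HK] := dlap_btest_le dl r0.
have dE h y : dlap h f y = dlap h (btest l r) (y - x).
  rewrite /dlap; apply: eq_bigr => i _; congr (_ / _); rewrite /d2 /f.
  by congr (_ - btest l r _ - btest l r _); rewrite addrAC.
have c2 : (fun k => RI (rnm n) (fun y => w y * dlap (u k) f y)) @ \oo -->
    RI (rnm n) (fun y => w y * btest (bneglap l) r (y - x)).
  (* The steps are at most 1, so by [sqD_le] the difference quotients of [f] vanish beyond the
     squared radius 2r + 2. *)
  pose r' := 2 * r + 2.
  pose g y := if sq (y - x) <= r' then K else 0.
  have gz k y : r' < sq (y - x) -> dlap (u k) f y = 0.
    move=> h; rewrite /dlap big1// => i _.
    have e b : sq b <= 1 -> r < sq (y + b - x).
      move=> b1; rewrite addrAC.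
      have e : sq (y - x) <= 2 * sq (y - x + b) + 2 * sq b.
        by have := sqD_le (y - x + b) (- b); rewrite addrK sqN.
      by rewrite /r' in h; lra.
    have s1 : sq (u k *: evec R i) <= 1.
      by rewrite sqZ sq_evec mulr1 exprn_ile1 ?(ltW (u0 _))// invf_le1// ler1n.
    have fy : f y = 0 by apply: f0; have := sq_ge0 (y - x); rewrite /r' in h; lra.
    rewrite /d2 fy (f0 _ (e _ s1)) (f0 _ (e (- _) _)) ?sqN//.
    by rewrite mulr0 !subr0 mul0r.
  have mg : measurable_fun setT g.
    apply: measurable_fun_ifT => //; apply: measurable_fun_ler => //.
    by apply: (measurable_shift_rv (- x)); exact: measurable_sq.
  have lg : L1 (rnm n) (fun y => `|w y * g y|).
    apply: L1_norm; apply: (@L1_loc _ _ K r' x) => //.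
    - by move=> y; rewrite /g; case: ifP; rewrite ?normr0// ger0_norm.
    - by move=> y h; rewrite /g leNgt h.
  have [] // := @RI_cvg R _ _ (rnm n) (fun k y => w y * dlap (u k) f y)
     (fun y => w y * btest (bneglap l) r (y - x)) _ _ _ _ lg.
  - by move=> k; apply: measurable_funM => //; exact: measurable_dlap.
  - move=> y; apply: cvgM; first exact: cvg_cst.
    by under eq_fun do rewrite dE; exact: dlap_btest_cvg.
  - move=> k y; rewrite !normrM; apply: ler_wpM2l => //.
    rewrite /g; case: (leP (sq (y - x)) r') => h; last by rewrite gz.
    by rewrite dE; apply: (le_trans (HK _ _ (u0 k))); exact: ler_norm.
have E k : RI (rnm n) (fun y => dlap (u k) w y * f y) = RI (rnm n) (fun y => w y * dlap (u k) f y).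
  exact: RI_dlap_swap mw lbw mf fM f0.
rewrite (funext E) in c1.
by rewrite -(cvg_lim _ c1)// -(cvg_lim _ c2).
Qed.

(** The innermost Laplacian is split off from [w], because bounds and measurability are inherited
    from the inside out. Powers of 2m + 3 leave at least 3 after all the transfers, as the
    fractional step will require. *)
Lemma neglap_parts m (w : 'rV[R]_n -> R) l (r : R) x : measurable_fun setT w ->
  neglap_defined m w -> dlap_bounded m w -> bdeg (m.*2 + 3) l -> 0 <= r ->
  RI (rnm n) (fun y => neglap_iter m w y * btest l r (y - x)) =
  RI (rnm n) (fun y => w y * btest (iter m bneglap l) r (y - x)).
Proof.
move=> + + + + r0; elim: m w l => // m IH w l mw dw bw dl.
have [dw1 dwm] := neglap_definedS dw.
rewrite neglap_iterSr IH//.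
- rewrite neglap_parts1//.
  + move=> s; have [M wM] := bw s; exists M => hs h1; apply: wM.
    exact: leq_trans h1 _.
  + by apply: bdeg_iter; apply: bdegW dl; rewrite doubleS -addSnnS ltnS -addnS leq_add2l.
- exact: measurable_neglap.
- exact: dlap_bounded_neglap.
- by apply: bdegW dl; rewrite doubleS leq_add2r -addn2 leq_addr.
Qed.

End TestFunctions.

(** * Regularity of the fractional Laplacian *)

Section PartialDerivatives.
Context {R : realType}.
Variable n : nat.
Implicit Types (x y z : 'rV[R]_n) (u w : 'rV[R]_n -> R) (i j : 'I_n).

Definition has_pd u i u' := forall y (s : R),
  is_derive s 1 (fun s => u (y + s *: evec R i)) (u' (y + s *: evec R i)).

Lemma pderiv_has_pd l u i : (forall x, derivable (pderiv l u) x (evec R i)) ->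
  has_pd (pderiv l u) i (pderiv (i :: l) u).
Proof. by move=> d y s; exact: line_derive. Qed.

Lemma has_pdD u u' w w' i : has_pd u i u' -> has_pd w i w' ->
  has_pd (fun y => u y + w y) i (fun y => u' y + w' y).
Proof. by move=> du dw y s; exact: is_deriveD. Qed.

Lemma has_pdZ c u u' i : has_pd u i u' -> has_pd (fun y => c * u y) i (fun y => c * u' y).
Proof. by move=> du y s; apply: is_derive_scale; first exact: du. Qed.

Lemma has_pd_shift a u u' i : has_pd u i u' -> has_pd (fun y => u (y + a)) i (fun y => u' (y + a)).
Proof.
move=> du y s; rewrite addrAC; have := du (y + a) s.
by under eq_fun do rewrite addrAC.
Qed.

Lemma has_pd_d2 z u u' i : has_pd u i u' -> has_pd (d2 u z) i (d2 u' z).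
Proof.
move=> du; have := has_pdD (has_pdD (has_pdZ 2 du) (has_pdZ (-1) (has_pd_shift z du)))
  (has_pdZ (-1) (has_pd_shift (- z) du)).
have E (f : 'rV[R]_n -> R) : (fun y => 2 * f y + -1 * f (y + z) + -1 * f (y - z)) = d2 f z.
  by apply/funext => y; rewrite /d2 !mulN1r.
by rewrite !E.
Qed.

Lemma has_pd0 i : has_pd (fun=> 0) i (fun=> 0).
Proof. by move=> y s; exact: is_derive_cst. Qed.

Lemma has_pd_sum (I : Type) (r : seq I) (u u' : I -> 'rV[R]_n -> R) i :
  (forall k, has_pd (u k) i (u' k)) ->
  has_pd (fun y => \sum_(k <- r) u k y) i (fun y => \sum_(k <- r) u' k y).
Proof.
move=> H; elim: r => [|k r IH].
  have E (f : I -> 'rV[R]_n -> R) : (fun y => \sum_(k <- [::]) f k y) = fun=> 0.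
    by apply/funext => y; rewrite big_nil.
  by rewrite !E; exact: has_pd0.
have E (f : I -> 'rV[R]_n -> R) : (fun y => \sum_(j <- k :: r) f j y) =
    (fun y => f k y + \sum_(j <- r) f j y).
  by apply/funext => y; rewrite big_cons.
by rewrite !E; exact: has_pdD.
Qed.

Lemma has_pd_dlap h u u' i : has_pd u i u' -> has_pd (dlap h u) i (dlap h u').
Proof.
move=> du; have E (f : 'rV[R]_n -> R) :
    dlap h f = fun y => \sum_(k <- index_enum 'I_n) (h ^+ 2)^-1 * d2 f (h *: evec R k) y.
  by apply/funext => y; apply: eq_bigr => k _; rewrite mulrC.
by rewrite !E; apply: has_pd_sum => k; apply: has_pdZ; exact: has_pd_d2.
Qed.

(* All partial derivatives of order [K] exist and are bounded by [M] on [S]. *)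
Fixpoint nb (S : set 'rV[R]_n) (M : R) (K : nat) u : Prop :=
  if K is K'.+1 then forall i, exists u', has_pd u i u' /\ nb S M K' u'
  else forall y, S y -> `|u y| <= M.

Lemma nb_eq S M K u w : u =1 w -> nb S M K u -> nb S M K w.
Proof. by move=> /funext ->. Qed.

Lemma nbW S M M' K u : M <= M' -> nb S M K u -> nb S M' K u.
Proof.
move=> MM'; elim: K u => [u H y Sy|K IH u H i]; first exact: le_trans (H y Sy) MM'.
by have [u' [d b]] := H i; exists u'; split=> //; exact: IH.
Qed.

Lemma nbD S M M' K u w : nb S M K u -> nb S M' K w -> nb S (M + M') K (fun y => u y + w y).
Proof.
elim: K u w => [u w H H' y Sy|K IH u w H H' i].
  by apply: (le_trans (ler_normD _ _)); apply: lerD; [exact: H|exact: H'].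
have [u' [d b]] := H i; have [w' [d' b']] := H' i.
by exists (fun y => u' y + w' y); split; [exact: has_pdD|exact: IH].
Qed.

Lemma nbZ S M K c u : nb S M K u -> nb S (`|c| * M) K (fun y => c * u y).
Proof.
elim: K u => [u H y Sy|K IH u H i]; first by rewrite normrM ler_wpM2l// H.
have [u' [d b]] := H i.
by exists (fun y => c * u' y); split; [exact: has_pdZ|exact: IH].
Qed.

Lemma nb_dlap (S S' : set 'rV[R]_n) M K h u : 0 < h <= 1 -> 
  (forall y i (s : R), S' y -> `|s| <= 1 -> S (y + s *: evec R i)) ->
  nb S M K.+2 u -> nb S' (2 * n%:R * M) K (dlap h u).
Proof.
move=> /andP[h0 h1] SS'; elim: K u => [u H y Sy|K IH u H i]; last first.
  by have [u' [d b]] := H i; exists (dlap h u'); split; [exact: has_pd_dlap|exact: IH].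
apply: (le_trans (ler_norm_sum _ _ _)).
have -> : 2 * n%:R * M = \sum_(i < n) 2 * M by rewrite sumr_const card_ord -mulr_natl; ring.
apply: ler_sum => i _; have [u' [d H']] := H i; have [u'' [d' b]] := H' i.
rewrite normrM normfV (ger0_norm (sqr_ge0 _)) ler_pdivrMr ?exprn_gt0//.
have := @second_diff_le R _ _ _ h M h0 (d y) (d' y); rewrite scale0r addr0 scaleNr.
apply => s sh; apply: b; apply: SS' => //; exact: le_trans h1.
Qed.

Lemma nb_foldr_dlap (S : nat -> set 'rV[R]_n) M K hs u :
  (forall (j : nat) y i (s : R), S j y -> `|s| <= 1 -> S j.+1 (y + s *: evec R i)) ->
  all (fun h => 0 < h <= 1) hs ->
  nb (S (size hs)) M ((size hs).*2 + K) u ->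
  nb (S 0) ((2 * n%:R) ^+ size hs * M) K (foldr dlap u hs).
Proof.
elim: hs S M K u => [|h hs IH] S M K u HS /= => [_|/andP[h01 ahs] H].
  by rewrite mul1r.
rewrite exprS -mulrA; apply: (nb_dlap h01 (HS 0%N)).
apply: (IH (fun k => S k.+1) M K.+2 u _ ahs); first by move=> k; exact: HS.
have -> : ((size hs).*2 + K.+2 = (size hs).+1.*2 + K)%N by rewrite doubleS !addSn !addnS.
exact: H.
Qed.

Definition ball_sq (r : R) : set 'rV[R]_n := [set y | sq y <= r].

(** By [sqD_le] a move of length at most 1 takes the ball of squared radius r into that of squared
    radius 2r + 2. *)
Definition grow (r : R) : R := 2 * r + 2.

Lemma ball_sq_grow r (j : nat) y i (s : R) : ball_sq (iter j grow r) y -> `|s| <= 1 ->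
  ball_sq (iter j.+1 grow r) (y + s *: evec R i).
Proof.
rewrite /ball_sq/= /grow => yr s1; apply: (le_trans (sqD_le _ _)).
rewrite sqZ sq_evec mulr1 lerD// ?ler_wpM2l//.
by rewrite ler_piMr// -real_normK ?num_real// exprn_ile1.
Qed.

(* Moves from [x] to [x + z] one coordinate at a time. *)
Lemma path_bound u (u' : 'I_n -> 'rV[R]_n -> R) x z (M : R) :
  (forall i, has_pd u i (u' i)) ->
  (forall i y, sq (y - x) <= sq z -> `|u' i y| <= M) ->
  `|u (x + z) - u x| <= M * \sum_i `|z ord0 i|.
Proof.
move=> du uM.
pose part (k : nat) : 'rV[R]_n := \row_j (if (j < k)%N then z ord0 j else 0).
have p0 : part 0 = 0 by apply/rowP => j; rewrite !mxE.
have pn : part n = z by apply/rowP => j; rewrite !mxE ltn_ord.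
have pS (i : 'I_n) : part i.+1 = part i + z ord0 i *: evec R i.
  apply/rowP => j; rewrite !mxE ltnS leq_eqVlt -(inj_eq val_inj) eq_sym.
  case: (eqVneq (i : nat) j) => [/val_inj ->|ij]/=; first by rewrite ltnn add0r mulr1.
  by rewrite mulr0 addr0.
have step (i : 'I_n) : `|u (x + part i.+1) - u (x + part i)| <= M * `|z ord0 i|.
  rewrite pS addrA; set c := z ord0 i; set y := x + part i.
  (* On the path each coordinate of the displacement is 0, a full coordinate of [z], or a part of
     one, so the point stays within the ball in which [u'] is controlled. *)
  have bd (s : R) : `|s| <= `|c| -> `|u' i (y + s *: evec R i)| <= M.
    move=> sc; apply: uM; rewrite /y addrAC [_ - x]addrC addrA addNr add0r.
    rewrite /sq; apply: ler_sum => j _; rewrite !mxE.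
    case: (eqVneq i j) => [<-|ij]; first by rewrite ltnn add0r mulr1 -(real_normK (num_real s)) -(real_normK (num_real c)) lerXn2r ?nnegrE.
    by rewrite mulr0 addr0; case: ifP => // _; rewrite expr0n sqr_ge0.
  have [c0|c0|c0] := ltgtP 0 c.
  - have [e /andP[e0 ec] E] := mvt0 c0 (du i y).
    rewrite scale0r addr0 in E; rewrite E normrM ler_wpM2r// bd//.
    by rewrite !ger0_norm ?(ltW e0) ?(ltW c0)// ltW.
  - have dN (s : R) : is_derive s 1 (fun s => u (y + (- s) *: evec R i)) (- u' i (y + (- s) *: evec R i)).
      apply: (@is_derive_comp R (fun s => u (y + s *: evec R i)) -%R s _ _ _ (du i y _) (is_derive_opp s)).
      by rewrite mulrN1.
    have Nc0 : 0 < - c by rewrite oppr_gt0.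
    have [e /andP[e0 ec] E] := mvt0 Nc0 dN.
    rewrite opprK oppr0 scale0r addr0 in E; rewrite E normrM !normrN ler_wpM2r// bd//.
    by rewrite normrN (ger0_norm (ltW e0)) ltr0_norm// ltW.
  - by rewrite -c0 scale0r addr0 subrr normr0 mulr0.
have H k : (k <= n)%N -> `|u (x + part k) - u x| <= M * \sum_(i < n | (i < k)%N) `|z ord0 i|.
  elim: k => [_|k IH kn]; first by rewrite p0 addr0 subrr normr0 big_pred0_eq mulr0.
  rewrite (bigD1 (Ordinal kn))//= mulrDr.
  have -> : \sum_(i < n | (i < k.+1)%N && (i != Ordinal kn)) `|z ord0 i| = \sum_(i < n | (i < k)%N) `|z ord0 i|.
    by apply: eq_bigl => i; rewrite -(inj_eq val_inj)/= ltnS ltn_neqAle andbC.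
  have -> : u (x + part k.+1) - u x = (u (x + part k.+1) - u (x + part k)) + (u (x + part k) - u x) by ring.
  apply: (le_trans (ler_normD _ _)); apply: lerD; first exact: (step (Ordinal kn)).
  exact: IH (ltnW kn).
have := H n (leqnn n); rewrite pn; congr (_ <= M * _).
by apply: eq_bigl => i; rewrite ltn_ord.
Qed.

Lemma abs_coord_le z i : `|z ord0 i| <= eucl z.
Proof.
rewrite -(@sqrtr_sqr R); apply: ler_wsqrtr; rewrite (bigD1 i)//= lerDl.
by apply: sumr_ge0 => j _; exact: sqr_ge0.
Qed.

Lemma sum_abs_le z : \sum_i `|z ord0 i| <= n%:R * eucl z.
Proof.
have -> : n%:R * eucl z = \sum_(i < n) eucl z by rewrite sumr_const card_ord mulr_natl.
by apply: ler_sum => i _; exact: abs_coord_le.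
Qed.

End PartialDerivatives.

(** * Derivatives of bumps, uniformly in the radius *)

Section MonomialBumps.
Context {R : realType}.
Variable n : nat.
Implicit Types (x y z : 'rV[R]_n) (u w : 'rV[R]_n -> R) (i j : 'I_n) (s : seq 'I_n).

Lemma has_pdM u u' w w' i : has_pd u i u' -> has_pd w i w' ->
  has_pd (fun y => u y * w y) i (fun y => u' y * w y + u y * w' y).
Proof. by move=> du dw y t; apply: is_derive_mul; [exact: du|exact: dw|]. Qed.

Lemma has_pd_coord i j : has_pd (fun y : 'rV[R]_n => y ord0 i) j (fun=> (i == j)%:R).
Proof.
move=> y t; have -> : (fun t => (y + t *: evec R j) ord0 i) = (fun t => y ord0 i + (i == j)%:R * t).
  by apply/funext => a; rewrite !mxE eq_sym mulrC.
exact: is_derive_affine.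
Qed.

Definition mono s y : R := \prod_(i <- s) y ord0 i.

(** A monomial is a list of indices, so its derivative in the j-th variable is the sum over the ways
    of deleting one occurrence of [j]; multiplicities replace coefficients. *)
Fixpoint rems j s : seq (seq 'I_n) :=
  if s is i :: s' then (if i == j then [:: s'] else [::]) ++ map (cons i) (rems j s') else [::].

Lemma size_rems j s : (size (rems j s) <= size s)%N.
Proof.
elim: s => //= i s IH; rewrite size_cat size_map.
by case: ifP => _ /=; [exact: IH|exact: leqW].
Qed.

Lemma rems_size j s t : t \in rems j s -> (size t < size s)%N.
Proof.
elim: s t => //= i s IH t; rewrite mem_cat => /orP[|/mapP[t' /IH h ->]] //.
by case: ifP => // _; rewrite inE => /eqP ->.
Qed.

Lemma mono_has_pd s j : has_pd (mono s) j (fun y => \sum_(t <- rems j s) mono t y).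
Proof.
elim: s => [|i s IH] /=.
  have -> : mono [::] = fun=> 1 by apply/funext => y; rewrite /mono big_nil.
  have -> : (fun y : 'rV[R]_n => \sum_(t <- [::]) mono t y) = fun=> 0.
    by apply/funext => y; rewrite big_nil.
  by move=> y t; exact: is_derive_cst.
have E : mono (i :: s) = fun y => y ord0 i * mono s y.
  by apply/funext => y; rewrite /mono big_cons.
have := has_pdM (has_pd_coord i j) IH; rewrite -E.
have -> // : (fun y => (i == j)%:R * mono s y + y ord0 i * (\sum_(t <- rems j s) mono t y)) =
  (fun y => \sum_(t <- (if i == j then [:: s] else [::]) ++ [seq i :: t | t <- rems j s]) mono t y).
apply/funext => y; rewrite big_cat big_map /= mulr_sumr; congr (_ + _).
  by case: ifP => _; rewrite ?big_cons big_nil ?mul1r ?mul0r ?addr0.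
by apply: eq_bigr => t _; rewrite /mono big_cons.
Qed.

Lemma bmp_has_pd k r j : has_pd (bmp k.+2 r) j (fun y => - (2 * k.+2%:R) * (y ord0 j * bmp k.+1 r y)).
Proof.
move=> y t; have := is_derive_bump k r y (evec R j) t.
by rewrite /bmp1 ip_evec /= [in X in _ -> X](mulrC (_ ord0 j)).
Qed.

Lemma nb_sum (S : set 'rV[R]_n) M K (I : eqType) (l : seq I) (u : I -> 'rV[R]_n -> R) :
  (forall k, k \in l -> nb S M K (u k)) ->
  nb S ((size l)%:R * M) K (fun y => \sum_(k <- l) u k y).
Proof.
elim: l => [_|k l IH H].
  rewrite mul0r; have -> : (fun y => \sum_(k <- [::]) u k y) = fun=> 0.
    by apply/funext => y; rewrite big_nil.
  elim: K => [y _|K IH i]; first by rewrite normr0.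
  by exists (fun=> 0); split; [exact: has_pd0|exact: IH].
have -> : (fun y => \sum_(k <- k :: l) u k y) = (fun y => u k y + \sum_(k <- l) u k y).
  by apply/funext => y; rewrite big_cons.
rewrite [size _]/= -natr1 mulrDl mul1r addrC; apply: nbD; first by apply: H; rewrite mem_head.
by apply: IH => j jl; apply: H; rewrite inE jl orbT.
Qed.

(** A derivative either deletes an index or appends one while lowering the power, so k + [size s]
    never grows and [r ^+ T] bounds every term. There are at most [size s] terms of the first kind,
    and the second has coefficient 2k: together at most 3T. *)
Lemma nb_mono_bmp K s k T r : 1 <= r -> (k + size s <= T)%N -> (K < k)%N ->
  nb setT ((3 * T%:R) ^+ K * r ^+ T) K (fun y => mono s y * bmp k r y).
Proof.
move=> r1; have r0 : 0 <= r by apply: le_trans r1.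
elim: K s k => [|K IH] s k kT Kk.
  case: k Kk kT => // k _ kT y _; rewrite expr0 mul1r normrM.
  have [h|h] := leP r (sq y).
    by rewrite bump_out// normr0 mulr0 exprn_ge0.
  apply: (@le_trans _ _ (r ^+ size s * r ^+ k.+1)).
    apply: ler_pM => //; last by rewrite ger0_norm ?bump_ge0 ?bump_le.
    rewrite /mono; elim: (s) => [|i s' IHs]; first by rewrite big_nil normr1 expr0.
    rewrite big_cons normrM exprS; apply: ler_pM => //.
    rewrite -(@ler_pXn2r _ 2) ?nnegrE// real_normK ?num_real//.
    apply: (@le_trans _ _ (sq y)).
      by rewrite /sq (bigD1 i)//= lerDl; apply: sumr_ge0 => j _; exact: sqr_ge0.
    by apply: (le_trans (ltW h)); rewrite expr2 ler_peMr.
  by rewrite -exprD ler_weXn2l// addnC.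
case: k Kk kT => [|[|k]] // Kk kT j.
exists (fun y => \sum_(t <- rems j s) mono t y * bmp k.+2 r y +
   - (2 * k.+2%:R) * (mono (j :: s) y * bmp k.+1 r y)); split.
  have := has_pdM (mono_has_pd s j) (bmp_has_pd k r j).
  congr has_pd; apply/funext => y; rewrite mulr_suml; congr (_ + _).
  by rewrite /mono big_cons; ring.
have B0 : 0 <= (3 * T%:R) ^+ K * r ^+ T by rewrite mulr_ge0 ?exprn_ge0 ?mulr_ge0.
have kt t : t \in rems j s -> (k.+2 + size t <= T)%N.
  by move/rems_size => h; apply: leq_trans kT; rewrite leq_add2l ltnW.
have H1 := @nb_sum setT ((3 * T%:R) ^+ K * r ^+ T) K _ (rems j s)
  (fun t y => mono t y * bmp k.+2 r y) (fun t tl => IH t k.+2 (kt t tl) (ltnW Kk)).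
have kT' : (k.+1 + size (j :: s) <= T)%N by rewrite /= addnS -addSn.
have H2 := @nbZ _ _ setT _ K (- (2 * k.+2%:R)) _ (IH (j :: s) k.+1 kT' Kk).
apply: nbW (nbD H1 H2).
rewrite normrN ger0_norm ?mulr_ge0// -mulrDl exprS -mulrA ler_wpM2r//.
rewrite -natrM -natrD -natrM ler_nat.
apply: (@leq_trans (size s + 2 * k.+2)%N); first by rewrite leq_add2r size_rems.
by move: kT; lia.
Qed.

Lemma nb_bmp K k (r : R) : 1 <= r -> (K < k)%N ->
  nb [set: 'rV[R]_n] ((3 * k%:R) ^+ K * r ^+ k) K (bmp k r).
Proof.
move=> r1 Kk; apply: (nb_eq _ (@nb_mono_bmp K [::] k k r r1 _ Kk)); last by rewrite addn0.
by move=> y; rewrite /mono big_nil mul1r.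
Qed.

Lemma foldr_dlap_eq0 u hs r y : (forall y, r < sq y -> u y = 0) ->
  all (fun h => 0 < h <= 1) hs -> iter (size hs) grow r < sq y -> foldr dlap u hs y = 0.
Proof.
move=> u0; elim: hs y => [y _|h hs IH y /= /andP[/andP[h0 h1] ahs] ry]; first exact: u0.
have far (b : 'rV[R]_n) : sq b <= 1 -> foldr dlap u hs (y + b) = 0.
  move=> b1; apply: IH => //; rewrite /grow in ry.
  have := sqD_le (y + b) (- b); rewrite addrK sqN => e.
  by lra.
rewrite /dlap big1// => i _; rewrite /d2.
have s1 : sq (h *: evec R i) <= 1.
  by rewrite sqZ sq_evec mulr1 exprn_ile1 ?(ltW h0).
have y0 : foldr dlap u hs y = 0.
  by have := far 0; rewrite addr0; apply; rewrite /sq big1// => k _; rewrite mxE expr0n.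
by rewrite y0 (far _ s1) (far (- _)) ?sqN// mulr0 !subr0 mul0r.
Qed.

Lemma iter_grow_le p (r : R) : 1 <= r -> iter p grow r <= 3 * 2 ^+ p * r.
Proof.
move=> r1; suff : iter p grow r <= 2 ^+ p * (r + 2) - 2.
  have p1 : 0 <= 2 ^+ p :> R by rewrite exprn_ge0.
  by nra.
elim: p => [|p IH]; first by rewrite expr0 mul1r addrK.
by rewrite iterS /grow exprS; nra.
Qed.

Section Interchange.
Context {d : measure_display} {T : measurableType d}.
Variable mu : {measure set T -> \bar R}.

Lemma RI_d2 (G : T -> 'rV[R]_n -> R) z y : (forall x, L1 mu (G ^~ x)) ->
  L1 mu (fun t => d2 (G t) z y) /\ d2 (fun x => RI mu (G ^~ x)) z y = RI mu (fun t => d2 (G t) z y).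
Proof.
move=> lG; have l2 := L1Z 2 (lG y).
split; first by apply: L1B; [apply: L1B|].
by rewrite /d2 -(RIZ _ (lG y)) -(RIB l2 (lG _)) -(RIB (L1B l2 (lG _)) (lG _)).
Qed.

Lemma RI_dlap h (G : T -> 'rV[R]_n -> R) y : (forall x, L1 mu (G ^~ x)) ->
  L1 mu (fun t => dlap h (G t) y) /\ dlap h (fun x => RI mu (G ^~ x)) y = RI mu (fun t => dlap h (G t) y).
Proof.
move=> lG; have H i := RI_d2 (h *: evec R i) y lG.
have E f : dlap h f y = \sum_(i <- index_enum 'I_n) (h ^+ 2)^-1 * d2 f (h *: evec R i) y.
  by apply: eq_bigr => i _; rewrite mulrC.
have lz i := L1Z (h ^+ 2)^-1 (H i).1.
have -> : (fun t => dlap h (G t) y) = fun t => \sum_(i <- index_enum 'I_n) (h ^+ 2)^-1 * d2 (G t) (h *: evec R i) y.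
  by apply/funext => t; exact: E.
split; first exact: L1_sum.
rewrite RI_sum// E; apply: eq_bigr => i _.
by rewrite (H i).2 RIZ//; exact: (H i).1.
Qed.

Lemma RI_foldr_dlap hs (G : T -> 'rV[R]_n -> R) : (forall x, L1 mu (G ^~ x)) ->
  (forall y, L1 mu (fun t => foldr dlap (G t) hs y)) /\
  (forall y, foldr dlap (fun x => RI mu (G ^~ x)) hs y = RI mu (fun t => foldr dlap (G t) hs y)).
Proof.
move=> lG; elim: hs => [|h hs [l E]] //=; split=> y.
  exact: (RI_dlap h y l).1.
rewrite (funext E); exact: (@RI_dlap h (fun t => foldr dlap (G t) hs) y l).2.
Qed.

End Interchange.

Lemma measurable_dlap2 d (T : measurableType d) (G : T -> 'rV[R]_n -> R) h :
  measurable_fun setT (fun z : T * 'rV[R]_n => G z.1 z.2) ->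
  measurable_fun setT (fun z : T * 'rV[R]_n => dlap h (G z.1) z.2).
Proof.
move=> mG; apply: measurable_sum => i; apply: measurable_funM => //.
have sh (a : 'rV[R]_n) : measurable_fun setT (fun z : T * 'rV[R]_n => G z.1 (z.2 + a)).
  apply: (measurableT_comp mG (g := fun z : T * 'rV[R]_n => (z.1, z.2 + a))).
  apply: measurable_fun_pair; first exact: measurable_fst.
  by apply: (measurableT_comp (@measurable_rv_add _ _ a)); exact: measurable_snd.
by apply: measurable_funB => //; apply: measurable_funB => //; exact: measurable_funM.
Qed.

Lemma measurable_foldr_dlap2 d (T : measurableType d) (G : T -> 'rV[R]_n -> R) hs :
  measurable_fun setT (fun z : T * 'rV[R]_n => G z.1 z.2) ->
  measurable_fun setT (fun z : T * 'rV[R]_n => foldr dlap (G z.1) hs z.2).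
Proof. by move=> mG; elim: hs => //= h hs IH; exact: (@measurable_dlap2 _ _ (fun t => foldr dlap (G t) hs) h IH). Qed.

End MonomialBumps.

(** * A smooth substitute for the tail of the kernel *)

Section SmoothTail.
Context {R : realType}.
Notation leb := (@lebesgue_measure R).

Definition ptail (a t r : R) : R := if t < r then r `^ (- a - 1) else 0.

Lemma ptail_ge0 a t r : 0 <= ptail a t r.
Proof. by rewrite /ptail; case: ifP => // _; exact: powR_ge0. Qed.

Lemma measurable_ptail a t : measurable_fun setT (ptail a t).
Proof.
by apply: measurable_fun_ifT => //; exact: measurable_fun_ltr.
Qed.

Lemma ptail_int a t : 0 < a -> 0 < t -> (\int[leb]_r (ptail a t r)%:E = (t `^ (- a) / a)%:E)%E.
Proof.
move=> a0 t0; rewrite -(integral_pow_tail a0 t0) integral_itv_if.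
by apply: eq_integral => r _; rewrite /ptail in_itv/= andbT; case: ifP.
Qed.

Lemma L1_ptail a t : 0 < a -> 0 < t -> L1 leb (ptail a t).
Proof.
move=> a0 t0; apply: ge0_L1; [exact: measurable_ptail|exact: ptail_ge0|].
by rewrite ptail_int// ltry.
Qed.

Lemma RI_ptail a t : 0 < a -> 0 < t -> RI leb (ptail a t) = t `^ (- a) / a.
Proof. by move=> a0 t0; rewrite /RI ptail_int. Qed.

Variables (a : R) (N : nat).
Hypotheses (a0 : 0 < a) (N0 : (0 < N)%N).

(** Its integral over r is homogeneous of degree -a in [rho], hence [pconst] times rho^(-a). With
    rho = |z|^2, a superposition of bumps thus reproduces the singular kernel. *)
Definition pint (rho r : R) : R := pp N (r - rho) * r `^ (- (a + N%:R + 1)).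

Lemma pint_ge0 rho r : 0 <= pint rho r.
Proof. by rewrite mulr_ge0 ?pp_ge0 ?powR_ge0. Qed.

Lemma measurable_pint rho : measurable_fun setT (pint rho).
Proof.
apply: measurable_funM; last exact: measurable_powR.
by apply: (measurableT_comp (@measurable_pp R N)); exact: measurable_funB.
Qed.

Lemma pint_out rho r : r <= rho -> pint rho r = 0.
Proof. by move=> h; rewrite /pint; case: N N0 => // k _; rewrite pp_neg ?mul0r// subr_le0. Qed.

Lemma pow_split r : 0 < r -> r ^+ N * r `^ (- (a + N%:R + 1)) = r `^ (- a - 1).
Proof.
move=> r0; have -> : - a - 1 = N%:R + - (a + N%:R + 1) by ring.
by rewrite (powRDp _ _ r0) powR_mulrn// ltW.
Qed.

Lemma pint_le rho r : 0 < rho -> pint rho r <= ptail a rho r.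
Proof.
move=> p0; rewrite /ptail; case: ltP => h; last by rewrite pint_out.
have r0 := lt_trans p0 h.
rewrite -(pow_split r0) /pint ler_wpM2r ?powR_ge0// pp_pos ?subr_ge0 ?(ltW h)//.
by rewrite lerXn2r ?nnegrE ?subr_ge0 ?(ltW h) ?(ltW r0)// gerBl ltW.
Qed.

Lemma L1_pint rho : 0 < rho -> L1 leb (pint rho).
Proof.
move=> p0; apply: (L1_le _ _ (L1_ptail a0 p0)); first exact: measurable_pint.
by move=> r; rewrite ger0_norm ?pint_ge0 ?pint_le.
Qed.

Definition pconst : R := RI leb (pint 1).

Lemma pconst_gt0 : 0 < pconst.
Proof.
(* For r > 2 one has r - 1 >= r/2, so this part of the integral already gives a positive lower
   bound. *)
have c0 : 0 < 2^-1 ^+ N * (2 `^ (- a) / a) :> R.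
  by rewrite mulr_gt0 ?exprn_gt0 ?divr_gt0 ?powR_gt0 ?invr_gt0.
apply: (lt_le_trans c0).
rewrite -(RI_ptail a0 (ltr0n _ 2)) -RIZ; last by apply: L1_ptail.
apply: le_RI; [by apply: L1Z; exact: L1_ptail|exact: L1_pint|].
move=> r; rewrite /ptail; case: ltP => h; last by rewrite mulr0 pint_ge0.
have r0 : 0 < r by apply: lt_trans h.
rewrite -(pow_split r0) mulrA -exprMn /pint ler_wpM2r ?powR_ge0// pp_pos ?lerXn2r ?nnegrE//; lra.
Qed.

Lemma RI_pint rho : 0 < rho -> RI leb (pint rho) = pconst * rho `^ (- a).
Proof.
move=> p0; have mp := measurable_pint.
have E : (\int[leb]_r (pint rho r)%:E = (rho `^ (- a))%:E * \int[leb]_r (pint 1 r)%:E)%E.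
  have mF : measurable_fun setT (fun r => (pint rho r)%:E) by apply/measurable_EFinP.
  have F0 r : (0 <= (pint rho r)%:E)%E by rewrite lee_fin pint_ge0.
  have S := ge0_integral_leb_scale p0 mF F0.
  have E1 r : pint rho (rho * r) = rho `^ (- a - 1) * pint 1 r.
    have [r1|r1] := leP r 1.
      by rewrite !pint_out ?mulr0//; rewrite -[leRHS]mulr1 ler_wpM2l// ltW.
    rewrite /pint !pp_pos ?subr_ge0 ?(ltW r1)//; last by rewrite ler_peMr ?ltW.
    rewrite powRM ?ltW// ?(lt_trans _ r1)//.
    have -> : rho * r - rho = rho * (r - 1) by ring.
    by rewrite exprMn -(pow_split p0); ring.
  have E2 : (\int[leb]_r (pint rho (rho * r))%:E = (rho `^ (- a - 1))%:E * \int[leb]_r (pint 1 r)%:E)%E.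
    rewrite -lebZl ?powR_ge0//.
    - by apply: eq_integral => r _; rewrite E1 EFinM.
    - by apply/measurable_EFinP.
    - by move=> r; rewrite lee_fin pint_ge0.
  rewrite S in E2.
  have : (rho%:E * ((rho^-1)%:E * \int[leb]_r (pint rho r)%:E) =
    rho%:E * ((rho `^ (- a - 1))%:E * \int[leb]_r (pint 1 r)%:E))%E by rewrite E2.
  rewrite !muleA -!EFinM divff ?gt_eqF// mul1e => ->; congr (_%:E * _)%E.
  by rewrite (powRDp (- a) (- 1) p0) powR_inv1 ?ltW//; field; rewrite gt_eqF.
by rewrite /RI E -(RI_EFin (L1_pint ltr01)) -EFinM mulrC.
Qed.

Variable n : nat.
Implicit Types y z : 'rV[R]_n.

Definition pwt (r : R) : R := if 1 <= r then r `^ (- (a + N%:R + 1)) else 0.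

Lemma pwt_ge0 r : 0 <= pwt r.
Proof. by rewrite /pwt; case: ifP => // _; exact: powR_ge0. Qed.

Lemma measurable_pwt : measurable_fun setT pwt.
Proof.
by apply: measurable_fun_ifT => //; exact: measurable_fun_ler.
Qed.

Definition kapf (r : R) z : R := pconst^-1 * (pwt r * bmp N r z).

(* The superposition of bumps that gives [|z|^(-2a)], restricted to radii [r >= 1]: smooth everywhere,
   and equal to [|z|^(-2a)] for [|z| >= 1], where the smaller bumps vanish. *)
Definition kap z : R := RI leb (kapf ^~ z).

Definition dilat (m : nat) : R := 3 * 2 ^+ m + 1.

Lemma dilat_gt0 m : 0 < dilat m.
Proof. by rewrite ltr_wpDl// mulr_ge0// exprn_ge0. Qed.

Definition kapC (m : nat) : R := pconst^-1 * ((2 * n%:R) ^+ m * (3 * N%:R) ^+ m.*2).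

Lemma kapC_ge0 m : 0 <= kapC m.
Proof.
rewrite mulr_ge0 ?invr_ge0 ?(ltW pconst_gt0)// mulr_ge0 ?exprn_ge0 ?mulr_ge0//.
Qed.

Lemma foldr_dlapZ c hs (u : 'rV[R]_n -> R) y :
  foldr dlap (fun y => c * u y) hs y = c * foldr dlap u hs y.
Proof.
elim: hs y => //= h hs IH y; rewrite /dlap mulr_sumr; apply: eq_bigr => i _.
by rewrite mulrA; congr (_ / _); rewrite /d2 !IH; ring.
Qed.

Lemma measurable_kapf2 : measurable_fun setT (fun t : R * 'rV[R]_n => kapf t.1 t.2).
Proof.
apply: measurable_funM => //; apply: measurable_funM; last exact: measurable_bump2.
by apply: (measurableT_comp measurable_pwt); exact: measurable_fst.
Qed.

(** Differences enlarge the support by the factor of [iter_grow_le] only, so a bump with r <= (1 +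
    |z|^2)/(2 dilat) does not reach z. For the other radii [nb_bmp] bounds the differences by r^N,
    and the weight leaves r^(-a-1), whose tail integral is of the order of [om a z]. *)
Lemma foldr_kapf_le hs r z : all (fun h => 0 < h <= 1) hs -> ((size hs).*2 < N)%N ->
  `|foldr dlap (kapf r) hs z| <=
    kapC (size hs) * ptail a ((1 + sq z) / (2 * dilat (size hs))) r.
Proof.
move=> ahs sN; have p0 := pconst_gt0; have D0 := dilat_gt0 (size hs).
have -> : kapf r = fun z => (pconst^-1 * pwt r) * bmp N r z.
  by apply/funext => y; rewrite /kapf mulrA.
rewrite foldr_dlapZ /pwt; case: ifPn => r1; last first.
  by rewrite mulr0 mul0r normr0 mulr_ge0 ?kapC_ge0 ?ptail_ge0.
have r0 : 0 < r by apply: lt_le_trans r1.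
rewrite /ptail; case: ltP => h; last first.
  rewrite (@foldr_dlap_eq0 _ _ _ _ r) ?mulr0 ?normr0//.
    by move=> y ry; case: N N0 => // k _; rewrite bump_out// ltW.
  apply: (le_lt_trans (iter_grow_le _ r1)).
  have : 2 * dilat (size hs) * r <= 1 + sq z by rewrite mulrC -ler_pdivlMr ?mulr_gt0.
  rewrite /dilat; have : 0 <= 3 * 2 ^+ size hs * r by rewrite !mulr_ge0 ?exprn_ge0 ?ltW.
  by nra.
rewrite !normrM (ger0_norm (powR_ge0 _ _)) ger0_norm ?invr_ge0 ?(ltW p0)//.
have nbb := @nb_bmp R n (size hs).*2 N r r1 sN.
have H := @nb_foldr_dlap R n (fun=> setT) ((3 * N%:R) ^+ (size hs).*2 * r ^+ N) 0 hs (bmp N r)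
  (fun _ _ _ _ _ _ => I) ahs.
rewrite addn0 in H; have {}H := H nbb z I.
rewrite -(pow_split r0) /kapC.
have -> : pconst^-1 * ((2 * n%:R) ^+ size hs * (3 * N%:R) ^+ (size hs).*2) *
   (r ^+ N * r `^ (- (a + N%:R + 1))) = pconst^-1 * r `^ (- (a + N%:R + 1)) *
  ((2 * n%:R) ^+ size hs * ((3 * N%:R) ^+ (size hs).*2 * r ^+ N)) by ring.
by apply: ler_wpM2l => //; rewrite mulr_ge0 ?powR_ge0 ?invr_ge0 ?(ltW p0).
Qed.

Lemma L1_kapf z : L1 leb (kapf ^~ z).
Proof.
have t0 : 0 < (1 + sq z) / (2 * dilat 0).
  by rewrite divr_gt0 ?sq1_gt0// mulr_gt0 ?dilat_gt0.
apply: (L1_le _ _ (L1Z (kapC 0) (L1_ptail a0 t0))).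
  exact: (measurableT_comp measurable_kapf2 (g := fun r : R => (r, z)) (measurable_fun_pair (@measurable_id _ _ _) (@measurable_cst _ _ _ _ _ _))).
by move=> r; exact: (@foldr_kapf_le [::]).
Qed.

Lemma foldr_kap_le (m : nat) : (m.*2 < N)%N -> exists2 C : R, 0 <= C & forall hs,
  (size hs <= m)%N -> all (fun h => 0 < h <= 1) hs ->
  forall z, `|foldr dlap kap hs z| <= C * om a z.
Proof.
move=> mN.
pose C k := kapC k * ((2 * dilat k) `^ a / a).
have C0 k : 0 <= C k by rewrite mulr_ge0 ?kapC_ge0// divr_ge0 ?powR_ge0// ltW.
exists (\sum_(k < m.+1) C k); first by apply: sumr_ge0.
move=> hs shs ahs z.
have sN : ((size hs).*2 < N)%N by apply: leq_ltn_trans mN; rewrite leq_double.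
have t0 : 0 < (1 + sq z) / (2 * dilat (size hs)).
  by rewrite divr_gt0 ?sq1_gt0// mulr_gt0 ?dilat_gt0.
have [_ ->] := RI_foldr_dlap hs L1_kapf.
have mf : measurable_fun setT (fun t => foldr dlap (kapf t) hs z).
  apply: (measurableT_comp (measurable_foldr_dlap2 hs measurable_kapf2) (g := fun r : R => (r, z))).
  exact: (measurable_fun_pair (@measurable_id _ _ _) (@measurable_cst _ _ _ _ _ _)).
have lt := L1_ptail a0 t0.
have B := @norm_RI_le _ _ _ leb _ _ mf (fun r => foldr_kapf_le r z ahs sN) (L1Z (kapC (size hs)) lt).
apply: (le_trans B).
rewrite RIZ// RI_ptail//.
apply: (@le_trans _ _ (C (size hs) * om a z)).
  rewrite /C /om powRM ?invr_ge0 ?(ltW (sq1_gt0 _))//; last by rewrite mulr_ge0 ?(ltW (dilat_gt0 _)).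
  rewrite powRVp ?mulr_gt0 ?dilat_gt0// opprK.
  by rewrite le_eqVlt; apply/orP; left; apply/eqP; ring.
apply: ler_wpM2r; first exact: om_ge0.
have ms : (size hs < m.+1)%N by [].
by rewrite (bigD1 (Ordinal ms))//= lerDl; apply: sumr_ge0.
Qed.

Lemma kapN z : kap (- z) = kap z.
Proof. by apply: eq_RI => r; rewrite /kapf bumpN. Qed.

Lemma kap_ge0 z : 0 <= kap z.
Proof.
apply: RI_ge0 => r; apply: mulr_ge0; first by rewrite invr_ge0 ltW ?pconst_gt0.
by apply: mulr_ge0; [exact: pwt_ge0|exact: bump_ge0].
Qed.

Lemma measurable_kap : measurable_fun setT kap.
Proof.
apply: (@measurable_RI _ _ _ _ _ leb (fun z r => kapf r z)).
apply: (measurableT_comp measurable_kapf2 (g := fun t : 'rV[R]_n * R => (t.2, t.1))).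
by apply: measurable_fun_pair; [exact: measurable_snd|exact: measurable_fst].
Qed.

Lemma kap_le z : z != 0 -> kap z <= sq z `^ (- a).
Proof.
move=> z0; have s0 := sq_gt0 z0; have p0 := pconst_gt0.
have -> : sq z `^ (- a) = pconst^-1 * RI leb (pint (sq z)).
  by rewrite RI_pint// mulrA mulVf ?mul1r// gt_eqF.
rewrite -RIZ; last exact: L1_pint.
apply: le_RI; [exact: L1_kapf|by apply: L1Z; exact: L1_pint|].
move=> r; rewrite /kapf ler_wpM2l ?invr_ge0 ?(ltW p0)// /pwt /pint mulrC.
case: ifP => _; first by [].
by rewrite mulr0 mulr_ge0 ?pp_ge0 ?powR_ge0.
Qed.

Lemma kap_eq z : 1 <= sq z -> kap z = sq z `^ (- a).
Proof.
move=> z1; have s0 : 0 < sq z by apply: lt_le_trans z1.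
have p0 := pconst_gt0.
have -> : sq z `^ (- a) = pconst^-1 * RI leb (pint (sq z)).
  by rewrite RI_pint// mulrA mulVf ?mul1r// gt_eqF.
rewrite -RIZ; last exact: L1_pint.
apply: eq_RI => r; rewrite /kapf; congr (_ * _); rewrite /pwt /pint mulrC.
case: ifPn => // h; rewrite mulr0 -/(pint (sq z) r) pint_out//.
by apply: le_trans z1; rewrite ltW// ltNge.
Qed.

End SmoothTail.

(** * Local bounds on difference quotients from Hölder regularity *)

Section Regularity.
Context {R : realType}.
Variable n : nat.
Implicit Types (x y z : 'rV[R]_n) (u w : 'rV[R]_n -> R) (i : 'I_n) (l : seq 'I_n).

Lemma uniform_bound (I : finType) (P : I -> R -> Prop) :
  (forall k c c', P k c -> c <= c' -> P k c') -> (forall k, exists c, P k c) ->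
  exists2 c, 0 <= c & forall k, P k c.
Proof.
move=> Pm /choice[f Pf]; exists (\sum_k `|f k|); first exact: sumr_ge0.
move=> k; apply: (Pm _ _ _ (Pf k)); apply: (le_trans (ler_norm _)).
by rewrite (bigD1 k)//= lerDl sumr_ge0.
Qed.

Lemma uniform_bound_seq K (P : seq 'I_n -> R -> Prop) :
  (forall l c c', P l c -> c <= c' -> P l c') ->
  (forall l, (size l <= K)%N -> exists c, P l c) ->
  exists2 c, 0 <= c & forall l, (size l <= K)%N -> P l c.
Proof.
elim: K P => [|K IH] P Pm HP.
  have [c Pc] := HP [::] isT; exists `|c| => // -[|//] _.
  exact: Pm Pc (ler_norm _).
have [c0 Pc0] := HP [::] isT.
have Hi i : exists c, (fun i c => forall l, (size l <= K)%N -> P (i :: l) c) i c.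
  have [|l sl|c _ Hc] := IH (fun l => P (i :: l)).
  - by move=> l; exact: Pm.
  - exact: HP.
  - by exists c.
have [||c1 c10 Hc1] := @uniform_bound _ (fun i c => forall l, (size l <= K)%N -> P (i :: l) c).
- by move=> i c c' H cc l sl; apply: Pm cc; exact: H.
- exact: Hi.
exists (`|c0| + c1); first by rewrite addr_ge0.
case=> [_|i l sl]; first by apply: (Pm _ _ _ Pc0); apply: (le_trans (ler_norm c0)); rewrite lerDl.
by apply: (Pm _ _ _ (Hc1 i l sl)); rewrite lerDr.
Qed.

Lemma eucl_ge0 z : 0 <= eucl z.
Proof. exact: sqrtr_ge0. Qed.

Lemma euclE z : eucl z = Num.sqrt (sq z).
Proof. by []. Qed.

Lemma eucl_le z (r : R) : 0 <= r -> sq z <= r ^+ 2 -> eucl z <= r.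
Proof. by move=> r0 h; rewrite euclE -(ger0_norm r0) -sqrtr_sqr; exact: ler_wsqrtr. Qed.

Lemma eucl_le1 z : sq z <= 1 -> eucl z <= 1.
Proof. by move=> h; apply: eucl_le; rewrite ?expr1n. Qed.

Lemma eucl_powR_le z (a b : R) : 0 < a -> a <= b -> sq z <= 1 -> eucl z `^ b <= eucl z `^ a.
Proof.
move=> a0 ab z1; have [z0|z0] := eqVneq (eucl z) 0.
  by rewrite z0 !powR0 ?gt_eqF// (lt_le_trans a0).
apply: ger_powR => //; rewrite lt_neqAle eq_sym z0 eucl_ge0/=; exact: eucl_le1.
Qed.

Definition loc_holder (al : R) u := forall r : R, exists2 C, 0 <= C &
  forall x z, sq x <= r -> sq z <= 1 -> `|u (x + z) - u x| <= C * eucl z `^ al.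

Lemma holder_loc_bounds (al al0 : R) u : 0 < al -> al <= al0 -> holder_loc al0 u ->
  locally_bounded u /\ loc_holder al u.
Proof.
move=> a0 aa H.
have inb (r : R) x : sq x <= 2 * `|r| + 2 -> eucl x <= 2 * `|r| + 2.
  move=> h; apply: eucl_le; first by rewrite addr_ge0// mulr_ge0.
  by apply: (le_trans h); have := normr_ge0 r; nra.
have p0 (r : R) : 0 < 2 * `|r| + 2 by rewrite ltr_wpDl// mulr_ge0.
split=> r.
  have [C HC] := H _ (p0 r).
  exists (`|C| * (2 * `|r| + 2) `^ al0 + `|u 0|) => y yr.
  have y1 : eucl y <= 2 * `|r| + 2 by apply: inb; have := ler_norm r; have := normr_ge0 r; lra.
  have e0 : eucl (0 : 'rV[R]_n) <= 2 * `|r| + 2.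
    by rewrite euclE /sq big1 ?sqrtr0 ?(ltW (p0 r))// => i _; rewrite mxE expr0n.
  have -> : u y = (u y - u 0) + u 0 by rewrite subrK.
  apply: (le_trans (ler_normD _ _)); rewrite lerD2r.
  apply: (le_trans (HC y 0 y1 e0)); rewrite subr0.
  apply: (@le_trans _ _ (`|C| * eucl y `^ al0)); first by rewrite ler_wpM2r ?powR_ge0 ?ler_norm.
  rewrite ler_wpM2l//.
  by apply: ge0_ler_powR => //; rewrite ?nnegrE ?eucl_ge0 ?(ltW (p0 r)) ?(ltW (lt_le_trans a0 aa)).
have [C HC] := H _ (p0 r); exists `|C| => // x z xr z1.
apply: (@le_trans _ _ (C * eucl z `^ al0)).
  have := HC (x + z) x; rewrite addrAC subrr add0r; apply.
  - apply: inb; apply: (le_trans (sqD_le _ _)); have := ler_norm r; lra.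
  - by apply: inb; have := ler_norm r; have := normr_ge0 r; lra.
apply: (@le_trans _ _ (`|C| * eucl z `^ al0)); first by rewrite ler_wpM2r ?powR_ge0 ?ler_norm.
by rewrite ler_wpM2l// eucl_powR_le.
Qed.

Variables (v : 'rV[R]_n -> R) (K : nat) (al al0 : R).
Hypotheses (hCk : Ck K v) (al_gt0 : 0 < al) (al_le1 : al <= 1) (alal0 : al <= al0).
Hypothesis htop : forall l, size l = K -> holder_loc al0 (pderiv l v).

Lemma Ck_has_pd l i : (size l < K)%N -> has_pd (pderiv l v) i (pderiv (i :: l) v).
Proof.
move=> sl; apply: pderiv_has_pd => x.
by have [_ /(_ sl)] := hCk (ltnW sl).
Qed.

(** Induction downwards from the top order [K]. Below it [path_bound] makes every derivative locally
    Lipschitz, hence Hölder of exponent [al] over displacements of length at most 1, since al <=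
    1. *)
Lemma pderiv_bounds l : (size l <= K)%N -> locally_bounded (pderiv l v) /\ loc_holder al (pderiv l v).
Proof.
move=> sl; have [j jE] : exists j, (size l + j = K)%N by exists (K - size l)%N; rewrite subnKC.
elim: j l jE {sl} => [|j IH] l jE.
  by apply: (holder_loc_bounds al_gt0 alal0); apply: htop; rewrite -jE addn0.
have IHi i : locally_bounded (pderiv (i :: l) v) by apply: (IH (i :: l) _).1; rewrite /= -jE addnS addSn.
have hp i : has_pd (pderiv l v) i (pderiv (i :: l) v).
  by apply: Ck_has_pd; rewrite -jE addnS ltnS leq_addr.
have unifM (r : R) : exists2 M, 0 <= M & forall i y, sq y <= r -> `|pderiv (i :: l) v y| <= M.
  have [||M M0 HM] := @uniform_bound _ (fun i c => forall y, sq y <= r -> `|pderiv (i :: l) v y| <= c).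
  - by move=> i c c' H cc y yr; apply: le_trans cc; exact: H.
  - by move=> i; have [M HM] := IHi i r; exists M.
  by exists M.
have lip (r r' : R) : exists2 M, 0 <= M & forall x z, sq x <= r -> sq z <= r' ->
    `|pderiv l v (x + z) - pderiv l v x| <= M * eucl z.
  have [M M0 HM] := unifM (2 * r' + 2 * r).
  exists (M * n%:R); first by rewrite mulr_ge0.
  move=> x z xr z1; apply: (@le_trans _ _ (M * \sum_i `|z ord0 i|)).
    apply: (path_bound hp) => i y yx; apply: HM.
    have -> : y = (y - x) + x by rewrite subrK.
    by apply: (le_trans (sqD_le _ _)); lra.
  by rewrite -mulrA ler_wpM2l// sum_abs_le.
split=> r.
  have [M M0 HM] := lip 0 r.
  exists (M * Num.sqrt `|r| + `|pderiv l v 0|) => y yr.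
  have -> : pderiv l v y = (pderiv l v (0 + y) - pderiv l v 0) + pderiv l v 0 by rewrite subrK add0r.
  apply: (le_trans (ler_normD _ _)); rewrite lerD2r.
  have s0 : sq (0 : 'rV[R]_n) <= 0 by rewrite /sq big1// => i _; rewrite mxE expr0n.
  apply: (le_trans (HM 0 y s0 yr)); rewrite ler_wpM2l// ler_wsqrtr//.
  by apply: (le_trans yr); exact: ler_norm.
have [M M0 HM] := lip r 1; exists M => // x z xr z1.
apply: (le_trans (HM x z xr z1)); rewrite ler_wpM2l//.
rewrite -[leLHS](powRr1 (eucl_ge0 z)); exact: eucl_powR_le.
Qed.

(** For [sg = 1] the second difference is, up to sign, the increment over z of y |-> u(y) - u(y -
    z). Its partial derivatives are Hölder increments, so [path_bound] gains one more power of
    |z|. *)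
Lemma d2_pderiv_bound (sg : nat) l : (sg <= 1)%N -> (size l + sg <= K)%N -> forall r : R,
  exists2 C, 0 <= C & forall x z, sq x <= r -> sq z <= 1 ->
    `|d2 (pderiv l v) z x| <= C * eucl z `^ (sg%:R + al).
Proof.
case: sg => [|[|//]] _ sl r.
  have [C C0 HC] := (pderiv_bounds (l := l) (leq_trans (leq_addr _ _) sl)).2 r.
  exists (2 * C); first by rewrite mulr_ge0.
  move=> x z xr z1; rewrite add0r.
  have -> : d2 (pderiv l v) z x = - (pderiv l v (x + z) - pderiv l v x)
     - (pderiv l v (x - z) - pderiv l v x) by rewrite /d2; ring.
  apply: (le_trans (ler_normB _ _)); rewrite normrN.
  have -> : 2 * C * eucl z `^ al = C * eucl z `^ al + C * eucl z `^ al by ring.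
  have h1 := HC x z xr z1.
  have h2 := HC x (- z) xr; rewrite sqN in h2; have {}h2 := h2 z1.
  have e : eucl (- z) = eucl z by rewrite !euclE sqN.
  by rewrite e in h2; exact: lerD.
rewrite addn1 in sl.
have [||C C0 HC] := @uniform_bound _ (fun i c => forall x z, sq x <= 2 + 2 * r -> sq z <= 1 ->
    `|pderiv (i :: l) v (x + z) - pderiv (i :: l) v x| <= c * eucl z `^ al).
- by move=> i c c' H cc x z xr z1; apply: (le_trans (H x z xr z1)); rewrite ler_wpM2r ?powR_ge0.
- by move=> i; have [C C0 HC] := (pderiv_bounds (l := i :: l) sl).2 (2 + 2 * r); exists C.
exists (C * n%:R); first by rewrite mulr_ge0.
move=> x z xr z1.
pose D y := pderiv l v y + -1 * pderiv l v (y - z).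
have hD i : has_pd D i (fun y => pderiv (i :: l) v y + -1 * pderiv (i :: l) v (y - z)).
  by apply: has_pdD; [|apply: has_pdZ; apply: has_pd_shift]; exact: Ck_has_pd.
have E : d2 (pderiv l v) z x = - (D (x + z) - D x).
  by rewrite /D /d2 addrK; ring.
rewrite E normrN; apply: (le_trans (path_bound (M := C * eucl z `^ al) hD _)).
  move=> i y yx; rewrite mulN1r.
  have := HC i y (- z); rewrite sqN; have -> : eucl (- z) = eucl z by rewrite !euclE sqN.
  rewrite -normrN opprB; apply => //.
  have -> : y = (y - x) + x by rewrite subrK.
  by apply: (le_trans (sqD_le _ _)); lra.
have [z0|z0] := eqVneq (eucl z) 0.
  have := sum_abs_le z; rewrite z0 mulr0 => h.
  apply: (@le_trans _ _ 0); last by rewrite !mulr_ge0 ?powR_ge0.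
  by rewrite mulr_ge0_le0 ?mulr_ge0 ?powR_ge0.
have zp : 0 < eucl z by rewrite lt_neqAle eq_sym z0 eucl_ge0.
rewrite addrC (powRDp _ _ zp) powRr1 ?(ltW zp)//.
have -> : C * n%:R * (eucl z `^ al * eucl z) = C * eucl z `^ al * (n%:R * eucl z) by ring.
by rewrite ler_wpM2l ?mulr_ge0 ?powR_ge0// sum_abs_le.
Qed.

Lemma nb_d2 (S : set 'rV[R]_n) M z p q l : (size l + p <= q)%N -> (q <= K)%N ->
  (forall l y, (size l <= q)%N -> S y -> `|d2 (pderiv l v) z y| <= M) ->
  nb S M p (d2 (pderiv l v) z).
Proof.
move=> + qK H; elim: p l => [|p IH] l lp; first by move=> y Sy; apply: H; rewrite ?addn0 in lp *.
rewrite addnS in lp => i; exists (d2 (pderiv (i :: l) v) z); split; last exact: IH.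
apply: has_pd_d2; apply: Ck_has_pd; apply: leq_trans qK.
by apply: leq_trans lp; rewrite ltnS leq_addr.
Qed.

Lemma nb_pderiv (S : set 'rV[R]_n) M p q l : (size l + p <= q)%N -> (q <= K)%N ->
  (forall l y, (size l <= q)%N -> S y -> `|pderiv l v y| <= M) ->
  nb S M p (pderiv l v).
Proof.
move=> + qK H; elim: p l => [|p IH] l lp; first by move=> y Sy; apply: H; rewrite ?addn0 in lp *.
rewrite addnS in lp => i; exists (pderiv (i :: l) v); split; last exact: IH.
apply: Ck_has_pd; apply: leq_trans qK.
by apply: leq_trans lp; rewrite ltnS leq_addr.
Qed.

Lemma iter_grow_mono (p q : nat) (r : R) : 0 <= r -> (p <= q)%N -> iter p grow r <= iter q grow r.
Proof.
move=> r0 pq; rewrite -(subnK pq) iterD; have : 0 <= iter p grow r.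
  by elim: (p) => //= k; rewrite /grow => h; rewrite addr_ge0 ?mulr_ge0.
elim: (q - p)%N => //= k IH h; apply: (le_trans (IH h)).
have : 0 <= iter k grow (iter p grow r) by apply: le_trans (IH h).
by rewrite /grow; lra.
Qed.

(* [sg] is 0 or 1: the second difference gains one order when a derivative is to spare. *)
Lemma foldr_dlap_d2_bound (sg m : nat) : (sg <= 1)%N -> (m.*2 + sg <= K)%N -> forall r : R,
  exists2 C, 0 <= C & forall hs, (size hs <= m)%N -> all (fun h => 0 < h <= 1) hs ->
  forall y z, sq y <= r -> sq z <= 1 -> `|foldr dlap (d2 v z) hs y| <= C * eucl z `^ (sg%:R + al).
Proof.
move=> sg1 mK r; pose r' := iter m (@grow R) `|r|.
have [||C C0 HC] := @uniform_bound_seq m.*2 (fun l c => forall x z, sq x <= r' -> sq z <= 1 ->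
   `|d2 (pderiv l v) z x| <= c * eucl z `^ (sg%:R + al)).
- by move=> l c c' H cc x z xr z1; apply: (le_trans (H x z xr z1)); rewrite ler_wpM2r ?powR_ge0.
- move=> l sl; have [||C C0 HC] := @d2_pderiv_bound sg l _ _ r'; last by exists C.
    exact: sg1.
  by apply: leq_trans mK; rewrite leq_add2r.
exists (\sum_(k < m.+1) (2 * n%:R) ^+ k * C).
  by apply: sumr_ge0 => k _; rewrite mulr_ge0 ?exprn_ge0 ?mulr_ge0.
move=> hs sm ahs y z yr z1.
have E0 : 0 <= eucl z `^ (sg%:R + al) by rewrite powR_ge0.
apply: (@le_trans _ _ ((2 * n%:R) ^+ size hs * C * eucl z `^ (sg%:R + al))).
  rewrite -mulrA.
  suff B : nb (@ball_sq R n `|r|) ((2 * n%:R) ^+ size hs * (C * eucl z `^ (sg%:R + al))) 0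
      (foldr dlap (d2 v z) hs).
    by apply: B; rewrite /ball_sq/=; apply: (le_trans yr); exact: ler_norm.
  apply: (nb_foldr_dlap (S := fun j => @ball_sq R n (iter j grow `|r|)) _ ahs).
  - by move=> j; exact: ball_sq_grow.
  - rewrite addn0; apply: (@nb_d2 _ _ _ _ m.*2 [::]) => /=.
    + by rewrite add0n leq_double.
    + by apply: leq_trans mK; rewrite leq_addr.
    + move=> l x sl xr; apply: HC => //; apply: (le_trans xr).
      exact: iter_grow_mono.
rewrite ler_wpM2r//.
have ms : (size hs < m.+1)%N by [].
rewrite (bigD1 (Ordinal ms))//= lerDl; apply: sumr_ge0 => k _.
by rewrite mulr_ge0 ?exprn_ge0 ?mulr_ge0.
Qed.

Lemma foldr_dlap_bound (m : nat) : (m.*2 <= K)%N -> dlap_bounded m v.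
Proof.
move=> mK r; pose r' := iter m (@grow R) `|r|.
have [||C C0 HC] := @uniform_bound_seq m.*2 (fun l c => forall x, sq x <= r' -> `|pderiv l v x| <= c).
- by move=> l c c' H cc x xr; apply: le_trans cc; exact: H.
- move=> l sl; have [M HM] := (pderiv_bounds (l := l) (leq_trans sl mK)).1 r'.
  by exists M.
exists (\sum_(k < m.+1) (2 * n%:R) ^+ k * C).
move=> hs sm ahs y yr.
apply: (@le_trans _ _ ((2 * n%:R) ^+ size hs * C)).
  suff B : nb (@ball_sq R n `|r|) ((2 * n%:R) ^+ size hs * C) 0 (foldr dlap v hs).
    by apply: B; rewrite /ball_sq/=; apply: (le_trans yr); exact: ler_norm.
  apply: (nb_foldr_dlap (S := fun j => @ball_sq R n (iter j grow `|r|)) _ ahs).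
  - by move=> j; exact: ball_sq_grow.
  - rewrite addn0; apply: (@nb_pderiv _ _ _ m.*2 [::]) => //=.
    + by rewrite add0n leq_double.
    + move=> l x sl xr; apply: HC => //; apply: (le_trans xr).
      exact: iter_grow_mono.
have ms : (size hs < m.+1)%N by [].
rewrite (bigD1 (Ordinal ms))//= lerDl; apply: sumr_ge0 => k _.
by rewrite mulr_ge0 ?exprn_ge0 ?mulr_ge0.
Qed.

End Regularity.

(** * Integrability of the kernel near 0 and of the weight *)

Section WeightedIntegrals.
Context {R : realType}.
Variable n : nat.
Implicit Types x y z : 'rV[R]_n.

Lemma half_add (x : R) : x = 2^-1 * (x + x).
Proof. by field. Qed.

Lemma sq00 : sq (0 : 'rV[R]_n) = 0.
Proof. by rewrite /sq big1// => i _; rewrite mxE expr0n. Qed.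

Lemma eucl0 : eucl (0 : 'rV[R]_n) = 0.
Proof. by rewrite euclE sq00 sqrtr0. Qed.

Lemma euclN z : eucl (- z) = eucl z.
Proof. by rewrite !euclE sqN. Qed.

Lemma eucl_gt0 z : z != 0 -> 0 < eucl z.
Proof. by move=> z0; rewrite euclE sqrtr_gt0 sq_gt0. Qed.

Lemma sq_euclE z : sq z = eucl z `^ 2%:R.
Proof. by rewrite powR_mulrn ?eucl_ge0// euclE sqr_sqrtr ?sq_ge0. Qed.

Definition kern_near (g be : R) z : R := if sq z <= 1 then eucl z `^ be * kern g z else 0.

Lemma kern_near_ge0 g be z : 0 <= kern_near g be z.
Proof.
by rewrite /kern_near; case: ifP => // _; apply: mulr_ge0; [exact: powR_ge0|exact: kern_ge0].
Qed.

Lemma measurable_eucl_powR (b : R) : measurable_fun setT (fun z => eucl z `^ b).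
Proof.
under eq_fun do rewrite eucl_powR.
by apply: (measurableT_comp (measurable_powR _)); exact: measurable_sq.
Qed.

Lemma measurable_kern_near g be : measurable_fun setT (kern_near g be).
Proof.
apply: measurable_fun_ifT => //; first by apply: measurable_fun_ler => //; exact: measurable_sq.
by apply: measurable_funM; [exact: measurable_eucl_powR|exact: measurable_kern].
Qed.

Lemma measurable_eucl : measurable_fun setT (fun z : 'rV[R]_n => eucl z).
Proof.
have -> : (fun z : 'rV[R]_n => eucl z) = (fun z => eucl z `^ 1).
  by apply/funext => z; rewrite powRr1 ?eucl_ge0.
exact: measurable_eucl_powR.
Qed.

Lemma kern0 (g : R) : 0 < g -> kern g (0 : 'rV[R]_n) = 0.
Proof.
move=> g0; rewrite /kern eucl0 powR0// oppr_eq0 gt_eqF// ltr_wpDl//.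
exact: mulr_gt0.
Qed.

(** Near 0 the function |z|^be |z|^(-n-2g) equals |z|^2 |z|^(-n-2h) with h = 1 + g - be/2. The two
    bounds on [be] say exactly that 0 < h < 1, the case already settled by [integral_trunc_kern]. *)
Lemma L1_kern_near g be : 0 < g -> 2 * g < be -> be < 2 + 2 * g -> L1 (rnm n) (kern_near g be).
Proof.
move=> g0 gb b2; pose h := 1 + g - be / 2.
have h0 : 0 < h by rewrite /h; lra.
have h1 : h < 1 by rewrite /h; lra.
apply: (L1_le _ _ (ge0_L1 _ _ (integral_trunc_kern n h0 h1))).
- exact: measurable_kern_near.
- move=> z; rewrite ger0_norm ?kern_near_ge0// /kern_near; case: ifPn => z1; last first.
    by rewrite mulr_ge0 ?trunc_sq_ge0 ?kern_ge0.
  rewrite /trunc_sq min_r//; have [->|z0] := eqVneq z 0.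
    by rewrite sq00 mul0r kern0// mulr0.
  have e0 := eucl_gt0 z0.
  rewrite sq_euclE /kern -!(powRDp _ _ e0) le_eqVlt; apply/orP; left; apply/eqP; congr (_ `^ _).
  by rewrite /h; field.
- by apply: measurable_funM; [exact: measurable_trunc_sq|exact: measurable_kern].
- by move=> z; rewrite mulr_ge0 ?trunc_sq_ge0 ?kern_ge0.
Qed.

Lemma kern_le_om (g e : R) z : 0 < n%:R / 2 + g -> 0 < e -> e <= sq z ->
  kern g z <= (1 + e^-1) `^ (n%:R / 2 + g) * om (n%:R / 2 + g) z.
Proof.
move=> a0 e0 ez; set a := n%:R / 2 + g in a0 *.
have z0 : 0 < sq z by apply: lt_le_trans ez.
have i0 : 0 < 1 + e^-1 by rewrite ltr_pwDl// invr_ge0 ltW.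
have -> : (1 + e^-1) `^ a * om a z = ((1 + sq z) / (1 + e^-1)) `^ (- a).
  rewrite powRM ?invr_ge0 ?(ltW i0) ?(ltW (sq1_gt0 z))// powRVp// opprK mulrC //.
rewrite kernE -/a; apply: powRN_le; [exact: ltW|by rewrite divr_gt0 ?sq1_gt0|].
rewrite ler_pdivrMr// mulrDr mulr1 addrC lerD2l.
by rewrite -ler_pdivrMr ?invr_gt0// invrK mul1r.
Qed.

Lemma L1_expN : L1 (rnm n) (fun z => expR (- sq z)).
Proof.
have h4 : 0 < 4^-1 :> R by rewrite invr_gt0.
have lh : L1 (rnm n) (heat 4^-1 : 'rV[R]_n -> R).
  apply: ge0_L1; [exact: measurable_heat|exact: heat_ge0|].
  by rewrite heat_int// ltry.
apply: (eq_L1 _ (L1Z (Num.sqrt (4 * pi * 4^-1) ^+ n) lh)) => z.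
rewrite /heat -lock mulrA divff ?mul1r; last by rewrite gt_eqF// exprn_gt0// sqrt_fourpi_gt0.
by congr expR; congr (- _); field.
Qed.

(** Outside the unit ball the weight is below the kernel; inside it is at most 1, hence below the
    Gaussian e^(1-|z|^2). *)
Lemma L1_om (g : R) : 0 < g -> g < 1 -> L1 (rnm n) (om (n%:R / 2 + g)).
Proof.
move=> g0 g1; have a0 : 0 < n%:R / 2 + g by rewrite ltr_wpDl// divr_ge0.
have lk : L1 (rnm n) (fun z => trunc_sq z * kern g z).
  apply: ge0_L1; [|by move=> z; rewrite mulr_ge0 ?trunc_sq_ge0 ?kern_ge0|exact: integral_trunc_kern].
  by apply: measurable_funM; [exact: measurable_trunc_sq|exact: measurable_kern].
apply: (L1_le _ _ (L1D lk (L1Z (expR 1) L1_expN))); first exact: measurable_om.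
move=> z; rewrite ger0_norm ?om_ge0//.
have k0 : 0 <= trunc_sq z * kern g z by rewrite mulr_ge0 ?trunc_sq_ge0 ?kern_ge0.
have [z1|z1] := leP (sq z) 1.
  apply: (@le_trans _ _ 1); last first.
    apply: (@le_trans _ _ (expR 1 * expR (- sq z))); last by rewrite lerDr.
    by rewrite -expRD -[leLHS]expR0 ler_expR subr_ge0.
  have e1 : 1 `^ (- (n%:R / 2 + g)) = 1 :> R by rewrite powR1.
  rewrite -[leRHS]e1.
  by apply: powRN_le; [exact: ltW|exact: ltr01|rewrite lerDl sq_ge0].
apply: ler_wpDr; first by rewrite mulr_ge0 ?expR_ge0.
rewrite /trunc_sq min_l ?mul1r ?(ltW z1)// kernE.
by apply: powRN_le; [exact: ltW|exact: lt_trans z1|rewrite lerDr].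
Qed.

Lemma measurable_addrv2 : measurable_fun setT (fun t : 'rV[R]_n * 'rV[R]_n => t.1 + t.2).
Proof.
apply/measurable_rvP => i; under eq_fun do rewrite mxE.
by apply: measurable_funD; apply: (measurableT_comp (@measurable_coord R n i));
  [exact: measurable_fst|exact: measurable_snd].
Qed.

Lemma measurable_subrv2 : measurable_fun setT (fun t : 'rV[R]_n * 'rV[R]_n => t.1 - t.2).
Proof.
apply: (measurableT_comp measurable_addrv2 (g := fun t : 'rV[R]_n * 'rV[R]_n => (t.1, - t.2))).
apply: measurable_fun_pair; first exact: measurable_fst.
by apply: (measurableT_comp (@measurable_rv_opp _ _)); exact: measurable_snd.
Qed.

Lemma measurable_d2_2 (v : 'rV[R]_n -> R) : measurable_fun setT v ->
  measurable_fun setT (fun t : 'rV[R]_n * 'rV[R]_n => d2 v t.1 t.2).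
Proof.
move=> mv; apply: measurable_funB; first apply: measurable_funB.
- by apply: measurable_funM => //; apply: (measurableT_comp mv); exact: measurable_snd.
- apply: (measurableT_comp mv); under eq_fun do rewrite addrC; exact: measurable_addrv2.
- apply: (measurableT_comp mv).
  apply: (measurableT_comp measurable_subrv2 (g := fun t : 'rV[R]_n * 'rV[R]_n => (t.2, t.1))).
  by apply: measurable_fun_pair; [exact: measurable_snd|exact: measurable_fst].
Qed.

Lemma foldr_dlapD hs (u w : 'rV[R]_n -> R) y :
  foldr dlap (fun y => u y + w y) hs y = foldr dlap u hs y + foldr dlap w hs y.
Proof.
elim: hs y => //= h hs IH y; rewrite /dlap -big_split; apply: eq_bigr => i _ /=.
by rewrite -mulrDl; congr (_ / _); rewrite /d2 !IH; ring.
Qed.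

Lemma foldr_dlap_refl hs (u : 'rV[R]_n -> R) c y :
  foldr dlap (fun y => u (c - y)) hs y = foldr dlap u hs (c - y).
Proof.
elim: hs y => //= h hs IH y; apply: eq_bigr => i _; congr (_ / _).
by rewrite /d2 !IH !opprD opprK !addrA; ring.
Qed.

End WeightedIntegrals.

Section HolderRegularity.
Context {R : realType}.
Variables (n m : nat) (g eps : R) (v : 'rV[R]_n -> R).
Implicit Types x y z : 'rV[R]_n.
Hypotheses (g_ge0 : 0 <= g) (a_gt0 : 0 < n%:R / 2 + g) (eps0 : 0 < eps).
Hypotheses (v0 : forall x, 0 <= v x) (hLs : Ls g v).
Hypothesis hC : Cka_loc (2 * m + Num.truncn (2 * g)%R)%N
             (2 * g - (Num.truncn (2 * g))%:R + eps) v.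

Let a := n%:R / 2 + g.
Let sg := Num.truncn (2 * g).
Let al0 := 2 * g - sg%:R + eps.
(** [eps] may be large; capping the exponent at 1 makes it a genuine Hölder exponent for all lower
    derivatives as well. *)
Let al := Num.min al0 1.

Let sg_le : sg%:R <= 2 * g.
Proof. by rewrite truncn_le mulr_ge0. Qed.

Let al_gt0 : 0 < al.
Proof. rewrite lt_min ltr01 andbT /al0; have := sg_le; have := eps0; lra. Qed.

Lemma measurable_v : measurable_fun setT v.
Proof. by apply: continuous_measurable_rv; have [/(_ [::] isT)[]] := hC. Qed.

Lemma v_dlap_bounded : dlap_bounded m v.
Proof.
have [hk ht] := hC.
apply: (@foldr_dlap_bound R n v (2 * m + sg) al al0 hk al_gt0 _ _ ht m).
- by rewrite ge_min lexx orbT.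
- by rewrite ge_min lexx.
- by rewrite mul2n leq_addr.
Qed.

Lemma v_locally_bounded : locally_bounded v.
Proof. exact: dlap_bounded_loc v_dlap_bounded. Qed.

Lemma L1_vom x : L1 (rnm n) (fun y => v (x + y) * om a y).
Proof.
apply: ge0_L1.
- apply: measurable_funM; last exact: measurable_om.
  under eq_fun do rewrite addrC; exact: measurable_shift_rv measurable_v.
- by move=> y; rewrite mulr_ge0 ?om_ge0.
- by apply: Ls_om => //; exact: measurable_v.
Qed.

Lemma vom_bound (r : R) : exists2 M, 0 <= M & forall x, sq x <= r ->
  RI (rnm n) (fun y => v (x + y) * om a y) <= M.
Proof.
have l0 : L1 (rnm n) (fun y => v y * om a y).
  by apply: (eq_L1 _ (L1_vom 0)) => y; rewrite add0r.
exists (2 `^ a * (1 + `|r|) `^ a * RI (rnm n) (fun y => v y * om a y)).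
  by rewrite !mulr_ge0 ?powR_ge0// RI_ge0// => y; rewrite mulr_ge0 ?om_ge0.
move=> x xr.
rewrite -(RI_shift (- x) (L1_vom x)) -RIZ//.
apply: le_RI; [exact: L1_shift (- x) (L1_vom x)|exact: L1Z|].
move=> y; rewrite addrC subrK mulrCA; apply: ler_wpM2l => //.
apply: (le_trans (om_shift y (- x) (ltW a_gt0))); rewrite sqN.
apply: ler_wpM2r; first exact: om_ge0.
apply: ler_wpM2l; first exact: powR_ge0.
apply: ge0_ler_powR; rewrite ?nnegrE ?(ltW a_gt0) ?(ltW (sq1_gt0 _)) ?addr_ge0//.
by rewrite lerD2l; apply: (le_trans xr); exact: ler_norm.
Qed.

End HolderRegularity.

(** * The fractional Laplacian of [v] as an absolutely convergent integral *)

Section FracLaplacian.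
Context {R : realType}.
Variables (n m : nat) (g eps : R) (v : 'rV[R]_n -> R).
Implicit Types x y z : 'rV[R]_n.
Hypotheses (g0 : 0 < g) (g1 : g < 1) (eps0 : 0 < eps) (v0 : forall x, 0 <= v x).
Hypothesis hLs : Ls g v.
Hypothesis hC : Cka_loc (2 * m + Num.truncn (2 * g)%R)%N
             (2 * g - (Num.truncn (2 * g))%:R + eps) v.
Hypothesis hdef : forall x, fraclap_defined g v x.

Let a := n%:R / 2 + g.
Let sg := Num.truncn (2 * g).
Let al0 := 2 * g - sg%:R + eps.
Let al := Num.min al0 1.
(** Order to which the second difference of [v] vanishes at z = 0. It exceeds 2g, so the singular
    integral converges absolutely, and stays below 2 + 2g as [L1_kern_near] requires. *)
Let be := sg%:R + al.

Let a_gt0 : 0 < a.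
Proof. by rewrite ltr_wpDl// divr_ge0. Qed.

Let sg_le : sg%:R <= 2 * g.
Proof. by rewrite truncn_le mulr_ge0// ltW. Qed.

Let sg_gt : 2 * g < sg%:R + 1.
Proof. by rewrite natr1; exact: truncnS_gt. Qed.

Let sg1 : (sg <= 1)%N.
Proof. rewrite -ltnS -(ltr_nat R); have := sg_le; have := g1; move: (sg%:R : R) => c; lra. Qed.

Let al_gt0 : 0 < al.
Proof. rewrite lt_min ltr01 andbT /al0; have := sg_le; have := eps0; lra. Qed.

Let be_gt : 2 * g < be.
Proof. by rewrite /be /al -ltrBlDl lt_min /al0; have h1 := sg_gt; have h2 := sg_le; have h3 := eps0; apply/andP; split; lra. Qed.

Let be_lt : be < 2 + 2 * g.
Proof.
have h : al <= 1 by rewrite ge_min lexx orbT.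
by rewrite /be; have := sg_le; lra.
Qed.

Let K := (2 * m + sg)%N.

Let mv : measurable_fun setT v := measurable_v hC.
Let vdb : dlap_bounded m v := v_dlap_bounded (ltW g0) eps0 hC.
Let vlb : locally_bounded v := v_locally_bounded (ltW g0) eps0 hC.
Let lvom := L1_vom (ltW g0) a_gt0 v0 hLs hC.
Let vomb := vom_bound (ltW g0) a_gt0 v0 hLs hC.

Let mK : (m.*2 + sg <= K)%N.
Proof. by rewrite /K mul2n. Qed.

Lemma foldr_d2_bound (r : R) : exists2 C, 0 <= C & forall hs, (size hs <= m)%N ->
  all (fun h => 0 < h <= 1) hs ->
  forall y z, sq y <= r -> sq z <= 1 -> `|foldr dlap (d2 v z) hs y| <= C * eucl z `^ be.
Proof.
have [hk ht] := hC.
apply: (@foldr_dlap_d2_bound R n v K al al0 hk al_gt0 _ _ ht sg m sg1 mK).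
- by rewrite ge_min lexx orbT.
- by rewrite ge_min lexx.
Qed.

(** Majorant of the symmetrized integrand: Hölder regularity for |z| <= 1, the weight and membership
    in [Ls] for |z| > 1. The factor 2^a is that of [kern_le_om] at distance 1. *)
Let kmaj (C : R) y z : R := C * kern_near g be z +
  2 `^ a * (2 * v y * om a z + (v (y + z) * om a z + v (y - z) * om a z)).

Let L1_vomN y : L1 (rnm n) (fun z => v (y - z) * om a z).
Proof. by apply: (eq_L1 _ (L1_opp (lvom y))) => z; rewrite /om sqN. Qed.

Let L1_omv y : L1 (rnm n) (fun z => 2 * v y * om a z + (v (y + z) * om a z + v (y - z) * om a z)).
Proof. by apply: L1D; [apply: L1Z; exact: L1_om|apply: L1D; [exact: lvom|exact: L1_vomN]]. Qed.

Let L1_kmaj C y : L1 (rnm n) (kmaj C y).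
Proof. by apply: L1D; apply: L1Z; [exact: (L1_kern_near n g0 be_gt be_lt)|exact: L1_omv]. Qed.

Lemma d2v_le y z : `|d2 v z y| <= 2 * v y + (v (y + z) + v (y - z)).
Proof.
rewrite /d2 addrA; apply: (le_trans (ler_normB _ _)); apply: lerD; last by rewrite ger0_norm.
apply: (le_trans (ler_normB _ _)); apply: lerD; last by rewrite ger0_norm.
by rewrite ger0_norm ?mulr_ge0.
Qed.

Let kmaj_ge (r : R) : exists2 C, 0 <= C & forall y z, sq y <= r ->
  `|d2 v z y| * kern g z <= kmaj C y z.
Proof.
have [C C0 HC] := foldr_d2_bound r; exists C => // y z yr.
have o0 : 0 <= 2 * v y * om a z + (v (y + z) * om a z + v (y - z) * om a z).
  by rewrite !addr_ge0 ?mulr_ge0 ?om_ge0.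
rewrite /kmaj /kern_near; case: ifPn => z1.
  apply: ler_wpDr; first by rewrite mulr_ge0 ?powR_ge0.
  by rewrite mulrA ler_wpM2r ?kern_ge0// (HC [::]).
rewrite mulr0 add0r -ltNge in z1 *.
have k := @kern_le_om R n g 1 z a_gt0 ltr01 (ltW z1).
rewrite invr1 -natr1 -/a in k.
apply: (@le_trans _ _ ((2 * v y + (v (y + z) + v (y - z))) * (2 `^ a * om a z))).
  by apply: ler_pM => //; [exact: kern_ge0|exact: d2v_le].
by rewrite le_eqVlt; apply/orP; left; apply/eqP; ring.
Qed.

Let measurable_d2k y : measurable_fun setT (fun z => d2 v z y * kern g z).
Proof.
apply: measurable_funM; last exact: measurable_kern.
apply: (measurableT_comp (measurable_d2_2 mv) (g := fun z : 'rV[R]_n => (z, y))).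
exact: measurable_fun_pair.
Qed.

Lemma L1_d2k y : L1 (rnm n) (fun z => d2 v z y * kern g z).
Proof.
have [C C0 HC] := kmaj_ge (sq y); apply: (L1_le (measurable_d2k y) _ (L1_kmaj C y)) => z.
by rewrite normrM (ger0_norm (kern_ge0 _ _)) HC.
Qed.

Lemma d2k_bound (r : R) : exists2 M, 0 <= M & forall y, sq y <= r ->
  RI (rnm n) (fun z => `|d2 v z y| * kern g z) <= M.
Proof.
have [C C0 HC] := kmaj_ge r; have [M M0 HM] := vomb r; have [V HV] := vlb r.
have k0 : 0 <= RI (rnm n) (kern_near g be) by apply: RI_ge0 => z; exact: kern_near_ge0.
have o0 : 0 <= RI (rnm n) (om a) by apply: RI_ge0 => z; exact: om_ge0.
exists (C * RI (rnm n) (kern_near g be) + 2 `^ a * (2 * `|V| * RI (rnm n) (om a) + (M + M))).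
  by rewrite addr_ge0 ?mulr_ge0// ?powR_ge0// addr_ge0 ?mulr_ge0// addr_ge0.
move=> y yr.
have l : L1 (rnm n) (fun z => `|d2 v z y| * kern g z).
  by apply: (eq_L1 _ (L1_norm (L1_d2k y))) => z; rewrite normrM (ger0_norm (kern_ge0 _ _)).
apply: (le_trans (le_RI l (L1_kmaj C y) (fun z => HC y z yr))).
have lo := L1_om n g0 g1.
rewrite /kmaj (RID (L1Z C (L1_kern_near n g0 be_gt be_lt)) (L1Z (2 `^ a) (L1_omv y))).
rewrite (RIZ _ (L1_kern_near n g0 be_gt be_lt)) (RIZ _ (L1_omv y)) lerD2l.
apply: ler_wpM2l; first exact: powR_ge0.
rewrite (RID (L1Z (2 * v y) lo) (L1D (lvom y) (L1_vomN y))) (RID (lvom y) (L1_vomN y)) (RIZ _ lo).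
apply: lerD; last apply: lerD; last 2 first.
- exact: HM.
- have -> : RI (rnm n) (fun z => v (y - z) * om a z) = RI (rnm n) (fun z => v (y + z) * om a z).
    by rewrite -(RI_opp (lvom y)); apply: eq_RI => z; rewrite /om sqN.
  exact: HM.
apply: ler_wpM2r => //; rewrite ler_wpM2l//; apply: le_trans (ler_norm V).
by apply: le_trans (HV y yr); exact: ler_norm.
Qed.

Let tk x (e : R) z : R := if e < eucl z then (v x - v (x + z)) * kern g z else 0.

Let L1_tk x e : 0 < e -> L1 (rnm n) (tk x e).
Proof.
move=> e0; pose c := (1 + (e ^+ 2)^-1) `^ a.
have lo := L1_om n g0 g1.
apply: (L1_le _ _ (L1Z c (L1D (L1Z (v x) lo) (lvom x)))).
  apply: measurable_fun_ifT => //.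
    apply: measurable_fun_ltr => //; exact: measurable_eucl.
  apply: measurable_funM; last exact: measurable_kern.
  apply: measurable_funB => //; under eq_fun do rewrite addrC.
  exact: measurable_shift_rv mv.
move=> z; have r0 : 0 <= c * (v x * om a z + v (x + z) * om a z).
  by rewrite mulr_ge0 ?powR_ge0// addr_ge0 ?mulr_ge0 ?om_ge0.
rewrite /tk; case: ifPn => ez; last by rewrite normr0.
rewrite normrM (ger0_norm (kern_ge0 _ _)).
have -> : c * (v x * om a z + v (x + z) * om a z) = (v x + v (x + z)) * (c * om a z) by ring.
apply: ler_pM => //; first exact: kern_ge0.
  by apply: (le_trans (ler_normB _ _)); rewrite !ger0_norm.
apply: kern_le_om => //; first by rewrite exprn_gt0.
by rewrite sq_euclE powR_mulrn ?eucl_ge0// lerXn2r ?nnegrE ?(ltW e0) ?eucl_ge0// ltW.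
Qed.

(** The truncation is symmetric, so averaging over z and -z replaces the first difference by half
    the second one. *)
Lemma frac_truncE x e : 0 < e -> frac_trunc g v x e =
  2^-1 * RI (rnm n) (fun z => if e < eucl z then d2 v z x * kern g z else 0).
Proof.
move=> e0; have lt := L1_tk x e0.
have E : (fun y => if e < eucl (x - y) then (v x - v y) / eucl (x - y) `^ (n%:R + 2 * g) else 0) =
   (fun y => tk x e (y + - x)).
  apply/funext => y; rewrite /tk -euclN opprB; case: ifP => // _.
  have -> : x + (y - x) = y by rewrite addrC subrK.
  by rewrite /kern powRN.
have lF := L1_shift (- x) lt.
have R1 : frac_trunc g v x e = RI (rnm n) (tk x e).
  rewrite -(RI_shift (- x) lt) (RI_maxE lF) /frac_trunc E /Rn_int.
  have mF := L1_measurable lF.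
  congr (fine _ - fine _); apply: Rn_int_ge0E.
  - by apply/measurable_EFinP; apply: measurable_maxr.
  - by move=> y; rewrite lee_fin le_max lexx orbT.
  - by apply/measurable_EFinP; apply: measurable_maxr => //; exact: measurable_funN.
  - by move=> y; rewrite lee_fin le_max lexx orbT.
have R2 : RI (rnm n) (tk x e) + RI (rnm n) (fun z => tk x e (- z)) =
    RI (rnm n) (fun z => if e < eucl z then d2 v z x * kern g z else 0).
  rewrite -(RID lt (L1_opp lt)); apply: eq_RI => z.
  rewrite /tk euclN; case: ifP => _; last by rewrite addr0.
  by rewrite kernN /d2; ring.
rewrite R1 -[X in _ = _ * X]R2 [X in _ * (_ + X)](RI_opp lt); exact: half_add.
Qed.

Lemma harmonic_right : (fun j : nat => j.+1%:R^-1 : R) @ \oo --> 0^'+.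
Proof.
move=> P; rewrite /at_right /within/= => H.
have h : \oo (fun j : nat => 0 < (j.+1%:R^-1 : R) -> P j.+1%:R^-1) := @harmonic_cvg0 R _ H.
by apply: filterS h => j; apply; rewrite invr_gt0.
Qed.

(** The principal value is evaluated along the truncations 1/(j+1). For second differences the limit
    follows by dominated convergence, so no cancellation remains to be tracked. *)
Lemma fraclapE x : fraclap g v x =
  C_frac n g * (2^-1 * RI (rnm n) (fun z => d2 v z x * kern g z)).
Proof.
rewrite /fraclap gt_eqF//; congr (_ * _).
have [gz|[_ cv]] := hdef x; first by move: g0; rewrite gz ltxx.
pose u (j : nat) : R := j.+1%:R^-1.
have u0 j : 0 < u j by rewrite invr_gt0.
have c1 : (fun j => frac_trunc g v x (u j)) @ \oo --> lim (frac_trunc g v x @ 0^'+).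
  exact: (cvg_comp _ _ harmonic_right cv).
have [||||_ c2] := @RI_cvg R _ _ (rnm n)
   (fun j z => if u j < eucl z then d2 v z x * kern g z else 0)
   (fun z => d2 v z x * kern g z) (fun z => `|d2 v z x * kern g z|).
- move=> j; apply: measurable_fun_ifT => //.
  apply: measurable_fun_ltr => //; exact: measurable_eucl.
- move=> z; have [->|z0] := eqVneq z 0.
    by rewrite /kern eucl0 powR0 ?mulr0; [under eq_fun do rewrite if_same; exact: cvg_cst|rewrite oppr_eq0 gt_eqF// ltr_wpDl// mulr_gt0].
  have e0 := eucl_gt0 z0.
  apply: cvg_near_cst; have hl : \forall j \near \oo, u j < eucl z by move/cvgr_lt : (@harmonic_cvg0 R); apply.
  by apply: filterS hl => j ->.
- by move=> j z; case: ifP => //; rewrite normr0.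
- by apply: L1_norm; exact: L1_d2k.
have c3 : (fun j => frac_trunc g v x (u j)) @ \oo --> 2^-1 * RI (rnm n) (fun z => d2 v z x * kern g z).
  under eq_fun do rewrite frac_truncE//.
  by apply: cvgM => //; exact: cvg_cst.
by rewrite -(cvg_lim _ c1)// -(cvg_lim _ c3).
Qed.

Lemma measurable_d2k2 :
  measurable_fun setT (fun t : 'rV[R]_n * 'rV[R]_n => d2 v t.1 t.2 * kern g t.1).
Proof.
apply: measurable_funM; first exact: measurable_d2_2 mv.
by apply: (measurableT_comp (@measurable_kern R n g)); exact: measurable_fst.
Qed.

Lemma measurable_fraclap : measurable_fun setT (fraclap g v).
Proof.
rewrite (funext fraclapE); apply: measurable_funM => //; apply: measurable_funM => //.
apply: (@measurable_RI _ _ _ _ _ (rnm n) (fun x z => d2 v z x * kern g z)).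
apply: (measurableT_comp measurable_d2k2 (g := fun t : 'rV[R]_n * 'rV[R]_n => (t.2, t.1))).
by apply: measurable_fun_pair; [exact: measurable_snd|exact: measurable_fst].
Qed.

Let N := m.*2.+1.
(** The kernel is split as [kp] + [kap]. The part [kp] vanishes for |z| >= 1, so [nearG] needs only
    local bounds on [v]; in [farG] the differences in x fall on [kap] and not on [v], whose
    derivatives are not controlled at infinity. [N] is the least power that lets [kap] bear m
    discrete Laplacians. *)
Let kp z : R := kern g z - kap a N z.
Let N0 : (0 < N)%N. Proof. by []. Qed.

Let kp_le z y (u : R) : (z = 0 -> u = 0) -> `|kp z * u| <= (if sq z <= 1 then kern g z else 0) * `|u|.
Proof.
move=> u0; have [z0|z0] := eqVneq z 0.
  by rewrite (u0 z0) mulr0 normr0 mulr0.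
have h1 := kap_le a_gt0 N0 z0; have h0 := kap_ge0 a_gt0 N0 z.
have kE : kern g z = sq z `^ (- a) by exact: kernE.
rewrite normrM ler_wpM2r//; case: ifPn => z1.
  by rewrite /kp kE ger0_norm ?subr_ge0// gerBl.
by rewrite /kp (kap_eq a_gt0 N0) ?kE ?subrr ?normr0// ltW// ltNge.
Qed.

Let nearG z x : R := kp z * d2 v z x.
Let farG y x : R := v y * kap a N (y - x).

Let d20 x : d2 v 0 x = 0.
Proof. by rewrite /d2 addr0 subr0; ring. Qed.

Let foldr_d20 hs x : foldr dlap (d2 v 0) hs x = 0.
Proof.
elim: hs x => [|h hs IH] x /=; first exact: d20.
by rewrite /dlap big1// => i _; rewrite /d2 !IH mulr0 !subr0 mul0r.
Qed.

Let measurable_kp : measurable_fun setT kp.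
Proof.
by apply: measurable_funB; [exact: measurable_kern|exact: measurable_kap].
Qed.

Let mnearG : measurable_fun setT (fun t : 'rV[R]_n * 'rV[R]_n => nearG t.1 t.2).
Proof.
apply: measurable_funM; last exact: measurable_d2_2 mv.
by apply: (measurableT_comp measurable_kp); exact: measurable_fst.
Qed.

Let near_bound (r : R) : exists2 C, 0 <= C & forall hs, (size hs <= m)%N ->
  all (fun h => 0 < h <= 1) hs -> forall z y, sq y <= r ->
  `|foldr dlap (nearG z) hs y| <= C * kern_near g be z.
Proof.
have [C C0 HC] := foldr_d2_bound r; exists C => // hs shs ahs z y yr.
rewrite /nearG foldr_dlapZ; apply: (le_trans (kp_le y _)).
  by move=> ->; exact: foldr_d20.
rewrite /kern_near; case: ifPn => z1; last by rewrite mul0r mulr0.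
rewrite mulrC mulrA; apply: ler_wpM2r; first exact: kern_ge0.
exact: HC.
Qed.

Let L1_nearG x : L1 (rnm n) (nearG ^~ x).
Proof.
have [C C0 HC] := near_bound (sq x).
apply: (L1_le _ _ (L1Z C (L1_kern_near n g0 be_gt be_lt))).
  exact: (measurableT_comp mnearG (g := fun z : 'rV[R]_n => (z, x)) (measurable_fun_pair (@measurable_id _ _ _) (@measurable_cst _ _ _ _ _ _))).
by move=> z; exact: (HC [::]).
Qed.

Let mfarG : measurable_fun setT (fun t : 'rV[R]_n * 'rV[R]_n => farG t.1 t.2).
Proof.
apply: measurable_funM.
  by apply: (measurableT_comp mv); exact: measurable_fst.
have H0 := @measurable_kap R a N n.
exact: (measurableT_comp H0 (@measurable_subrv2 R n)).
Qed.

Let far_bound : exists2 C, 0 <= C & forall hs, (size hs <= m)%N ->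
  all (fun h => 0 < h <= 1) hs -> forall y x,
  `|foldr dlap (farG y) hs x| <= C * (v y * om a (y - x)).
Proof.
have [C C0 HC] := foldr_kap_le a_gt0 N0 n (ltnSn m.*2); exists C => // hs shs ahs y x.
rewrite /farG foldr_dlapZ foldr_dlap_refl normrM ger0_norm// mulrCA ler_wpM2l//.
exact: HC.
Qed.

Let L1_vom' x : L1 (rnm n) (fun y => v y * om a (y - x)).
Proof. by apply: (eq_L1 _ (L1_shift (- x) (lvom x))) => y; rewrite addrC subrK. Qed.

Let L1_farG x : L1 (rnm n) (farG ^~ x).
Proof.
have [C C0 HC] := far_bound.
apply: (L1_le _ _ (L1Z C (L1_vom' x))).
  exact: (measurableT_comp mfarG (g := fun z : 'rV[R]_n => (z, x)) (measurable_fun_pair (@measurable_id _ _ _) (@measurable_cst _ _ _ _ _ _))).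
by move=> y; exact: (HC [::]).
Qed.

Let L1_kapom : L1 (rnm n) (@kap R a N n).
Proof.
have [C C0 HC] := foldr_kap_le a_gt0 N0 n (ltnSn m.*2).
apply: (L1_le _ _ (L1Z C (L1_om n g0 g1))); first exact: measurable_kap.
by move=> z; exact: (HC [::]).
Qed.

Let fraclap_split x : fraclap g v x = C_frac n g * 2^-1 *
  (RI (rnm n) (nearG ^~ x) + (2 * RI (rnm n) (@kap R a N n) * v x + -2 * RI (rnm n) (farG ^~ x))).
Proof.
rewrite fraclapE -mulrA; congr (_ * (_ * _)).
have lp : L1 (rnm n) (fun z => kap a N z * v (x + z)).
  by apply: (eq_L1 _ (L1_shift x (L1_farG x))) => z; rewrite /farG addrK mulrC addrC.
have lm : L1 (rnm n) (fun z => kap a N z * v (x - z)).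
  by apply: (eq_L1 _ (L1_opp lp)) => z; rewrite kapN.
have E1 : RI (rnm n) (fun z => kap a N z * v (x + z)) = RI (rnm n) (farG ^~ x).
  by rewrite -(RI_shift x (L1_farG x)); apply: eq_RI => z; rewrite /farG addrK mulrC addrC.
have E2 : RI (rnm n) (fun z => kap a N z * v (x - z)) = RI (rnm n) (farG ^~ x).
  by rewrite -E1 -(RI_opp lp); apply: eq_RI => z; rewrite kapN.
have l1 := L1Z (2 * v x) L1_kapom.
have -> : 2 * RI (rnm n) (@kap R a N n) * v x + -2 * RI (rnm n) (farG ^~ x) =
  RI (rnm n) (fun z => 2 * v x * kap a N z - kap a N z * v (x + z) - kap a N z * v (x - z)).
  by rewrite (RIB (L1B l1 lp) lm) (RIB l1 lp) (RIZ _ L1_kapom) E1 E2; ring.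
rewrite -(RID (L1_nearG x) (L1B (L1B l1 lp) lm)); apply: eq_RI => z.
by rewrite /nearG /kp /d2; ring.
Qed.

(** This lets [neglap_parts] be applied to w = (-Delta)^g v. Of the three terms of [fraclap_split],
    the near one uses the second differences of [v], the middle one its local bounds, and the far
    one the decay of the differences of [kap] against [Ls]. *)
Lemma fraclap_dlap_bounded : dlap_bounded m (fraclap g v).
Proof.
move=> r; have [C1 C10 H1] := near_bound r; have [C2 C20 H2] := far_bound.
have [V HV] := vdb r; have [M M0 HM] := vomb r.
pose c := 2 * RI (rnm n) (@kap R a N n).
pose B := C1 * RI (rnm n) (kern_near g be : 'rV[R]_n -> R) + (`|c| * V + 2 * (C2 * M)).
exists (`|C_frac n g * 2^-1| * B) => hs shs ahs y yr.
have -> : fraclap g v = fun x => C_frac n g * 2^-1 *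
  (RI (rnm n) (nearG ^~ x) + (c * v x + -2 * RI (rnm n) (farG ^~ x))).
  exact: funext fraclap_split.
rewrite foldr_dlapZ normrM; apply: ler_wpM2l => //.
rewrite !foldr_dlapD !foldr_dlapZ.
have [_ ->] := RI_foldr_dlap hs L1_nearG.
have [_ ->] := RI_foldr_dlap hs L1_farG.
apply: (le_trans (ler_normD _ _)); apply: lerD.
  have lk := L1_kern_near n g0 be_gt be_lt.
  rewrite -(RIZ C1 lk); apply: (norm_RI_le _ _ (L1Z C1 lk)).
    apply: (measurableT_comp (measurable_foldr_dlap2 hs mnearG) (g := fun z : 'rV[R]_n => (z, y))).
    exact: (measurable_fun_pair (@measurable_id _ _ _) (@measurable_cst _ _ _ _ _ _)).
  by move=> z; exact: H1.
apply: (le_trans (ler_normD _ _)); apply: lerD; rewrite normrM; first by rewrite ler_wpM2l// HV.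
have -> : `|-2| = 2 :> R by rewrite normrN ger0_norm.
apply: ler_wpM2l => //.
apply: (@le_trans _ _ (RI (rnm n) (fun z => C2 * (v z * om a (z - y))))).
  apply: (norm_RI_le _ _ (L1Z C2 (L1_vom' y))).
    apply: (measurableT_comp (measurable_foldr_dlap2 hs mfarG) (g := fun z : 'rV[R]_n => (z, y))).
    exact: (measurable_fun_pair (@measurable_id _ _ _) (@measurable_cst _ _ _ _ _ _)).
  by move=> z; exact: H2.
rewrite (RIZ _ (L1_vom' y)) ler_wpM2l//.
have -> : RI (rnm n) (fun z => v z * om a (z - y)) = RI (rnm n) (fun z => v (y + z) * om a z).
  by rewrite -(RI_shift y (L1_vom' y)); apply: eq_RI => z; rewrite addrK addrC.
exact: HM.
Qed.

End FracLaplacian.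

(** * Superposing bumps into derivatives of the heat kernel *)

Section HeatDerivatives.
Context {R : realType}.
Variable n : nat.

(* [(-d/dt)^j] of the heat kernel is [t^-j Q_j(|y|^2/4t)] times the heat kernel. *)
Fixpoint Qp (j : nat) : {poly R} :=
  if j is j'.+1 then ((n%:R / 2)%:P + j'%:R) * Qp j' + 'X * (Qp j')^`() - 'X * Qp j' else 1.

(** Laguerre's equation: [Qp j] is j! times the generalized Laguerre polynomial of parameter n/2 -
    1. It reconciles the recursion in time that defines [Qp] with iteration of the Laplacian in
    space. *)
Lemma Qp_laguerre j :
  'X * (Qp j)^`()^`() + ((n%:R / 2)%:P - 'X) * (Qp j)^`() + j%:R * Qp j = 0.
Proof.
elim: j => [|j IH]; first by rewrite /= !derivC !mulr0 mul0r !addr0.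
set Q := Qp j in IH *.
have cst0 : ((n%:R / 2)%:P + j%:R : {poly R})^`() = 0.
  by rewrite derivD derivC add0r -polyC_natr derivC.
have E1 : (Qp j.+1)^`() = j.+1%:R * (Q^`() - Q).
  rewrite [Qp _]/= -/Q derivB derivD !derivM cst0 derivX -natr1.
  have -> : 'X * Q^`()^`() = - (((n%:R / 2)%:P - 'X) * Q^`() + j%:R * Q).
    by apply/eqP; rewrite -addr_eq0 addrA IH.
  by ring.
have E2 : (Qp j.+1)^`()^`() = j.+1%:R * (Q^`()^`() - Q^`()).
  by rewrite E1 -polyC_natr derivM derivC mul0r add0r derivB.
rewrite E2 E1 [Qp j.+1]/= -/Q.
transitivity (j.+1%:R * ('X * Q^`()^`() + ((n%:R / 2)%:P - 'X) * Q^`() + j%:R * Q)); last by rewrite IH mulr0.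
by ring.
Qed.

Definition psi (j : nat) (t : R) (y : 'rV[R]_n) : R :=
  t^-1 ^+ j * (Qp j).[sq y / (4 * t)] * heat t y.

Lemma psi0 t y : psi 0 t y = heat t y.
Proof. by rewrite /psi expr0 hornerC !mul1r. Qed.

Lemma poly_heat_le (p : {poly R}) : exists2 C, 0 <= C & forall t (y : 'rV[R]_n), 0 < t ->
  `|p.[sq y / t]| * heat t y <= C * heat (2 * t) y.
Proof.
elim/poly_ind: p => [|p c _].
  by exists 0 => // t y t0; rewrite horner0 normr0 !mul0r.
pose q := p * 'X + c%:P.
have /choice[f Hf] : forall i : nat, exists c : R, 0 <= c /\ forall t (y : 'rV[R]_n), 0 < t ->
    (sq y / t) ^+ i * heat t y <= c * heat (2 * t) y.
  move=> i.
  have [C C0 HC] := @heat_moment_le R n i%:R (ler0n _ _).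
  exists C; split; first exact: ltW.
  move=> t y t0; have := HC t y t0; rewrite powR_mulrn// divr_ge0 ?sq_ge0// ltW//.
exists (\sum_(i < size q) `|q`_i| * f i).
  by apply: sumr_ge0 => i _; rewrite mulr_ge0// (Hf i).1.
move=> t y t0; rewrite horner_coef [leRHS]mulr_suml.
have h0 : 0 <= heat t y by exact: heat_ge0.
apply: (@le_trans _ _ (\sum_(i < size q) `|q`_i * (sq y / t) ^+ i| * heat t y)).
  by rewrite -[leRHS]mulr_suml; apply: ler_wpM2r => //; exact: ler_norm_sum.
apply: ler_sum => i _; rewrite normrM -!mulrA ler_wpM2l//.
rewrite ger0_norm ?exprn_ge0 ?divr_ge0 ?sq_ge0 ?(ltW t0)//.
exact: (Hf i).2.
Qed.

Lemma psi_le j : exists2 C, 0 <= C & forall t (y : 'rV[R]_n), 0 < t ->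
  `|psi j t y| <= C * t^-1 ^+ j * heat (2 * t) y.
Proof.
have [C C0 HC] := poly_heat_le (Qp j \Po (4^-1 *: 'X)).
exists C => // t y t0; rewrite /psi !normrM (ger0_norm (heat_ge0 _ _)).
rewrite (ger0_norm (exprn_ge0 _ _)) ?invr_ge0 ?(ltW t0)//.
rewrite -mulrA [C * _]mulrC -mulrA ler_wpM2l ?exprn_ge0 ?invr_ge0 ?(ltW t0)//.
have := HC t y t0; rewrite horner_comp hornerZ hornerX.
by have -> : 4^-1 * (sq y / t) = sq y / (4 * t) by field; rewrite gt_eqF.
Qed.

Lemma is_derive_inv (t : R) : 0 < t -> is_derive t 1 (fun s : R => s^-1) (- (t^-1 ^+ 2)).
Proof.
move=> t0; have := @is_deriveV R id t 1 1 (lt0r_neq0 t0) (is_derive_id t 1).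
by rewrite /GRing.scale/= mulr1 exprVn.
Qed.

Lemma is_derive_horner (p : {poly R}) (x : R) : is_derive x 1 (fun s => p.[s]) p^`().[x].
Proof.
elim/poly_ind: p => [|p c IH].
  by under eq_fun do rewrite horner0; rewrite derivC horner0; exact: is_derive_cst.
have -> : (fun s => (p * 'X + c%:P).[s]) = (fun s => p.[s] * s + c).
  by apply/funext => s; rewrite hornerMXaddC.
have d := is_deriveD (is_derive_mul IH (is_derive_id x 1) erefl) (is_derive_cst c x 1).
by apply: (is_derive_eq d); rewrite derivMXaddC hornerD hornerMX mulr1 addr0 addrC.
Qed.

Lemma is_derive_heat (t : R) (y : 'rV[R]_n) : 0 < t ->
  is_derive t 1 (fun s => heat s y) (t^-1 * (sq y / (4 * t) - n%:R / 2) * heat t y).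
Proof.
move=> t0; have n4 : (4 * t != 0) by rewrite gt_eqF// mulr_gt0.
pose F (s : R) := (4 * pi) `^ (- (n%:R / 2)) * (s `^ (- (n%:R / 2)) * expR (- (sq y / 4) * s^-1)).
have E : {near t, (fun s => heat s y) =1 F}.
  near=> s; have s0 : 0 < s by near: s; exact: lt_nbhsr.
  rewrite heat_powR// /F powRM ?mulr_ge0 ?pi_ge0 ?(ltW s0)// -mulrA; congr (_ * (_ * expR _)).
  by field; rewrite gt_eqF.
have dp : is_derive t 1 (fun s : R => s `^ (- (n%:R / 2))) (- (n%:R / 2) * t `^ (- (n%:R / 2) - 1)).
  exact: is_derive1_powR.
have de : is_derive t 1 (fun s : R => expR (- (sq y / 4) * s^-1))
    (expR (- (sq y / 4) * t^-1) * (- (sq y / 4) * - (t^-1 ^+ 2))).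
  exact: (@is_derive_comp R expR (fun s => - (sq y / 4) * s^-1) t _ _ _ (is_derive_expR _)
    (is_derive_scale (is_derive_inv t0) erefl) erefl).
have dF := is_derive_scale (k := (4 * pi) `^ (- (n%:R / 2))) (is_derive_mul dp de erefl) erefl.
have E' : \near t, F t = heat t y by apply: filterS E => s ->.
apply: (is_derive_eq (near_eq_is_derive E' dF)).
have Et := nbhs_singleton E; rewrite Et /F.
have t1 : t `^ (- (n%:R / 2) - 1) = t `^ (- (n%:R / 2)) * t^-1.
  by rewrite (powRDp _ _ t0) powR_inv1// ltW.
by rewrite t1; field; rewrite gt_eqF.
Unshelve. all: by end_near. Qed.

Lemma is_derive_psi j (t : R) (y : 'rV[R]_n) : 0 < t ->
  is_derive t 1 (fun s => psi j s y) (- psi j.+1 t y).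
Proof.
move=> t0.
have dj : is_derive t 1 (fun s : R => s^-1 ^+ j) (j%:R * t^-1 ^+ j.-1 * - (t^-1 ^+ 2)).
  exact: (@is_derive_comp R (fun s => s ^+ j) (fun s => s^-1) t _ _ _ (is_derive_pow j _) (is_derive_inv t0)).
have du : is_derive t 1 (fun s : R => sq y / (4 * s)) (sq y / 4 * - (t^-1 ^+ 2)).
  have -> : (fun s : R => sq y / (4 * s)) = (fun s => sq y / 4 * s^-1).
    by apply/funext => s; rewrite invfM mulrA.
  exact: (is_derive_scale (is_derive_inv t0)).
have dQ := @is_derive_comp R (fun u => (Qp j).[u]) (fun s => sq y / (4 * s)) t _ _ _ (is_derive_horner _ _) du erefl.
have d := is_derive_mul (is_derive_mul dj dQ erefl) (is_derive_heat y t0) erefl.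
apply: (is_derive_eq d); rewrite /psi /= -polyC_natr !hornerE /=.
have -> : j%:R * t^-1 ^+ j.-1 * - t^-1 ^+ 2 = - (j%:R * t^-1 ^+ j * t^-1).
  move: t^-1 => u; case: j {dj du dQ d} => [|j] /=; first by rewrite !mul0r oppr0.
  by rewrite [u ^+ j.+1]exprS; ring.
by rewrite [t^-1 ^+ j.+1]exprS; field; rewrite gt_eqF.
Qed.

End HeatDerivatives.

Section Superposition.
Context {R : realType}.
Notation leb := (@lebesgue_measure R).
Variable n : nat.
Variable b : R.
Hypothesis b0 : 0 < b.

Definition ewt (r : R) : R := if 0 < r then expR (- (b * r)) else 0.

Lemma ewt_ge0 r : 0 <= ewt r.
Proof. by rewrite /ewt; case: ifP => // _; exact: expR_ge0. Qed.

Lemma measurable_ewt : measurable_fun setT ewt.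
Proof.
apply: measurable_fun_ifT => //; first exact: measurable_fun_ltr.
by apply: (measurableT_comp (@measurable_expR R)); apply: measurable_funN; exact: measurable_funM.
Qed.

Lemma L1_exp_tail : L1 leb ewt.
Proof.
apply: ge0_L1; [exact: measurable_ewt|exact: ewt_ge0|].
have mF : measurable_fun setT (fun r : R => (if 0 < r then expR (- r) else 0)%:E).
  apply/measurable_EFinP; apply: measurable_fun_ifT => //; first exact: measurable_fun_ltr.
  by apply: (measurableT_comp (@measurable_expR R)); exact: measurable_funN.
have F0 r : (0 <= (if 0 < r then expR (- r) else 0)%:E :> \bar R)%E.
  by rewrite lee_fin; case: ifP => // _; exact: expR_ge0.
have := ge0_integral_leb_scale b0 mF F0.
have -> : (\int[leb]_r (if (0 < b * r)%R then expR (- (b * r)) else 0)%:E = \int[leb]_r (ewt r)%:E)%E.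
  by apply: eq_integral => r _; rewrite /ewt pmulr_rgt0.
move=> ->.
have -> : (\int[leb]_r (if (0 < r)%R then expR (- r) else 0)%:E = 1%:E)%E.
  have := integral_exp_tail (0 : R); rewrite oppr0 expR0 => <-.
  rewrite integral_itv_if; apply: eq_integral => r _; rewrite in_itv/= andbT.
  by case: ifP.
by rewrite -EFinM ltry.
Qed.

End Superposition.

(** * Exponential superposition of bumps in the radius *)

Section Superposition2.
Context {R : realType}.
Notation leb := (@lebesgue_measure R).
Variable n : nat.
Variable b : R.
Hypothesis b0 : 0 < b.

Lemma L1_ewt_poly (q : nat) : L1 leb (fun r => ewt b r * (1 + r) ^+ q).
Proof.
have b2 : 0 < b / 2 by rewrite divr_gt0.
have [C C0 HC] := powR_le_exp_scale (ler0n R q) b2.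
apply: (L1_le _ _ (L1Z (C * expR (b / 2)) (L1_exp_tail b2))).
  by apply: measurable_funM; [exact: measurable_ewt|apply: measurable_funX; exact: measurable_funD].
move=> r; rewrite /ewt; case: ltP => r0; last by rewrite mul0r normr0 mulr0.
have r1 : 0 <= 1 + r by rewrite addr_ge0// ltW.
rewrite ger0_norm ?mulr_ge0 ?expR_ge0 ?exprn_ge0//.
have := HC _ r1; rewrite powR_mulrn// => h.
apply: (@le_trans _ _ (expR (- (b * r)) * (C * expR (b / 2 * (1 + r))))).
  by rewrite ler_wpM2l ?expR_ge0.
rewrite le_eqVlt; apply/orP; left; apply/eqP.
have -> : b / 2 * (1 + r) = b / 2 + b / 2 * r by ring.
have -> : - (b * r) = - (b / 2 * r) - b / 2 * r by field.
rewrite !expRD; have : expR (- (b / 2 * r)) * expR (b / 2 * r) = 1 by rewrite -expRD addNr expR0.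
move=> e; transitivity (C * expR (b / 2) * expR (- (b / 2 * r)) *
  (expR (- (b / 2 * r)) * expR (b / 2 * r))); last by rewrite e mulr1.
by ring.
Qed.

(** The integral of r^k e^(-br) over the half-line. *)
Definition gk (k : nat) : R := k`!%:R / b ^+ k.+1.

Lemma Gamma_fact (k : nat) : Gamma (k%:R + 1) = k`!%:R :> R.
Proof.
elim: k => [|k IH].
  apply: EFin_inj; rewrite add0r -GammaE// subrr fact0.
  have := integral_exp_tail (0 : R); rewrite oppr0 expR0 => <-.
  rewrite !integral_itv_if; apply: eq_integral => r _; case: ifP => // h.
  by rewrite powRr0 mul1r.
by rewrite -natr1 GammaS ?ltr_wpDl// IH factS natrM natr1.
Qed.

(** The Gaussian originates here, with rho = |y|^2: shifting r by [rho] pulls out e^(-b rho) and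
    leaves a Gamma integral, which is read off from [fracint_exp]. *)
Lemma bmp_exp_int (k : nat) (rho : R) : 0 <= rho ->
  (\int[leb]_r (ewt b r * pp k.+1 (r - rho))%:E = (gk k.+1 * expR (- (b * rho)))%:E)%E.
Proof.
move=> p0; have b1 : 0 < b^-1 by rewrite invr_gt0.
have k2 : 0 < k.+1%:R + 1 :> R by rewrite ltr_wpDl.
pose F r := (ewt b r * pp k.+1 (r - rho))%:E.
have mF : measurable_fun setT F.
  apply/measurable_EFinP; apply: measurable_funM; first exact: measurable_ewt.
  by apply: (measurableT_comp (@measurable_pp R _)); exact: measurable_funB.
have F0 r : (0 <= F r)%E by rewrite lee_fin mulr_ge0 ?ewt_ge0 ?pp_ge0.
rewrite -(ge0_integral_leb_shift rho mF F0).
have mF2 : measurable_fun setT (fun r : R => F (r + rho)).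
  exact: (measurableT_comp mF (measurable_funD (@measurable_id _ _ _) (@measurable_cst _ _ _ _ _ _))).
have E := ge0_integral_leb_scale b1 mF2 (fun r => F0 _).
rewrite invrK in E.
have E2 : (\int[leb]_r F (b^-1 * r + rho)%R =
    ((gk k.+1 * expR (- (b * rho))) * b)%:E)%E.
  have -> : (gk k.+1 * expR (- (b * rho))) * b = Gamma (k.+1%:R + 1) * (b^-1 ^+ k.+1 * expR (- (b * rho))).
    by rewrite Gamma_fact /gk [b ^+ _.+2]exprS exprVn; field; rewrite expf_neq0// gt_eqF.
  have := @fracint_exp R (k.+1%:R + 1) 0 k2.
  rewrite /fracint oppr0 expR0 => h.
  have c0 : 0 <= Gamma (k.+1%:R + 1) * (b^-1 ^+ k.+1 * expR (- (b * rho))).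
    by rewrite !mulr_ge0 ?expR_ge0 ?exprn_ge0 ?(ltW b1)// ltW// Gamma_gt0.
  rewrite -[RHS]mule1 -h -lebZl//.
  - apply: eq_integral => r _; rewrite add0r -!EFinM /F; congr EFin.
    have [r0|r0] := ltP 0 r; last first.
      rewrite hpow_le0// !mul0r mulr0 pp_neg ?mulr0// addrK.
      by rewrite mulr_ge0_le0// ltW.
    have s0 : 0 < b^-1 * r + rho by rewrite ltr_pwDl// mulr_gt0.
    rewrite hpow_gt0// !addrK powR_mulrn ?ltW// pp_pos ?mulr_ge0 ?(ltW b1) ?(ltW r0)//.
    rewrite /ewt s0 exprMn.
    have -> : - (b * (b^-1 * r + rho)) = - r - b * rho by field; rewrite gt_eqF.
    by rewrite expRD; field; rewrite gt_eqF// Gamma_gt0.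
  - apply: emeasurable_funM; apply/measurable_EFinP.
      by apply: measurable_funM => //; exact: measurable_hpow.
    apply: (measurableT_comp (@measurable_expR R)); apply: measurable_funN.
    exact: measurable_funD.
  - by move=> r; rewrite mule_ge0 ?lee_fin ?hpowG_ge0 ?expR_ge0.
rewrite E in E2.
have : ((b^-1)%:E * (b%:E * \int[leb]_r F (r + rho)%R) = (b^-1)%:E * (gk k.+1 * expR (- (b * rho)) * b)%:E)%E.
  by rewrite E2.
rewrite muleA -!EFinM mulVf ?gt_eqF// mul1e => ->; congr EFin.
by field; rewrite gt_eqF.
Qed.

Lemma RI_bmp_exp (k : nat) (y : 'rV[R]_n) :
  RI leb (fun r => ewt b r * bmp k.+1 r y) = gk k.+1 * expR (- (b * sq y)).
Proof. by rewrite /RI /bmp bmp_exp_int// sq_ge0. Qed.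

(* [int_0^oo r^i (r - rho)_+^k e^(-b r) dr] is the value at [rho] of [supP i k] times [e^(-b rho)]. *)
Fixpoint supP (i k : nat) : {poly R} :=
  if i is i'.+1 then supP i' k.+1 + 'X * supP i' k else (gk k)%:P.

(** Differentiating int r^i (r - rho)_+^(k+1) e^(-br) dr in [rho] yields -(k+1) times the integral
    with power k; dividing out e^(-b rho) turns d/drho into d/drho - b. *)
Lemma supP_deriv i k : (supP i k.+1)^`() - b%:P * supP i k.+1 = - (k.+1%:R * supP i k).
Proof.
elim: i k => [|i IH] k /=.
  rewrite derivC sub0r -polyCM -polyC_natr -polyCM; congr (- _%:P).
  by rewrite /gk factS natrM [b ^+ k.+2]exprS; field; rewrite !expf_neq0 ?gt_eqF.
rewrite derivD derivM derivX mul1r.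
transitivity (((supP i k.+2)^`() - b%:P * supP i k.+2) + supP i k.+1 +
  'X * ((supP i k.+1)^`() - b%:P * supP i k.+1)); first by ring.
rewrite !IH -[k.+2%:R]natr1; by ring.
Qed.

(* Minus the Laplacian conjugated by [e^(-b|y|^2)], on polynomials in [|y|^2]. *)
Definition Lb (p : {poly R}) : {poly R} :=
  - (4%:R * 'X * (p^`()^`() - 2%:R * b%:P * p^`() + b%:P * b%:P * p)
     + 2%:R * n%:R * (p^`() - b%:P * p)).

Definition supl (l : seq (R * nat * nat)) : {poly R} := \sum_(t <- l) t.1.1 *: supP t.1.2 t.2.

Lemma LbD p q : Lb (p + q) = Lb p + Lb q.
Proof. by rewrite /Lb !derivD; ring. Qed.

Lemma LbZ c p : Lb (c *: p) = c *: Lb p.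
Proof. by rewrite /Lb !derivZ -!mul_polyC; ring. Qed.

Lemma Lb0 : Lb 0 = 0.
Proof. by rewrite /Lb !deriv0; ring. Qed.

Lemma Lb_supP i k : Lb (supP i k.+2) =
  (2 * n%:R * k.+2%:R + 4 * k.+2%:R * k.+1%:R) *: supP i k.+1 -
  (4 * k.+2%:R * k.+1%:R) *: supP i.+1 k.
Proof.
set p := supP i k.+2.
have h1 : p^`() - b%:P * p = - (k.+2%:R * supP i k.+1) by exact: supP_deriv.
have h2 : p^`()^`() - b%:P * p^`() = - (k.+2%:R * (supP i k.+1)^`()).
  have := congr1 (@deriv R) h1; rewrite derivB derivM derivC mul0r add0r derivN.
  by rewrite -polyC_natr derivM derivC mul0r add0r.
have h3 := supP_deriv i k.
have -> : Lb p = - (4%:R * 'X * ((p^`()^`() - b%:P * p^`()) - b%:P * (p^`() - b%:P * p))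
     + 2%:R * n%:R * (p^`() - b%:P * p)) by rewrite /Lb; ring.
rewrite h1 h2.
have -> : - (k.+2%:R * (supP i k.+1)^`()) - b%:P * - (k.+2%:R * supP i k.+1) =
  - (k.+2%:R * ((supP i k.+1)^`() - b%:P * supP i k.+1)) by ring.
rewrite h3 /= -!mul_polyC !(polyCD, polyCM, polyC_natr); ring.
Qed.

(** Superposition intertwines the list operation with the conjugated Laplacian. As an identity
    between polynomials it requires no differentiation under the integral. *)
Lemma supl_neglap l : bdeg 2 l -> supl (bneglap n l) = Lb (supl l).
Proof.
rewrite /supl; elim: l => [_|t l IH /= /andP[kt /IH {}IH]].
  by rewrite /bneglap/= !big_nil Lb0.
rewrite /bneglap/= big_cons big_cons -/(bneglap n l) IH big_cons LbD LbZ addrA; congr (_ + _).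
move: kt; case: t => [[c i] [|[|k]]] //= _.
rewrite Lb_supP /= scalerBr !scalerA scaleNr.
by congr (_ - _); rewrite ?mulrA.
Qed.

Lemma L1_btest_exp l (y : 'rV[R]_n) : L1 leb (fun r => ewt b r * btest l r y).
Proof.
have [C [q [C0 HC]]] := btest_le n l.
apply: (L1_le _ _ (L1Z C (L1_ewt_poly q))).
  apply: measurable_funM; first exact: measurable_ewt.
  apply: (measurableT_comp (@measurable_btest2 R n l) (g := fun r : R => (r, y))).
  exact: measurable_fun_pair.
move=> r; rewrite normrM (ger0_norm (ewt_ge0 _ _)) mulrCA.
have [r0|r0] := leP 0 r; first by rewrite ler_wpM2l ?ewt_ge0 ?HC.
by rewrite /ewt ltNge (ltW r0) /= !mul0r.
Qed.

Lemma RI_btest_exp l (y : 'rV[R]_n) : bdeg 1 l ->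
  RI leb (fun r => ewt b r * btest l r y) = (supl l).[sq y] * expR (- (b * sq y)).
Proof.
move=> dl.
have L i k : L1 leb (fun r => ewt b r * (r ^+ i * bmp k.+1 r y)).
  apply: (L1_le _ _ (L1_ewt_poly (i + k.+1))).
    apply: measurable_funM; first exact: measurable_ewt.
    apply: measurable_funM; first exact: measurable_funX.
    apply: (measurableT_comp (@measurable_bump2 R n k.+1) (g := fun r : R => (r, y))).
    exact: measurable_fun_pair.
  move=> r; rewrite normrM (ger0_norm (ewt_ge0 _ _)).
  have [r0|r0] := leP 0 r; last by rewrite /ewt ltNge (ltW r0) /= !mul0r.
  apply: ler_wpM2l; first exact: ewt_ge0.
  rewrite ger0_norm; last by apply: mulr_ge0; [exact: exprn_ge0|exact: bump_ge0].
  apply: le_trans (expr_le_1D r0 (leqnn _)); rewrite exprD; apply: ler_wpM2l.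
    exact: exprn_ge0.
  exact: bump_le.
have E i k : RI leb (fun r => ewt b r * (r ^+ i * bmp k.+1 r y)) =
    (supP i k.+1).[sq y] * expR (- (b * sq y)).
  elim: i k => [|i IH] k.
    by rewrite /= hornerC -RI_bmp_exp; apply: eq_RI => r; rewrite expr0 mul1r.
  rewrite /= hornerD hornerM hornerX mulrDl -mulrA -!IH -(RIZ _ (L i k)) -(RID (L i k.+1) (L1Z _ (L i k))).
  apply: eq_RI => r; rewrite /bmp; have [h|h] := leP r (sq y).
    by rewrite !pp_neg ?subr_le0// !mulr0 addr0.
  by rewrite !pp_pos ?subr_ge0 ?(ltW h)// [r ^+ i.+1]exprS [_ ^+ k.+2]exprS; ring.
rewrite /supl /btest horner_sum mulr_suml.
elim: l dl => [_|[[c i] [|k]] l IH] //=.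
  by rewrite !big_nil; rewrite -[RHS](RI_0 leb); apply: eq_RI => r; rewrite big_nil mulr0.
move=> /IH {}IH; rewrite big_cons/= hornerZ -mulrA -E -(RIZ _ (L i k)) -IH.
have lb : L1 leb (fun r => ewt b r * \sum_(j <- l) bterm j r y) := L1_btest_exp l y.
rewrite -(RID (L1Z c (L i k)) lb); apply: eq_RI => r.
by rewrite big_cons /bterm/=; ring.
Qed.

End Superposition2.

(** * From bumps to the derivatives of the heat kernel *)

Section PsiSuperposition.
Context {R : realType}.
Notation leb := (@lebesgue_measure R).
Variable n : nat.

(** Laguerre's equation eliminates the second derivative from the conjugated Laplacian; what remains
    is the recursion for [Qp]. *)
Lemma Lb_Qp (b : R) j :
  Lb n b (@Qp R n j \Po (b *: 'X)) = (4 * b) *: (@Qp R n j.+1 \Po (b *: 'X)).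
Proof.
set c : {poly R} := (n%:R / 2)%:P.
have hn : (n%:R : {poly R}) = 2%:R * c.
  by rewrite /c -!polyC_natr -polyCM; congr (_%:P); field.
set q : {poly R} := b *: 'X.
have qX : 'X * b%:P = q by rewrite /q -mul_polyC mulrC.
have dq : q^`() = b%:P by rewrite /q derivZ derivX alg_polyC.
set Q := @Qp R n j; set P := Q \Po q; set P1 := Q^`() \Po q; set P2 := Q^`()^`() \Po q.
have d1 : P^`() = P1 * b%:P by rewrite /P deriv_comp dq.
have d2 : P^`()^`() = P2 * b%:P * b%:P.
  by rewrite d1 derivM derivC mulr0 addr0 /P1 deriv_comp dq.
have lag : q * P2 + (c - q) * P1 + j%:R * P = 0.
  have := congr1 (fun p => p \Po q) (@Qp_laguerre R n j).
  rewrite -!polyC_natr !(comp_polyB, comp_polyD, comp_polyM, comp_polyX, comp_polyC, comp_poly0).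
  by rewrite polyC0.
have E : @Qp R n j.+1 \Po q = (c + j%:R) * P + q * P1 - q * P.
  by rewrite /= -!polyC_natr !(comp_polyB, comp_polyD, comp_polyM, comp_polyX, comp_polyC).
rewrite E /Lb d2 d1 hn -mul_polyC polyCM.
have -> : (4 : R)%:P = 4%:R :> {poly R} by rewrite polyC_natr.
have P2E : q * P2 = - ((c - q) * P1 + j%:R * P) by apply/eqP; rewrite -addr_eq0 addrA lag.
transitivity (- (4%:R * b%:P * (q * P2 - 2%:R * q * P1 + q * P) + 4%:R * b%:P * c * (P1 - P))).
  by rewrite -qX; ring.
by rewrite P2E; ring.
Qed.

Lemma iter_Lb_Qp (b a : R) j : iter j (Lb n b) a%:P = (a * (4 * b) ^+ j) *: (@Qp R n j \Po (b *: 'X)).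
Proof.
elim: j => [|j IH] /=; first by rewrite expr0 mulr1 comp_polyC alg_polyC.
by rewrite IH LbZ Lb_Qp scalerA -mulrA -exprSr.
Qed.

(* Superposed in the radius with weight [e^(-r/4t)], this test function gives the heat kernel at time [t];
   the bump power leaves room for [m + 1] Laplacians. *)
Definition psil (m : nat) (t : R) : seq (R * nat * nat) :=
  [:: ((4 * pi * t) `^ (- (n%:R / 2)) / gk (4 * t)^-1 (m.*2 + 3), 0%N, (m.*2 + 3)%N)].

Lemma psil_deg m t : bdeg (m.*2 + 3) (psil m t).
Proof. by rewrite /= leqnn. Qed.

(** At b = 1/(4t) the factor 4b of [Lb_Qp] is 1/t, so j Laplacians in space give the same function
    as j derivatives in time: this is where the heat equation enters. *)
Lemma psi_superpos m j t (y : 'rV[R]_n) : 0 < t -> (j <= m)%N ->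
  RI leb (fun r => ewt (4 * t)^-1 r * btest (iter j (bneglap n) (psil m t)) r y) = psi j t y.
Proof.
move=> t0 jm; have b0 : 0 < (4 * t)^-1 by rewrite invr_gt0 mulr_gt0.
have deg k i : (i <= m)%N -> (k <= 3)%N -> bdeg k (iter i (bneglap n) (psil m t)).
  move=> im k3; apply: (bdegW k3); apply: bdeg_iter; apply: bdegW (psil_deg m t).
  by rewrite leq_add2r leq_double.
rewrite RI_btest_exp//; last exact: deg.
have -> : supl (4 * t)^-1 (iter j (bneglap n) (psil m t)) =
    iter j (Lb n (4 * t)^-1) ((4 * pi * t) `^ (- (n%:R / 2)))%:P.
  elim: j jm => [_|j IH jm].
    rewrite /= /supl big_cons big_nil addr0 /= -mul_polyC -polyCM; congr (_%:P).
    have g0 : gk (4 * t)^-1 (m.*2 + 3) != 0.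
      by rewrite mulf_neq0 ?invr_neq0 ?expf_neq0 ?(gt_eqF b0)// pnatr_eq0 -lt0n fact_gt0.
    by rewrite mulfVK.
  rewrite iterS supl_neglap// ?IH//; first by rewrite ltnW.
  by apply: deg => //; exact: ltnW.
rewrite iter_Lb_Qp hornerZ horner_comp hornerZ hornerX /psi heat_powR//.
have -> : 4 * (4 * t)^-1 = t^-1 by field; rewrite gt_eqF.
have -> : (4 * t)^-1 * sq y = sq y / (4 * t) by rewrite mulrC.
by ring.
Qed.

Lemma measurable_horner (p : {poly R}) : measurable_fun setT (fun x : R => p.[x]).
Proof.
elim/poly_ind: p => [|p c IH].
  by under eq_fun do rewrite horner0; exact: measurable_cst.
have -> : (fun x : R => (p * 'X + c%:P).[x]) = (fun x => p.[x] * x + c).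
  by apply/funext => x; rewrite hornerMXaddC.
by apply: measurable_funD => //; exact: measurable_funM.
Qed.

Lemma measurable_psi j t : measurable_fun setT (psi j t : 'rV[R]_n -> R).
Proof.
apply: measurable_funM; last exact: measurable_heat.
apply: measurable_funM => //; apply: (measurableT_comp (measurable_horner _)).
by apply: measurable_funM => //; exact: measurable_sq.
Qed.

Lemma measurable_psi2 j : measurable_fun setT
  (fun z : R * 'rV[R]_n => if 0 < z.1 then psi j z.1 z.2 else 0).
Proof.
have m1 : measurable_fun setT (fun z : R * 'rV[R]_n => z.1) by exact: measurable_fst.
have m2 : measurable_fun setT (fun z : R * 'rV[R]_n => sq z.2).
  by apply: (measurableT_comp (@measurable_sq R n)); exact: measurable_snd.
have m4 : measurable_fun setT (fun z : R * 'rV[R]_n => (4 * z.1) `^ (-1)).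
  by apply: (measurableT_comp (measurable_powR _)); exact: measurable_funM.
have -> : (fun z : R * 'rV[R]_n => if 0 < z.1 then psi j z.1 z.2 else 0) =
  (fun z => if 0 < z.1 then (z.1 `^ (-1)) ^+ j * (@Qp R n j).[sq z.2 * (4 * z.1) `^ (-1)] *
     ((4 * pi * z.1) `^ (- (n%:R / 2)) * expR (- (sq z.2 * (4 * z.1) `^ (-1)))) else 0).
  apply/funext => z; case: ifPn => // z0.
  by rewrite /psi heat_powR// !powR_inv1 ?mulr_ge0 ?(ltW z0).
apply: measurable_fun_ifT => //; first by apply: measurable_fun_ltr => //; exact: measurable_cst.
apply: measurable_funM.
  apply: measurable_funM.
    by apply: measurable_funX; apply: (measurableT_comp (measurable_powR _)).
  apply: (measurableT_comp (measurable_horner _)); exact: measurable_funM.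
apply: measurable_funM.
  by apply: (measurableT_comp (measurable_powR _)); exact: measurable_funM.
apply: (measurableT_comp (@measurable_expR R)); apply: measurable_funN; exact: measurable_funM.
Qed.

End PsiSuperposition.

(** * Heat averages: weighted bounds, time derivatives, semigroup law *)

Section HeatFlow.
Context {R : realType}.
Notation leb := (@lebesgue_measure R).
Variable n : nat.
Implicit Types x y z : 'rV[R]_n.

(** For t >= 1 and a = n/2 + g one has (1+|z|^2)^a <= t^a (1+|z|^2/t)^a; the Gaussian absorbs the
    second factor, and t^a t^(-n/2) = t^g. This is the origin of the growth rate t^g of U_0. *)
Lemma heat_le_om (g : R) : 0 <= g -> exists2 C, 0 <= C & forall t z, 1 <= t ->
  heat (2 * t) z <= C * t `^ g * om (n%:R / 2 + g) z.
Proof.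
move=> g0; set a := n%:R / 2 + g.
have a0 : 0 <= a by rewrite addr_ge0// divr_ge0.
have e8 : 0 < 8^-1 :> R by rewrite invr_gt0.
have [C C0 HC] := powR_le_exp_scale a0 e8.
exists ((8 * pi) `^ (- (n%:R / 2)) * (C * expR 8^-1)).
  by rewrite mulr_ge0 ?powR_ge0// mulr_ge0 ?expR_ge0// ltW.
move=> t z t1; have t0 : 0 < t by apply: lt_le_trans t1.
have z0 := sq1_gt0 z; have s0 := sq_ge0 z.
have q0 : 0 <= 1 + sq z / t by rewrite addr_ge0// divr_ge0// ltW.
have h1 : (1 + sq z) `^ a <= t `^ a * (C * expR (8^-1 * (1 + sq z / t))).
  apply: (@le_trans _ _ ((t * (1 + sq z / t)) `^ a)).
    apply: ge0_ler_powR => //; rewrite ?nnegrE ?(ltW z0) ?mulr_ge0 ?(ltW t0)//.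
    by rewrite mulrDr mulr1 mulrCA divff ?gt_eqF// mulr1 lerD2r.
  by rewrite powRM ?(ltW t0)// ler_wpM2l ?powR_ge0// HC.
rewrite /om powRN -ler_pdivrMr ?invr_gt0 ?powR_gt0// invrK.
rewrite heat_powR ?mulr_gt0//.
have -> : 4 * pi * (2 * t) = 8 * pi * t :> R by ring.
rewrite powRM ?mulr_ge0 ?pi_ge0 ?(ltW t0)//.
apply: (@le_trans _ _ ((8 * pi) `^ (- (n%:R / 2)) * t `^ (- (n%:R / 2)) *
   expR (- (sq z / (4 * (2 * t)))) * (t `^ a * (C * expR (8^-1 * (1 + sq z / t)))))).
  by rewrite ler_wpM2l// !mulr_ge0 ?powR_ge0 ?expR_ge0.
have -> : t `^ g = t `^ (- (n%:R / 2)) * t `^ a.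
  by rewrite -(powRDp _ _ t0); congr (_ `^ _); rewrite /a; ring.
have -> : 8^-1 * (1 + sq z / t) = 8^-1 + sq z / (4 * (2 * t)) by field; rewrite gt_eqF.
rewrite expRD; have E : expR (- (sq z / (4 * (2 * t)))) * expR (sq z / (4 * (2 * t))) = 1.
  by rewrite -expRD addNr expR0.
rewrite le_eqVlt; apply/orP; left; apply/eqP.
transitivity ((8 * pi) `^ (- (n%:R / 2)) * (C * expR 8^-1) * (t `^ (- (n%:R / 2)) * t `^ a) *
  (expR (- (sq z / (4 * (2 * t)))) * expR (sq z / (4 * (2 * t))))); first by ring.
by rewrite E mulr1.
Qed.

Variables (h : 'rV[R]_n -> R) (y : 'rV[R]_n).
Hypothesis mh : measurable_fun setT h.
Hypothesis h0 : forall z, 0 <= h z.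
Hypothesis lh : forall t : R, 0 < t -> L1 (rnm n) (fun z => heat t (y + z) * h z).

Let measurable_psiy j t : measurable_fun setT (fun z => psi j t (y + z)).
Proof.
have -> : (fun z => psi j t (y + z)) = (fun z => psi j t (z + y)) by apply/funext => z; rewrite addrC.
by apply: measurable_shift_rv; exact: measurable_psi.
Qed.

Lemma L1_psi (j : nat) (t : R) : 0 < t -> L1 (rnm n) (fun z => psi j t (y + z) * h z).
Proof.
move=> t0; have [C C0 HC] := @psi_le R n j.
have t20 : 0 < 2 * t by rewrite mulr_gt0.
apply: (L1_le _ _ (L1Z (C * t^-1 ^+ j) (lh t20))); first exact: measurable_funM.
by move=> z; rewrite normrM (ger0_norm (h0 z)) mulrA ler_wpM2r// HC.
Qed.

(** Differentiation under the integral on t/2 < s < 2t: there the derivative of [psi j] is dominated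
    by a multiple of the heat kernel at time 2s, hence by one at the fixed time 4t. *)
Lemma is_derive_RI_psi (j : nat) (t : R) : 0 < t ->
  is_derive t 1 (fun s => RI (rnm n) (fun z => psi j s (y + z) * h z))
    (- RI (rnm n) (fun z => psi j.+1 t (y + z) * h z)).
Proof.
move=> t0; pose u := t / 2; pose w := 2 * t.
have u0 : 0 < u by rewrite divr_gt0.
have It : (`]u, w[%classic : set R) t by rewrite /= in_itv/= /u /w; apply/andP; split; lra.
pose f (s : R) z := psi j s (y + z) * h z.
have If (s : R) : (`]u, w[%classic : set R) s -> 0 < s.
  by rewrite /= in_itv/= => /andP[us _]; exact: lt_trans us.
have dpsi (s : R) z : 0 < s -> is_derive s 1 (f ^~ z) (- psi j.+1 s (y + z) * h z).
  move=> s0; apply: (is_derive_mul (is_derive_psi j (y + z) s0) (is_derive_cst (h z) s 1)).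
  by rewrite mulr0 addr0.
have dE (s : R) z : 0 < s -> partial1of2 f s z = - psi j.+1 s (y + z) * h z.
  by move=> s0; rewrite partial1of2E; have [_ ->] := dpsi s z s0.
have [C C0 HC] := @psi_le R n j.+1.
pose G z := C * u^-1 ^+ j.+1 * (8 `^ (n%:R / 2)) * (heat (4 * t) (y + z) * h z).
have t40 : 0 < 4 * t by rewrite mulr_gt0.
have G0 z : 0 <= G z.
  rewrite /G; apply: mulr_ge0; last by apply: mulr_ge0; [exact: heat_ge0|exact: h0].
  by rewrite mulr_ge0 ?powR_ge0// mulr_ge0// exprn_ge0// invr_ge0 ltW.
have iG : (rnm n).-integrable setT (EFin \o G) := L1Z _ (lh t40).
have fi (s : R) : (`]u, w[%classic : set R) s -> (rnm n).-integrable setT (EFin \o f s).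
  by move=> /If s0; exact: L1_psi.
have df (s : R) z : (`]u, w[%classic : set R) s -> setT z -> derivable (f ^~ z) s 1.
  by move=> /If s0 _; have [] := dpsi s z s0.
have Gub (s : R) z : (`]u, w[%classic : set R) s -> setT z -> `|partial1of2 f s z| <= G z.
  move=> Is _; have s0 := If s Is; move: Is; rewrite /= in_itv/= => /andP[us sw].
  rewrite dE// normrM normrN (ger0_norm (h0 z)) /G mulrA ler_wpM2r//.
  apply: (le_trans (HC s (y + z) s0)).
  have s20 : 0 < 2 * s by rewrite mulr_gt0.
  have s4 : 2 * s <= 4 * t by rewrite /w in sw; lra.
  have hs := heat_scale_le (y + z) s20 s4.
  rewrite -!(mulrA C); apply: ler_wpM2l => //; rewrite -mulrA; apply: ler_pM.
  - by rewrite exprn_ge0// invr_ge0 ltW.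
  - exact: heat_ge0.
  - by rewrite lerXn2r ?nnegrE ?invr_ge0 ?(ltW s0) ?(ltW u0)// lef_pV2 ?posrE// ltW.
  - apply: (le_trans hs); apply: ler_wpM2r; first exact: heat_ge0.
    apply: ge0_ler_powR; rewrite ?nnegrE ?divr_ge0 ?(ltW t40) ?(ltW s20)//.
    by rewrite ler_pdivrMr//; rewrite /u in us; lra.
have dF := derivable_under_integral measurableT It fi df G0 iG Gub.
have eF := differentiation_under_integral measurableT It fi df G0 iG Gub.
split; first exact: dF.
rewrite -derive1E; transitivity (RI (rnm n) (fun z => partial1of2 f t z)); first exact: eF.
rewrite -RIN; last exact: L1_psi.
by apply: eq_RI => z; rewrite dE// mulNr.
Qed.

End HeatFlow.

Section Semigroup.
Context {R : realType}.
Variable n : nat.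
Implicit Types x y z : 'rV[R]_n.

Lemma L1_heat_heat t u y : 0 < t -> 0 < u -> L1 (rnm n) (fun z => heat t (y + z) * heat u z).
Proof.
move=> t0 u0; have lm : L1 (rnm n) (fun z => heat t (y - z) * heat u z).
  apply: ge0_L1.
  - apply: measurable_funM; last exact: measurable_heat.
    apply: (measurableT_comp (@measurable_heat R n t)).
    have -> : (fun z => y - z) = (fun z => - (z + (- y))) by apply/funext => z; rewrite opprD opprK addrC.
    apply: (measurableT_comp (@measurable_rv_opp R n)); exact: measurable_rv_add.
  - by move=> z; apply: mulr_ge0; exact: heat_ge0.
  - by rewrite heat_conv// ltry.
by apply: (eq_L1 _ (L1_opp lm)) => z; rewrite opprK heatN.
Qed.

(** The case j = 0 is the convolution law of Gaussians; each further index comes from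
    differentiating both sides in t. *)
Lemma psi_semigroup (j : nat) (t u : R) y : 0 < t -> 0 < u ->
  RI (rnm n) (fun z => psi j t (y + z) * heat u z) = psi j (t + u) y.
Proof.
move=> + u0; elim: j t => [|j IH] t t0.
  under eq_RI do rewrite psi0.
  rewrite -(RI_opp (L1_heat_heat y t0 u0)) psi0 addrC; apply: EFin_inj.
  rewrite -(heat_conv y u0 t0) RI_EFin; last exact: L1_opp (L1_heat_heat y t0 u0).
  by apply: eq_integral => z _; rewrite heatN.
have d1 := is_derive_RI_psi (@measurable_heat R n u) (@heat_ge0 R n u) (fun s s0 => L1_heat_heat y s0 u0) j t0.
have tu : 0 < t + u by rewrite addr_gt0.
have d2 : is_derive t 1 (fun s => psi j (s + u) y) (- psi j.+1 (t + u) y).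
  apply: (@is_derive_comp R (fun s => psi j s y) (fun s => s + u) t _ 1 _ (is_derive_psi j y tu)).
    have -> : (fun s : R => s + u) = (fun s => u + s) by apply/funext => s; rewrite addrC.
    exact: is_derive_addl.
  by rewrite mulr1.
have E : \near t, RI (rnm n) (fun z => psi j t (y + z) * heat u z) = psi j (t + u) y.
  near=> s; apply: IH; near: s; exact: lt_nbhsr.
have d3 := near_eq_is_derive E d1.
by apply: oppr_inj; have [_ <-] := d3; have [_ <-] := d2.
Unshelve. all: by end_near. Qed.

End Semigroup.

(** * Testing the equation against the heat kernel *)

Section FracOfTest.
Context {R : realType}.
Notation leb := (@lebesgue_measure R).
Variable n : nat.
Implicit Types x y z : 'rV[R]_n.

Lemma om_lower (a P : R) z : 0 <= a -> 1 + sq z <= P -> 1 <= P `^ a * om a z.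
Proof.
move=> a0 h; have z0 := sq1_gt0 z; have P0 := lt_le_trans z0 h.
rewrite /om powRN -ler_pdivrMr ?invr_gt0 ?powR_gt0// invrK mul1r.
by apply: ge0_ler_powR => //; rewrite nnegrE ltW.
Qed.

(** A function supported in the ball of squared radius r obeys any polynomial weight, at the price
    of a power of 1 + r. *)
Lemma btest_le_om (a : R) l : 0 <= a -> bdeg 1 l -> exists C : R, exists q : nat, 0 <= C /\
  forall r y, 0 < r -> `|btest l r y| <= C * (1 + r) ^+ q * ((1 + r) `^ a * om a y).
Proof.
move=> a0 dl; have [C [q [C0 HC]]] := btest_le n l; exists C, q; split=> // r y r0.
have P0 : 0 <= 1 + r by rewrite addr_ge0// ltW.
have [h|h] := leP r (sq y).
  by rewrite btest_out// normr0 !mulr_ge0 ?exprn_ge0 ?powR_ge0 ?om_ge0.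
apply: (le_trans (HC r y (ltW r0))); rewrite ler_peMr ?mulr_ge0 ?exprn_ge0//.
by apply: om_lower => //; rewrite lerD2l ltW.
Qed.

Lemma powR_le_pow (a : R) (q : nat) (P : R) : 1 <= P -> a <= q%:R -> P `^ a <= P ^+ q.
Proof.
move=> P1 aq; rewrite -powR_mulrn; last by apply: le_trans P1.
exact: ler_powR.
Qed.

(** The factor [om] in y is the decay that pairs with [Ls]. For |z| <= 1 the second difference gains
    |z|^2 and vanishes unless |y|^2 <= 2r + 2. For |z| > 1 the kernel is comparable to the weight at
    z, and when y + z or y - z lies in the ball, Peetre's inequality trades it for the weight at y
    at the cost of a power of 1 + r. *)
Lemma d2_btest_kern_le (g : R) l : 0 < g -> g < 1 -> bdeg 3 l ->
  exists C : R, exists q : nat, 0 <= C /\ forall r y z, 0 < r ->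
  `|d2 (btest l r) z y| * kern g z <= C * (1 + r) ^+ q * om (n%:R / 2 + g) y *
     (3 * (trunc_sq z * kern g z) + (om (n%:R / 2 + g) (y + z) + om (n%:R / 2 + g) (y - z))).
Proof.
move=> g0 g1 dl; set a := n%:R / 2 + g.
have a0 : 0 < a by rewrite ltr_wpDl// divr_ge0.
have [C1 [q1 [C10 H1]]] := btest_le n l.
have [C2 [q2 [C20 H2]]] := d2_btest_le n dl.
pose C3 := C1 + C2; pose q3 := maxn q1 q2.
exists (C3 * 12 `^ a), (q3 + (n + 2))%N; split.
  by rewrite mulr_ge0 ?powR_ge0// addr_ge0.
move=> r y z r0; pose P := 1 + r.
have P1 : 1 <= P by rewrite lerDl ltW.
have P0 : 0 < P by apply: lt_le_trans P1.
pose B := C3 * P ^+ q3.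
have B0 : 0 <= B by rewrite mulr_ge0 ?exprn_ge0 ?addr_ge0// ltW.
have b1 (w : 'rV[R]_n) : `|btest l r w| <= B.
  apply: (le_trans (H1 r w (ltW r0))); apply: (@le_trans _ _ (C1 * P ^+ q3)).
    by rewrite ler_wpM2l// ler_weXn2l ?leq_maxl.
  by rewrite /B ler_wpM2r ?exprn_ge0 ?(ltW P0)// lerDl.
have b2 : `|d2 (btest l r) z y| <= B * sq z.
  apply: (le_trans (H2 r z y (ltW r0))); apply: ler_wpM2r; first exact: sq_ge0.
  apply: (@le_trans _ _ (C2 * P ^+ q3)).
    by rewrite ler_wpM2l// ler_weXn2l ?leq_maxr.
  by rewrite /B ler_wpM2r ?exprn_ge0 ?(ltW P0)// lerDr.
have out (w : 'rV[R]_n) : r <= sq w -> btest l r w = 0 by apply: btest_out; exact: bdegW dl.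
have k0 := kern_ge0 g z; have t0 := trunc_sq_ge0 z.
have oy := om_ge0 a y; have op := om_ge0 a (y + z); have om_ := om_ge0 a (y - z).
pose D := 12 `^ a * (P `^ a * P `^ a).
have Pa1 : 1 <= P `^ a.
  by rewrite -(powRr0 P); apply: ler_powR => //; exact: ltW.
have Pa0 : 0 <= P `^ a by rewrite powR_ge0.
have D3 : 3 `^ a * P `^ a <= D.
  apply: ler_pM; rewrite ?powR_ge0//.
    by apply: ge0_ler_powR => //; rewrite ?nnegrE ?(ltW a0)// ler_nat.
  by rewrite ler_peMl.
have D4 : 4 `^ a * (P `^ a * P `^ a) <= D.
  apply: ler_wpM2r; first by rewrite mulr_ge0.
  by apply: ge0_ler_powR => //; rewrite ?nnegrE ?(ltW a0)// ler_nat.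
have D1 : P `^ a <= D.
  apply: le_trans D3; rewrite ler_peMl// -[leLHS](powRr0 3).
  by apply: ler_powR; [rewrite ler1n|exact: ltW].
have D0 : 0 <= D by apply: le_trans D1.
suff H : `|d2 (btest l r) z y| * kern g z <=
    B * D * om a y * (3 * (trunc_sq z * kern g z) + (om a (y + z) + om a (y - z))).
  apply: (le_trans H); apply: ler_wpM2r.
    by rewrite addr_ge0 ?mulr_ge0// addr_ge0.
  apply: ler_wpM2r => //.
  have PP : P `^ a * P `^ a <= P ^+ (n + 2).
    rewrite -(powRDp _ _ P0); apply: powR_le_pow => //.
    rewrite natrD /a; have -> : n%:R / 2 + g + (n%:R / 2 + g) = n%:R + 2 * g :> R by field.
    by rewrite lerD2l; lra.
  rewrite /B /D exprD -/P.
  have -> : C3 * P ^+ q3 * (12 `^ a * (P `^ a * P `^ a)) =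
    C3 * 12 `^ a * (P ^+ q3 * (P `^ a * P `^ a)) by ring.
  apply: ler_wpM2l; first by rewrite mulr_ge0 ?powR_ge0// addr_ge0.
  by rewrite ler_wpM2l ?exprn_ge0// ltW.
clearbody B D.
have [z1|z1] := leP (sq z) 1.
  have [far|near_] := ltP (2 * r + 2) (sq y).
    have e (w : 'rV[R]_n) : sq w <= 1 -> btest l r (y + w) = 0.
      move=> w1; apply: out; have := sqD_le (y + w) (- w); rewrite addrK sqN.
      by lra.
    rewrite /d2 e// (e (- z)) ?sqN//.
    have := e 0; rewrite sq00 addr0 => ->//.
    rewrite mulr0 !subr0 normr0 mul0r; apply: mulr_ge0; first by rewrite !mulr_ge0.
    by apply: addr_ge0; [rewrite !mulr_ge0|exact: addr_ge0].
  have o1 : 1 <= D * om a y.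
    apply: (@le_trans _ _ ((3 * P) `^ a * om a y)).
      by apply: om_lower; [exact: ltW|rewrite /P; lra].
    by apply: ler_wpM2r => //; rewrite powRM// ltW.
  apply: (@le_trans _ _ (B * (D * om a y) * (trunc_sq z * kern g z))).
    rewrite mulrA; apply: ler_wpM2r => //.
    rewrite /trunc_sq min_r//; apply: (le_trans b2); apply: ler_wpM2r; first exact: sq_ge0.
    by rewrite ler_peMr.
  have -> : B * (D * om a y) = B * D * om a y by ring.
  apply: ler_wpM2l; first by rewrite !mulr_ge0.
  have : 0 <= trunc_sq z * kern g z by rewrite mulr_ge0.
  by move: (trunc_sq z * kern g z) => c c0; lra.
have tE : trunc_sq z = 1 by rewrite /trunc_sq min_l// ltW.
have bo (w : 'rV[R]_n) : `|btest l r w| <= B * (P `^ a * om a w).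
  have [h|h] := leP r (sq w).
    by rewrite out// normr0 !mulr_ge0 ?om_ge0.
  apply: (le_trans (b1 w)); rewrite ler_peMr// om_lower// ?(ltW a0)//.
  by rewrite lerD2l ltW.
have far (w : 'rV[R]_n) : sq w = sq z -> `|btest l r (y + w)| * kern g z <= B * D * om a y * om a (y + w).
  move=> wz; have [h|h] := leP r (sq (y + w)).
    by rewrite out// normr0 mul0r !mulr_ge0 ?om_ge0.
  have kz : kern g z <= 4 `^ a * P `^ a * om a y.
    apply: (le_trans (@kern_le_om R n g 1 z a0 ltr01 (ltW z1))); rewrite invr1 -/a.
    have -> : om a z = om a w by rewrite /om wz.
    apply: (@le_trans _ _ ((1 + 1) `^ a * (2 `^ a * (1 + sq (y + w)) `^ a * om a y))).
      by rewrite ler_wpM2l ?powR_ge0// om_peetre// ltW.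
    have -> : 4 `^ a = (1 + 1) `^ a * 2 `^ a :> R.
      by rewrite -powRM ?addr_ge0//; congr (_ `^ _); ring.
    rewrite !mulrA; apply: ler_wpM2r => //; apply: ler_wpM2l; first by rewrite mulr_ge0 ?powR_ge0.
    apply: ge0_ler_powR; rewrite ?nnegrE ?(ltW a0) ?(ltW (sq1_gt0 _)) ?(ltW P0)//.
    by rewrite lerD2l ltW.
  apply: (@le_trans _ _ (B * (P `^ a * om a (y + w)) * (4 `^ a * P `^ a * om a y))).
    by apply: ler_pM.
  have -> : B * (P `^ a * om a (y + w)) * (4 `^ a * P `^ a * om a y) =
    4 `^ a * (P `^ a * P `^ a) * (B * om a y * om a (y + w)) by ring.
  have -> : B * D * om a y * om a (y + w) = D * (B * om a y * om a (y + w)) by ring.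
  by apply: ler_wpM2r => //; rewrite !mulr_ge0 ?om_ge0.
have fp := far z erefl; have fm := far (- z) (sqN z).
have mid : `|btest l r y| * kern g z <= B * D * om a y * kern g z.
  apply: ler_wpM2r => //; apply: (le_trans (bo y)); rewrite -mulrA ler_wpM2l//.
  by rewrite ler_wpM2r.
have tri : `|d2 (btest l r) z y| <= 2 * `|btest l r y| + `|btest l r (y + z)| + `|btest l r (y - z)|.
  rewrite /d2; apply: (le_trans (ler_normB _ _)); rewrite lerD2r.
  by apply: (le_trans (ler_normB _ _)); rewrite lerD2r normrM ger0_norm.
apply: (le_trans (ler_wpM2r k0 tri)); rewrite tE.
have mk : 0 <= B * D * om a y * kern g z by rewrite !mulr_ge0.
have -> : (2 * `|btest l r y| + `|btest l r (y + z)| + `|btest l r (y - z)|) * kern g z =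
  2 * (`|btest l r y| * kern g z) + `|btest l r (y + z)| * kern g z + `|btest l r (y - z)| * kern g z.
  by ring.
have -> : B * D * om a y * (3 * (1 * kern g z) + (om a (y + z) + om a (y - z))) =
  3 * (B * D * om a y * kern g z) + B * D * om a y * om a (y + z) + B * D * om a y * om a (y - z).
  by ring.
by lra.
Qed.

End FracOfTest.

(** * Superposing the tested equation over all radii *)

Section SuperposeTests.
Context {R : realType}.
Notation leb := (@lebesgue_measure R).
Variable n : nat.
Implicit Types x y z : 'rV[R]_n.

Lemma ge0_le_lty d (T : measurableType d) (mu : {measure set T -> \bar R}) (f : T -> \bar R) (g : T -> R) :
  measurable_fun setT f -> (forall s, (0 <= f s)%E) -> (forall s, (f s <= (g s)%:E)%E) ->
  L1 mu g -> (\int[mu]_s f s < +oo)%E.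
Proof.
move=> mf f0 fg lg; apply: le_lt_trans (L1_lty (L1_norm lg)).
apply: ge0_le_integral => //.
- by apply/measurable_EFinP; do 2 apply: measurableT_comp => //; exact: L1_measurable lg.
- by move=> y _; apply: (le_trans (fg y)); rewrite lee_fin normr_id; exact: ler_norm.
Qed.

Lemma fubini_lty d1 d2 (T1 : measurableType d1) (T2 : measurableType d2)
  (m1 : {sigma_finite_measure set T1 -> \bar R}) (m2 : {sigma_finite_measure set T2 -> \bar R})
  (F : T1 -> T2 -> R) (g : T1 -> R) :
  measurable_fun setT (fun s : T1 * T2 => F s.1 s.2) -> (forall s, L1 m2 (F s)) ->
  (forall s, RI m2 (fun u => `|F s u|) <= g s) -> L1 m1 g ->
  (\int[m1]_s \int[m2]_u `|F s u|%:E < +oo)%E.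
Proof.
move=> mF lF Fg lg; apply: (ge0_le_lty _ _ _ lg).
- apply: (@measurable_fun_fubini_tonelli_F _ _ _ _ R m2 (fun s => `|F s.1 s.2|%:E)) => //.
  by apply/measurable_EFinP; exact: measurableT_comp.
- by move=> s; apply: integral_ge0.
- by move=> s; rewrite -(RI_EFin (L1_norm (lF s))) lee_fin.
Qed.

Variables (F v : 'rV[R]_n -> R) (a t : R) (m : nat) (x : 'rV[R]_n) (L : R -> 'rV[R]_n -> R).
Let b := (4 * t)^-1.
Hypotheses (t0 : 0 < t) (mF : measurable_fun setT F) (F0 : forall y, 0 <= F y).
Hypotheses (bF : locally_bounded F) (mv : measurable_fun setT v) (v0 : forall y, 0 <= v y).
Hypothesis lv : L1 (rnm n) (fun y => v (x + y) * om a y).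
Hypothesis HL : forall r, 0 < r ->
  RI (rnm n) (fun y => F (x + y) * btest (psil n m t) r y) = RI (rnm n) (fun y => v (x + y) * L r y).
Hypothesis mL : measurable_fun setT (fun s : R * 'rV[R]_n => L s.1 s.2).
Hypothesis bL : exists C : R, exists q : nat, 0 <= C /\
  forall r y, 0 < r -> `|L r y| <= C * (1 + r) ^+ q * om a y.

Let b0 : 0 < b. Proof. by rewrite invr_gt0 mulr_gt0. Qed.

Let mxF : measurable_fun setT (fun y => F (x + y)).
Proof. by under eq_fun do rewrite addrC; exact: measurable_shift_rv mF. Qed.

Let mxv : measurable_fun setT (fun y => v (x + y)).
Proof. by under eq_fun do rewrite addrC; exact: measurable_shift_rv mv. Qed.

Let ewtE r : r <= 0 -> ewt b r = 0.
Proof. by move=> r0; rewrite /ewt ltNge r0. Qed.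

Let L1_vL r : 0 < r -> L1 (rnm n) (fun y => v (x + y) * L r y).
Proof.
move=> r0; have [C [q [C0 HC]]] := bL.
apply: (L1_le _ _ (L1Z (C * (1 + r) ^+ q) lv)).
  apply: measurable_funM => //; exact: (measurableT_comp mL (g := fun y : 'rV[R]_n => (r, y)) (measurable_pair1 r)).
by move=> y; rewrite normrM (ger0_norm (v0 _)) mulrCA ler_wpM2l// HC.
Qed.

Let btest_ge0 r y : 0 <= btest (psil n m t) r y.
Proof.
rewrite /btest big_cons big_nil addr0 /bterm/= mulr1; apply: mulr_ge0; last exact: bump_ge0.
rewrite divr_ge0 ?powR_ge0// /gk divr_ge0// exprn_ge0// ltW//.
Qed.

Let L1_Fb r : 0 < r -> L1 (rnm n) (fun y => F (x + y) * btest (psil n m t) r y).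
Proof.
move=> r0; have [C [q [C0 HC]]] := btest_le n (psil n m t).
apply: (@L1_loc R n _ _ (C * (1 + r) ^+ q) r 0) => //.
- have -> : (fun y => F (x + y)) = (fun y => F (y + x)) by apply/funext => y; rewrite addrC.
  exact: locally_bounded_shift.
- exact: measurable_btest.
- by move=> y; apply: HC; exact: ltW.
- by move=> y; rewrite subr0 => h; apply: btest_out; [rewrite /= addn3|exact: ltW].
Qed.

(** Nothing is assumed on the growth of [F]. But [F] and the bumps are nonnegative, so the integral
    of |G1 r| is that of G1 r, which the equation equates with the [v] side; the bound there
    justifies Fubini on both sides and yields the integrability of [F] against the heat kernel. *)
Lemma superpose_tests : L1 (rnm n) (fun y => F (x + y) * heat t y) /\
  RI (rnm n) (fun y => F (x + y) * heat t y) =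
  RI (rnm n) (fun y => v (x + y) * RI leb (fun r => ewt b r * L r y)).
Proof.
have [C [q [C0 HC]]] := bL.
pose V := RI (rnm n) (fun y => v (x + y) * om a y).
have V0 : 0 <= V by apply: RI_ge0 => y; rewrite mulr_ge0 ?om_ge0.
pose G1 r y := ewt b r * (F (x + y) * btest (psil n m t) r y).
pose G2 r y := ewt b r * (v (x + y) * L r y).
have m1 : measurable_fun setT (fun s : R * 'rV[R]_n => ewt b s.1).
  by apply: (measurableT_comp (@measurable_ewt R b)); exact: measurable_fst.
have mG1 : measurable_fun setT (fun s : R * 'rV[R]_n => G1 s.1 s.2).
  apply: measurable_funM => //; apply: measurable_funM; last exact: measurable_btest2.
  by apply: (measurableT_comp mxF); exact: measurable_snd.
have mG2 : measurable_fun setT (fun s : R * 'rV[R]_n => G2 s.1 s.2).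
  apply: measurable_funM => //; apply: measurable_funM => //.
  by apply: (measurableT_comp mxv); exact: measurable_snd.
have lG1 r : L1 (rnm n) (G1 r).
  have [r0|r0] := leP r 0; last by apply: L1Z; exact: L1_Fb.
  by apply: (eq_L1 _ (L1_0 _)) => y; rewrite /G1 ewtE// mul0r.
have lG2 r : L1 (rnm n) (G2 r).
  have [r0|r0] := leP r 0; last by apply: L1Z; exact: L1_vL.
  by apply: (eq_L1 _ (L1_0 _)) => y; rewrite /G2 ewtE// mul0r.
have lw : L1 leb (fun r => (C * V) * (ewt b r * (1 + r) ^+ q)) by apply: L1Z; exact: L1_ewt_poly.
have vL r : 0 < r -> RI (rnm n) (fun y => `|v (x + y) * L r y|) <= C * (1 + r) ^+ q * V.
  move=> r0; rewrite /V -(RIZ _ lv); apply: le_RI; [exact/L1_norm/L1_vL|exact: L1Z|].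
  by move=> y; rewrite normrM (ger0_norm (v0 _)) mulrCA ler_wpM2l// HC.
have G12 r : RI (rnm n) (G1 r) = RI (rnm n) (G2 r).
  have [r0|r0] := leP r 0; last by rewrite (RIZ _ (L1_Fb r0)) (RIZ _ (L1_vL r0)) HL.
  by apply: eq_RI => y; rewrite /G1 /G2 ewtE// !mul0r.
have bG2 r : RI (rnm n) (fun y => `|G2 r y|) <= (C * V) * (ewt b r * (1 + r) ^+ q).
  have [r0|r0] := leP r 0.
    rewrite ewtE// mul0r mulr0 -[leRHS](RI_0 (rnm n)) le_eqVlt; apply/orP; left; apply/eqP.
    by apply: eq_RI => y; rewrite /G2 ewtE// mul0r normr0.
  have -> : RI (rnm n) (fun y => `|G2 r y|) = ewt b r * RI (rnm n) (fun y => `|v (x + y) * L r y|).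
    rewrite -(RIZ _ (L1_norm (L1_vL r0))); apply: eq_RI => y.
    by rewrite normrM ger0_norm ?ewt_ge0.
  have -> : C * V * (ewt b r * (1 + r) ^+ q) = ewt b r * (C * (1 + r) ^+ q * V) by ring.
  by rewrite ler_wpM2l ?ewt_ge0// vL.
have i2 := @fubini_lty _ _ _ _ leb (rnm n) G2 _ mG2 lG2 bG2 lw.
(* The bound for the [v] side is transferred to the [F] side by positivity and the tested
   equation. *)
have bG1 r : RI (rnm n) (fun y => `|G1 r y|) <= (C * V) * (ewt b r * (1 + r) ^+ q).
  have -> : RI (rnm n) (fun y => `|G1 r y|) = RI (rnm n) (G1 r).
    by apply: eq_RI => y; rewrite ger0_norm// /G1 mulr_ge0 ?ewt_ge0// mulr_ge0.
  rewrite G12; apply: le_trans (bG2 r).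
  apply: (le_trans (ler_norm _)); apply: (norm_RI_le _ _ (L1_norm (lG2 r))) => //.
  exact: L1_measurable (lG2 r).
have i1 := @fubini_lty _ _ _ _ leb (rnm n) G1 _ mG1 lG1 bG1 lw.
have E1 y : RI leb (fun r => G1 r y) = F (x + y) * heat t y.
  rewrite -psi0 -(psi_superpos y t0 (leq0n m)) -(RIZ _ (L1_btest_exp b0 (psil n m t) y)).
  by apply: eq_RI => r; rewrite /G1 mulrCA.
have E2 y : RI leb (fun r => G2 r y) = v (x + y) * RI leb (fun r => ewt b r * L r y).
  rewrite -RIZ; first by apply: eq_RI => r; rewrite /G2 mulrCA.
  apply: (L1_le _ _ (L1Z (C * om a y) (L1_ewt_poly b0 q))).
    apply: measurable_funM; first exact: measurable_ewt.
    exact: (measurableT_comp mL (g := fun r : R => (r, y)) (measurable_pair2 y)).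
  move=> r; rewrite normrM ger0_norm ?ewt_ge0//.
  have [r0|r0] := leP r 0; first by rewrite ewtE// !mul0r mulr0.
  rewrite mulrCA ler_wpM2l ?ewt_ge0//; apply: (le_trans (HC r y r0)).
  by rewrite le_eqVlt; apply/orP; left; apply/eqP; ring.
have s1 : measurable_fun setT (fun s : 'rV[R]_n * R => G1 s.2 s.1).
  by apply: (measurableT_comp mG1 (g := fun s : 'rV[R]_n * R => (s.2, s.1))); exact: measurable_fun_pair.
split.
  apply: (eq_L1 E1); apply: (@L1_RI _ _ _ _ _ (rnm n) leb (fun y r => G1 r y)) => //.
  exact: (@fubini_swap_lty _ _ _ _ _ leb (rnm n) G1 mG1 i1).
transitivity (RI (rnm n) (fun y => RI leb (fun r => G1 r y))).
  by apply: eq_RI => y; rewrite E1.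
rewrite -(@RI_fubini _ _ _ _ _ leb (rnm n) G1 mG1 i1).
have -> : RI leb (fun r => RI (rnm n) (G1 r)) = RI leb (fun r => RI (rnm n) (G2 r)) by apply: eq_RI.
rewrite (@RI_fubini _ _ _ _ _ leb (rnm n) G2 mG2 i2).
by apply: eq_RI => y; rewrite E2.
Qed.

End SuperposeTests.

(** * Fractional Laplacian of bumps and its superposition *)

Section FracOfPsi.
Context {R : realType}.
Notation leb := (@lebesgue_measure R).
Variables (n : nat) (g : R).
Hypotheses (g0 : 0 < g) (g1 : g < 1).
Implicit Types x y z : 'rV[R]_n.
Let a := n%:R / 2 + g.

Let a_gt0 : 0 < a.
Proof. by rewrite ltr_wpDl// divr_ge0. Qed.

(* The fractional Laplacian as an absolutely convergent integral of second differences. *)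
Definition fracL (u : 'rV[R]_n -> R) y : R :=
  C_frac n g * (2^-1 * RI (rnm n) (fun z => d2 u z y * kern g z)).

Lemma measurable_d2btest l : measurable_fun setT
  (fun s : (R * 'rV[R]_n) * 'rV[R]_n => d2 (btest l s.1.1) s.2 s.1.2).
Proof.
have m11 : measurable_fun setT (fun s : (R * 'rV[R]_n) * 'rV[R]_n => s.1.1).
  by apply: (measurableT_comp measurable_fst); exact: measurable_fst.
have m12 : measurable_fun setT (fun s : (R * 'rV[R]_n) * 'rV[R]_n => s.1.2).
  by apply: (measurableT_comp measurable_snd); exact: measurable_fst.
have m2 : measurable_fun setT (fun s : (R * 'rV[R]_n) * 'rV[R]_n => s.2) by exact: measurable_snd.
have H (f : (R * 'rV[R]_n) * 'rV[R]_n -> 'rV[R]_n) : measurable_fun setT f ->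
    measurable_fun setT (fun s => btest l s.1.1 (f s)).
  move=> mf; apply: (measurableT_comp (@measurable_btest2 R n l) (g := fun s => (s.1.1, f s))).
  exact: measurable_fun_pair.
apply: measurable_funB; first apply: measurable_funB.
- by apply: measurable_funM => //; exact: H.
- apply: H; apply: (measurableT_comp (@measurable_addrv2 R n) (g := fun s => (s.1.2, s.2))).
  exact: measurable_fun_pair.
- apply: H; apply: (measurableT_comp (@measurable_subrv2 R n) (g := fun s => (s.1.2, s.2))).
  exact: measurable_fun_pair.
Qed.

Lemma d2_btest_kern l : bdeg 3 l -> exists C : R, exists q : nat, 0 <= C /\ forall r y, 0 < r ->
  L1 (rnm n) (fun z => d2 (btest l r) z y * kern g z) /\
  RI (rnm n) (fun z => `|d2 (btest l r) z y * kern g z|) <= C * (1 + r) ^+ q * om a y.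
Proof.
move=> dl; have [C [q [C0 HC]]] := d2_btest_kern_le n g0 g1 dl.
have lk : L1 (rnm n) (fun z => trunc_sq z * kern g z).
  apply: ge0_L1; [|by move=> z; rewrite mulr_ge0 ?trunc_sq_ge0 ?kern_ge0|exact: integral_trunc_kern].
  by apply: measurable_funM; [exact: measurable_trunc_sq|exact: measurable_kern].
have lo := L1_om n g0 g1.
have lop y : L1 (rnm n) (fun z => om a (y + z)).
  by apply: (eq_L1 _ (L1_shift y lo)) => z; rewrite (addrC y z).
have lom y : L1 (rnm n) (fun z => om a (y - z)) by apply: (eq_L1 _ (L1_opp (lop y))).
have op y : RI (rnm n) (fun z => om a (y + z)) = RI (rnm n) (om a).
  by rewrite -(RI_shift y lo); apply: eq_RI => z; rewrite (addrC y z).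
have om_ y : RI (rnm n) (fun z => om a (y - z)) = RI (rnm n) (om a).
  by rewrite -(op y) -(RI_opp (lop y)).
pose T := RI (rnm n) (fun z => trunc_sq z * kern g z); pose O := RI (rnm n) (@om R n a).
have T0 : 0 <= T by apply: RI_ge0 => z; rewrite mulr_ge0 ?trunc_sq_ge0 ?kern_ge0.
have O0 : 0 <= O by apply: RI_ge0 => z; exact: om_ge0.
exists (C * (3 * T + (O + O))), q; split.
  by rewrite mulr_ge0// addr_ge0 ?mulr_ge0// addr_ge0.
move=> r y r0; have l3 := L1Z 3 lk; have l2 := L1D (lop y) (lom y).
have lG := L1Z (C * (1 + r) ^+ q * om a y) (L1D l3 l2).
have mf : measurable_fun setT (fun z => d2 (btest l r) z y * kern g z).
  apply: measurable_funM; last exact: measurable_kern.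
  exact: (measurableT_comp (measurable_d2btest l) (g := fun z : 'rV[R]_n => ((r, y), z)) (measurable_pair1 (r, y))).
have le z : `|d2 (btest l r) z y * kern g z| <= C * (1 + r) ^+ q * om a y *
    (3 * (trunc_sq z * kern g z) + (om a (y + z) + om a (y - z))).
  by rewrite normrM (ger0_norm (kern_ge0 _ _)); exact: HC.
have lf := L1_le mf le lG; split => //.
apply: (le_trans (le_RI (L1_norm lf) lG le)).
rewrite (RIZ _ (L1D l3 l2)) (RID l3 l2) (RIZ _ lk) (RID (lop y) (lom y)) op om_ -/T -/O.
by rewrite le_eqVlt; apply/orP; left; apply/eqP; ring.
Qed.

Section FixedTime.
Variables (t : R) (m : nat).
Hypothesis t0 : 0 < t.
Let b := (4 * t)^-1.
Let b0 : 0 < b. Proof. by rewrite invr_gt0 mulr_gt0. Qed.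
Let l := iter m (bneglap n) (psil n m t).
Let dl : bdeg 3 l.
Proof. by apply: bdeg_iter; exact: psil_deg. Qed.

Let H3 y (r : R) z := ewt b r * (d2 (btest l r) z y * kern g z).

Let mH3 y : measurable_fun setT (fun s : R * 'rV[R]_n => H3 y s.1 s.2).
Proof.
apply: measurable_funM.
  by apply: (measurableT_comp (@measurable_ewt R b)); exact: measurable_fst.
apply: measurable_funM; last by apply: (measurableT_comp (@measurable_kern R n g)); exact: measurable_snd.
apply: (measurableT_comp (measurable_d2btest l) (g := fun s : R * 'rV[R]_n => ((s.1, y), s.2))).
by apply: measurable_fun_pair => //; exact: measurable_fun_pair.
Qed.

Let ewtE r : r <= 0 -> ewt b r = 0.
Proof. by move=> r0; rewrite /ewt ltNge r0. Qed.

Lemma fracL_btest_bound : exists C : R, exists q : nat, 0 <= C /\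
  forall r y, 0 < r -> `|fracL (btest l r) y| <= C * (1 + r) ^+ q * om a y.
Proof.
have [C [q [C0 HC]]] := d2_btest_kern dl.
exists (C_frac n g * (2^-1 * C)), q.
have c0 := C_frac_gt0 n g0 g1.
split; first by apply: mulr_ge0; [exact: ltW|rewrite mulr_ge0].
move=> r y r0; have [l1 h1] := HC r y r0.
rewrite /fracL; move: (C_frac n g) c0 => c c0.
rewrite (normrM c) (normrM 2^-1) (ger0_norm (ltW c0)) (ger0_norm (x := 2^-1))// -!mulrA.
rewrite ler_wpM2l ?(ltW c0)// ler_wpM2l// mulrA; apply: le_trans h1.
by apply: norm_RI_le => //; [exact: L1_measurable l1|exact: L1_norm].
Qed.

Let H3_L1 y r : L1 (rnm n) (H3 y r).
Proof.
have [C [q [C0 HC]]] := d2_btest_kern dl.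
have [r0|r0] := leP r 0; last by apply: L1Z; exact: (HC r y r0).1.
by apply: (eq_L1 _ (L1_0 _)) => z; rewrite /H3 ewtE// mul0r.
Qed.

Let H3_bound : exists2 C : R, 0 <= C & forall y,
  (\int[leb]_r \int[rnm n]_z `|H3 y r z|%:E < +oo)%E /\
  RI leb (fun r => RI (rnm n) (fun z => `|H3 y r z|)) <= C * om a y.
Proof.
have [C [q [C0 HC]]] := d2_btest_kern dl.
have lw := L1_ewt_poly b0 q.
have w0 : 0 <= RI leb (fun r => ewt b r * (1 + r) ^+ q).
  apply: RI_ge0 => r; rewrite /ewt; case: ltP => r0; last by rewrite mul0r.
  by rewrite mulr_ge0 ?expR_ge0// exprn_ge0// addr_ge0// ltW.
exists (C * RI leb (fun r => ewt b r * (1 + r) ^+ q)); first by rewrite mulr_ge0.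
move=> y.
have le r : RI (rnm n) (fun z => `|H3 y r z|) <= (C * om a y) * (ewt b r * (1 + r) ^+ q).
  have [r0|r0] := leP r 0.
    rewrite ewtE// mul0r mulr0 -[leRHS](RI_0 (rnm n)) le_eqVlt; apply/orP; left; apply/eqP.
    by apply: eq_RI => z; rewrite /H3 ewtE// mul0r normr0.
  have -> : RI (rnm n) (fun z => `|H3 y r z|) = ewt b r * RI (rnm n) (fun z => `|d2 (btest l r) z y * kern g z|).
    rewrite -(RIZ _ (L1_norm (HC r y r0).1)); apply: eq_RI => z.
    by rewrite normrM ger0_norm ?ewt_ge0.
  have -> : C * om a y * (ewt b r * (1 + r) ^+ q) = ewt b r * (C * (1 + r) ^+ q * om a y) by ring.
  by rewrite ler_wpM2l ?ewt_ge0// (HC r y r0).2.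
have i3 := @fubini_lty R _ _ _ _ leb (rnm n) (H3 y) _ (mH3 y) (H3_L1 y) le (L1Z _ lw).
split=> //.
have -> : C * RI leb (fun r => ewt b r * (1 + r) ^+ q) * om a y =
   RI leb (fun r => C * om a y * (ewt b r * (1 + r) ^+ q)) by rewrite (RIZ _ lw); ring.
apply: le_RI => //; last exact: L1Z.
apply: (@L1_RI _ _ _ _ _ leb (rnm n) (fun r z => `|H3 y r z|)).
  exact: measurableT_comp (mH3 y).
by under eq_integral do under eq_integral do rewrite normr_id.
Qed.

Let RI_H3 y z : RI leb (fun r => H3 y r z) = d2 (psi m t) z y * kern g z.
Proof.
have lb w := L1_btest_exp b0 l (w : 'rV[R]_n).
have E w : RI leb (fun r => ewt b r * btest l r (w : 'rV[R]_n)) = psi m t w.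
  exact: psi_superpos.
have [l1 e1] := @RI_d2 R n _ _ leb (fun r w => ewt b r * btest l r w) z y lb.
rewrite -(funext E) e1 mulrC -(RIZ _ l1); apply: eq_RI => r.
by rewrite /H3 /d2; ring.
Qed.

(** Fubini in the radius and z, with absolute convergence from [d2_btest_kern], whose constants grow
    polynomially in the radius. *)
Lemma fracL_psi_superpos y : RI leb (fun r => ewt b r * fracL (btest l r) y) = fracL (psi m t) y.
Proof.
have [C C0 HC] := H3_bound; have [i3 _] := HC y.
rewrite /fracL.
have -> : (fun z => d2 (psi m t) z y * kern g z) = (fun z => RI leb (fun r => H3 y r z)).
  by apply/funext => z; rewrite RI_H3.
rewrite -(@RI_fubini _ _ _ _ _ leb (rnm n) (H3 y) (mH3 y) i3).
have l1 := @L1_RI _ _ _ _ _ leb (rnm n) (H3 y) (mH3 y) i3.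
rewrite mulrA -(RIZ _ l1); apply: eq_RI => r.
have [C' [q [C0' HC']]] := d2_btest_kern dl.
have [r0|r0] := leP r 0.
  rewrite ewtE// mul0r.
  have -> : RI (rnm n) (H3 y r) = 0.
    by rewrite -[RHS](RI_0 (rnm n)); apply: eq_RI => z; rewrite /H3 ewtE// mul0r.
  by rewrite mulr0.
by rewrite /H3 (RIZ _ (HC' r y r0).1); ring.
Qed.

(** The weighted bounds for bumps, integrated over the radius, pass to [psi]; no separate analysis
    of the Gaussian is needed. *)
Lemma d2_psi_kern : exists2 C : R, 0 <= C & forall y,
  L1 (rnm n) (fun z => d2 (psi m t) z y * kern g z) /\
  RI (rnm n) (fun z => `|d2 (psi m t) z y * kern g z|) <= C * om a y.
Proof.
have [C C0 HC] := H3_bound; exists C => // y; have [i3 h3] := HC y.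
have mH : measurable_fun setT (fun s : 'rV[R]_n * R => H3 y s.2 s.1).
  by apply: (measurableT_comp (mH3 y) (g := fun s : 'rV[R]_n * R => (s.2, s.1))); exact: measurable_fun_pair.
have i3' := @fubini_swap_lty _ _ _ _ _ leb (rnm n) (H3 y) (mH3 y) i3.
have l1 : L1 (rnm n) (fun z => d2 (psi m t) z y * kern g z).
  by apply: (eq_L1 (RI_H3 y)); exact: (@L1_RI _ _ _ _ _ (rnm n) leb (fun z r => H3 y r z)).
split=> //; apply: le_trans h3.
have mN : measurable_fun setT (fun s : R * 'rV[R]_n => `|H3 y s.1 s.2|).
  exact: measurableT_comp (mH3 y).
have iN : (\int[leb]_r \int[rnm n]_z `| `|H3 y r z| |%:E < +oo)%E.
  by under eq_integral do under eq_integral do rewrite normr_id.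
rewrite (@RI_fubini _ _ _ _ _ leb (rnm n) (fun r z => `|H3 y r z|) mN iN).
apply: le_RI; first exact: L1_norm.
  apply: (@L1_RI _ _ _ _ _ (rnm n) leb (fun z r => `|H3 y r z|)).
    exact: measurableT_comp mH.
  exact: (@fubini_swap_lty _ _ _ _ _ leb (rnm n) (fun r z => `|H3 y r z|) mN iN).
move=> z; rewrite -RI_H3.
have lz : L1 leb (fun r => H3 y r z).
  have lb w := L1_btest_exp b0 l (w : 'rV[R]_n).
  have [l2 _] := @RI_d2 R n _ _ leb (fun r w => ewt b r * btest l r w) z y lb.
  by apply: (eq_L1 _ (L1Z (kern g z) l2)) => r; rewrite /H3 /d2; ring.
by apply: norm_RI_le => //; [exact: L1_measurable lz|exact: L1_norm].
Qed.

End FixedTime.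
End FracOfPsi.

(** * The singular integral as a Marchaud derivative in time *)

Section FracOfPsi.
Context {R : realType}.
Notation leb := (@lebesgue_measure R).
Variables (n : nat) (g : R).
Hypotheses (g0 : 0 < g) (g1 : g < 1).
Implicit Types x y z : 'rV[R]_n.
Let a := n%:R / 2 + g.
Let k := g / Gamma (1 - g).

Let k_gt0 : 0 < k.
Proof. by rewrite divr_gt0// Gamma_gt0// subr_gt0. Qed.

Lemma d20 (u : 'rV[R]_n -> R) y : d2 u 0 y = 0.
Proof. by rewrite /d2 addr0 subr0; ring. Qed.

Lemma L1_heat (t : R) : 0 < t -> L1 (rnm n) (heat t : 'rV[R]_n -> R).
Proof.
move=> t0; apply: ge0_L1; [exact: measurable_heat|exact: heat_ge0|].
by rewrite heat_int// ltry.
Qed.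

Lemma RI_heat (t : R) : 0 < t -> RI (rnm n) (heat t : 'rV[R]_n -> R) = 1.
Proof. by move=> t0; apply: EFin_inj; rewrite RI_EFin ?heat_int//; exact: L1_heat. Qed.

Lemma RI_hpow_heat z : z != 0 ->
  L1 leb (fun s => hpow (- g) s * heat s z) /\
  k * RI leb (fun s => hpow (- g) s * heat s z) = C_frac n g * kern g z.
Proof.
move=> z0; have := kern_heat g0 g1 z0; rewrite -/k.
have -> : (\int[leb]_(t in `]0%R, +oo[) (t `^ (- g - 1) * heat t z)%:E =
    \int[leb]_t (hpow (- g) t * heat t z)%:E)%E.
  under [RHS]eq_integral do rewrite EFinM.
  by rewrite integral_hpow; under [RHS]eq_integral do rewrite -EFinM.
have m1 : measurable_fun setT (fun s => hpow (- g) s * heat s z).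
  exact: (measurableT_comp (@heat_power_measurable R n (- g)) (measurable_pair2 z)).
have p1 s : 0 <= hpow (- g) s * heat s z by rewrite mulr_ge0 ?hpow_ge0 ?heat_ge0.
move=> E; have lt : (\int[leb]_t (hpow (- g) t * heat t z)%:E < +oo)%E.
  rewrite ltey; apply/eqP => h; move: E; rewrite h gt0_muley// lte_fin//.
have l1 := @ge0_L1 R _ _ leb _ m1 p1 lt; split => //.
by apply: EFin_inj; rewrite EFinM RI_EFin// E.
Qed.

Section FixedTime.
Variables (t : R) (m : nat).
Hypothesis t0 : 0 < t.

Let H4 y z (s : R) := d2 (psi m t) z y * (hpow (- g) s * heat s z).

Let mH4 y : measurable_fun setT (fun u : 'rV[R]_n * R => H4 y u.1 u.2).
Proof.
apply: measurable_funM.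
  by apply: (measurableT_comp (measurable_d2_2 (measurable_psi m t)) (g := fun u : 'rV[R]_n * R => (u.1, y))); apply: measurable_fun_pair => //; exact: measurable_fst.
apply: (measurableT_comp (@heat_power_measurable R n (- g)) (g := fun u : 'rV[R]_n * R => (u.2, u.1))).
by apply: measurable_fun_pair; [exact: measurable_snd|exact: measurable_fst].
Qed.

Let H4_L1 y z : L1 leb (H4 y z).
Proof.
have [->|z0] := eqVneq z 0; last by apply: L1Z; exact: (RI_hpow_heat z0).1.
by apply: (eq_L1 _ (L1_0 _)) => s; rewrite /H4 d20 mul0r.
Qed.

Let RI_H4 y z : RI leb (H4 y z) = C_frac n g / k * (d2 (psi m t) z y * kern g z).
Proof.
have [->|z0] := eqVneq z 0.
  rewrite d20 mul0r mulr0 -[RHS](RI_0 leb); apply: eq_RI => s.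
  by rewrite /H4 d20 mul0r.
have [l1 e] := RI_hpow_heat z0.
rewrite /H4 (RIZ _ l1).
have -> : C_frac n g / k * (d2 (psi m t) z y * kern g z) = k^-1 * (C_frac n g * kern g z) * d2 (psi m t) z y.
  by move: (C_frac n g) => c; ring.
by rewrite -e mulKf ?gt_eqF// mulrC.
Qed.

Let H4_bound : exists2 C, 0 <= C & forall y,
  (\int[rnm n]_z \int[leb]_s `|H4 y z s|%:E < +oo)%E /\
  RI (rnm n) (fun z => RI leb (fun s => `|H4 y z s|)) <= C * om a y.
Proof.
have [C C0 HC] := d2_psi_kern n g0 g1 m t0.
have c0 := C_frac_gt0 n g0 g1.
have ck0 : 0 <= C_frac n g / k by rewrite divr_ge0// ltW.
exists (C_frac n g / k * C); first exact: mulr_ge0.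
move=> y; have [l1 h1] := HC y.
have ck := RIZ (C_frac n g / k) (L1_norm l1).
have E z : RI leb (fun s => `|H4 y z s|) = C_frac n g / k * `|d2 (psi m t) z y * kern g z|.
  (* For fixed y and z the sign of [H4] is that of the second difference, hence the same for all s,
     so the absolute value commutes with the integral. *)
  have -> : RI leb (fun s => `|H4 y z s|) = `|RI leb (H4 y z)|.
    have [d0|d0] := leP 0 (d2 (psi m t) z y).
      rewrite ger0_norm; last by apply: RI_ge0 => s; rewrite mulr_ge0// mulr_ge0 ?hpow_ge0 ?heat_ge0.
      by apply: eq_RI => s; rewrite ger0_norm// mulr_ge0// mulr_ge0 ?hpow_ge0 ?heat_ge0.
    have e1 s : `|H4 y z s| = - H4 y z s.
      by rewrite ler0_norm// nmulr_rle0// mulr_ge0 ?hpow_ge0 ?heat_ge0.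
    rewrite (eq_RI leb e1) (RIN (H4_L1 y z)) ler0_norm//.
    rewrite -oppr_ge0 -(RIN (H4_L1 y z)); apply: RI_ge0 => s; rewrite -e1; exact: normr_ge0.
  by rewrite RI_H4 [LHS](normrM (C_frac n g / k)) ger0_norm.
have le z : RI leb (fun s => `|H4 y z s|) <= C_frac n g / k * `|d2 (psi m t) z y * kern g z|.
  by rewrite E.
have i1 := @fubini_lty R _ _ _ _ (rnm n) leb (H4 y) _ (mH4 y) (H4_L1 y) le (L1Z _ (L1_norm l1)).
split => //; rewrite (eq_RI (rnm n) E) ck -(mulrA (C_frac n g / k)); exact: ler_wpM2l.
Qed.

Let psi_heat y (s : R) : 0 < s -> L1 (rnm n) (fun z => psi m t (y + z) * heat s z).
Proof.
move=> s0; apply: L1_psi => //; [exact: measurable_heat|move=> z; exact: heat_ge0|].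
by move=> w w0; exact: L1_heat_heat.
Qed.

Let RIz_H4 y (s : R) : 0 < s ->
  RI (rnm n) (fun z => H4 y z s) = hpow (- g) s * (2 * (psi m t y - psi m (t + s) y)).
Proof.
move=> s0.
have lh := L1_heat s0; have lp := psi_heat y s0.
have lm : L1 (rnm n) (fun z => psi m t (y - z) * heat s z).
  by apply: (eq_L1 _ (L1_opp lp)) => z; rewrite heatN.
have em : RI (rnm n) (fun z => psi m t (y - z) * heat s z) = psi m (t + s) y.
  rewrite -(psi_semigroup m y t0 s0) -(RI_opp lp).
  by apply: eq_RI => z; rewrite heatN.
have -> : RI (rnm n) (fun z => H4 y z s) = hpow (- g) s * RI (rnm n)
    (fun z => 2 * psi m t y * heat s z - psi m t (y + z) * heat s z - psi m t (y - z) * heat s z).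
  rewrite -(RIZ _ (L1B (L1B (L1Z _ lh) lp) lm)); apply: eq_RI => z.
  by rewrite /H4 /d2; ring.
rewrite (RIB (L1B (L1Z _ lh) lp) lm) (RIB (L1Z _ lh) lp) (RIZ _ lh) RI_heat// psi_semigroup// em.
by congr (_ * _); ring.
Qed.

Let D s y := hpow (- g) s * (psi m t y - psi m (t + s) y).

Let RIz_H4' y s : RI (rnm n) (fun z => H4 y z s) = 2 * D s y.
Proof.
have [s0|s0] := leP s 0; last by rewrite RIz_H4// /D; ring.
rewrite /D hpow_le0// mul0r mulr0 -[RHS](RI_0 (rnm n)); apply: eq_RI => z.
by rewrite /H4 hpow_le0// mul0r mulr0.
Qed.

(** By subordination the kernel is an integral of heat kernels over s. Integrating the second
    difference of [psi] at time t against the heat kernel of time s gives twice psi(t) - psi(t+s),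
    by the semigroup law; Fubini does the rest. *)
Lemma fracL_psi y : L1 leb (fun s => D s y) /\
  fracL g (psi m t) y = k * RI leb (fun s => D s y).
Proof.
have [C C0 HC] := H4_bound; have [i1 _] := HC y.
have i2 := @fubini_swap_lty _ _ _ _ _ (rnm n) leb (H4 y) (mH4 y) i1.
have mH : measurable_fun setT (fun u : R * 'rV[R]_n => H4 y u.2 u.1).
  by apply: (measurableT_comp (mH4 y) (g := fun u : R * 'rV[R]_n => (u.2, u.1))); exact: measurable_fun_pair.
have l2 := @L1_RI _ _ _ _ _ leb (rnm n) (fun s z => H4 y z s) mH i2.
have lD : L1 leb (fun s => D s y).
  by apply: (eq_L1 _ (L1Z 2^-1 l2)) => s; rewrite RIz_H4' mulKf.
split => //; have [C' C0' HC'] := d2_psi_kern n g0 g1 m t0.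
have := @RI_fubini _ _ _ _ _ (rnm n) leb (H4 y) (mH4 y) i1.
rewrite (eq_RI _ (RI_H4 y)) (eq_RI leb (RIz_H4' y)) (RIZ _ lD) (RIZ _ (HC' y).1) /fracL.
move: (C_frac n g) (RI _ _) (RI leb _) => c p q h.
have kn : k != 0 by rewrite gt_eqF.
have -> : q = 2^-1 * (c / k * p) by rewrite h mulKf.
by field.
Qed.

(** Absolute version of [fracL_psi] with the weight in y, needed to exchange the integral against
    [v] with the one in s. *)
Lemma RI_psi_diff_le : exists2 C, 0 <= C & forall y, RI leb (fun s => `|D s y|) <= C * om a y.
Proof.
have [C C0 HC] := H4_bound; exists (2^-1 * C); first exact: mulr_ge0.
move=> y; have [i1 h1] := HC y.
have mN : measurable_fun setT (fun u : 'rV[R]_n * R => `|H4 y u.1 u.2|).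
  exact: measurableT_comp (mH4 y).
have iN : (\int[rnm n]_z \int[leb]_s `| `|H4 y z s| |%:E < +oo)%E.
  by under eq_integral do under eq_integral do rewrite normr_id.
have mNs : measurable_fun setT (fun u : R * 'rV[R]_n => `|H4 y u.2 u.1|).
  by apply: (measurableT_comp mN (g := fun u : R * 'rV[R]_n => (u.2, u.1))); exact: measurable_fun_pair.
have iNs := @fubini_swap_lty _ _ _ _ _ (rnm n) leb (fun z s => `|H4 y z s|) mN iN.
have l2 := @L1_RI _ _ _ _ _ leb (rnm n) (fun s z => `|H4 y z s|) mNs iNs.
move: h1; rewrite (@RI_fubini _ _ _ _ _ (rnm n) leb (fun z s => `|H4 y z s|) mN iN) => h1.
have lD := L1_norm (fracL_psi y).1.
have h2 : RI leb (fun s => `|D s y|) <= RI leb (fun s => 2^-1 * RI (rnm n) (fun z => `|H4 y z s|)).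
  apply: le_RI => //; first exact: L1Z.
  move=> s; have [s0|s0] := leP s 0.
    rewrite /D hpow_le0// mul0r normr0 mulr_ge0//; apply: RI_ge0 => z; exact: normr_ge0.
  have e : `|D s y| = 2^-1 * `|RI (rnm n) (fun z => H4 y z s)|.
    by rewrite RIz_H4' (normrM 2) (ger0_norm (x := 2))// mulKf.
  rewrite e ler_wpM2l//.
  have l1 : L1 (rnm n) (fun z => H4 y z s).
    have lh := L1_heat s0; have lp := psi_heat y s0.
    have lm : L1 (rnm n) (fun z => psi m t (y - z) * heat s z).
      by apply: (eq_L1 _ (L1_opp lp)) => z; rewrite heatN.
    apply: (eq_L1 _ (L1Z (hpow (- g) s) (L1B (L1B (L1Z (2 * psi m t y) lh) lp) lm))) => z.
    by rewrite /H4 /d2; ring.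
  by apply: norm_RI_le => //; [exact: L1_measurable l1|exact: L1_norm].
apply: (le_trans h2); rewrite (RIZ _ l2) -mulrA; exact: ler_wpM2l.
Qed.

End FixedTime.
End FracOfPsi.

(** * Moving the fractional Laplacian onto a bump *)

Section FracParts.
Context {R : realType}.
Notation leb := (@lebesgue_measure R).
Variables (n m : nat) (g eps : R) (v : 'rV[R]_n -> R).
Implicit Types x y z : 'rV[R]_n.
Hypotheses (g0 : 0 < g) (g1 : g < 1) (eps0 : 0 < eps) (v0 : forall x, 0 <= v x).
Hypothesis hLs : Ls g v.
Hypothesis hC : Cka_loc (2 * m + Num.truncn (2 * g)%R)%N
             (2 * g - (Num.truncn (2 * g))%:R + eps) v.
Hypothesis hdef : forall x, fraclap_defined g v x.

Let a := n%:R / 2 + g.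

Let a_gt0 : 0 < a.
Proof. by rewrite ltr_wpDl// divr_ge0. Qed.

Section OneTest.
Variables (l : seq (R * nat * nat)) (r : R) (x : 'rV[R]_n).
Hypotheses (dl : bdeg 3 l) (r0 : 0 < r).

Let vx y := v (x + y).

Let mvx : measurable_fun setT vx.
Proof. by rewrite /vx; under eq_fun do rewrite addrC; exact: measurable_shift_rv (measurable_v hC). Qed.

Let G1 y z := btest l r y * (d2 v z (x + y) * kern g z).
Let G2 y z := vx y * (d2 (btest l r) z y * kern g z).

Let mG1 : measurable_fun setT (fun s : 'rV[R]_n * 'rV[R]_n => G1 s.1 s.2).
Proof.
apply: measurable_funM.
  by apply: (measurableT_comp (measurable_btest l r)); exact: measurable_fst.
apply: (measurableT_comp (measurable_d2k2 hC) (g := fun s : 'rV[R]_n * 'rV[R]_n => (s.2, x + s.1))).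
apply: measurable_fun_pair; first exact: measurable_snd.
under eq_fun do rewrite addrC.
by apply: (measurableT_comp (@measurable_rv_add _ _ x)); exact: measurable_fst.
Qed.

Let mG2 : measurable_fun setT (fun s : 'rV[R]_n * 'rV[R]_n => G2 s.1 s.2).
Proof.
apply: measurable_funM.
  by apply: (measurableT_comp mvx); exact: measurable_fst.
apply: measurable_funM; last by apply: (measurableT_comp (@measurable_kern R n g)); exact: measurable_snd.
apply: (measurableT_comp (measurable_d2_2 (measurable_btest l r)) (g := fun s : 'rV[R]_n * 'rV[R]_n => (s.2, s.1))).
by apply: measurable_fun_pair; [exact: measurable_snd|exact: measurable_fst].
Qed.

Let btest_bnd : exists M, forall y, `|btest l r y| <= M.
Proof.
have [C [q [C0 HC]]] := btest_le n l; exists (C * (1 + r) ^+ q) => y.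
by apply: HC; exact: ltW.
Qed.

Let btest_supp y : r < sq (y - 0) -> btest l r y = 0.
Proof. by rewrite subr0 => /ltW h; apply: btest_out => //; exact: bdegW dl. Qed.

Let i1 : (\int[rnm n]_y \int[rnm n]_z `|G1 y z|%:E < +oo)%E.
Proof.
have [B HB] := btest_bnd.
have lb : L1 (rnm n) (btest l r : 'rV[R]_n -> R).
  exact: (L1_compact (measurable_btest l r) HB btest_supp).
have [M M0 HM] := d2k_bound g0 g1 eps0 v0 hLs hC (2 * sq x + 2 * r).
have lz y := L1_d2k g0 g1 eps0 v0 hLs hC (x + y).
apply: (@fubini_lty R _ _ _ _ (rnm n) (rnm n) G1 (fun y => M * `|btest l r y|)) => //.
- by move=> y; exact: L1Z.
- move=> y; have -> : RI (rnm n) (fun z => `|G1 y z|) = `|btest l r y| * RI (rnm n) (fun z => `|d2 v z (x + y) * kern g z|).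
    by rewrite -(RIZ _ (L1_norm (lz y))); apply: eq_RI => z; rewrite normrM.
  have [h|h] := ltP r (sq y).
    by rewrite btest_supp ?subr0// normr0 mul0r mulr0.
  rewrite mulrC; apply: ler_wpM2r => //.
  have -> : RI (rnm n) (fun z => `|d2 v z (x + y) * kern g z|) = RI (rnm n) (fun z => `|d2 v z (x + y)| * kern g z).
    by apply: eq_RI => z; rewrite normrM (ger0_norm (kern_ge0 _ _)).
  by apply: HM; apply: (le_trans (sqD_le x y)); rewrite lerD2l ler_wpM2l.
- by apply: L1Z; exact: L1_norm.
Qed.

Let i2 : (\int[rnm n]_y \int[rnm n]_z `|G2 y z|%:E < +oo)%E.
Proof.
have [C [q [C0 HC]]] := d2_btest_kern n g0 g1 dl.
have lv := L1_vom (ltW g0) a_gt0 v0 hLs hC x.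
apply: (@fubini_lty R _ _ _ _ (rnm n) (rnm n) G2 (fun y => C * (1 + r) ^+ q * (vx y * om a y))) => //.
- by move=> y; apply: L1Z; exact: (HC r y r0).1.
- move=> y; have [lz hz] := HC r y r0.
  have -> : RI (rnm n) (fun z => `|G2 y z|) = vx y * RI (rnm n) (fun z => `|d2 (btest l r) z y * kern g z|).
    by rewrite -(RIZ _ (L1_norm lz)); apply: eq_RI => z; rewrite normrM (ger0_norm (v0 _)).
  by rewrite mulrCA; apply: ler_wpM2l; [exact: v0|rewrite /a].
- exact: L1Z.
Qed.

Let swap z : RI (rnm n) (G1 ^~ z) = RI (rnm n) (G2 ^~ z).
Proof.
have [B HB] := btest_bnd.
have lvx : locally_bounded vx.
  have -> : vx = (fun y => v (y + x)) by apply/funext => y; rewrite /vx addrC.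
  exact: locally_bounded_shift (v_locally_bounded (ltW g0) eps0 hC).
have mf : measurable_fun setT (fun y => kern g z * btest l r y).
  by apply: measurable_funM => //; exact: measurable_btest.
have bf y : `|kern g z * btest l r y| <= kern g z * B.
  by rewrite normrM (ger0_norm (kern_ge0 _ _)) ler_wpM2l ?kern_ge0.
have sf y : r < sq (y - 0) -> kern g z * btest l r y = 0.
  by move=> h; rewrite btest_supp// mulr0.
have := RI_d2_swap z mvx lvx mf bf sf => e.
transitivity (RI (rnm n) (fun y => d2 vx z y * (kern g z * btest l r y))).
  by apply: eq_RI => y; rewrite /G1 /d2 /vx !addrA; ring.
by rewrite e; apply: eq_RI => y; rewrite /G2 /d2; ring.
Qed.

(** For fixed z the second difference is moved by [RI_d2_swap]. Fubini in (y, z) holds on the left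
    because the bump has compact support, on the right because of the weighted decay and [Ls]. *)
Lemma fraclap_parts : RI (rnm n) (fun y => fraclap g v (x + y) * btest l r y) =
  RI (rnm n) (fun y => v (x + y) * fracL g (btest l r) y).
Proof.
have [C [q [C0 HC]]] := d2_btest_kern n g0 g1 dl.
have lz y := L1_d2k g0 g1 eps0 v0 hLs hC (x + y).
have e1 y : fraclap g v (x + y) * btest l r y = C_frac n g * 2^-1 * RI (rnm n) (G1 y).
  rewrite (fraclapE g0 g1 eps0 v0 hLs hC hdef) /G1 (RIZ _ (lz y)).
  by move: (C_frac n g) => c; ring.
have e2 y : v (x + y) * fracL g (btest l r) y = C_frac n g * 2^-1 * RI (rnm n) (G2 y).
  rewrite /fracL /G2 (RIZ _ (HC r y r0).1) -/(vx y).
  by move: (C_frac n g) => c; ring.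
rewrite (eq_RI _ e1) (eq_RI _ e2).
have f1 := @RI_fubini _ _ _ _ _ (rnm n) (rnm n) G1 mG1 i1.
have f2 := @RI_fubini _ _ _ _ _ (rnm n) (rnm n) G2 mG2 i2.
have z1 := RIZ (C_frac n g * 2^-1) (@L1_RI _ _ _ _ _ (rnm n) (rnm n) G1 mG1 i1).
have z2 := RIZ (C_frac n g * 2^-1) (@L1_RI _ _ _ _ _ (rnm n) (rnm n) G2 mG2 i2).
apply: (etrans z1); apply: (etrans _ (esym z2)); congr (_ * _).
apply: (etrans f1); apply: (etrans _ (esym f2)).
by apply: eq_RI => z; exact: swap.
Qed.

End OneTest.
End FracParts.

Section NeglapIter.
Context {R : realType}.
Variable n : nat.
Implicit Types x y z : 'rV[R]_n.

Lemma neglap_iter_regular m (w : 'rV[R]_n -> R) : measurable_fun setT w -> neglap_defined m w ->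
  dlap_bounded m w -> measurable_fun setT (neglap_iter m w) /\ locally_bounded (neglap_iter m w).
Proof.
elim: m w => [|m IH] w mw dw bw; first by split => //; exact: dlap_bounded_loc bw.
have [d1 d2] := neglap_definedS dw; rewrite neglap_iterSr.
by apply: IH => //; [exact: measurable_neglap|exact: dlap_bounded_neglap].
Qed.

Lemma neglap_parts_shift m (w : 'rV[R]_n -> R) l (r : R) x : measurable_fun setT w ->
  neglap_defined m w -> dlap_bounded m w -> bdeg (m.*2 + 3) l -> 0 < r ->
  RI (rnm n) (fun y => neglap_iter m w (x + y) * btest l r y) =
  RI (rnm n) (fun y => w (x + y) * btest (iter m (bneglap n) l) r y).
Proof.
move=> mw dw bw dl r0; have [mF bF] := neglap_iter_regular mw dw bw.
have bnd l' : exists M, forall y, `|btest l' r (y - x)| <= M.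
  have [C [q [C0 HC]]] := btest_le n l'; exists (C * (1 + r) ^+ q) => y.
  by apply: HC; exact: ltW.
have key l' w' : bdeg 3 l' -> measurable_fun setT w' -> locally_bounded w' ->
  RI (rnm n) (fun y => w' (x + y) * btest l' r y) = RI (rnm n) (fun y => w' y * btest l' r (y - x)).
  move=> dl' mw' lw'; have [M HM] := bnd l'.
  have ml : measurable_fun setT (fun y : 'rV[R]_n => btest l' r (y - x)).
    exact: measurable_shift_rv (measurable_btest l' r).
  have sl y : r < sq (y - x) -> btest l' r (y - x) = 0.
    by move=> /ltW h; apply: btest_out => //; exact: bdegW dl'.
  rewrite -(RI_shift x (L1_loc mw' lw' ml HM sl)); apply: eq_RI => y.
  by rewrite addrK addrC.
rewrite (key l _ (bdegW _ dl) mF bF) ?leq_addl// (neglap_parts x mw dw bw dl (ltW r0)).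
by rewrite key//; [exact: bdeg_iter|exact: dlap_bounded_loc bw].
Qed.

End NeglapIter.

(** * The equation in terms of heat averages *)

Section Transform.
Context {R : realType}.
Notation leb := (@lebesgue_measure R).
Variable n : nat.
Implicit Types x y z : 'rV[R]_n.

(** With [h] a translate of [v] by [x] this is U_j(t) at [x]; with a translate of F and j = 0 it is
    W(t). *)
Definition ptr (h : 'rV[R]_n -> R) (j : nat) (t : R) : R := RI (rnm n) (fun y => psi j t y * h y).

Lemma measurable_fracL2 (g : R) l :
  measurable_fun setT (fun s : R * 'rV[R]_n => fracL g (btest l s.1) s.2).
Proof.
apply: measurable_funM => //; apply: measurable_funM => //.
apply: (@measurable_RI _ _ _ _ _ (rnm n) (fun (s : R * 'rV[R]_n) z => d2 (btest l s.1) z s.2 * kern g z)).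
apply: measurable_funM; last by apply: (measurableT_comp (@measurable_kern R n g)); exact: measurable_snd.
exact: measurable_d2btest.
Qed.

Section Solution.
Variables (m : nat) (g eps : R) (v : 'rV[R]_n -> R) (x : 'rV[R]_n).
Hypotheses (g_ge0 : 0 <= g) (g1 : g < 1) (a_gt0 : 0 < n%:R / 2 + g).
Hypotheses (eps0 : 0 < eps) (v0 : forall x, 0 <= v x).
Hypothesis hLs : Ls g v.
Hypothesis hC : Cka_loc (2 * m + Num.truncn (2 * g)%R)%N
             (2 * g - (Num.truncn (2 * g))%:R + eps) v.
Hypothesis hdef : forall x, fraclap_defined g v x.
Hypothesis hm : neglap_defined m (fraclap g v).
Let F := neglap_iter m (fraclap g v).
Hypothesis F0 : forall x, 0 <= F x.
Let vx y := v (x + y).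
Let Fx y := F (x + y).

Let mvx : measurable_fun setT vx.
Proof. by rewrite /vx; under eq_fun do rewrite addrC; exact: measurable_shift_rv (measurable_v hC). Qed.

Let lv := L1_vom g_ge0 a_gt0 v0 hLs hC x.

Lemma L1_heat_v (t : R) : 0 < t -> L1 (rnm n) (fun y => heat t y * vx y).
Proof.
move=> t0; have [C C0 HC] := heat_le_om n g_ge0.
(* [heat_le_om] covers only kernels of time at least 2, so the time is first raised to max(t, 2). *)
pose u := Num.max t 2.
have tu : t <= u by rewrite /u le_max lexx.
have u2 : 2 <= u by rewrite /u le_max lexx orbT.
have u1 : 1 <= u / 2 by rewrite ler_pdivlMr// mul1r.
pose c := (u / t) `^ (n%:R / 2) * (C * (u / 2) `^ g).
apply: (L1_le _ _ (L1Z c lv)); first by apply: measurable_funM => //; exact: measurable_heat.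
move=> y; rewrite normrM (ger0_norm (heat_ge0 _ _)) (ger0_norm (v0 _)) mulrC -/(vx y).
rewrite mulrCA; apply: ler_wpM2l; first exact: v0.
apply: (le_trans (heat_scale_le y t0 tu)); rewrite /c -mulrA; apply: ler_wpM2l; first exact: powR_ge0.
have -> : u = 2 * (u / 2) by rewrite mulrC divfK.
by rewrite [2 * (u / 2) / 2]mulrAC divff// mul1r; exact: HC.
Qed.

Lemma frac_ptr : 0 < g -> forall t, 0 < t ->
  L1 (rnm n) (fun y => heat t y * Fx y) /\
  L1 leb (fun s => hpow (- g) s * (ptr vx m t - ptr vx m (t + s))) /\
  ptr Fx 0 t = g / Gamma (1 - g) * RI leb (fun s => hpow (- g) s * (ptr vx m t - ptr vx m (t + s))).
Proof.
move=> g0 t t0.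
have mw := measurable_fraclap g0 g1 eps0 v0 hLs hC hdef.
have bw := fraclap_dlap_bounded g0 g1 eps0 v0 hLs hC hdef.
have [mF bF] := neglap_iter_regular mw hm bw.
pose L r y := fracL g (btest (iter m (bneglap n) (psil n m t)) r) y.
have HL r : 0 < r -> RI (rnm n) (fun y => F (x + y) * btest (psil n m t) r y) =
    RI (rnm n) (fun y => v (x + y) * L r y).
  (* The m classical Laplacians move to the test function first, then the fractional one; bump
     powers of at least 3 are left for it. *)
  move=> r0; rewrite (neglap_parts_shift x mw hm bw (psil_deg n m t) r0).
  apply: (fraclap_parts g0 g1 eps0 v0 hLs hC hdef x _ r0).
  by apply: bdeg_iter; exact: psil_deg.
have mL : measurable_fun setT (fun s : R * 'rV[R]_n => L s.1 s.2) by exact: measurable_fracL2.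
have [lW eW] := superpose_tests t0 mF F0 bF (measurable_v hC) v0 lv HL mL (fracL_btest_bound n g0 g1 t m).
split; first by apply: (eq_L1 _ lW) => y; rewrite mulrC.
pose D s y := hpow (- g) s * (psi m t y - psi m (t + s) y).
pose G y s := vx y * D s y.
have mG : measurable_fun setT (fun u : 'rV[R]_n * R => G u.1 u.2).
  (* [psi] is jointly measurable for positive times; the guard changes nothing because [hpow]
     vanishes for s <= 0. *)
  have -> : (fun u : 'rV[R]_n * R => G u.1 u.2) = (fun u => vx u.1 * (hpow (- g) u.2 *
      (psi m t u.1 - (if 0 < t + u.2 then psi m (t + u.2) u.1 else 0)))).
    apply/funext => u; rewrite /G /D; have [u0|u0] := leP u.2 0; first by rewrite hpow_le0// !mul0r.
    by rewrite addr_gt0.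
  apply: measurable_funM; first by apply: (measurableT_comp mvx); exact: measurable_fst.
  apply: measurable_funM; first by apply: (measurableT_comp (@measurable_hpow R (- g))); exact: measurable_snd.
  apply: measurable_funB; first by apply: (measurableT_comp (measurable_psi m t)); exact: measurable_fst.
  apply: (measurableT_comp (@measurable_psi2 R n m) (g := fun u : 'rV[R]_n * R => (t + u.2, u.1))).
  apply: measurable_fun_pair; last exact: measurable_fst.
  by apply: measurable_funD => //; exact: measurable_snd.
have [C C0 HC] := RI_psi_diff_le n g0 g1 m t0.
have lD y := fracL_psi g0 g1 m t0 y.
have iG : (\int[rnm n]_y \int[leb]_s `|G y s|%:E < +oo)%E.
  apply: (@fubini_lty R _ _ _ _ (rnm n) leb G (fun y => C * (vx y * om (n%:R / 2 + g) y)) mG).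
  - by move=> y; apply: L1Z; exact: (lD y).1.
  - move=> y; have -> : RI leb (fun s => `|G y s|) = vx y * RI leb (fun s => `|D s y|).
      rewrite -(RIZ _ (L1_norm (lD y).1)); apply: eq_RI => s.
      by rewrite normrM (ger0_norm (v0 _)).
    by rewrite mulrCA; apply: ler_wpM2l; [exact: v0|exact: HC].
  - exact: L1Z.
have lps j s : 0 < s -> L1 (rnm n) (fun y => psi j s y * vx y).
  move=> s0; have lh u : 0 < u -> L1 (rnm n) (fun z => heat u (0 + z) * vx z).
    by move=> u0; apply: (eq_L1 _ (L1_heat_v u0)) => z; rewrite add0r.
  have h0 z : 0 <= vx z by exact: v0.
  by apply: (eq_L1 _ (L1_psi mvx h0 lh j s0)) => z; rewrite add0r.
have e s : RI (rnm n) (fun y => G y s) = hpow (- g) s * (ptr vx m t - ptr vx m (t + s)).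
  have [s0|s0] := leP s 0.
    rewrite hpow_le0// mul0r -[RHS](RI_0 (rnm n)); apply: eq_RI => y.
    by rewrite /G /D hpow_le0// mul0r mulr0.
  rewrite /ptr -(RIB (lps m t t0) (lps m _ (addr_gt0 t0 s0))).
  rewrite -(RIZ _ (L1B (lps m t t0) (lps m _ (addr_gt0 t0 s0)))); apply: eq_RI => y.
  by rewrite /G /D; ring.
have mG' : measurable_fun setT (fun u : R * 'rV[R]_n => G u.2 u.1).
  by apply: (measurableT_comp mG (g := fun u : R * 'rV[R]_n => (u.2, u.1))); exact: measurable_fun_pair.
have iG' := @fubini_swap_lty _ _ _ _ _ (rnm n) leb G mG iG.
have lE := @L1_RI _ _ _ _ _ leb (rnm n) (fun s y => G y s) mG' iG'.
split; first by apply: (eq_L1 _ lE) => s; exact: e.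
rewrite -(eq_RI leb e) -(@RI_fubini _ _ _ _ _ (rnm n) leb G mG iG).
have lG := @L1_RI _ _ _ _ _ (rnm n) leb G mG iG.
rewrite -(RIZ _ lG); apply: (etrans (y := RI (rnm n) (fun y => F (x + y) * heat t y))).
  by apply: eq_RI => y; rewrite psi0 mulrC.
rewrite eW; apply: eq_RI => y; rewrite /L (fracL_psi_superpos g0 g1 m t0 y).
rewrite (lD y).2 /G (RIZ _ (lD y).1) -/(vx y); ring.
Qed.

Lemma nofrac_ptr : g = 0 -> forall t, 0 < t ->
  L1 (rnm n) (fun y => heat t y * Fx y) /\ ptr Fx 0 t = ptr vx m t.
Proof.
move=> gz t t0.
have wE : fraclap g v = v by apply/funext => y; rewrite /fraclap gz eqxx.
have mw : measurable_fun setT (fraclap g v) by rewrite wE; exact: measurable_v hC.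
have bw : dlap_bounded m (fraclap g v) by rewrite wE; exact: v_dlap_bounded g_ge0 eps0 hC.
have [mF bF] := neglap_iter_regular mw hm bw.
pose l := iter m (bneglap n) (psil n m t).
have dl : bdeg 3 l by apply: bdeg_iter; exact: psil_deg.
pose a := n%:R / 2 + g.
have HL r : 0 < r -> RI (rnm n) (fun y => F (x + y) * btest (psil n m t) r y) =
    RI (rnm n) (fun y => v (x + y) * btest l r y).
  by move=> r0; rewrite (neglap_parts_shift x mw hm bw (psil_deg n m t) r0) wE.
have bL : exists C : R, exists q : nat, 0 <= C /\
    forall r y, 0 < r -> `|btest l r y| <= C * (1 + r) ^+ q * om a y.
  have [C [q [C0 HC]]] := btest_le_om n (ltW a_gt0) (bdegW (isT : (1 <= 3)%N) dl).
  (* [btest_le_om] loses (1 + r)^a; the real exponent is rounded up to an integer to fit the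
     polynomial form. *)
  exists C, (q + (Num.truncn a).+1)%N; split => // r y r0.
  apply: (le_trans (HC r y r0)); rewrite exprD.
  have -> : C * ((1 + r) ^+ q * (1 + r) ^+ (Num.truncn a).+1) * om a y =
    C * (1 + r) ^+ q * ((1 + r) ^+ (Num.truncn a).+1 * om a y) by ring.
  have c0 : 0 <= C * (1 + r) ^+ q by rewrite mulr_ge0// exprn_ge0// addr_ge0// ltW.
  apply: ler_wpM2l => //; apply: ler_wpM2r; first exact: om_ge0.
  by apply: powR_le_pow; [rewrite lerDl ltW|exact/ltW/truncnS_gt].
have [lW eW] := superpose_tests t0 mF F0 bF (measurable_v hC) v0 lv HL (@measurable_btest2 R n l) bL.
split; first by apply: (eq_L1 _ lW) => y; rewrite mulrC.
apply: (etrans (y := RI (rnm n) (fun y => F (x + y) * heat t y))).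
  by apply: eq_RI => y; rewrite psi0 mulrC.
by rewrite eW; apply: eq_RI => y; rewrite (psi_superpos y t0 (leqnn m)) mulrC.
Qed.

End Solution.
End Transform.

(** * Fractional calculus on the half-line *)

Section FractionalCalculus.
Context {R : realType}.
Notation leb := (@lebesgue_measure R).
Implicit Types (s t r h : R) (y w : R -> R).

Definition fint s y t : R := RI leb (fun r => hpow s r / Gamma s * y (t + r)).
Definition tame s y := forall t, 0 < t -> L1 leb (fun r => hpow s r * y (t + r)).

Let measurable_addl t : measurable_fun setT (fun r : R => t + r).
Proof. exact: measurable_funD. Qed.

Lemma tame_fint s y t : 0 < t -> tame s y -> L1 leb (fun r => hpow s r / Gamma s * y (t + r)).
Proof. by move=> t0 /(_ t t0)/(L1Z (Gamma s)^-1); apply: eq_L1 => r /=; ring. Qed.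

Lemma measurable_fint s y : measurable_fun setT y -> measurable_fun setT (fint s y).
Proof.
move=> my; apply: (@measurable_RI _ _ _ _ _ leb (fun t r => hpow s r / Gamma s * y (t + r))).
apply: measurable_funM.
  apply: measurable_funM => //; apply: (measurableT_comp (@measurable_hpow R s)); exact: measurable_snd.
by apply: (measurableT_comp my); apply: measurable_funD; [exact: measurable_fst|exact: measurable_snd].
Qed.

Lemma fint_ge0 s y t : 0 < s -> (forall r, 0 <= y r) -> 0 <= fint s y t.
Proof. by move=> s0 y0; apply: RI_ge0 => r; apply: mulr_ge0; [exact: hpowG_ge0|exact: y0]. Qed.

Lemma fracintE s y t : 0 < t -> tame s y -> fracint s (fun t => (y t)%:E) t = (fint s y t)%:E.
Proof. by move=> t0 ty; rewrite /fint RI_EFin//; exact: tame_fint. Qed.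

Lemma tame_le s y w : measurable_fun setT y -> (forall r, `|y r| <= w r) -> tame s w -> tame s y.
Proof.
move=> my yw tw t t0.
have mf : measurable_fun setT (fun r => hpow s r * y (t + r)).
  by apply: measurable_funM; [exact: measurable_hpow|exact: (measurableT_comp my)].
apply: (L1_le _ _ (tw t t0)); first exact: mf.
by move=> r; rewrite normrM (ger0_norm (hpow_ge0 _ _)) ler_wpM2l ?hpow_ge0.
Qed.

Lemma tame_norm s y : tame s y -> tame s (fun r => `|y r|).
Proof.
move=> ty t t0; apply: (eq_L1 _ (L1_norm (ty t t0))) => r.
by rewrite normrM (ger0_norm (hpow_ge0 _ _)).
Qed.

Lemma tameB s y w : tame s y -> tame s w -> tame s (fun r => y r - w r).
Proof. by move=> ty tw t t0; apply: (eq_L1 _ (L1B (ty t t0) (tw t t0))) => r; rewrite mulrBr. Qed.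

Lemma fintB s y w t : 0 < t -> tame s y -> tame s w ->
  fint s (fun r => y r - w r) t = fint s y t - fint s w t.
Proof.
move=> t0 ty tw; rewrite /fint -(RIB (tame_fint t0 ty) (tame_fint t0 tw)).
by apply: eq_RI => r; rewrite mulrBr.
Qed.

Lemma eq_fint s y w t : 0 < t -> (forall r, 0 < r -> y r = w r) -> fint s y t = fint s w t.
Proof.
move=> t0 yw; apply: eq_RI => r; have [r0|r0] := leP r 0; first by rewrite hpow_le0// !mul0r.
by rewrite yw// addr_gt0.
Qed.

Lemma eq_tame s y w : (forall r, 0 < r -> y r = w r) -> tame s y -> tame s w.
Proof.
move=> yw ty t t0; apply: (eq_L1 _ (ty t t0)) => r.
have [r0|r0] := leP r 0; first by rewrite hpow_le0// !mul0r.
by rewrite yw// addr_gt0.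
Qed.

(** For y >= 0 the identity [fracint_add] in the extended reals transfers: convergence at order s +
    u makes the iterated integral finite. *)
Lemma fint_add_ge0 s u y t : 0 < s -> 0 < u -> 0 < t -> measurable_fun setT y ->
  (forall r, 0 <= y r) -> tame u y -> tame (s + u) y ->
  L1 leb (fun r => hpow s r * fint u y (t + r)) /\ fint s (fint u y) t = fint (s + u) y t.
Proof.
move=> s0 p0 t0 my y0 t1 t2.
have mE : measurable_fun setT (fun t => (y t)%:E) by exact/measurable_EFinP.
have y0E r : (0 <= (y r)%:E)%E by rewrite lee_fin.
have := @fracint_add R s u (fun t => (y t)%:E) t s0 p0 mE y0E.
rewrite (fracintE t0 t2).
have -> : fracint s (fracint u (fun t => (y t)%:E)) t =
    (\int[leb]_r (hpow s r / Gamma s * fint u y (t + r))%:E)%E.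
  apply: eq_integral => r _; have [h|h] := leP r 0; first by rewrite hpow_le0// !mul0r mul0e.
  by rewrite fracintE ?addr_gt0// EFinM.
move=> e.
have m1 : measurable_fun setT (fun r => hpow s r / Gamma s * fint u y (t + r)).
  apply: measurable_funM; last by apply: (measurableT_comp (measurable_fint u my)).
  by apply: measurable_funM => //; exact: measurable_hpow.
have p1 r : 0 <= hpow s r / Gamma s * fint u y (t + r).
  by apply: mulr_ge0; [exact: hpowG_ge0|exact: fint_ge0].
have l1 : L1 leb (fun r => hpow s r / Gamma s * fint u y (t + r)).
  by apply: ge0_L1 => //; rewrite e ltry.
split; last by apply: EFin_inj; rewrite [in LHS]/fint RI_EFin.
apply: (eq_L1 _ (L1Z (Gamma s) l1)) => r.
by have := Gamma_gt0 s0; move: (Gamma s) (fint _ _ _) => c f c0; field; rewrite gt_eqF.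
Qed.

Lemma fint_add s u y : 0 < s -> 0 < u -> measurable_fun setT y ->
  tame u y -> tame (s + u) y ->
  tame s (fint u y) /\ forall t, 0 < t -> fint s (fint u y) t = fint (s + u) y t.
Proof.
move=> s0 p0 my t1 t2.
pose yp r := Num.max (y r) 0; pose yn r := Num.max (- y r) 0.
have mp : measurable_fun setT yp by exact: measurable_maxr.
have mn : measurable_fun setT yn by apply: measurable_maxr => //; exact: measurable_funN.
have p_ge0 r : 0 <= yp r by rewrite le_max lexx orbT.
have n_ge0 r : 0 <= yn r by rewrite le_max lexx orbT.
have yE r : y r = yp r - yn r.
  rewrite /yp /yn; have [h|h] := leP 0 (y r).
    by rewrite max_r ?oppr_le0// subr0.
  by rewrite max_l ?oppr_ge0 ?(ltW h)// sub0r opprK.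
have tp q : tame q y -> tame q yp.
  move=> /tame_norm; apply: tame_le => // r; rewrite ger0_norm// /yp ge_max normr_ge0 andbT; exact: ler_norm.
have tn q : tame q y -> tame q yn.
  move=> /tame_norm; apply: tame_le => // r; rewrite ger0_norm// /yn ge_max normr_ge0 andbT -normrN; exact: ler_norm.
have fE q t : 0 < t -> tame q y -> fint q y t = fint q yp t - fint q yn t.
  move=> t0 tq; rewrite -(fintB t0 (tp q tq) (tn q tq)); congr (fint _ _ _).
  by apply/funext => r.
have P t (t0 : 0 < t) := fint_add_ge0 s0 p0 t0 mp p_ge0 (tp _ t1) (tp _ t2).
have N t (t0 : 0 < t) := fint_add_ge0 s0 p0 t0 mn n_ge0 (tn _ t1) (tn _ t2).
have tP : tame s (fint u yp) by move=> t t0; exact: (P t t0).1.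
have tN : tame s (fint u yn) by move=> t t0; exact: (N t t0).1.
have e r : 0 < r -> fint u yp r - fint u yn r = fint u y r by move=> h; rewrite fE.
split; first exact: (eq_tame e (tameB tP tN)).
move=> t t0; rewrite -(eq_fint s t0 e) (fintB t0 tP tN) (P t t0).2 (N t t0).2 fE//.
Qed.

Lemma RI_itv_pow_head s t : 0 < s -> 0 < t ->
  L1 leb (fun r => if (0 < r) && (r <= t) then r `^ (s - 1) else 0) /\
  RI leb (fun r => if (0 < r) && (r <= t) then r `^ (s - 1) else 0) = t `^ s / s.
Proof.
move=> s0 t0; have := integral_pow_head s0 t0; rewrite integral_itv_if.
under eq_integral do rewrite in_itv/=.
have e r : (if (0 < r) && (r <= t) then (r `^ (s - 1))%:E else 0%E) =
  (if (0 < r) && (r <= t) then r `^ (s - 1) else 0)%:E by case: ifP.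
under eq_integral do rewrite e.
have mf : measurable_fun setT (fun r : R => if (0 < r) && (r <= t) then r `^ (s - 1) else 0).
  apply: measurable_fun_ifT; [|exact: measurable_powR|exact: measurable_cst].
  by apply: measurable_and; [exact: measurable_fun_ltr|exact: measurable_fun_ler].
move=> E; have l1 : L1 leb (fun r => if (0 < r) && (r <= t) then r `^ (s - 1) else 0).
  apply: (@ge0_L1 R _ _ leb _ mf); last by rewrite E ltry.
  by move=> r; case: ifP => // _; exact: powR_ge0.
by split => //; apply: EFin_inj; rewrite RI_EFin.
Qed.

Lemma RI_itv_pow_tail s t : 0 < s -> 0 < t ->
  L1 leb (fun r => if t < r then r `^ (- s - 1) else 0) /\
  RI leb (fun r => if t < r then r `^ (- s - 1) else 0) = t `^ (- s) / s.
Proof.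
move=> s0 t0; have := integral_pow_tail s0 t0; rewrite integral_itv_if.
under eq_integral do rewrite in_itv/= andbT.
have e r : (if t < r then (r `^ (- s - 1))%:E else 0%E) =
  (if t < r then r `^ (- s - 1) else 0)%:E by case: ifP.
under eq_integral do rewrite e.
have mf : measurable_fun setT (fun r : R => if t < r then r `^ (- s - 1) else 0).
  apply: measurable_fun_ifT; [|exact: measurable_powR|exact: measurable_cst].
  exact: measurable_fun_ltr.
move=> E; have l1 : L1 leb (fun r => if t < r then r `^ (- s - 1) else 0).
  apply: (@ge0_L1 R _ _ leb _ mf); last by rewrite E ltry.
  by move=> r; case: ifP => // _; exact: powR_ge0.
by split => //; apply: EFin_inj; rewrite RI_EFin.
Qed.

(** Split at r = t: below, t + r >= t; above, t + r >= r. The terms 1/s and 1/(k-s) are the two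
    power integrals. *)
Lemma hpow_decay_le s (k A : R) y t : 0 < s -> s < k -> 0 < t -> 0 <= A ->
  measurable_fun setT y -> (forall r, t <= r -> `|y r| <= A * r `^ (- k)) ->
  L1 leb (fun r => hpow s r * y (t + r)) /\
  `|RI leb (fun r => hpow s r * y (t + r))| <= A * (s^-1 + (k - s)^-1) * t `^ (s - k).
Proof.
move=> s0 sk t0 A0 my hy; have ks : 0 < k - s by rewrite subr_gt0.
have k0 : 0 < k by apply: lt_trans sk.
have [l1 e1] := RI_itv_pow_head s0 t0; have [l2 e2] := RI_itv_pow_tail ks t0.
have lG := L1Z A (L1D (L1Z (t `^ (- k)) l1) l2).
have mf : measurable_fun setT (fun r => hpow s r * y (t + r)).
  by apply: measurable_funM; [exact: measurable_hpow|exact: (measurableT_comp my)].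
have le r : `|hpow s r * y (t + r)| <= A * (t `^ (- k) * (if (0 < r) && (r <= t) then r `^ (s - 1) else 0) +
    (if t < r then r `^ (- (k - s) - 1) else 0)).
  have [r0|r0] := leP r 0.
    by rewrite hpow_le0// mul0r normr0 mulr0 add0r ltNge (le_trans r0 (ltW t0)) mulr0.
  rewrite normrM (ger0_norm (hpow_ge0 _ _)) hpow_gt0//=.
  have tr : t <= t + r by rewrite lerDl ltW.
  apply: (le_trans (ler_wpM2l (powR_ge0 _ _) (hy _ tr))); rewrite mulrCA; apply: ler_wpM2l => //.
  have [h|h] := leP r t.
    rewrite addr0 mulrC; apply: ler_wpM2r; first exact: powR_ge0.
    by apply: powRN_le => //; exact: ltW.
  rewrite mulr0 add0r; have -> : - (k - s) - 1 = s - 1 - k by ring.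
  rewrite [leRHS](powRDp _ _ r0).
  apply: ler_wpM2l; first exact: powR_ge0.
  by apply: powRN_le => //; [exact: ltW|rewrite lerDr ltW].
have lf := @L1_le R _ _ leb _ _ mf le lG; split => //.
apply: (le_trans (@norm_RI_le R _ _ leb _ _ mf le lG)).
rewrite (RIZ _ (L1D (L1Z (t `^ (- k)) l1) l2)) (RID (L1Z (t `^ (- k)) l1) l2) (RIZ _ l1) e1 e2.
have -> : t `^ (- (k - s)) = t `^ (s - k) by rewrite opprB.
have -> : t `^ (- k) * (t `^ s / s) = t `^ (s - k) / s.
  by rewrite mulrA -(powRDp _ _ t0) addrC.
by rewrite le_eqVlt; apply/orP; left; apply/eqP; ring.
Qed.

Definition decay (k : R) y := forall T, 0 < T -> exists2 A, 0 <= A & forall r, T <= r -> `|y r| <= A * r `^ (- k).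

Lemma decay_tame s k y : 0 < s -> s < k -> measurable_fun setT y -> decay k y -> tame s y.
Proof.
move=> s0 sk my hy t t0; have [A A0 HA] := hy t t0.
exact: (hpow_decay_le s0 sk t0 A0 my HA).1.
Qed.

Lemma decay_cvg0 k y : 0 < k -> decay k y -> y t @[t --> +oo] --> (0 : R).
Proof.
move=> k0 /(_ 1 ltr01)[A A0 HA].
have c1 : A * t `^ (- k) @[t --> +oo] --> (0 : R).
  by rewrite -[X in _ --> X](mulr0 A); apply: cvgMr; exact: cvg_powRN.
apply/cvgr0Pnorm_le => e e0; near=> t.
apply: (@le_trans _ _ (A * t `^ (- k))).
  by apply: HA; near: t; exact: nbhs_pinfty_ge.
apply: (le_trans (ler_norm _)); near: t; move/cvgr0Pnorm_le : c1; exact.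
Unshelve. all: by end_near.
Qed.

Lemma decay_fint s k y : 0 < s -> s < k -> measurable_fun setT y -> decay k y -> decay (k - s) (fint s y).
Proof.
move=> s0 sk my hy T T0; have [A A0 HA] := hy T T0.
have G0 := Gamma_gt0 s0; have ks : 0 < k - s by rewrite subr_gt0.
exists ((Gamma s)^-1 * (A * (s^-1 + (k - s)^-1))).
  by rewrite mulr_ge0 ?invr_ge0 ?(ltW G0)// mulr_ge0// addr_ge0 ?invr_ge0 ?ltW.
move=> t Tt; have t0 := lt_le_trans T0 Tt.
have [lt ht] := hpow_decay_le s0 sk t0 A0 my (fun r tr => HA r (le_trans Tt tr)).
have -> : fint s y t = (Gamma s)^-1 * RI leb (fun r => hpow s r * y (t + r)).
  by rewrite -(RIZ _ lt); apply: eq_RI => r; ring.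
have gi : 0 <= (Gamma s)^-1 by rewrite invr_ge0 ltW.
by rewrite normrM ger0_norm// -mulrA ler_wpM2l// opprB.
Qed.

End FractionalCalculus.

(** * Order one: the fundamental theorem on the half-line *)

Section FractionalCalculusFTC.
Context {R : realType}.
Notation leb := (@lebesgue_measure R).
Implicit Types (s t r h : R) (y w : R -> R).

Lemma Gamma1 : Gamma 1 = 1 :> R.
Proof.
rewrite Gamma_D0; have := integral_exp_tail (0 : R); rewrite oppr0 expR0.
have -> : (\int[leb]_(t in `]0%R, +oo[) (t `^ (1 - 1) * expR (- t))%:E = \int[leb]_(x in `]0%R, +oo[) (expR (- x))%:E)%E.
  by apply: eq_integral => x _; rewrite subrr powRr0 mul1r.
by move=> ->.
Qed.

Lemma hpow1 r : hpow 1 r = if 0 < r then 1 else 0.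
Proof. by case: ltP => r0; [rewrite hpow_gt0// subrr powRr0|rewrite hpow_le0]. Qed.

Lemma fint1 y t : fint 1 y t = RI leb (fun r => if 0 < r then y (t + r) else 0).
Proof. by apply: eq_RI => r; rewrite Gamma1 divr1 hpow1; case: ifP => _; rewrite ?mul1r ?mul0r. Qed.

Lemma tame1 y t : 0 < t -> tame 1 y -> L1 leb (fun r => if 0 < r then y (t + r) else 0).
Proof.
by move=> t0 ty; apply: (eq_L1 _ (ty t t0)) => r; rewrite hpow1; case: ifP => _; rewrite ?mul1r ?mul0r.
Qed.

Lemma measurable_seg y t h : measurable_fun setT y ->
  measurable_fun setT (fun r : R => if (0 < r) && (r < h) then y (t + r) else 0).
Proof.
move=> my; apply: measurable_fun_ifT; [|by apply: (measurableT_comp my); exact: measurable_funD|exact: measurable_cst].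
by apply: measurable_and; exact: measurable_fun_ltr.
Qed.

Lemma L1_seg y t h : 0 < t -> measurable_fun setT y -> tame 1 y ->
  L1 leb (fun r => if (0 < r) && (r < h) then y (t + r) else 0).
Proof.
move=> t0 my ty; apply: (@L1_le R _ _ leb _ _ (measurable_seg t h my) _ (L1_norm (tame1 t0 ty))).
move=> r; case: (0 < r) => //=; case: (r < h) => //; by rewrite normr0.
Qed.

Section FTC.
Variables (G y : R -> R).
Hypotheses (dG : forall t : R, 0 < t -> is_derive t 1 G (- y t)).
Hypotheses (cy : forall t, 0 < t -> {for t, continuous y}).
Hypotheses (my : measurable_fun setT y) (ty : tame 1 y).

Lemma RI_seg t h : 0 < t -> 0 < h ->
  RI leb (fun r => if (0 < r) && (r < h) then y (t + r) else 0) = G t - G (t + h).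
Proof.
move=> t0 h0; have l1 := L1_seg h t0 my ty; apply: EFin_inj; rewrite RI_EFin//.
have mE (D : set R) : measurable_fun D (fun r => (y (t + r))%:E).
  apply: measurable_funTS; apply/measurable_EFinP; apply: (measurableT_comp my).
  exact: measurable_funD.
have dF (r : R) : 0 <= r -> is_derive r 1 (fun r => - G (t + r)) (y (t + r)).
  move=> r0; have d := dG (ltr_wpDr r0 t0).
  have d' := is_derive_comp d (is_derive_addl t r) erefl.
  have -> : (fun r => - G (t + r)) = (fun r => -1 * G (t + r)) by apply/funext => q; rewrite mulN1r.
  by apply: (is_derive_scale d'); rewrite mulr1 mulN1r opprK.
transitivity (\int[leb]_(r in `]0%R, h[) (y (t + r))%:E)%E.
  rewrite integral_itv_if; apply: eq_integral => r _; rewrite in_itv/=; by case: ifP.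
rewrite integral_itv_bndo_bndc// integral_itv_obnd_cbnd//.
rewrite (@continuous_FTC2 _ _ (fun r => - G (t + r)))//.
- by rewrite addr0 -EFinB; congr EFin; ring.
- apply: continuous_in_subspaceT => r; rewrite inE/= in_itv/= => /andP[r0 _].
  apply: (@continuous_comp _ _ _ (fun r : R => t + r) y).
    exact: is_derive_cont (is_derive_addl t r).
  by apply: cy; exact: ltr_wpDr.
- split.
  + by move=> r; rewrite in_itv/= => /andP[r0 _]; case: (dF r (ltW r0)).
  + by apply: cvg_at_right_filter; exact: is_derive_cont (dF _ (lexx 0)).
  + by apply: cvg_at_left_filter; exact: is_derive_cont (dF _ (ltW h0)).
- by move=> r; rewrite in_itv/= => /andP[r0 _]; rewrite derive1E; case: (dF r (ltW r0)).
Qed.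

(** The offset [c] lets the integrals started at t and at t + h run to common endpoints, so that the
    values of [G] there cancel even when [G] has no limit at infinity. *)
Lemma FTC_cvg t c : 0 < t -> 0 <= c ->
  (fun k : nat => G t - G (t + (c + k.+1%:R))) @ \oo --> fint 1 y t.
Proof.
move=> t0 c0; rewrite fint1.
have lt := tame1 t0 ty.
pose f_ (k : nat) r : R := if (0 < r) && (r < c + k.+1%:R) then y (t + r) else 0.
have m_ k : measurable_fun setT (f_ k) by exact: measurable_seg.
have c_ r : f_ ^~ r @ \oo --> (if 0 < r then y (t + r) else 0).
  apply: cvg_near_cst; near=> k; rewrite /f_; case: (0 < r) => //=.
  have -> // : r < c + k.+1%:R.
  near: k; exists (Num.truncn r) => //= k hk; rewrite ltr_wpDl//; apply: (lt_le_trans (truncnS_gt r)).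
  by rewrite ler_nat ltnS.
have b_ k r : `|f_ k r| <= `|if 0 < r then y (t + r) else 0|.
  by rewrite /f_; case: (0 < r) => //=; case: ifP => //; rewrite normr0.
have [_ c1] := @RI_cvg R _ _ leb f_ _ _ m_ c_ b_ (L1_norm lt).
have e k : RI leb (f_ k) = G t - G (t + (c + k.+1%:R)) by rewrite RI_seg// ltr_wpDl.
by rewrite -(funext e).
Unshelve. all: by end_near.
Qed.

Lemma fint1_FTC t : 0 < t -> G t @[t --> +oo] --> (0 : R) -> fint 1 y t = G t.
Proof.
move=> t0 cG; have c1 := FTC_cvg t0 (lexx 0).
have c2 : (fun k : nat => G t - G (t + (0 + k.+1%:R))) @ \oo --> G t - 0.
  apply: cvgB; first exact: cvg_cst.
  apply: (cvg_comp _ _ _ cG).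
  apply/cvgryPge => A; exists (Num.truncn A) => //= k hk.
  rewrite add0r ler_wpDl ?(ltW t0)//; apply: (le_trans (ltW (truncnS_gt A))).
  by rewrite ler_nat ltnS.
by rewrite subr0 in c2; move/cvg_unique : c1 => /(_ _ _ c2); apply.
Qed.

End FTC.
End FractionalCalculusFTC.

(** * Inversion of the Marchaud derivative *)

Section InvertMarchaud.
Context {R : realType}.
Notation leb := (@lebesgue_measure R).
Implicit Types (s t r h : R) (y w : R -> R).

Variables (g : R) (Y y V : R -> R).
Hypotheses (g0 : 0 < g) (g1 : g < 1).
Hypotheses (dY : forall t : R, 0 < t -> is_derive t 1 Y (- y t)).
Hypotheses (cy : forall t, 0 < t -> {for t, continuous y}).
Hypotheses (my : measurable_fun setT y) (ty : tame 1 y) (tgy : tame (1 - g) y).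
Hypothesis Y_cvg : Y t @[t --> +oo] --> (0 : R).
Hypothesis HV : forall t, 0 < t ->
  V t = g / Gamma (1 - g) * RI leb (fun s => hpow (- g) s * (Y t - Y (t + s))).

(** Write Y(t) - Y(t+s) as the integral of y(t+r) over 0 < r < s and exchange r with s: the tail
    integral of s^(-g-1) from r is r^(-g)/g, the kernel of order 1 - g. Inversion is then the
    semigroup law g + (1 - g) = 1. *)
Let marchaud_fint t : 0 < t -> V t = fint (1 - g) y t.
Proof.
move=> t0; rewrite HV//.
pose K r s := (if (0 < r) && (r < s) then y (t + r) else 0) * hpow (- g) s.
have mK : measurable_fun setT (fun u : R * R => K u.1 u.2).
  apply: measurable_funM; last by apply: (measurableT_comp (@measurable_hpow R (- g))); exact: measurable_snd.
  apply: measurable_fun_ifT; last exact: measurable_cst.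
    apply: measurable_and; first by apply: measurable_fun_ltr => //; exact: measurable_fst.
    by apply: measurable_fun_ltr; [exact: measurable_fst|exact: measurable_snd].
  by apply: (measurableT_comp my); apply: measurable_funD => //; exact: measurable_fst.
have KE r s : 0 < r -> K r s = y (t + r) * (if r < s then s `^ (- g - 1) else 0).
  move=> r0; rewrite /K r0/=; case: ltP => h; last by rewrite mul0r mulr0.
  by rewrite hpow_gt0// (lt_trans r0).
have K0 r s : r <= 0 -> K r s = 0 by move=> r0; rewrite /K ltNge r0/= mul0r.
have lK r : L1 leb (K r).
  have [r0|r0] := leP r 0; first by apply: (eq_L1 _ (L1_0 _)) => s; rewrite K0.
  by apply: (eq_L1 _ (L1Z (y (t + r)) (RI_itv_pow_tail g0 r0).1)) => s; rewrite KE.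
have hE r : 0 < r -> r `^ (- g) / g = hpow (1 - g) r / g.
  by move=> r0; rewrite hpow_gt0//; congr (_ `^ _ / _); ring.
have eK r : RI leb (K r) = g^-1 * (hpow (1 - g) r * y (t + r)).
  have [r0|r0] := leP r 0.
    by rewrite hpow_le0// mul0r mulr0 -[RHS](RI_0 leb); apply: eq_RI => s; rewrite K0.
  have [l e] := RI_itv_pow_tail g0 r0.
  rewrite (eq_RI leb (fun s => KE r s r0)) (RIZ _ l) e hE//; ring.
have aK r : RI leb (fun s => `|K r s|) <= g^-1 * `|hpow (1 - g) r * y (t + r)|.
  have [r0|r0] := leP r 0.
    rewrite hpow_le0// mul0r normr0 mulr0 -[leRHS](RI_0 leb) le_eqVlt; apply/orP; left; apply/eqP.
    by apply: eq_RI => s; rewrite K0// normr0.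
  have [l e] := RI_itv_pow_tail g0 r0.
  have -> : RI leb (fun s => `|K r s|) = `|y (t + r)| * (r `^ (- g) / g).
    rewrite -e -(RIZ _ l); apply: eq_RI => s; rewrite KE// normrM; congr (_ * _).
    by rewrite ger0_norm//; case: ifP => // _; exact: powR_ge0.
  rewrite hE// normrM (ger0_norm (hpow_ge0 _ _)) le_eqVlt; apply/orP; left; apply/eqP; ring.
have lg := L1Z g^-1 (L1_norm (tgy t0)).
have iK := @fubini_lty R _ _ _ _ leb leb K _ mK lK aK lg.
have := @RI_fubini _ _ _ _ _ leb leb K mK iK.
rewrite (eq_RI leb eK) (RIZ _ (tgy t0)).
have -> : RI leb (fun s => RI leb (K ^~ s)) = RI leb (fun s => hpow (- g) s * (Y t - Y (t + s))).
  apply: eq_RI => s; have [s0|s0] := leP s 0.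
    rewrite hpow_le0// mul0r -[RHS](RI_0 leb); apply: eq_RI => r.
    by rewrite /K hpow_le0// mulr0.
  rewrite -(RI_seg dY cy my ty t0 s0) -(RIZ _ (L1_seg s t0 my ty)).
  by apply: eq_RI => r; rewrite /K mulrC.
move=> <-; rewrite /fint.
have -> : RI leb (fun r => hpow (1 - g) r / Gamma (1 - g) * y (t + r)) =
    (Gamma (1 - g))^-1 * RI leb (fun r => hpow (1 - g) r * y (t + r)).
  by rewrite -(RIZ _ (tgy t0)); apply: eq_RI => r; ring.
have G0 : Gamma (1 - g) != 0 by rewrite gt_eqF// Gamma_gt0// subr_gt0.
have gn0 : g != 0 by rewrite gt_eqF.
by move: (Gamma _) (RI _ _) G0 => c I c0; field; apply/andP.
Qed.

Lemma invert_marchaud t : 0 < t -> fint g V t = Y t.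
Proof.
move=> t0; rewrite (eq_fint g t0 marchaud_fint).
have g10 : 0 < 1 - g by rewrite subr_gt0.
have ty' : tame (g + (1 - g)) y by rewrite addrCA subrr addr0.
have [_ ->] := fint_add g0 g10 my tgy ty'; last exact: t0.
by rewrite addrCA subrr addr0 (fint1_FTC dY cy my ty t0 Y_cvg).
Qed.

End InvertMarchaud.

(** * From U_m down to U_0 *)

Section Descent.
Context {R : realType}.
Notation leb := (@lebesgue_measure R).
Implicit Types (s t r h : R) (y w : R -> R).
Variables (u : nat -> R -> R) (w : R -> R) (m : nat) (g k : R).
Hypotheses (g_ge0 : 0 <= g) (g1 : g < 1) (mgk : m%:R + g < k) (mg0 : 0 < m%:R + g).
Hypothesis mu : forall j, measurable_fun setT (u j).
Hypothesis du : forall j (t : R), 0 < t -> is_derive t 1 (u j) (- u j.+1 t).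
Hypothesis bu : forall j, decay (j%:R - g) (u j).
Hypotheses (mw : measurable_fun setT w) (w0 : forall t, 0 <= w t) (dw : decay k w).

Let cu j t : 0 < t -> {for t, continuous (u j)}.
Proof. by move=> t0; exact: is_derive_cont (du j t0). Qed.

Let u_cvg0 j : u j.+1 t @[t --> +oo] --> (0 : R).
Proof.
apply: decay_cvg0 (bu j.+1); rewrite subr_gt0 (lt_le_trans g1)//.
by rewrite ler1n.
Qed.

(* [u j] differs from the [w]-potential of order [m - j + g] by a constant. *)
Let affine_to j s := forall t h, 0 < t -> 0 < h ->
  u j t - u j (t + h) = fint s w t - fint s w (t + h).

Let cvg_shift (G : R -> R) (t l : R) : G t @[t --> +oo] --> l ->
  (fun i : nat => G (t + i.+1%:R)) @ \oo --> l.
Proof.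
move=> cG; apply: (cvg_comp _ _ _ cG); apply/cvgryPge => A; exists (Num.truncn (A - t)) => //= i hi.
rewrite -lerBlDl; apply: (le_trans (ltW (truncnS_gt _))).
by rewrite ler_nat ltnS.
Qed.

(** For a positive index both sides vanish at infinity, so no constant is possible. At index 0 only
    the bound O(t^g) is available, and the constant survives. *)
Let affine_eq j s : 0 < s -> s < k -> affine_to j.+1 s -> forall t, 0 < t -> u j.+1 t = fint s w t.
Proof.
move=> s0 sk H t t0.
have c1 : (fun i : nat => u j.+1 t - u j.+1 (t + i.+1%:R)) @ \oo --> u j.+1 t - 0.
  by apply: cvgB; [exact: cvg_cst|exact: cvg_shift].
have c2 : (fun i : nat => fint s w t - fint s w (t + i.+1%:R)) @ \oo --> fint s w t - 0.
  apply: cvgB; [exact: cvg_cst|apply: cvg_shift].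
  by apply: decay_cvg0 (decay_fint s0 sk mw dw); rewrite subr_gt0.
have e : (fun i : nat => u j.+1 t - u j.+1 (t + i.+1%:R)) = (fun i : nat => fint s w t - fint s w (t + i.+1%:R)).
  by apply/funext => i; apply: H.
by move: c1; rewrite e => /cvg_unique/(_ c2); rewrite !subr0; apply.
Qed.

(** Both increments are limits of integrals of [u j.+1] with common endpoints, so nothing need be
    known about [u j] at infinity. *)
Let descend (G : R -> R) j : tame 1 G -> (forall t, 0 < t -> u j.+1 t = G t) ->
  forall t h, 0 < t -> 0 < h -> u j t - u j (t + h) = fint 1 G t - fint 1 G (t + h).
Proof.
move=> tG uG t h t0 h0.
have tu : tame 1 (u j.+1) by apply: eq_tame tG => r r0; rewrite uG.
have th0 : 0 < t + h by rewrite addr_gt0.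
have F := FTC_cvg (du j) (cu (j := j.+1)) (mu j.+1) tu.
have c : (fun i : nat => u j t - u j (t + (h + i.+1%:R)) - (u j (t + h) - u j (t + h + (0 + i.+1%:R))))
    @ \oo --> fint 1 G t - fint 1 G (t + h).
  by apply: cvgB; rewrite -(eq_fint 1 _ uG)//; apply: F => //; exact: ltW.
have c2 : (fun i : nat => u j t - u j (t + (h + i.+1%:R)) - (u j (t + h) - u j (t + h + (0 + i.+1%:R))))
    @ \oo --> u j t - u j (t + h).
  apply: cvg_near_cst; apply: nearW => i /=.
  by rewrite add0r (addrA t h); ring.
by move: c2 => /cvg_unique/(_ c); apply.
Qed.

Let tame_w s : 0 < s -> s < k -> tame s w.
Proof. by move=> s0 sk; exact: decay_tame mw dw. Qed.

Let affine_step j s : 0 < s -> 1 + s < k -> affine_to j.+1 s -> affine_to j (1 + s).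
Proof.
move=> s0 sk H; have s1 : s < k by apply: lt_trans sk; rewrite ltrDr.
have uw := affine_eq s0 s1 H.
have [tf ef] := fint_add (@ltr01 R) s0 mw (tame_w s0 s1) (tame_w (addr_gt0 (@ltr01 R) s0) sk).
move=> t h t0 h0; rewrite (descend tf uw t0 h0) !ef// addr_gt0//.
Qed.

Let affine_down j s : 0 < s -> s + j%:R < k -> affine_to j s -> affine_to 0 (s + j%:R).
Proof.
elim: j s => [|j IH] s s0 sk H; first by rewrite addr0.
have -> : s + j.+1%:R = 1 + s + j%:R by rewrite -natr1; ring.
apply: IH; first by rewrite addr_gt0.
  by apply: le_lt_trans sk; rewrite le_eqVlt; apply/orP; left; apply/eqP; rewrite -natr1; ring.
apply: affine_step => //; apply: le_lt_trans sk; rewrite addrC lerD2l -natr1 lerDr//.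
Qed.

(** By the mean value theorem an increment of [u j] decays like its derivative, one order faster
    than [u j] itself. *)
Let diff_decay j h : 0 < h -> decay (j.+1%:R - g) (fun r => u j r - u j (r + h)).
Proof.
move=> h0 T T0; have [A A0 HA] := bu j.+1 T0; exists (A * h); first by rewrite mulr_ge0// ltW.
move=> r Tr; have r0 := lt_le_trans T0 Tr.
have rh : r < r + h by rewrite ltrDl.
have dm q : q \in `]r, r + h[ -> is_derive q 1 (u j) (- u j.+1 q).
  by rewrite in_itv/= => /andP[rq _]; apply: du; exact: lt_trans rq.
have cm : {within `[r, r + h], continuous (u j)}.
  apply: continuous_in_subspaceT => q; rewrite inE/= in_itv/= => /andP[rq _].
  by apply: cu; exact: lt_le_trans rq.
have [q] := MVT rh dm cm; rewrite in_itv/= => /andP[rq _] e.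
have -> : u j r - u j (r + h) = u j.+1 q * h by rewrite -opprB e; ring.
rewrite normrM (gtr0_norm h0) mulrAC; apply: ler_wpM2r; first exact: ltW.
apply: (le_trans (HA q (le_trans Tr (ltW rq)))); apply: ler_wpM2l => //.
apply: powRN_le => //; last exact: ltW.
by rewrite subr_ge0 (le_trans (ltW g1))// ler1n.
Qed.

Lemma descent_int : g = 0 -> (forall t, 0 < t -> u m t = w t) ->
  forall t h, 0 < t -> 0 < h ->
  u 0 t - u 0 (t + h) = fint (m%:R + g) w t - fint (m%:R + g) w (t + h).
Proof.
move=> gz uw; have m0 : (0 < m)%N by rewrite -(ltr_nat R); move: mg0; rewrite gz addr0.
move: uw mgk; rewrite -(prednK m0) gz addr0 => uw mk.
have k1 : 1 < k by apply: le_lt_trans mk; rewrite ler1n.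
have A1 : affine_to m.-1 1 by move=> t h t0 h0; exact: descend (tame_w ltr01 k1) uw t h t0 h0.
have E : 1 + m.-1%:R = m.-1.+1%:R :> R by rewrite nat1r.
by rewrite -E in mk *; exact: affine_down ltr01 mk A1.
Qed.

Lemma descent_frac : 0 < g ->
  (forall t, 0 < t -> L1 leb (fun s => hpow (- g) s * (u m t - u m (t + s))) /\ w t = g / Gamma (1 - g) * RI leb (fun s => hpow (- g) s * (u m t - u m (t + s)))) ->
  forall t h, 0 < t -> 0 < h ->
  u 0 t - u 0 (t + h) = fint (m%:R + g) w t - fint (m%:R + g) w (t + h).
Proof.
move=> g0 HW; have gk : g < k by apply: le_lt_trans mgk; rewrite lerDr.
rewrite addrC; apply: affine_down => //; first by rewrite addrC.
move=> t h t0 h0.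
(* The inversion is applied to increments: for m = 0 the function [u m] is only O(t^g), whereas [Y]
   tends to 0. *)
pose Y r := u m r - u m (r + h); pose y r := u m.+1 r - u m.+1 (r + h).
pose V r := w r - w (r + h).
have dsh j (r : R) : 0 < r -> is_derive r 1 (fun r => u j (r + h)) (- u j.+1 (r + h)).
  move=> r0; have d := du j (addr_gt0 r0 h0).
  have -> : (fun r => u j (r + h)) = (fun r => u j (h + r)) by apply/funext => q; rewrite addrC.
  rewrite addrC in d; rewrite (addrC r h).
  by apply: (is_derive_comp d (is_derive_addl h r)); rewrite mulr1.
have msh j : measurable_fun setT (fun r => u j (r + h)).
  by apply: (measurableT_comp (mu j)); exact: measurable_funD.
have dY (r : R) : 0 < r -> is_derive r 1 Y (- y r).
  move=> r0; have := is_deriveB (du m r0) (dsh m r r0).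
  by rewrite /y opprB opprK (addrC (- _)).
have cy (r : R) : 0 < r -> {for r, continuous y}.
  move=> r0; exact: is_derive_cont (is_deriveB (du m.+1 r0) (dsh m.+1 r r0)).
have my : measurable_fun setT y by exact: measurable_funB.
have dy : decay (m.+2%:R - g) y by exact: diff_decay.
have m2 : 1 < m.+2%:R - g by rewrite -natr1 -natr1; have := ler0n R m; have := g1; lra.
have ty : tame 1 y by exact: decay_tame my dy.
have tgy : tame (1 - g) y.
  by apply: decay_tame my dy; [rewrite subr_gt0|apply: lt_trans m2; rewrite ltrBlDr ltrDl].
have Yc : Y t @[t --> +oo] --> (0 : R).
  by apply: decay_cvg0 (diff_decay m h0); rewrite subr_gt0 (lt_le_trans g1)// ler1n.
have wsh r : fint g (fun r => w (r + h)) r = fint g w (r + h).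
  by apply: eq_RI => q; rewrite addrAC.
have tw := tame_w g0 gk.
have tsh : tame g (fun r => w (r + h)).
  move=> r r0; apply: (eq_L1 _ (tw (r + h) (addr_gt0 r0 h0))) => q; by rewrite addrAC.
have HV r : 0 < r -> V r = g / Gamma (1 - g) * RI leb (fun s => hpow (- g) s * (Y r - Y (r + s))).
  move=> r0; have [l1 e1] := HW r r0; have [l2 e2] := HW (r + h) (addr_gt0 r0 h0).
  rewrite /V e1 e2 -mulrBr -(RIB l1 l2); congr (_ * _); apply: eq_RI => q.
  by rewrite /Y (addrAC r q h); ring.
by rewrite -wsh -(fintB t0 tw tsh) (invert_marchaud g0 g1 dY cy my ty tgy Yc HV t0).
Qed.

End Descent.

(** * Integral representation *)

Section HeatEstimates.
Context {R : realType}.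
Notation leb := (@lebesgue_measure R).
Variable n : nat.
Implicit Types x y z : 'rV[R]_n.

Lemma heat_le_om_from (g T : R) : 0 <= g -> 0 < T -> exists2 C, 0 <= C & forall (t : R) z, T <= t ->
  heat (2 * t) z <= C * t `^ g * om (n%:R / 2 + g) z.
Proof.
move=> g0 T0; have [C C0 HC] := heat_le_om n g0.
pose l := Num.max 1 T^-1.
have l1 : 1 <= l by rewrite /l le_max lexx.
have l0 : 0 < l by apply: lt_le_trans l1.
exists (l `^ (n%:R / 2) * C * l `^ g); first by rewrite !mulr_ge0 ?powR_ge0.
move=> t z Tt; have t0 := lt_le_trans T0 Tt.
have lt : 1 <= l * t.
  apply: (@le_trans _ _ (T^-1 * T)); first by rewrite mulVf ?gt_eqF.
  by apply: ler_pM => //; [rewrite invr_ge0 ltW|exact: ltW|rewrite /l le_max lexx orbT].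
have t2 : 0 < 2 * t by rewrite mulr_gt0.
have tl : 2 * t <= 2 * (l * t) by rewrite ler_wpM2l// ler_peMl// ltW.
apply: (le_trans (heat_scale_le z t2 tl)).
have -> : 2 * (l * t) / (2 * t) = l by field; rewrite gt_eqF.
rewrite -!mulrA; apply: ler_wpM2l; first exact: powR_ge0.
apply: (le_trans (HC _ z lt)); rewrite (powRM _ (ltW l0) (ltW t0)).
by rewrite le_eqVlt; apply/orP; left; apply/eqP; ring.
Qed.

(** Away from the origin the moment bound of order n/2 + 1 beats the prefactor t^(-n/2) and leaves a
    factor t; the Gaussian at time 1 is kept in order to integrate unbounded functions. *)
Lemma heat_le_far (d : R) : 0 < d -> exists2 C, 0 <= C & forall (t : R) y, 0 < t -> 2 * t <= 1 ->
  d <= sq y -> heat t y <= C * t * heat 1 y.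
Proof.
move=> d0; pose a : R := n%:R / 2 + 1.
have a0 : 0 <= a by rewrite addr_ge0// divr_ge0.
have [C C0 HC] := heat_moment_le n a0.
exists (C * d `^ (- a)); first by rewrite mulr_ge0 ?powR_ge0 ?ltW.
move=> t y t0 t1 dy; have y0 := lt_le_trans d0 dy.
have t2 : 0 < 2 * t by rewrite mulr_gt0.
have q0 : 0 < sq y / t by rewrite divr_gt0.
have h1 : heat t y <= C * (sq y / t) `^ (- a) * heat (2 * t) y.
  rewrite -mulrA mulrCA mulrC powRN -ler_pdivrMr ?invr_gt0 ?powR_gt0// invrK mulrC; exact: HC.
apply: (le_trans h1); rewrite -!mulrA; apply: ler_wpM2l; first exact: ltW.
have h2 : heat (2 * t) y <= t `^ (- (n%:R / 2)) * heat 1 y.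
  apply: (le_trans (heat_scale_le y t2 t1)); apply: ler_wpM2r; first exact: heat_ge0.
  rewrite div1r powRVp//; apply: powRN_le => //.
  by rewrite ler_peMl ?(ltW t0)// ler1n.
have e : (sq y / t) `^ (- a) * t `^ (- (n%:R / 2)) = t * sq y `^ (- a).
  rewrite powRM ?invr_ge0 ?(ltW y0) ?(ltW t0)// powRVp// opprK -mulrA -powRDp//.
  by rewrite /a addrAC subrr add0r powRr1 ?(ltW t0)// mulrC.
apply: (le_trans (ler_wpM2l (powR_ge0 _ _) h2)).
rewrite (mulrA ((sq y / t) `^ _)) e (mulrA (d `^ _)); apply: ler_wpM2r; first exact: heat_ge0.
rewrite mulrC; apply: ler_wpM2r; first exact: ltW.
by apply: powRN_le.
Qed.

(** |y|^2 <= 2|y+z|^2 + 2|z|^2, so doubling the time on the right absorbs the displacement. The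
    exponential factor tends to 1 as t grows, which makes the limiting constant independent of z. *)
Lemma heat_harnack (t : R) y z : 0 < t ->
  heat t (y + z) <= 2 `^ (n%:R / 2) * expR (sq z / (4 * t)) * heat (2 * t) y.
Proof.
move=> t0; have t2 : 0 < 2 * t by rewrite mulr_gt0.
rewrite !heat_powR//.
have -> : 4 * pi * (2 * t) = 2 * (4 * pi * t) :> R by ring.
rewrite (powRM (x := 2)) ?(ltW (fourpi_gt0 t0))//.
have e0 : 2 `^ (n%:R / 2) * 2 `^ (- (n%:R / 2)) = 1 :> R by rewrite -powRDp// subrr powRr0.
have -> : 2 `^ (n%:R / 2) * expR (sq z / (4 * t)) *
   (2 `^ (- (n%:R / 2)) * (4 * pi * t) `^ (- (n%:R / 2)) * expR (- (sq y / (4 * (2 * t))))) =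
   2 `^ (n%:R / 2) * 2 `^ (- (n%:R / 2)) * ((4 * pi * t) `^ (- (n%:R / 2)) *
   (expR (sq z / (4 * t)) * expR (- (sq y / (4 * (2 * t)))))) by ring.
rewrite e0 mul1r; apply: ler_wpM2l; first exact: powR_ge0.
rewrite -expRD ler_expR -subr_ge0.
have h := sqD_le (y + z) (- z); rewrite addrK sqN in h.
have -> : sq z / (4 * t) - sq y / (4 * (2 * t)) - - (sq (y + z) / (4 * t)) =
    (2 * sq (y + z) + 2 * sq z - sq y) / (8 * t) by field; rewrite gt_eqF.
by apply: divr_ge0; [lra|rewrite mulr_ge0// ltW].
Qed.

Lemma rv_norm_sq_le y (e : R) : 0 <= e -> sq y <= e ^+ 2 -> `|y| <= e.
Proof.
move=> e0 h; apply: rv_norm_le => // i.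
rewrite -(ler_pXn2r (n := 2))// ?nnegrE// -normrX ger0_norm ?sqr_ge0//; apply: le_trans h.
by rewrite /sq (bigD1 i)//= lerDl sumr_ge0// => j _; exact: sqr_ge0.
Qed.

Section Weight.
Variable h : 'rV[R]_n -> R.
Hypotheses (mh : measurable_fun setT h) (h0 : forall y, 0 <= h y).
Hypothesis lh : forall t : R, 0 < t -> L1 (rnm n) (fun y => heat t y * h y).

(** Extended by 0 to t <= 0 so as to be measurable on the whole line, as the convolutions in time
    require. *)
Definition ptr_pos j (t : R) : R := if 0 < t then ptr h j t else 0.

Let lh0 (t : R) : 0 < t -> L1 (rnm n) (fun z => heat t (0 + z) * h z).
Proof. by move=> /lh; apply: eq_L1 => z; rewrite add0r. Qed.

Let ptrE j : ptr h j = (fun s => RI (rnm n) (fun z => psi j s (0 + z) * h z)).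
Proof. by apply/funext => s; apply: eq_RI => z; rewrite add0r. Qed.

Lemma measurable_ptr_pos j : measurable_fun setT (ptr_pos j).
Proof.
have -> : ptr_pos j = (fun t => RI (rnm n) (fun y => (if 0 < t then psi j t y else 0) * h y)).
  apply/funext => t; rewrite /ptr_pos; case: ltP => // t0.
  by rewrite -[LHS](RI_0 (rnm n)); apply: eq_RI => y; rewrite mul0r.
apply: (@measurable_RI _ _ _ _ _ (rnm n) (fun (t : R) (y : 'rV[R]_n) => (if 0 < t then psi j t y else 0) * h y)).
apply: measurable_funM; first exact: measurable_psi2.
by apply: (measurableT_comp mh); exact: measurable_snd.
Qed.

Lemma is_derive_ptr_pos j (t : R) : 0 < t -> is_derive t 1 (ptr_pos j) (- ptr_pos j.+1 t).
Proof.
move=> t0.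
have E : {near t, ptr h j =1 ptr_pos j}.
  by near=> s; rewrite /ptr_pos; have -> // : 0 < s; near: s; exact: lt_nbhsr.
apply: (near_eq_is_derive E).
have d := is_derive_RI_psi mh h0 lh0 j t0; rewrite {1}/ptr_pos t0.
by rewrite (ptrE j) (ptrE j.+1).
Unshelve. all: by end_near.
Qed.

Lemma ptr_pos0_ge0 t : 0 <= ptr_pos 0 t.
Proof.
rewrite /ptr_pos; case: ifP => // _; apply: RI_ge0 => y.
by rewrite psi0 mulr_ge0 ?heat_ge0.
Qed.

Lemma decay_ptr_pos (g : R) j : 0 <= g -> L1 (rnm n) (fun y => h y * om (n%:R / 2 + g) y) ->
  decay (j%:R - g) (ptr_pos j).
Proof.
move=> g0 lo T T0; have [C C0 HC] := @psi_le R n j; have [D D0 HD] := heat_le_om_from g0 T0.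
pose V := RI (rnm n) (fun y => h y * om (n%:R / 2 + g) y).
have V0 : 0 <= V by apply: RI_ge0 => y; rewrite mulr_ge0 ?om_ge0.
exists (C * D * V); first by rewrite !mulr_ge0.
move=> t Tt; have t0 := lt_le_trans T0 Tt; rewrite /ptr_pos t0.
have e : t^-1 ^+ j * t `^ g = t `^ (- (j%:R - g)).
  rewrite opprB addrC powRDp// powRN -powR_mulrn ?invr_ge0 ?(ltW t0)//.
  by rewrite powRVp// powRN.
have le y : `|psi j t y * h y| <= C * D * t `^ (- (j%:R - g)) * (h y * om (n%:R / 2 + g) y).
  rewrite normrM (ger0_norm (h0 y)) -e mulrC.
  have -> : C * D * (t^-1 ^+ j * t `^ g) * (h y * om (n%:R / 2 + g) y) =
    h y * (C * t^-1 ^+ j * (D * t `^ g * om (n%:R / 2 + g) y)) by ring.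
  apply: ler_wpM2l => //; apply: (le_trans (HC t y t0)); apply: ler_wpM2l; last exact: HD.
  by rewrite mulr_ge0// exprn_ge0// invr_ge0 ltW.
apply: (le_trans (norm_RI_le _ le (L1Z _ lo))).
  by apply: measurable_funM => //; exact: measurable_psi.
by rewrite (RIZ _ lo) -/V mulrAC.
Qed.

(** Hölder's inequality is replaced by h <= l + l^(1-p) h^p. Since the heat kernel is at most c
    t^(-n/2), the level l = t^(-n/2p) balances the two contributions. *)
Lemma decay_ptr_Lp (p : R) : 1 < p -> L1 (rnm n) (fun y => h y `^ p) ->
  exists2 A, 0 <= A & forall t, 0 < t -> ptr h 0 t <= A * t `^ (- (n%:R / (2 * p))).
Proof.
move=> p1 lp; have p0 : 0 < p by apply: lt_trans p1.
pose N := RI (rnm n) (fun y => h y `^ p); pose c : R := (4 * pi) `^ (- (n%:R / 2)).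
have N0 : 0 <= N by apply: RI_ge0 => y; exact: powR_ge0.
exists (1 + c * N); first by rewrite addr_ge0// mulr_ge0// powR_ge0.
move=> t t0; pose k := n%:R / (2 * p); pose l := t `^ (- k).
have l0 : 0 < l by exact: powR_gt0.
have hl y : h y <= l + l `^ (- (p - 1)) * h y `^ p.
  have [hl|hl] := leP (h y) l; first by rewrite (le_trans hl)// lerDl mulr_ge0 ?powR_ge0.
  have hy0 := lt_trans l0 hl.
  have e : h y = h y `^ (- (p - 1)) * h y `^ p.
    by rewrite -powRDp// opprB subrK powRr1// ltW.
  rewrite {1}e; apply: (@le_trans _ _ (l `^ (- (p - 1)) * h y `^ p)); last by rewrite lerDr ltW.
  apply: ler_wpM2r; first exact: powR_ge0.
  by apply: powRN_le => //; [rewrite subr_ge0 ltW|exact: ltW].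
have hh y : heat t y <= c * t `^ (- (n%:R / 2)).
  rewrite heat_powR// powRM ?(ltW t0)//; last by rewrite mulr_ge0// ltW// pi_gt0.
  rewrite ler_piMr ?mulr_ge0 ?powR_ge0// -expR0 ler_expR oppr_le0 divr_ge0 ?sq_ge0//.
  by rewrite mulr_ge0// ltW.
have lt := L1_heat n t0.
have lG := L1D (L1Z l lt) (L1Z (c * t `^ (- (n%:R / 2)) * l `^ (- (p - 1))) lp).
have le y : psi 0 t y * h y <= l * heat t y + c * t `^ (- (n%:R / 2)) * l `^ (- (p - 1)) * h y `^ p.
  rewrite psi0; apply: (le_trans (ler_wpM2l (heat_ge0 _ _) (hl y))).
  rewrite mulrDr [X in X + _]mulrC lerD2l.
  have -> : c * t `^ (- (n%:R / 2)) * l `^ (- (p - 1)) * h y `^ p =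
    c * t `^ (- (n%:R / 2)) * (l `^ (- (p - 1)) * h y `^ p) by ring.
  by apply: ler_wpM2r => //; rewrite mulr_ge0 ?powR_ge0.
have l1 : L1 (rnm n) (fun y => psi 0 t y * h y) by apply: (eq_L1 _ (lh t0)) => y; rewrite psi0.
apply: (le_trans (le_RI l1 lG le)).
rewrite (RID (L1Z l lt) (L1Z _ lp)) (RIZ _ lt) (RIZ _ lp) RI_heat// mulr1 -/N.
have e : t `^ (- (n%:R / 2)) * l `^ (- (p - 1)) = l.
  rewrite /l -powRrM -powRDp//; congr (_ `^ _); rewrite /k; field; rewrite gt_eqF//.
by rewrite -(mulrA c) e -/k -/l mulrDl mul1r mulrAC.
Qed.

(** An approximate identity for a possibly unbounded [h]: near 0 continuity is used, elsewhere the
    heat kernel is at most C t times the one at time 1, against which [h] is integrable. *)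
Lemma ptr_cvg_at0 : {for 0, continuous h} -> ptr h 0 t @[t --> 0^'+] --> h 0.
Proof.
move=> ch; apply/cvgrPdist_le => e e0.
have e2 : 0 < e / 2 by rewrite divr_gt0.
have [d d0 Hd] : exists2 d, 0 < d & forall y, sq y <= d -> `|h 0 - h y| <= e / 2.
  move/cvgrPdist_le : ch => /(_ _ e2) /nbhs_ballP[r/= r0 Hr].
  exists ((r / 2) ^+ 2); first by rewrite exprn_gt0// divr_gt0.
  move=> y yr; apply: Hr; rewrite -ball_normE/= sub0r normrN.
  apply: (@le_lt_trans _ _ (r / 2)); last by rewrite ltr_pdivrMr// ltr_pMr// ltr1n.
  by apply: rv_norm_sq_le => //; rewrite divr_ge0// ltW.
have [C C0 HC] := heat_le_far d0.
have l1 := lh ltr01.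
have lH := L1D l1 (L1Z (h 0) (L1_heat n (@ltr01 R))).
pose B := RI (rnm n) (fun y => heat 1 y * h y + h 0 * heat 1 y).
have B0 : 0 <= B by apply: RI_ge0 => y; rewrite addr_ge0// mulr_ge0 ?heat_ge0.
have cb : 0 < C * B + 1 by rewrite ltr_wpDl// mulr_ge0.
have q0 : 0 < e / 2 / (C * B + 1) by rewrite divr_gt0.
near=> t; have t0 : 0 < t by near: t; exact: nbhs_right_gt.
have tq : t <= e / 2 / (C * B + 1) by near: t; exact: nbhs_right_le.
have t1 : 2 * t <= 1.
  by rewrite mulrC -ler_pdivlMr//; near: t; apply: nbhs_right_le; rewrite divr_gt0.
have lt := L1_heat n t0; have lht := lh t0.
have -> : h 0 - ptr h 0 t = RI (rnm n) (fun y => h 0 * heat t y - heat t y * h y).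
  rewrite (RIB (L1Z (h 0) lt) lht) (RIZ _ lt) RI_heat// mulr1; congr (_ - _).
  by apply: eq_RI => y; rewrite psi0.
have le y : `|h 0 * heat t y - heat t y * h y| <= e / 2 * heat t y + C * t * (heat 1 y * h y + h 0 * heat 1 y).
  have -> : h 0 * heat t y - heat t y * h y = (h 0 - h y) * heat t y by ring.
  rewrite normrM (ger0_norm (heat_ge0 _ _)).
  have [hd|hd] := leP (sq y) d.
    apply: (@le_trans _ _ (e / 2 * heat t y)); first by rewrite ler_wpM2r ?heat_ge0// Hd.
    by rewrite lerDl mulr_ge0// ?mulr_ge0 ?(ltW t0)// addr_ge0// mulr_ge0 ?heat_ge0.
  apply: (@le_trans _ _ ((h y + h 0) * (C * t * heat 1 y))).
    apply: ler_pM => //; first exact: heat_ge0.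
      by apply: (le_trans (ler_normB _ _)); rewrite !ger0_norm// addrC.
    by apply: HC => //; exact: ltW.
  have -> : (h y + h 0) * (C * t * heat 1 y) = C * t * (heat 1 y * h y + h 0 * heat 1 y) by ring.
  by rewrite lerDr mulr_ge0 ?heat_ge0// ltW.
have lG := L1D (L1Z (e / 2) lt) (L1Z (C * t) lH).
have mF : measurable_fun setT (fun y => h 0 * heat t y - heat t y * h y) := L1_measurable (L1B (L1Z (h 0) lt) lht).
apply: (le_trans (norm_RI_le mF le lG)).
rewrite (RID (L1Z (e / 2) lt) (L1Z (C * t) lH)) (RIZ _ lt) (RIZ _ lH) RI_heat// mulr1 -/B.
rewrite [leRHS](half_add e) -lerBrDl.
have -> : 2^-1 * (e + e) - e / 2 = e / 2 by lra.
apply: (@le_trans _ _ ((C * B + 1) * t)); first by rewrite mulrAC ler_wpM2r ?(ltW t0)// lerDl.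
by rewrite mulrC -ler_pdivlMr.
Unshelve. all: by end_near.
Qed.

End Weight.

Lemma ptr_harnack (v : 'rV[R]_n -> R) x x' (t : R) : (forall y, 0 <= v y) -> 0 < t ->
  (forall x (t : R), 0 < t -> L1 (rnm n) (fun y => heat t y * v (x + y))) ->
  ptr (fun y => v (x + y)) 0 t <=
  2 `^ (n%:R / 2) * expR (sq (x' - x) / (4 * t)) * ptr (fun y => v (x' + y)) 0 (2 * t).
Proof.
move=> v0 t0 lv; have t2 : 0 < 2 * t by rewrite mulr_gt0.
rewrite /ptr -(RI_shift (x' - x) (eq_L1 (fun y => congr1 (fun r => r * v (x + y)) (esym (psi0 t y))) (lv x t t0))).
have l2 : L1 (rnm n) (fun y => psi 0 (2 * t) y * v (x' + y)).
  by apply: (eq_L1 _ (lv x' _ t2)) => y; rewrite psi0.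
rewrite -(RIZ _ l2); apply: le_RI.
- have := L1_shift (x' - x) (lv x t t0); apply: eq_L1 => y; by rewrite psi0.
- exact: L1Z.
- move=> y; rewrite !psi0 mulrA.
  have -> : x + (y + (x' - x)) = x' + y by rewrite addrCA subrKC addrC.
  by apply: ler_wpM2r => //; exact: heat_harnack.
Qed.

End HeatEstimates.

(** * The limit t -> 0 and the Riesz kernel *)

Section RieszPotential.
Context {R : realType}.
Notation leb := (@lebesgue_measure R).
Variable n : nat.
Implicit Types x y z : 'rV[R]_n.

Section Weight.
Variables (h : 'rV[R]_n -> R) (s k A : R).
Hypotheses (n_gt0 : (0 < n)%N) (s0 : 0 < s) (sn : s < n%:R / 2) (sk : s < k) (A0 : 0 <= A).
Hypotheses (mh : measurable_fun setT h) (h0 : forall y, 0 <= h y).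
Hypothesis lh : forall t : R, 0 < t -> L1 (rnm n) (fun y => heat t y * h y).
Hypothesis ch : {for 0, continuous h}.
Hypothesis dh : forall t : R, 0 < t -> ptr h 0 t <= A * t `^ (- k).

Let w := ptr_pos h 0.

Let wE t : 0 < t -> w t = ptr h 0 t.
Proof. by rewrite /w /ptr_pos => ->. Qed.

Let mw : measurable_fun setT w := measurable_ptr_pos mh 0.
Let w0 t : 0 <= w t := ptr_pos0_ge0 h0 t.

Let k0 : 0 < k. Proof. exact: lt_trans sk. Qed.

Lemma decay_ptr_pos0 : decay k w.
Proof.
move=> T T0; exists A => // t Tt; have t0 := lt_le_trans T0 Tt.
by rewrite ger0_norm// wE//; exact: dh.
Qed.

Let w_bounded : exists2 B, 0 <= B & forall t, 0 < t -> w t <= B.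
Proof.
have c := ptr_cvg_at0 h0 lh ch.
have [d d0 Hd] : exists2 d, 0 < d & forall t, 0 < t -> t < d -> ptr h 0 t <= h 0 + 1.
  have : \forall t \near 0^'+, ptr h 0 t <= h 0 + 1 by move/cvgr_le : c; apply; rewrite ltrDl.
  case=> d/= d0 Hd; exists d => // t t0 td; apply: Hd => //=.
  by rewrite sub0r normrN gtr0_norm.
exists (Num.max (h 0 + 1) (A * d `^ (- k))).
  by rewrite le_max addr_ge0.
move=> t t0; rewrite wE// le_max; have [td|td] := ltP t d; first by rewrite Hd.
apply/orP; right; apply: (le_trans (dh t0)); apply: ler_wpM2l => //.
by apply: powRN_le => //; exact: ltW.
Qed.

Let f_ (i : nat) r := hpow s r / Gamma s * w (i.+1%:R^-1 + r).
Let f r := hpow s r / Gamma s * w r.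

Let mf_ (i : nat) : measurable_fun setT (f_ i).
Proof.
apply: measurable_funM; first by apply: measurable_funM => //; exact: measurable_hpow.
by apply: (measurableT_comp mw); exact: measurable_funD.
Qed.

(** Dominated convergence: [w] is bounded, near time 0 by continuity of [h] at the origin, which
    handles r <= 1; beyond that the decay of order k > s takes over. *)
Lemma fint_cvg_at0 : L1 leb f /\ (fun i : nat => fint s w i.+1%:R^-1) @ \oo --> RI leb f.
Proof.
have [B B0 HB] := w_bounded; have G0 := Gamma_gt0 s0.
have ks : 0 < k - s by rewrite subr_gt0.
have [l1 _] := RI_itv_pow_head s0 (@ltr01 R); have [l2 _] := RI_itv_pow_tail ks (@ltr01 R).
have lG := L1Z (Gamma s)^-1 (L1D (L1Z B l1) (L1Z A l2)).
have Gi : 0 <= (Gamma s)^-1 by rewrite invr_ge0 ltW.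
apply: (@RI_cvg R _ _ leb f_ f _ mf_ _ _ lG).
- move=> r; have [r0|r0] := leP r 0.
    have -> : f_ ^~ r = (fun=> f r) by apply/funext => i; rewrite /f_ /f (hpow_le0 s r0) !mul0r.
    exact: cvg_cst.
  apply: cvgMr.
  have c : {for r, continuous w} by exact: is_derive_cont (is_derive_ptr_pos mh h0 lh 0 r0).
  have cr : (fun i : nat => i.+1%:R^-1 + r) @ \oo --> r.
    rewrite -[X in _ --> X](add0r r); apply: cvgD; last exact: cvg_cst.
    exact: harmonic_cvg0.
  exact: (cvg_comp _ _ cr c).
- move=> i r; have i0 : 0 < i.+1%:R^-1 :> R by rewrite invr_gt0.
  rewrite /f_; have [r0|r0] := leP r 0.
    rewrite hpow_le0// !mul0r normr0/= ltNge (le_trans r0)//= mulr0 add0r mulr0 mulr0//.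
  have ir : 0 < i.+1%:R^-1 + r by rewrite addr_gt0.
  rewrite ger0_norm; last by apply: mulr_ge0; [exact: hpowG_ge0|exact: w0].
  rewrite mulrAC mulrC; apply: ler_wpM2l => //=; rewrite hpow_gt0//.
  have [r1|r1] := leP r 1.
    by rewrite mulr0 addr0 mulrC; apply: ler_wpM2r; [exact: powR_ge0|exact: HB].
  rewrite mulr0 add0r; have -> : - (k - s) - 1 = - k + (s - 1) by ring.
  rewrite [X in _ <= A * X](powRDp _ _ r0) mulrA [leLHS]mulrC; apply: ler_wpM2r; first exact: powR_ge0.
  rewrite wE//; apply: (le_trans (dh ir)); apply: ler_wpM2l => //.
  by apply: powRN_le => //; [exact: ltW|rewrite lerDr ltW].
Qed.

Let e (y : 'rV[R]_n) : R := eucl y `^ (n%:R - 2 * s).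

(** Tonelli and [integral_heat_power] with exponent -s. At y = 0 the quotient is 0 by the convention
    on division, but a point is null. *)
Lemma RI_riesz : (RI leb f)%:E = ((c_ns n s)%:E * \int[rnm n]_y (h y / e y)%:E)%E.
Proof.
have [lf _] := fint_cvg_at0; have G0 := Gamma_gt0 s0.
have ns0 : 0 < n%:R / 2 - s by rewrite subr_gt0.
pose K (u : R * 'rV[R]_n) : R := hpow s u.1 / Gamma s * heat u.1 u.2 * h u.2.
have mK : measurable_fun setT (fun u => (K u)%:E).
  apply/measurable_EFinP; apply: measurable_funM; last first.
    by apply: (measurableT_comp mh); exact: measurable_snd.
  have -> : (fun u : R * 'rV[R]_n => hpow s u.1 / Gamma s * heat u.1 u.2) =
    (fun u => (Gamma s)^-1 * (hpow s u.1 * heat u.1 u.2)) by apply/funext => u; ring.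
  by apply: measurable_funM => //; exact: heat_power_measurable.
have K0 u : (0 <= (K u)%:E)%E.
  by rewrite lee_fin /K mulr_ge0// mulr_ge0 ?heat_ge0// hpowG_ge0.
have me : measurable_fun setT (fun y => (h y / e y)%:E).
  apply/measurable_EFinP; apply: measurable_funM => //; rewrite /e.
  have -> : (fun y : 'rV[R]_n => (eucl y `^ (n%:R - 2 * s))^-1) = (fun y => eucl y `^ (- (n%:R - 2 * s))).
    by apply/funext => y; rewrite powRN.
  exact: measurable_eucl_powR.
have he y : (0 <= (h y / e y)%:E)%E by rewrite lee_fin divr_ge0 ?powR_ge0.
have c0 : 0 <= c_ns n s.
  rewrite /c_ns divr_ge0 ?(ltW (Gamma_gt0 ns0))// mulr_ge0 ?(ltW G0)// mulr_ge0 ?powR_ge0//.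
rewrite RI_EFin//.
transitivity (\int[leb]_r \int[rnm n]_y (K (r, y))%:E)%E.
  apply: eq_integral => r _; have [r0|r0] := leP r 0.
    rewrite /f hpow_le0// !mul0r; apply/esym/integral0_eq => y _.
    by rewrite /K/= hpow_le0// !mul0r.
  rewrite /f wE// EFinM /ptr RI_EFin; last by apply: (eq_L1 _ (lh r0)) => y; rewrite psi0.
  rewrite -intZl; first last.
  - by move=> y; rewrite lee_fin psi0 mulr_ge0 ?heat_ge0.
  - apply/measurable_EFinP; apply: measurable_funM => //; exact: measurable_psi.
  - exact: hpowG_ge0.
  by apply: eq_integral => y _; rewrite -EFinM /K/= psi0 mulrA.
rewrite (@fubini_tonelli _ _ _ _ R leb (rnm n) (fun u => (K u)%:E) mK K0).
rewrite -intZl//; apply: ge0_ae_eq_integral => //.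
- exact: (@measurable_fun_fubini_tonelli_G _ _ _ _ R leb (fun u => (K u)%:E)).
- exact: measurable_funeM.
- by move=> y _; apply: integral_ge0.
- by move=> y _; apply: mule_ge0; [rewrite lee_fin|exact: he].
exists [set 0]; split; [exact: measurable_rv_set1|exact: rnm_set1|].
move=> y /= H; apply: contrapT => /eqP y0; apply: H => _.
have := @integral_heat_power R n (- s) y; rewrite opprK mulrN => /(_ ns0 y0) I.
have -> : (\int[leb]_x (K (x, y))%:E = (h y / Gamma s)%:E * \int[leb]_(t in `]0%R, +oo[) (t `^ (s - 1) * heat t y)%:E)%E.
  have -> : (\int[leb]_(t in `]0%R, +oo[) (t `^ (s - 1) * heat t y)%:E = \int[leb]_t (hpow s t * heat t y)%:E)%E.
    under [RHS]eq_integral do rewrite EFinM.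
    by rewrite integral_hpow; apply: eq_integral => t _; rewrite EFinM.
  rewrite -lebZl.
  - by apply: eq_integral => t _; rewrite -EFinM /K/=; congr EFin; ring.
  - by rewrite divr_ge0// ltW.
  - by apply/measurable_EFinP; exact: (measurableT_comp (@heat_power_measurable R n s) (measurable_pair2 y)).
  - by move=> t; rewrite lee_fin mulr_ge0 ?hpow_ge0 ?heat_ge0.
rewrite I -!EFinM; congr EFin.
have -> : 4 `^ (- s) = (2 `^ (2 * s))^-1 :> R.
  have -> : 4 = 2 `^ 2%:R :> R by rewrite powR_mulrn// -natrX.
  by rewrite -powRrM -powRN mulrN.
rewrite !powRN /e /c_ns.
move: (eucl y `^ _) (Gamma (_ - _)) (Gamma s) G0 (pi `^ _) (2 `^ _) => q g1 g2 g20 c d.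
rewrite !invfM; ring.
Qed.

End Weight.
End RieszPotential.

(** * Determination of the constant and conclusion *)

Section StrongSolution.
Context {R : realType}.
Notation leb := (@lebesgue_measure R).
Variables (n m : nat) (g p : R) (v F : 'rV[R]_n -> R).
Implicit Types x y z : 'rV[R]_n.
Let s := m%:R + g.
Hypotheses (g_ge0 : 0 <= g) (g1 : g < 1) (s0 : 0 < s) (sn : s < n%:R / 2).
Hypotheses (v0 : forall x, 0 <= v x) (F0 : forall x, 0 <= F x).
Hypothesis vF : strong_solution m g v F.
Hypotheses (p1 : 1 < p) (pn : p < n%:R / (2 * s)) (FLp : Lp p F).
Let k := n%:R / (2 * p).

Let n_gt0 : (0 < n)%N.
Proof.
rewrite lt0n; apply/eqP => n0; move: (lt_trans s0 sn); rewrite n0 mul0r ltxx; by [].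
Qed.

Let a_gt0 : 0 < n%:R / 2 + g.
Proof. by rewrite ltr_pwDl// divr_gt0// ltr0n. Qed.

Let sk : s < k.
Proof.
have p0 : 0 < p by apply: lt_trans p1.
have := pn; rewrite /k !ltr_pdivlMr ?mulr_gt0//; by rewrite mulrCA (mulrCA s) (mulrC p).
Qed.

Let FE : neglap_iter m (fraclap g v) = F.
Proof. by apply/funext => x; have [_ [_ [_ [_ [_ h]]]]] := vF. Qed.

Let cF : continuous F.
Proof. by have [_ [_ [_ [_ [h _]]]]] := vF; rewrite -FE. Qed.

Let mF : measurable_fun setT F := continuous_measurable_rv cF.

Let cv : continuous v.
Proof. by have [_ [[eps [_ [/(_ [::] isT)[h _] _]]] _]] := vF. Qed.

Let cont_shift (u : 'rV[R]_n -> R) x : continuous u -> {for 0, continuous (fun y => u (x + y))}.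
Proof.
move=> cu; suff : (fun y => u (x + y)) y @[y --> (0 : 'rV[R]_n)] --> u (x + 0) by [].
apply/(@cvgrPdist_le R R 'rV[R]_n (nbhs (0 : 'rV[R]_n)) (nbhs_filter _)) => e e0.
have /cvgrPdist_le/(_ _ e0)/nbhs_ballP[r/= r0 Hr] := cu (x + 0).
apply/nbhs_ballP; exists r => //= y; rewrite -ball_normE/= sub0r normrN => yr.
by apply: Hr; rewrite -ball_normE/= addr0 opprD addrA subrr add0r normrN.
Qed.

Let mshift (u : 'rV[R]_n -> R) x : measurable_fun setT u -> measurable_fun setT (fun y => u (x + y)).
Proof. by move=> mu; under eq_fun do rewrite addrC; exact: measurable_shift_rv. Qed.

Let lv x t : 0 < t -> L1 (rnm n) (fun y => heat t y * v (x + y)).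
Proof.
have [hLs [[eps [eps0 hC]] [hdef [hm _]]]] := vF; move=> t0.
exact: (L1_heat_v x g_ge0 a_gt0 v0 hLs hC t0).
Qed.

Let F0' x : 0 <= neglap_iter m (fraclap g v) x.
Proof. by rewrite FE. Qed.

Let lF x t : 0 < t -> L1 (rnm n) (fun y => heat t y * F (x + y)).
Proof.
have [hLs [[eps [eps0 hC]] [hdef [hm _]]]] := vF; move=> t0.
have [g_gt0|g_le0] := ltP 0 g.
  by have [h _] := frac_ptr x g_ge0 g1 a_gt0 eps0 v0 hLs hC hdef hm F0' g_gt0 t0; rewrite FE in h.
have gz : g = 0 by apply/le_anti; rewrite g_le0 g_ge0.
by have [h _] := nofrac_ptr x g_ge0 a_gt0 eps0 v0 hLs hC hm F0' gz t0; rewrite FE in h.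
Qed.

Let lFp x : L1 (rnm n) (fun y => F (x + y) `^ p).
Proof.
have mp : measurable_fun setT (fun y => F y `^ p) by apply: (measurableT_comp (measurable_powR p)).
have lp : L1 (rnm n) (fun y => F y `^ p).
  apply: ge0_L1 => //; first by move=> y; exact: powR_ge0.
  have e : (fun y => (`|F y| `^ p)%:E) = (fun y => (F y `^ p)%:E) by apply/funext => y; rewrite ger0_norm.
  have := FLp; rewrite /Lp e Rn_int_ge0E//; first exact/measurable_EFinP.
  by move=> y; rewrite lee_fin powR_ge0.
by apply: (eq_L1 _ (L1_shift x lp)) => y; rewrite addrC.
Qed.

Let W x := ptr_pos (fun y => F (x + y)) 0.

Let FW x : exists2 A, 0 <= A & forall t : R, 0 < t -> ptr (fun y => F (x + y)) 0 t <= A * t `^ (- k).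
Proof. exact: (decay_ptr_Lp _ (lF x)). Qed.

Let dW x : decay k (W x).
Proof. by have [A A0 HA] := FW x; apply: decay_ptr_pos0 HA. Qed.

(** Equality of all increments of U_0 and of the potential of W over positive times leaves a
    constant depending on [x] alone. *)
Let const_part x : exists C : R, forall t, 0 < t -> ptr (fun y => v (x + y)) 0 t = C + fint s (W x) t.
Proof.
have [hLs [[eps [eps0 hC]] [hdef [hm _]]]] := vF.
pose vx y := v (x + y); pose Fx y := F (x + y).
have mvx : measurable_fun setT vx by apply: mshift; exact: continuous_measurable_rv.
have vx0 y : 0 <= vx y by exact: v0.
have lvx t : 0 < t -> L1 (rnm n) (fun y => heat t y * vx y) by exact: lv.
have mFx : measurable_fun setT Fx by exact: mshift.
have Fx0 y : 0 <= Fx y by exact: F0.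
have lom : L1 (rnm n) (fun y => vx y * om (n%:R / 2 + g) y) := L1_vom g_ge0 a_gt0 v0 hLs hC x.
have mu j := measurable_ptr_pos mvx j.
have du j (t : R) (t0 : 0 < t) := is_derive_ptr_pos mvx vx0 lvx j t0.
have bu j := decay_ptr_pos mvx vx0 j g_ge0 lom.
have mw := measurable_ptr_pos mFx 0.
have pE j t : 0 < t -> ptr_pos vx j t = ptr vx j t by move=> t0; rewrite /ptr_pos t0.
have wE t : 0 < t -> ptr_pos Fx 0 t = ptr Fx 0 t by move=> t0; rewrite /ptr_pos t0.
have H : forall t h, 0 < t -> 0 < h -> ptr_pos vx 0 t - ptr_pos vx 0 (t + h) =
    fint s (W x) t - fint s (W x) (t + h).
  have [g_gt0|g_le0] := ltP 0 g.
    have K := descent_frac g1 sk mu du bu mw (dW x) g_gt0; apply: K => t t0.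
    have [_ [l1 e1]] := frac_ptr x g_ge0 g1 a_gt0 eps0 v0 hLs hC hdef hm F0' g_gt0 t0.
    rewrite FE in e1.
    have e r : hpow (- g) r * (ptr vx m t - ptr vx m (t + r)) =
       hpow (- g) r * (ptr_pos vx m t - ptr_pos vx m (t + r)).
      have [r0|r0] := leP r 0; first by rewrite hpow_le0// !mul0r.
      by rewrite !pE// addr_gt0.
    split; first by apply: (eq_L1 _ l1) => r; exact: e.
    by rewrite /W wE// -(eq_RI leb e) -e1.
  have gz : g = 0 by apply/le_anti; rewrite g_le0 g_ge0.
  apply: (descent_int g1 sk s0 mu du bu mw (dW x) gz) => t t0.
  have [_ e1] := nofrac_ptr x g_ge0 a_gt0 eps0 v0 hLs hC hm F0' gz t0.
  by rewrite FE in e1; rewrite wE// pE// -e1.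
have E1 (a b c d : R) : a - b = c - d -> a = b - d + c by move=> E; lra.
have E2 (a b c d : R) : a - b = c - d -> b = a - c + d by move=> E; lra.
(* The difference does not depend on t; its value is read off at t = 1. *)
exists (ptr vx 0 1 - fint s (W x) 1) => t t0.
rewrite -!pE//; have [t1|t1|->] := ltgtP t 1; last by rewrite subrK.
  have h0 : 0 < 1 - t by rewrite subr_gt0.
  by apply: E1; have := H t (1 - t) t0 h0; rewrite subrKC.
have h0 : 0 < t - 1 by rewrite subr_gt0.
by apply: E2; have := H 1 (t - 1) ltr01 h0; rewrite subrKC.
Qed.

Let fint_W_ge0 x t : 0 <= fint s (W x) t.
Proof. by apply: fint_ge0 => // r; apply: ptr_pos0_ge0 => y; exact: F0. Qed.

Let fint_W_cvg0 x : fint s (W x) t @[t --> +oo] --> (0 : R).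
Proof.
apply: (@decay_cvg0 _ (k - s)); first by rewrite subr_gt0.
apply: decay_fint => //; apply: measurable_ptr_pos; exact: mshift.
Qed.

Let solution_up_to_const : exists C : 'rV[R]_n -> R, exists K : R, exists J : 'rV[R]_n -> R,
  [/\ 0 < K, forall x, 0 <= C x, forall x x', C x <= K * C x',
    forall x, 0 <= J x /\ (J x)%:E = ((c_ns n s)%:E * \int[rnm n]_y (F (x + y) / eucl y `^ (n%:R - 2 * s))%:E)%E
    & forall x, v x = C x + J x].
Proof.
have /choice[C HC] := const_part.
have cC x : ptr (fun y => v (x + y)) 0 t @[t --> +oo] --> C x.
  have cc : C x + fint s (W x) t @[t --> +oo] --> C x + 0.
    by apply: cvgD; [exact: cvg_cst|exact: fint_W_cvg0].
  rewrite addr0 in cc; apply: cvg_trans cc; apply: near_eq_cvg; near=> t.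
  by rewrite HC//; near: t; exact: nbhs_pinfty_gt.
have C0 x : 0 <= C x.
  apply: (cvgr_to_ge (cC x)); apply: nearW => t; apply: RI_ge0 => y.
  by rewrite psi0 mulr_ge0 ?heat_ge0.
pose J x := RI leb (fun r => hpow s r / Gamma s * W x r).
have JE x : L1 leb (fun r => hpow s r / Gamma s * W x r) /\
    (fun i : nat => fint s (W x) i.+1%:R^-1) @ \oo --> J x /\
    (J x)%:E = ((c_ns n s)%:E * \int[rnm n]_y (F (x + y) / eucl y `^ (n%:R - 2 * s))%:E)%E.
  have [A A0 HA] := FW x; have cFx := cont_shift (x := x) cF; have mFx := mshift x mF.
  have Fx0 y : 0 <= F (x + y) by exact: F0.
  have [l c] := fint_cvg_at0 s0 sk A0 mFx Fx0 (lF x) cFx HA.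
  by split => //; split => //; exact: (RI_riesz n_gt0 s0 sn sk A0 mFx Fx0 (lF x) cFx HA).
(* For t >= |x' - x|^2 the Harnack factor at time t/2 is at most 2^(n/2) e, so in the limit t -> oo
   a single constant serves all pairs of points. *)
exists C, (2 `^ (n%:R / 2) * expR 1), J; split => //.
- move=> x x'; pose q := sq (x' - x).
  have c2 : 2 `^ (n%:R / 2) * expR 1 * ptr (fun y => v (x' + y)) 0 t @[t --> +oo] --> 2 `^ (n%:R / 2) * expR 1 * C x'.
    by apply: cvgMr; exact: cC.
  apply: (cvgr_to_ge c2); near=> t.
  have t0 : 0 < t by near: t; exact: nbhs_pinfty_gt.
  have tq : q <= t by near: t; apply: nbhs_pinfty_ge; exact: num_real.
  have u0 : 0 < t / 2 by rewrite divr_gt0.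
  have h := @ptr_harnack R n v x x' _ v0 u0 lv.
  have e2 : 2 * (t / 2) = t by field.
  rewrite e2 in h; apply: (@le_trans _ _ (ptr (fun y => v (x + y)) 0 (t / 2))).
    by rewrite HC// lerDl.
  apply: (le_trans h); apply: ler_wpM2r.
    by apply: RI_ge0 => y; rewrite psi0 mulr_ge0 ?heat_ge0.
  apply: ler_wpM2l; first exact: powR_ge0.
  rewrite ler_expR ler_pdivrMr ?mulr_gt0// mul1r; apply: (le_trans tq).
  by rewrite mulrCA ler_peMr ?(ltW t0)//; lra.
- move=> x; split; last by have [_ [_ ->]] := JE x.
  apply: RI_ge0 => r; apply: mulr_ge0; first exact: hpowG_ge0.
  by apply: ptr_pos0_ge0 => y; exact: F0.
(* Both sides are limits of U_0 along the times 1/(i+1): the left by continuity of [v] at [x], the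
   right by [fint_cvg_at0]. *)
- move=> x; have [_ [cJ _]] := JE x.
  have c1 : (fun i : nat => ptr (fun y => v (x + y)) 0 i.+1%:R^-1) @ \oo --> v x.
    have := ptr_cvg_at0 (fun y => v0 (x + y)) (lv x) (cont_shift (x := x) cv); rewrite addr0 => c.
    exact: (cvg_comp _ _ (@harmonic_right R) c).
  have c2 : (fun i : nat => ptr (fun y => v (x + y)) 0 i.+1%:R^-1) @ \oo --> C x + J x.
    have -> : (fun i : nat => ptr (fun y => v (x + y)) 0 i.+1%:R^-1) = (fun i : nat => C x + fint s (W x) i.+1%:R^-1).
      by apply/funext => i; rewrite HC// invr_gt0.
    by apply: cvgD; [exact: cvg_cst|exact: cJ].
  by move: c1 => /cvg_unique/(_ c2); apply.
Unshelve. all: by end_near.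
Qed.

(* Harnack makes the constant of integration comparable at all points, so a nonzero one
   would bound [v] away from [0]. *)
Lemma strong_solution_riesz : (forall d, 0 < d -> ~ forall x, d <= v x) ->
  forall x, ((v x)%:E = (c_ns n s)%:E * \int[rnm n]_y (F (x + y) / eucl y `^ (n%:R - 2 * s))%:E)%E.
Proof.
have [C [K [J [K0 C0 CK HJ vE]]]] := solution_up_to_const.
move=> nv x; have [J0 JE] := HJ x; rewrite -JE vE.
suff -> : C x = 0 by rewrite add0r.
apply: contrapT => /eqP cx; have Cx : 0 < C x by rewrite lt_def cx C0.
apply: (nv (K^-1 * C x)); first by rewrite mulr_gt0// invr_gt0.
move=> x'; rewrite vE; apply: (@le_trans _ _ (C x')); last by rewrite lerDl; exact: (HJ x').1.
by rewrite mulrC ler_pdivrMr// mulrC.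
Qed.

(** The heat kernel has mass one, so a lower bound on the source is inherited by W, which tends to
    0. *)
Lemma strong_solution_source_not_ge c : 0 < c -> ~ forall y, c <= F y.
Proof.
move=> c0 Fc; have cw := decay_cvg0 (lt_trans s0 sk) (@dW 0).
have : c <= 0; last by rewrite leNgt c0.
apply: (cvgr_to_ge cw); near=> t; have t0 : 0 < t by near: t; exact: nbhs_pinfty_gt.
rewrite /W /ptr_pos t0; have lt := L1_heat n t0.
rewrite -[c]mulr1 -(RI_heat n t0) -(RIZ _ lt); apply: le_RI; first exact: L1Z.
  by apply: (eq_L1 _ (lF 0 t0)) => y; rewrite psi0.
by move=> y; rewrite psi0 mulrC; apply: ler_wpM2l; [exact: heat_ge0|exact: Fc].
Unshelve. all: by end_near.
Qed.

End StrongSolution.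

Theorem theorem3p1 (R : realType) (n m : nat) (g : R)
  (f : 'rV[R]_n -> R -> R) (v : 'rV[R]_n -> R) (p : R) :
  let s := m%:R + g in
  0 <= g -> g < 1 ->
  0 < s -> s < n%:R / 2 ->
  {within [set q : 'rV[R]_n * R | 0 <= q.2], continuous (fun q => f q.1 q.2)} ->
  (forall x t, 0 <= t -> 0 <= f x t) ->
  (forall x, 0 <= v x) ->
  strong_solution m g v (fun x => f x (v x)) ->
  1 < p -> p < n%:R / (2 * s) ->
  Lp p (fun x => f x (v x)) ->
  ((forall x t1 t2, 0 < t1 -> t1 <= t2 -> f x t1 <= f x t2) /\
   (forall t, 0 < t -> exists c : R, 0 < c /\ forall x, c <= f x t))
  \/ (forall e : R, 0 < e -> exists r : R, forall x, r < eucl x -> `|v x| < e) ->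
  forall x : 'rV[R]_n,
    ((v x)%:E = (c_ns n s)%:E *
      Rn_int_ge0 (fun y => (f y (v y) / eucl (x - y) `^ (n%:R - 2 * s))%:E))%E.
Proof.
move=> s g0 g1 s0 sn _ f0 v0 vF p1 pn FLp H x.
set F := fun x => f x (v x) in vF FLp.
have F0 y : 0 <= F y by exact: f0.
have n0 : (0 < n)%N.
  by rewrite lt0n; apply/eqP => n0; move: (lt_trans s0 sn); rewrite n0 mul0r ltxx.
have mF : measurable_fun setT F.
  apply: continuous_measurable_rv; have [_ [_ [_ [_ [cF FE]]]]] := vF.
  by move: cF; rewrite (funext FE).
have nv d : 0 < d -> ~ forall x, d <= v x.
  move=> d0 dv; case: H => [[mono low]|van].
    have [c [c0 cf]] := low d d0.
    apply: (strong_solution_source_not_ge g0 g1 s0 sn v0 F0 vF p1 pn FLp c0) => y.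
    by apply: (le_trans (cf y)); exact: mono.
  have [r Hr] := van d d0.
  (* [r] may be negative, hence the absolute value; since n > 0 there is a coordinate direction in
     which to leave the ball. *)
  pose e := (`|r| + 1) *: evec R (Ordinal n0).
  have r1 : 0 <= `|r| + 1 by rewrite addr_ge0.
  have : r < eucl e.
    rewrite euclE sqZ sq_evec mulr1 sqrtr_sqr ger0_norm//.
    by apply: (le_lt_trans (ler_norm r)); rewrite ltrDl.
  by move=> /Hr; rewrite ger0_norm// ltNge dv.
have mG : measurable_fun setT (fun y => (F y / eucl (x - y) `^ (n%:R - 2 * s))%:E).
  apply/measurable_EFinP; apply: measurable_funM => //.
  have -> : (fun y : 'rV[R]_n => (eucl (x - y) `^ (n%:R - 2 * s))^-1) = (fun y => eucl (y - x) `^ (- (n%:R - 2 * s))).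
    by apply/funext => y; rewrite powRN -opprB euclN.
  exact: (measurable_shift_rv (- x) (measurable_eucl_powR _)).
have G0 y : (0 <= (F y / eucl (x - y) `^ (n%:R - 2 * s))%:E)%E.
  by rewrite lee_fin divr_ge0 ?powR_ge0.
apply: (etrans (strong_solution_riesz g0 g1 s0 sn v0 F0 vF p1 pn FLp nv x)); congr (_ * _)%E.
apply/esym; apply: (etrans (Rn_int_ge0E mG G0)).
apply: (etrans (esym (ge0_integral_rnm_shift x mG G0))).
(* The substitution y |-> y + x centres the kernel at the origin, where the representation was
   obtained. *)
by apply: eq_integral => y _; rewrite opprD addrCA subrr addr0 euclN addrC.
Qed.
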